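(* Let $(u,p)$ be a weak solution (of the HHMO-model) with $u^*<\Psi(\alpha)$. Assume that $p$ satisfies condition (P), with associated function $p^*$, and that there exists $\gamma\ge0$ such that $$\lim_{x\to\infty}x\int_x^\infty p^*(\xi)\,d\xi=\gamma .$$ Then $u$ converges uniformly to $\Phi_\gamma$, i.e. $\lim_{t\to\infty}\sup_{\eta\ge0}|u(\eta\sqrt t,t)-\Phi_\gamma(\eta)|=0$. Furthermore, $\Phi_\gamma(\alpha)=u^*$ if $\gamma>0$, and $0<\Phi_0(\alpha)\le u^*$ if $\gamma=0$.
   Context: Let $\alpha,\beta,u^*>0$ be constants. The HHMO-model is formally $u_t=u_{xx}+\frac{\alpha\beta}{2\sqrt t}\,\delta(x-\alpha\sqrt t)-p\,u$ for $x>0,t>0$, with $u_x(0,t)=0$ and $u(x,0)=0$ for $x>0$; it is extended to $x\in\mathbb{R}$ by even reflection. Let $$\Psi(\eta)=\frac{\alpha\beta}{2}e^{\alpha^2/4}\int_{\max\{|\eta|,\alpha\}}^\infty e^{-\zeta^2/4}\,d\zeta ,$$ and $\psi(x,t)=\Psi(x/\sqrt t)$ for $t>0$; for $t=0$, $\psi(x,0)=0$ if $x\ne0$ and $\psi(0,0)=\Psi(\alpha)$. A weak solution is a pair $(u,p)$ of functions on $\mathbb{R}\times[0,\infty)$ such that: (i) $u(x,t)=u(-x,t)$ and $p(x,t)=p(-x,t)$ for all $x\in\mathbb{R}$, $t\ge0$; (ii) for every $T>0$, $u-\psi$ is bounded on $\mathbb{R}\times[0,T]$, and $u-\psi$ and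 $\partial_x(u-\psi)$ are continuous on $\mathbb{R}\times[0,T]$; (iii) $p$ is measurable and $p(x,t)=0$ if $\sup_{s\in[0,t]}u(x,s)<u^*$, $p(x,t)\in[0,1]$ if $\sup_{s\in[0,t]}u(x,s)=u^*$, $p(x,t)=1$ if $\sup_{s\in[0,t]}u(x,s)>u^*$; (iv) $p(x,t)$ is non-decreasing in $t$ for every $x\in\mathbb{R}$; (v) for every $T>0$, $$\int_0^T\!\!\int_{\mathbb{R}}\varphi_t\,(u-\psi)\,dy\,ds=\int_0^T\!\!\int_{\mathbb{R}}\bigl(\varphi_x\,(u-\psi)_x+p\,u\,\varphi\bigr)\,dy\,ds$$ for every $\varphi$ with $\varphi,\varphi_x,\varphi_t$ continuous on $\mathbb{R}\times[0,T]$ that vanishes for large $|x|$ and for $t=T$. Condition (P): there exists a measurable function $p^*$ on $(0,\infty)$ such that for a.e. $x>0$, $p(x,t)=p^*(x)$ for all $t>x^2/\alpha^2$. For $\gamma\ge0$ let $\kappa=\frac{1+\sqrt{4\gamma+1}}{2}$, let $M(a,b,z)=\sum_{n\ge0}\frac{(a)_n}{(b)_n}\frac{z^n}{n!}$ be Kummer's function, $\operatorname{erfc}(z)=\frac{2}{\sqrt\pi}\int_z^\infty e^{-y^2}dy$, and define $$u^*_\gamma=\left(\frac{\kappa\,M(\frac\kappa2+1,\kappa+\frac12,-\frac{\alpha^2}{4})}{\alpha\,M(\frac\kappa2,\kappa+\frac12,-\frac{\alpha^2}{4})}+\frac{\exp(-\frac{\alpha^2}{4})}{\sqrt\pi\,\operatorname{erfc}(\frac\alpha2)}\right)^{-1}\frac{\alpha\beta}{2},$$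 $$\Phi_\gamma(\eta)=\begin{cases}\dfrac{u^*_\gamma\,\eta^\kappa\,M(\frac\kappa2,\kappa+\frac12,-\frac{\eta^2}{4})}{\alpha^\kappa\,M(\frac\kappa2,\kappa+\frac12,-\frac{\alpha^2}{4})}&\text{if }0\le\eta<\alpha,\\[2ex]\dfrac{u^*_\gamma}{\operatorname{erfc}(\frac\alpha2)}\,\operatorname{erfc}(\frac\eta2)&\text{if }\eta\ge\alpha.\end{cases}$$ *)

(* Defs.v *)
From HB Require Import structures.
From mathcomp Require Import all_boot all_order all_algebra.
From mathcomp Require Import all_classical all_reals all_analysis.
From mathcomp Require Import measurable_realfun.

Set Implicit Arguments.
Unset Strict Implicit.
Unset Printing Implicit Defensive.

Import Order.TTheory GRing.Theory Num.Theory.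
Import numFieldNormedType.Exports.

Local Open Scope classical_set_scope.
Local Open Scope ring_scope.

(* Measurability with respect to the completion of mu; for Lebesgue measure
   (or its square) this is Lebesgue, and not only Borel, measurability. The
   integral of the library against mu is a supremum over mu-measurable simple
   functions, and so gives the usual value on such functions as well. *)
Definition completed_measurable_fun d (T : measurableType d) (R : realType)
    (mu : {measure set T -> \bar R}) (D : set T) (f : T -> R) : Prop :=
  @measurable_fun _ _ (g_sigma_algebraType (completed_algebra_gen mu)) R D f.

Section SpecialFunctions.
Variable R : realType.
Notation leb := (@lebesgue_measure R).

Definition erfc (z : R) : R :=
  2 / Num.sqrt pi * \int[leb]_(y in `[z, +oo[) expR (- y ^+ 2).

Definition pochhammer (a : R) (n : nat) : R := \prod_(i < n) (a + i%:R).

Definition kummerM (a b z : R) : R :=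
  limn (pseries (fun n => pochhammer a n / pochhammer b n / n`!%:R) z).

End SpecialFunctions.

Section HHMO.
Variable R : realType.
Notation leb := (@lebesgue_measure R).

Definition Psi (alpha beta eta : R) : R :=
  alpha * beta / 2 * expR (alpha ^+ 2 / 4) *
  \int[leb]_(zeta in `[Num.max `|eta| alpha, +oo[) expR (- (zeta ^+ 2 / 4)).

(* Only meaningful for t >= 0. *)
Definition psi (alpha beta x t : R) : R :=
  if t == 0 then (if x == 0 then Psi alpha beta alpha else 0)
  else Psi alpha beta (x / Num.sqrt t).

(* Functions of (x, t) are total on R * R; every clause below restricts t to
   [0, +oo[ or to [0, T], so that their values for t < 0 play no role. *)

Definition strip (T : R) : set (R * R) := [set z | 0 <= z.2 <= T].

Definition continuous_on_strip (T : R) (f : R -> R -> R) : Prop :=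
  {within strip T, continuous (fun z : R * R => f z.1 z.2)}.

Definition d_x (f : R -> R -> R) (x t : R) : R := derive1 (fun y => f y t) x.

Definition derivable_x (T : R) (f : R -> R -> R) : Prop :=
  forall x t : R, 0 <= t <= T -> derivable (fun y => f y t) x 1.

(* ft is the t-derivative of f on the closed strip, one-sided at t = 0, T. *)
Definition is_d_t (T : R) (f ft : R -> R -> R) : Prop :=
  forall x t : R, 0 <= t <= T ->
    (f x s - f x t) / (s - t) @[s --> within `[0, T] t^'] --> ft x t.

Definition test_function (T : R) (phi phit : R -> R -> R) : Prop :=
  [/\ continuous_on_strip T phi,
      derivable_x T phi /\ continuous_on_strip T (d_x phi),
      is_d_t T phi phit /\ continuous_on_strip T phit,
      exists K : R, forall x t : R, 0 <= t <= T -> K <= `|x| -> phi x t = 0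
    & forall x : R, phi x T = 0].

Definition running_sup (u : R -> R -> R) (x t : R) : \bar R :=
  ereal_sup [set (u x s)%:E | s in `[0, t]].

Record weak_solution (alpha beta ustar : R) (u p : R -> R -> R) : Prop :=
  WeakSolution {
  weak_even : forall x t : R, 0 <= t -> u x t = u (- x) t /\ p x t = p (- x) t ;
  weak_regular : forall T : R, 0 < T ->
    let w := fun x t : R => u x t - psi alpha beta x t in
    [/\ exists K : R, forall x t : R, 0 <= t <= T -> `|w x t| <= K,
        continuous_on_strip T w,
        derivable_x T w
      & continuous_on_strip T (d_x w)] ;
  weak_measurable :
    completed_measurable_fun (leb \x leb)%E
      (setT `*` `[0, +oo[) (fun z : R * R => p z.1 z.2) ;
  weak_precipitation : forall x t : R, 0 <= t ->
    [/\ (running_sup u x t < ustar%:E)%E -> p x t = 0,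
        running_sup u x t = ustar%:E -> 0 <= p x t <= 1
      & (ustar%:E < running_sup u x t)%E -> p x t = 1] ;
  weak_nondecreasing : forall x s t : R, 0 <= s -> s <= t -> p x s <= p x t ;
  weak_equation : forall T : R, 0 < T ->
    forall phi phit : R -> R -> R, test_function T phi phit ->
    let w := fun x t : R => u x t - psi alpha beta x t in
    \int[leb]_(s in `[0, T]) (\int[leb]_y (phit y s * w y s)) =
    \int[leb]_(s in `[0, T])
      (\int[leb]_y (d_x phi y s * d_x w y s + p y s * u y s * phi y s))
}.

Definition condition_P (alpha : R) (p : R -> R -> R) (pstar : R -> R) : Prop :=
  completed_measurable_fun leb `]0, +oo[ pstar /\
  {ae leb, forall x : R, 0 < x ->
     forall t : R, x ^+ 2 / alpha ^+ 2 < t -> p x t = pstar x}.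

Definition kappa (gamma : R) : R := (1 + Num.sqrt (4 * gamma + 1)) / 2.

Definition ustar_gamma (alpha beta gamma : R) : R :=
  let k := kappa gamma in
  (k * kummerM (k / 2 + 1) (k + 1 / 2) (- (alpha ^+ 2 / 4))
     / (alpha * kummerM (k / 2) (k + 1 / 2) (- (alpha ^+ 2 / 4)))
   + expR (- (alpha ^+ 2 / 4)) / (Num.sqrt pi * erfc (alpha / 2)))^-1
  * (alpha * beta / 2).

(* Only meaningful for eta >= 0. *)
Definition Phi (alpha beta gamma eta : R) : R :=
  let k := kappa gamma in
  if eta < alpha then
    ustar_gamma alpha beta gamma * eta `^ k
      * kummerM (k / 2) (k + 1 / 2) (- (eta ^+ 2 / 4))
    / (alpha `^ k * kummerM (k / 2) (k + 1 / 2) (- (alpha ^+ 2 / 4)))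
  else ustar_gamma alpha beta gamma / erfc (alpha / 2) * erfc (eta / 2).

End HHMO.

(* Main.v *)
Require Import Defs.
From HB Require Import structures.
From mathcomp Require Import all_boot all_order all_algebra.
From mathcomp Require Import all_classical all_reals all_analysis.
From mathcomp Require Import measurable_realfun.
From mathcomp Require Import ring lra.

Set Implicit Arguments.
Unset Strict Implicit.
Unset Printing Implicit Defensive.

Import Order.TTheory GRing.Theory Num.Theory.
Import numFieldNormedType.Exports.

Local Open Scope classical_set_scope.
Local Open Scope ring_scope.

(* The function w = u - psi solves w_t = w_xx - p u weakly. All bounds come from one local maximum principle:
   if sg = 1 or sg = -1, g is classical near a point and g_t - g_xx - sg p u < 0 there, then sg w + g has no
   local maximum there among earlier times. To see it, test the weak equation with bumps, mollify sg w + g in x and compare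
   second variations at a maximum of the mollification. Only the comparison of p u with a measurable function is used.
   It yields 0 <= u <= psi, then u = O(t^(-3/8)) on bounded sets (p = 1 near x = 0, since u* < Psi(alpha)),
   and p(x, t) = 0 for x >= (alpha + delta) sqrt t and t large.
   Let P(x) be the integral of p* over [x, oo) and E' = P - gamma / x, so that x E'(x) -> 0. With eta = x / sqrt t,
   the function Phi_gamma(eta) exp (E(alpha sqrt t) - E(x)) for eta < alpha, continued by Phi_gamma(eta), solves
   S_t = S_xx - p* S up to a small error, which is absorbed by small multiples of sqrt(eta) e^(- eta^2 / 4), of the Gaussian
   tail (convex kinks at eta = alpha) and of t^(-1/4) e^(- eta^2 / 4) (initial time). Comparing u with it on
   x >= X, t >= T0 from both sides gives the convergence. Finally u(y, .) <= u* wherever p*(y) < 1, and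
   sup u(y, .) >= u* wherever p*(y) > 0; both occur for arbitrarily large y (the latter if gamma > 0), which
   determines Phi_gamma(alpha). *)

(** * Integrals of arbitrary functions *)

(** The limit hypothesis controls [p*] only on average: [p*] may oscillate between 0 and 1, so
    [p* - gamma / x^2] is not pointwise small and Phi_gamma itself is no approximate solution. The
    factor exp(-E) removes [p*] exactly, since E'' contains - p*; what remains carries factors x
    E'(x) = x P(x) - gamma, which tend to 0. Subtracting E from its value at x = alpha sqrt t keeps
    the factor equal to 1 at the source, so the slope jump there is preserved. The remaining
    residual is of order eta^(-3/2) / t near eta = 0, exactly what the heat operator makes of
    sqrt(eta) e^(- eta^2 / 4). On the lateral boundary x = X that correction has size t^(-1/4);
    hence u must first be shown to decay with some exponent above 1/4, and 3/8 is one. Regularity is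
    the other obstacle: w has a continuous x-derivative but no t-derivative, and slices of p may be
    non-measurable. Therefore time derivatives appear only as increments of mollifications, and p
    enters only through inequalities with a measurable function. *)

Section nonmeasurable_integral.
Context d (T : measurableType d) (R : realType) (mu : {measure set T -> \bar R}).
Import HBNNSimple.
Local Open Scope ereal_scope.

(* Slices of p need not be measurable; what survives for arbitrary functions is monotonicity up to a null set. *)
Lemma ge0_le_integral_negligible (N : set T) (f g : T -> \bar R) :
  mu.-negligible N -> (forall x, 0 <= f x) -> (forall x, 0 <= g x) ->
  (forall x, ~ N x -> f x <= g x) -> \int[mu]_x f x <= \int[mu]_x g x.
Proof.
move=> [A [mA A0 NA]] f0 g0 fg.
rewrite ge0_integralTE// ge0_integralTE//.
apply: ge_ereal_sup => _ [h/= hf <-].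
(* A simple function below [f], set to 0 on the measurable null set [A], lies below [g] everywhere
   and keeps its integral; so the suprema over simple functions compare. *)
have mAC : measurable (~` A) by exact: measurableC.
apply: ereal_sup_ubound => /=; exists (proj_nnsfun h mAC).
  move=> x; rewrite /= mindicE.
  have [xA|xA] := boolP (x \in ~` A).
    by rewrite mulr1 (le_trans (hf x))// fg// => /NA; move: xA; rewrite inE.
  by rewrite mulr0.
rewrite -!integralT_nnsfun; apply: ae_eq_integral => //.
- exact/measurable_EFinP/measurable_funP.
- exact/measurable_EFinP/measurable_funP.
- exists A; split => // x /= /not_implyP[_]; apply: contra_notP => nAx.
  by rewrite /= mindicE mem_set// mulr1.
Qed.

Lemma integral_eq_negligible (N : set T) (f g : T -> \bar R) :
  mu.-negligible N -> (forall x, ~ N x -> f x = g x) ->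
  \int[mu]_x f x = \int[mu]_x g x.
Proof.
move=> N0 fg; rewrite [LHS]integralE [RHS]integralE.
have aux (k l : T -> \bar R) : (forall x, 0 <= k x) -> (forall x, 0 <= l x) ->
    (forall x, ~ N x -> k x = l x) -> \int[mu]_x k x = \int[mu]_x l x.
  move=> k0 l0 kl; apply/eqP; rewrite eq_le.
  by rewrite !(@ge0_le_integral_negligible N)// => x nx; rewrite kl.
congr (_ - _); apply: aux => //.
- by move=> x nx; rewrite !funeposE fg.
- by move=> x nx; rewrite !funenegE fg.
Qed.

Lemma le_integral_negligible (N : set T) (f g : T -> \bar R) :
  mu.-negligible N -> (forall x, ~ N x -> f x <= g x) ->
  \int[mu]_x f x <= \int[mu]_x g x.
Proof.
move=> N0 fg; rewrite [leLHS]integralE [leRHS]integralE.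
apply: leeB; apply: (ge0_le_integral_negligible N0) => // x Nx.
- by rewrite !funeposE ge_max !le_max lexx orbT andbT fg.
- by rewrite !funenegE ge_max !le_max lexx orbT andbT leeN2 fg.
Qed.

End nonmeasurable_integral.

Section nonmeasurable_Rintegral.
Context d (T : measurableType d) (R : realType) (mu : {measure set T -> \bar R}).

(** [Rintegral] sends an infinite integral to 0, so real integrals are monotone only once both are
    known to be finite; for an arbitrary [f] this comes from squeezing between [- h] and [h]. *)
Lemma fin_num_integral_dominated (D : set T) (N : set T) (f h : T -> R) :
  measurable D -> mu.-negligible N -> mu.-integrable D (EFin \o h) ->
  (forall x, D x -> ~ N x -> `|f x| <= h x) ->
  (\int[mu]_(x in D) (f x)%:E)%E \is a fin_num.
Proof.
move=> mD N0 ih fh.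
have hfin := integrable_fin_num mD ih.
rewrite fin_numElt; apply/andP; split.
  apply: (@lt_le_trans _ _ (\int[mu]_(x in D) (- h x)%:E)%E).
    rewrite ltNye_eq; apply/orP; left.
    exact/integrable_fin_num/(@integrableN _ _ _ _ _ (EFin \o h)).
  rewrite integral_mkcond [leRHS]integral_mkcond.
  apply: (le_integral_negligible N0) => x Nx; rewrite /patch; case: ifPn => // xD.
  by rewrite lee_fin; have := fh _ (set_mem xD) Nx; rewrite ler_norml => /andP[].
apply: (@le_lt_trans _ _ (\int[mu]_(x in D) (h x)%:E)%E); last first.
  by rewrite ltey_eq hfin.
rewrite integral_mkcond [leRHS]integral_mkcond.
apply: (le_integral_negligible N0) => x Nx; rewrite /patch; case: ifPn => // xD.
by rewrite lee_fin; have := fh _ (set_mem xD) Nx; rewrite ler_norml => /andP[].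
Qed.

Lemma le_Rintegral_negligible (D : set T) (N : set T) (f g h : T -> R) :
  measurable D -> mu.-negligible N -> mu.-integrable D (EFin \o h) ->
  (forall x, D x -> ~ N x -> `|f x| <= h x) ->
  (forall x, D x -> ~ N x -> `|g x| <= h x) ->
  (forall x, D x -> ~ N x -> f x <= g x) ->
  \int[mu]_(x in D) f x <= \int[mu]_(x in D) g x.
Proof.
move=> mD N0 ih fh gh fg; rewrite /Rintegral fine_le//.
- exact: (fin_num_integral_dominated mD N0 ih).
- exact: (fin_num_integral_dominated mD N0 ih).
rewrite integral_mkcond [leRHS]integral_mkcond.
apply: (le_integral_negligible N0) => x Nx; rewrite /patch; case: ifPn => // xD.
by rewrite lee_fin fg//; exact: set_mem.
Qed.

End nonmeasurable_Rintegral.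

(** For each rational [q] the set where [f > q] is a Borel set up to a null set. Countably many null
    sets fit into one Borel null set [U]; off [U] the function is Borel, and it is extended by 0. *)
Lemma completed_lebesgue_measurable_funP (R : realType) (D : set R) (f : R -> R) :
  measurable D -> completed_measurable_fun (@lebesgue_measure R) D f ->
  exists (N : set R) (g : R -> R), [/\ (@lebesgue_measure R).-negligible N,
    measurable_fun setT g & forall x, D x -> ~ N x -> f x = g x].
Proof.
move=> mD mf.
have mlev (q : rat) : completed_algebra_gen (@lebesgue_measure R)
    (D `&` f @^-1` `]ratr q, +oo[).
  rewrite -g_sigma_completed_algebra_genE; apply: mf => //.
  rewrite g_sigma_completed_algebra_genE; exists D => //; exists set0.
    exact: negligible_set0.
  by rewrite setU0.
have /choice[A /choice[N ANP]] : forall q : rat, exists A N : set R, [/\ measurable A,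
    (@lebesgue_measure R).-negligible N & A `|` N = D `&` f @^-1` `]ratr q, +oo[].
  by move=> q; have [A mA [N nN ANE]] := mlev q; exists A, N.
have {ANP}[mA nN ANE] : [/\ forall q, measurable (A q),
   forall q, (@lebesgue_measure R).-negligible (N q)
   & forall q, A q `|` N q = D `&` f @^-1` `]ratr q, +oo[].
  by split => q; have [] := ANP q.
have [U [mU U0 NU]] : (@lebesgue_measure R).-negligible
    (\bigcup_n oapp N set0 (@unpickle rat n)).
  apply: negligible_bigcup => n; case: unpickle => //=.
  exact: negligible_set0.
have NqU q : N q `<=` U.
  by move=> x Nx; apply: NU; exists (pickle q); [|rewrite pickleK].
pose E := D `\` U.
have mE : measurable E by exact: measurableD.
have mEf : measurable_fun E f.
  move=> mT; apply: (measurability _ (RGenOInfty.measurableE R)) => //.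
  move=> /= _ [_ [y ->] <-].
  (* A real level [y] is reached from the rational levels above it; [pickle] turns this into a union
     over the natural numbers. *)
  rewrite [X in measurable X](_ : _ = \bigcup_n
     (if @unpickle rat n is Some q then if (y < ratr q) then A q `&` E else set0 else set0)).
    apply: bigcup_measurable => n _; case: unpickle => // q; case: ifPn => // _.
    exact: measurableI.
  apply/seteqP; split=> x.
    move=> [Ex]; rewrite /= in_itv/= andbT => yf.
    have [q] := rat_in_itvoo yf; rewrite in_itv/= => /andP[yq qf].
    exists (pickle q); [by []|rewrite pickleK yq; split => //].
    have : (A q `|` N q) x.
      by rewrite ANE; split; [exact: Ex.1|rewrite /= in_itv/= andbT].
    by case => // /NqU/Ex.2.
  move=> [n _]; case: unpickle => // q; case: ifPn => // yq [Ax Ex]; split => //.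
  have : (A q `|` N q) x by left.
  rewrite ANE /= => -[_]; rewrite in_itv/= andbT in_itv/= andbT.
  exact: lt_trans.
exists U, (f \_ E); split.
- by exists U; split.
- exact/(measurable_restrictT f mE).
- by move=> x Dx nUx; rewrite patchE mem_set.
Qed.

(** * Bump functions and mollification *)

Lemma is_derive_compE (R : realType) (f g : R -> R) (x a b c : R) :
  is_derive (g x) 1 f a -> is_derive x 1 g b -> c = a * b ->
  is_derive x 1 (fun y => f (g y)) c.
Proof. by move=> df dg ->; exact: is_derive1_comp df dg. Qed.

Lemma is_derive_continuous (R : realType) (f : R -> R) (x a : R) :
  is_derive x 1 f a -> {for x, continuous f}.
Proof. by case=> H _; apply/differentiable_continuous/derivable1_diffP. Qed.

Section truncated_powers.
Variable R : realType.
Implicit Types x y z d e s t : R.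

Lemma continuous_max0 : continuous (fun z : R => Num.max 0 z).
Proof. by move=> z; apply: continuous_max; [exact: cst_continuous|exact: id]. Qed.

Lemma is_derive_sqr_max0 z :
  is_derive z 1 (fun z : R => (Num.max 0 z) ^+ 2) (2 * Num.max 0 z).
Proof.
have [z0|z0|->] := ltgtP z 0.
- rewrite mulr0.
  apply: (@near_eq_is_derive _ _ _ (cst 0)).
    near=> y; rewrite max_l ?expr0n//.
    by near: y; exact: lt_le_nbhsl.
- apply: (@near_eq_is_derive _ _ _ (fun y : R => y ^+ 2)).
    near=> y; rewrite max_r//.
    by near: y; exact: lt_le_nbhsr.
  by apply: is_derive_eq; rewrite /GRing.scale/=; ring.
- apply/is_derive1_caratheodory; exists (fun y => Num.max 0 y); split.
  + move=> y; rewrite !subr0 maxxx expr0n/= subr0.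
    by case: (leP 0 y) => y0; rewrite ?expr2// mul0r mul0r.
  + exact: continuous_max0.
  + by rewrite maxxx mulr0.
Unshelve. all: by end_near. Qed.

(** Squaring the truncated parabola gives a C^1 function. This is smooth enough, because of the two
    x-derivatives of a mollification one always falls on the mollified function. *)
Definition bump d z : R := (Num.max 0 (d ^+ 2 - z ^+ 2)) ^+ 2.
Definition dbump d z : R := - 4 * z * Num.max 0 (d ^+ 2 - z ^+ 2).

Lemma is_derive_bump d z : is_derive z 1 (bump d) (dbump d z).
Proof.
have H : is_derive z 1 (fun z : R => d ^+ 2 - z ^+ 2) (- (2 * z)).
  by apply: is_derive_eq; rewrite /GRing.scale/=; ring.
have := @is_derive1_comp _ _ (fun z : R => d ^+ 2 - z ^+ 2) z _ _
  (is_derive_sqr_max0 (d ^+ 2 - z ^+ 2)) H.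
by move=> /is_derive_eq; apply; rewrite /dbump; ring.
Qed.

Lemma bump_ge0 d z : 0 <= bump d z. Proof. exact: sqr_ge0. Qed.

Lemma bump_gt0 d z : `|z| < d -> 0 < bump d z.
Proof.
move=> zd; rewrite exprn_gt0// lt_max subr_gt0 -(real_normK (num_real z)).
by rewrite ltr_pXn2r ?nnegrE ?zd ?orbT// ltW// (le_lt_trans _ zd).
Qed.

Lemma max0_out d z : 0 <= d -> d <= `|z| -> Num.max 0 (d ^+ 2 - z ^+ 2) = 0.
Proof.
move=> d0 dz; apply: max_l; rewrite subr_le0 -(real_normK (num_real z)).
by rewrite ler_pXn2r ?nnegrE.
Qed.

Lemma bump_out d z : 0 <= d -> d <= `|z| -> bump d z = 0.
Proof. by move=> d0 dz; rewrite /bump max0_out// expr0n. Qed.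

Lemma dbump_out d z : 0 <= d -> d <= `|z| -> dbump d z = 0.
Proof. by move=> d0 dz; rewrite /dbump max0_out// mulr0. Qed.

Lemma continuous_bump d : continuous (bump d).
Proof.
by move=> z; have /derivable1_diffP/differentiable_continuous := @ex_derive _ _ _ _ _ _ _ (is_derive_bump d z).
Qed.

Lemma continuous_dbump d : continuous (dbump d).
Proof.
move=> z; apply: cvgM; first by apply: cvgM; [exact: cvg_cst|exact: cvg_id].
apply: (@continuous_comp _ _ _ (fun z : R => d ^+ 2 - z ^+ 2)); last exact: continuous_max0.
by apply: cvgB; [exact: cvg_cst|exact: exprn_continuous].
Qed.

(** The integral of the tent [dstep], which is supported on [0, 1] with peak 2 at 1/2; so [step]
    climbs from 0 to 1. *)
Definition step z : R := 2 * ((Num.max 0 z) ^+ 2 -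
  2 * (Num.max 0 (z - 2^-1)) ^+ 2 + (Num.max 0 (z - 1)) ^+ 2).
Definition dstep z : R := 4 * (Num.max 0 z -
  2 * Num.max 0 (z - 2^-1) + Num.max 0 (z - 1)).

Lemma is_derive_step z : is_derive z 1 step (dstep z).
Proof.
have H a : is_derive z 1 (fun z : R => (Num.max 0 (z - a)) ^+ 2) (2 * Num.max 0 (z - a)).
  have Ha : is_derive z 1 (fun z : R => z - a) 1.
    by apply: is_derive_eq; rewrite subr0.
  have := @is_derive1_comp _ _ (fun z : R => z - a) z _ _ (is_derive_sqr_max0 (z - a)) Ha.
  by move=> /is_derive_eq; apply; rewrite mulr1.
have H0 := is_derive_sqr_max0 z.
rewrite /step; apply: is_derive_eq.
by rewrite /dstep /GRing.scale/=; ring.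
Qed.

Lemma dstep_ge0 z : 0 <= dstep z.
Proof.
rewrite /dstep; have [?|?] := leP 0 z; have [?|?] := leP 0 (z - 2^-1);
  have [?|?] := leP 0 (z - 1); lra.
Qed.

Lemma dstep_out z : ~~ (0 < z < 1) -> dstep z = 0.
Proof.
rewrite /dstep; have [?|?] := leP 0 z; have [?|?] := leP 0 (z - 2^-1);
  have [?|?] := leP 0 (z - 1); rewrite negb_and -!leNgt => /orP[] ?; lra.
Qed.

Lemma step_le0 z : z <= 0 -> step z = 0.
Proof.
move=> z0; rewrite /step !max_l//; first by rewrite expr0n; lra.
- by lra.
- by lra.
Qed.

Lemma step_ge1 z : 1 <= z -> step z = 1.
Proof.
move=> z0; rewrite /step !max_r//; first by field.
- by lra.
- by lra.
- by lra.
Qed.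

Lemma continuous_step : continuous step.
Proof.
by move=> z; have /derivable1_diffP/differentiable_continuous := @ex_derive _ _ _ _ _ _ _ (is_derive_step z).
Qed.

Lemma continuous_dstep : continuous dstep.
Proof.
have H a : continuous (fun z : R => Num.max 0 (z - a)).
  move=> z; apply: (@continuous_comp _ _ _ (fun z : R => z - a)); last exact: continuous_max0.
  by apply: cvgB; [exact: cvg_id|exact: cvg_cst].
move=> z; apply: cvgM; first exact: cvg_cst.
apply: cvgD; last exact: H.
apply: cvgB; first exact: continuous_max0.
by apply: cvgM; [exact: cvg_cst|exact: H].
Qed.

Lemma le_step y z : y <= z -> step y <= step z.
Proof.
move=> yz; apply: (@ger0_derive1_le_cc _ step y z) => //.
- by move=> x _; apply: (@ex_derive _ _ _ _ _ _ _ (is_derive_step x)).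
- by move=> x _; rewrite derive1E; have [_ ->] := is_derive_step x; exact: dstep_ge0.
- by apply: continuous_subspaceT; exact: continuous_step.
- by rewrite in_itv/= lexx.
- by rewrite in_itv/= lexx andbT.
Qed.

End truncated_powers.

Section calculus.
Variable R : realType.

(** Heine's theorem, from the near-covering form of compactness, which glues the local radii into
    one. *)
Lemma compact_unif_continuous (K : set (R * R)) (f : R * R -> R) (e : R) :
  compact K -> {within K, continuous f} -> 0 < e ->
  exists2 r : R, 0 < r & forall z z' : R * R, K z -> K z' -> `|z.1 - z'.1| < r ->
    `|z.2 - z'.2| < r -> `|f z - f z'| < e.
Proof.
move=> cK cf e0.
pose P (r : R) (z : R * R) := forall z', K z -> K z' -> `|z.1 - z'.1| < r ->
    `|z.2 - z'.2| < r -> `|f z - f z'| < e.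
have : \forall r \near 0^'+, forall z, K z -> P r z.
  move/compact_near_coveringP : cK; apply => z Kz.
  have : within K (nbhs z) [set t | `|f z - f t| < e / 2].
    rewrite (nbhs_subspace_in Kz); have /cvgrPdist_lt := cf z.
    by apply; rewrite divr_gt0.
  move=> /nbhs_ballP[r /= r0 Hr].
  near=> z1 r1 => z2 Kz1 Kz2 d1 d2.
  have z1b : ball z (r / 2) z1 by near: z1; apply: nbhsx_ballx; rewrite divr_gt0.
  have r1r : r1 <= r / 2 by near: r1; apply: nbhs_right_le; rewrite divr_gt0.
  have B1 : `|f z - f z1| < e / 2.
    by apply: Hr => //; apply: le_ball z1b; lra.
  have B2 : `|f z - f z2| < e / 2.
    apply: Hr => //; rewrite (splitr r); apply: ball_triangle z1b _.
    by split; [exact: lt_le_trans d1 r1r|exact: lt_le_trans d2 r1r].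
  rewrite (le_lt_trans (ler_distD (f z) _ _))// (splitr e) ltrD//.
  by rewrite distrC.
move=> H; near (0:R)^'+ => r; exists r => // z z' Kz Kz' d1 d2.
have : forall z, K z -> P r z by near: r.
by move=> /(_ z Kz); apply.
Unshelve. all: by end_near. Qed.

(** At a local maximum [f' x = 0]; positivity of the second derivative at the single point [x] makes
    [f'] positive just to the right, and the mean value theorem makes [f] increase there. *)
Lemma no_max_of_deriv2_gt0 (f f' : R -> R) (x l : R) :
  (\forall y \near x, is_derive (y : R) (1 : R) f (f' y)) ->
  is_derive x 1 f' l -> 0 < l -> ~ (\forall y \near x, f y <= f x).
Proof.
move=> df df' l0 fmax.
have f'x : f' x = 0.
  have /nbhs_ballP[r /= r0 Hr] : \forall y \near x, is_derive (y : R) (1 : R) f (f' y) /\ f y <= f x.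
    exact: filterI.
  have xr : x \in `]x - r, x + r[ by rewrite in_itv/= ltrBlDr !ltrDl r0.
  have inb y : y \in `]x - r, x + r[ -> ball x r y.
    by rewrite in_itv/= -ltr_distlC.
  have [] := @derive1_at_max _ f (x - r) (x + r) x _ _ xr _.
  - by rewrite lerD2l (@le_trans _ _ 0)// ?oppr_le0 ltW.
  - by move=> y /inb /Hr[[]].
  - by move=> y /inb /Hr[].
  - by move=> _ <-; have [[_ <-] _] := Hr _ (inb _ xr).
have /is_derive1_caratheodory[g [gE gc gx]] := df'.
have gpos : \forall y \near x, 0 < g y by exact: (@cvgr_gt _ _ _ _ g (g x) gc 0 (eq_ind_r (fun a => 0 < a) l0 gx)).
have /nbhs_ballP[r /= r0 Hr] : \forall y \near x,
    [/\ is_derive (y : R) (1 : R) f (f' y), f y <= f x & 0 < g y].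
  by near=> y; split; near: y.
pose y := x + r / 2.
have xy : x < y by rewrite ltrDl divr_gt0.
have inb z : x <= z <= y -> ball x r z.
  move=> /andP[xz zy]; rewrite /ball/= distrC ger0_norm ?subr_ge0//.
  by rewrite ltrBlDl (le_lt_trans zy)// ltrD2l ltr_pdivrMr// ltr_pMr// ltr1n.
have dfy z : z \in `[x, y] -> is_derive z 1 f (f' z).
  by rewrite in_itv/= => /inb /Hr[].
have [z zxy fE] := @MVT _ f f' x y xy (fun z zxy => dfy z (subset_itv_oo_cc zxy))
  (derivable_within_continuous (fun z zxy => @ex_derive _ _ _ _ _ _ _ (dfy z zxy))).
have : f y <= f x by have [] := Hr y (inb y (introT andP (conj (ltW xy) (lexx y)))).
apply/negP; rewrite -ltNge -subr_gt0 fE mulr_gt0 ?subr_gt0//.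
move: zxy; rewrite in_itv/= => /andP[xz zy].
have [_ _ gz] := Hr z (inb z (introT andP (conj (ltW xz) (ltW zy)))).
by have := gE z; rewrite f'x subr0 => ->; rewrite mulr_gt0// subr_gt0.
Unshelve. all: by end_near. Qed.

End calculus.

Section kernel.
Variable R : realType.
Notation leb := (@lebesgue_measure R).
Implicit Types (l h x y d : R) (q : R -> R).

Lemma integrable_segment l h (f : R -> R) : {within `[l, h], continuous f} ->
  leb.-integrable `[l, h] (EFin \o f).
Proof.
by move=> cf; apply: continuous_compact_integrable => //; exact: segment_compact.
Qed.

Lemma bounded_segment l h (f : R -> R) : {within `[l, h], continuous f} ->
  exists2 M : R, 0 < M & forall y, l <= y <= h -> `|f y| <= M.
Proof.
move=> cf.
have := compact_bounded (continuous_compact cf (@segment_compact _ l h)).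
move=> /ex_strict_bound_gt0[M M0 HM]; exists M => // y ylh; apply/ltW/HM.
by exists y => //; rewrite /= in_itv.
Qed.

Lemma integrable_segmentM l h (f k : R -> R) : {within `[l, h], continuous f} ->
  measurable_fun setT k -> (forall y, 0 <= k y <= 1) ->
  leb.-integrable `[l, h] (EFin \o (fun y => k y * f y)).
Proof.
move=> cf mk k01; rewrite (_ : _ \o _ = (EFin \o k) \* (EFin \o f))%E//.
apply: integrableMr => //; first exact: measurable_funTS.
  exists 1; split => // M M1 y _ /=; have /andP[k0 k1] := k01 y.
  by rewrite ger0_norm// (le_trans k1)// ltW.
exact: integrable_segment.
Qed.

Lemma Rintegral_supp l h (f : R -> R) : (forall y, ~~ (l <= y <= h) -> f y = 0) ->
  \int[leb]_y f y = \int[leb]_(y in `[l, h]) f y.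
Proof.
move=> f0; rewrite [RHS]Rintegral_mkcond; congr (Rintegral _ _ _).
apply/funext => y; rewrite patchE; case: ifPn => //.
by rewrite notin_setE/= in_itv/= => /negP/f0.
Qed.

Lemma Rintegral_segment_cst l h (c : R) : l < h ->
  \int[leb]_(y in `[l, h]) c = c * (h - l).
Proof.
by move=> lh; rewrite /Rintegral integral_cst//= lebesgue_measure_itv/= lte_fin lh -EFinD -EFinM.
Qed.

Lemma ge_dbump d z : 0 < d -> `|dbump d z| <= 4 * d ^+ 3.
Proof.
move=> d0; have [dz|zd] := leP d `|z|.
  by rewrite dbump_out ?normr0 ?mulr_ge0 ?exprn_ge0// ltW.
have zd2 : 0 <= d ^+ 2 - z ^+ 2.
  by rewrite subr_ge0 -(real_normK (num_real z)) ler_pXn2r ?nnegrE ?(ltW zd) ?(ltW d0).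
rewrite /dbump max_r// normrM (ger0_norm zd2) (_ : 4 * d ^+ 3 = 4 * d * d ^+ 2); last by ring.
rewrite ler_pM// ?gerBl ?sqr_ge0// normrM normrN (ger0_norm (ler0n _ 4)).
by rewrite ler_pM2l// ltW.
Qed.

Lemma within_continuous_bumpM l h d x q : {within `[l, h], continuous q} ->
  {within `[l, h], continuous (fun y => bump d (y - x) * q y)}.
Proof.
move=> cq y; apply: cvgM; last exact: cq.
apply: (continuous_subspaceT (f := fun y => bump d (y - x))) => z.
apply: (@continuous_comp _ _ _ (fun z : R => z - x) (bump d)); last exact: continuous_bump.
by apply: cvgB; [exact: cvg_id|exact: cvg_cst].
Qed.

Lemma within_continuous_dbumpM l h d x q : {within `[l, h], continuous q} ->
  {within `[l, h], continuous (fun y => dbump d (y - x) * q y)}.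
Proof.
move=> cq y; apply: cvgM; last exact: cq.
apply: (continuous_subspaceT (f := fun y => dbump d (y - x))) => z.
apply: (@continuous_comp _ _ _ (fun z : R => z - x) (dbump d)); last exact: continuous_dbump.
by apply: cvgB; [exact: cvg_id|exact: cvg_cst].
Qed.

Lemma is_derive_bump_shift d x y :
  is_derive y 1 (fun y : R => bump d (y - x)) (dbump d (y - x)).
Proof.
have H : is_derive y 1 (fun y : R => y - x) 1 by apply: is_derive_eq; rewrite subr0.
have := @is_derive1_comp _ _ (fun y : R => y - x) y _ _ (is_derive_bump d (y - x)) H.
by move=> /is_derive_eq; apply; rewrite mulr1.
Qed.

Lemma is_derive_bump_center d x y :
  is_derive x 1 (fun x : R => bump d (y - x)) (- dbump d (y - x)).
Proof.
have H : is_derive x 1 (fun x : R => y - x) (- 1) by apply: is_derive_eq; lra.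
have := @is_derive1_comp _ _ (fun x : R => y - x) x _ _ (is_derive_bump d (y - x)) H.
by move=> /is_derive_eq; apply; rewrite mulrN1.
Qed.

(** The derivative falls on the bump, so continuity of [q] suffices; the constant [4 * d ^+ 3 * M]
    dominates the differentiated integrand. *)
Lemma is_derive_mollify l h d x q : 0 < d -> {within `[l, h], continuous q} ->
  is_derive x 1 (fun x : R => \int[leb]_(y in `[l, h]) (bump d (y - x) * q y))
    (- \int[leb]_(y in `[l, h]) (dbump d (y - x) * q y)).
Proof.
move=> d0 cq.
pose f (x y : R) := bump d (y - x) * q y.
have df x' y : is_derive x' 1 (f ^~ y) (- dbump d (y - x') * q y).
  have H := is_derive_bump_center d x' y.
  rewrite /f; apply: is_derive_eq.
  by rewrite /GRing.scale/=; ring.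
have [M M0 qM] := bounded_segment cq.
have d1E : partial1of2 f = fun x y => - dbump d (y - x) * q y.
  apply/funext => x'; apply/funext => y.
  by rewrite partial1of2E; have [_ ->] := df x' y.
have H1 : `]x - 1, x + 1[%classic x by rewrite /= in_itv/= ltrBlDr !ltrDl ltr01.
have H2 x' : `]x - 1, x + 1[%classic x' -> leb.-integrable `[l, h] (EFin \o f x').
  by move=> _; apply: integrable_segment; exact: within_continuous_bumpM.
have H3 x' y : `]x - 1, x + 1[%classic x' -> `[l, h]%classic y -> derivable (f ^~ y) x' 1.
  by move=> _ _; have [] := df x' y.
have H4 (y : R) : 0 <= 4 * d ^+ 3 * M by rewrite !mulr_ge0 ?exprn_ge0// ltW.
have H5 : leb.-integrable `[l, h] (EFin \o (fun=> 4 * d ^+ 3 * M)).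
  by apply: integrable_segment; apply: continuous_subspaceT => z; exact: cvg_cst.
have H6 x' y : `]x - 1, x + 1[%classic x' -> `[l, h]%classic y ->
    `|partial1of2 f x' y| <= 4 * d ^+ 3 * M.
  move=> _; rewrite /= in_itv/= => ylh.
  by rewrite d1E normrM normrN ler_pM// ?ge_dbump// qM.
have D1 := (@derivable_under_integral R _ _ leb f `[l, h] (measurable_itv _) x (x - 1) (x + 1) H1 H2 H3 _ H4 H5 H6).
have D2 := (@differentiation_under_integral R _ _ leb f `[l, h] (measurable_itv _) x (x - 1) (x + 1) H1 H2 H3 _ H4 H5 H6).
apply: DeriveDef => //; rewrite -derive1E D2 d1E -[RHS]mulN1r -RintegralZl//; last first.
  by apply: integrable_segment; exact: within_continuous_dbumpM.
by apply: eq_Rintegral => y _; rewrite mulN1r mulNr.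
Qed.

(** The boundary terms vanish because the support of the bump lies inside the segment. *)
Lemma mollify_by_parts l h d x (v v' : R -> R) : 0 <= d -> l < h -> l <= x - d -> x + d <= h ->
  {within `[l, h], continuous v'} ->
  (forall y, l <= y <= h -> is_derive y 1 v (v' y)) ->
  \int[leb]_(y in `[l, h]) (dbump d (y - x) * v y) =
  - \int[leb]_(y in `[l, h]) (bump d (y - x) * v' y).
Proof.
move=> d0 lh lx xh cv' dv.
have cv : {within `[l, h], continuous v}.
  apply: derivable_within_continuous => y; rewrite in_itv/= => /dv H.
  exact: ex_derive.
have cb : {within `[l, h], continuous (fun y => dbump d (y - x))}.
  apply: continuous_subspaceT => z.
  apply: (@continuous_comp _ _ _ (fun z : R => z - x) (dbump d)); last exact: continuous_dbump.
  by apply: cvgB; [exact: cvg_id|exact: cvg_cst].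
have oo (f f' : R -> R) : (forall y, l <= y <= h -> is_derive y 1 f (f' y)) ->
    derivable_oo_LRcontinuous f l h.
  move=> df; have cf y : l <= y <= h -> {for y, continuous f}.
    by move=> /df[? _]; apply/differentiable_continuous/derivable1_diffP.
  split.
  - by move=> y; rewrite in_itv/= => /andP[/ltW ly /ltW yh]; have [] := df y (introT andP (conj ly yh)).
  - by apply: cvg_at_right_filter; apply: cf; rewrite lexx ltW.
  - by apply: cvg_at_left_filter; apply: cf; rewrite lexx ltW.
have ooE (f f' : R -> R) : (forall y, l <= y <= h -> is_derive y 1 f (f' y)) ->
    {in `]l, h[, derive1 f =1 f'}.
  move=> df y; rewrite in_itv/= => /andP[/ltW ly /ltW yh]; rewrite derive1E.
  by have [_ ->] := df y (introT andP (conj ly yh)).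
have db y : l <= y <= h -> is_derive y 1 (fun y : R => bump d (y - x)) (dbump d (y - x)).
  by move=> _; exact: is_derive_bump_shift.
rewrite (@Rintegration_by_parts _ (fun y => bump d (y - x)) v (fun y => dbump d (y - x)) v' l h)//.
- rewrite [bump d (h - x)]bump_out// ?[bump d (l - x)]bump_out//.
  + by rewrite !mul0r subrr sub0r opprK.
  + rewrite ler0_norm; lra.
  + rewrite ger0_norm; lra.
- exact: oo db.
- exact: ooE db.
- exact: oo dv.
- exact: ooE dv.
Qed.

End kernel.

Section segment_plane.
Variable R : realType.

Definition rect (l h s t : R) : set (R * R) := `[l, h] `*` `[s, t].

Lemma compact_rect l h s t : compact (rect l h s t).
Proof. by apply: compact_setX; exact: segment_compact. Qed.

Lemma rectP l h s t (z : R * R) : rect l h s t z <-> l <= z.1 <= h /\ s <= z.2 <= t.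
Proof. by rewrite /rect /= !in_itv. Qed.

Lemma bounded_rect l h s t (f : R * R -> R) : {within rect l h s t, continuous f} ->
  exists2 M : R, 0 < M & forall y tau, l <= y <= h -> s <= tau <= t -> `|f (y, tau)| <= M.
Proof.
move=> cf.
have := compact_bounded (continuous_compact cf (@compact_rect l h s t)).
move=> /ex_strict_bound_gt0[M M0 HM]; exists M => // y tau ylh taust; apply/ltW/HM.
by exists (y, tau) => //; rewrite rectP.
Qed.

Lemma within_comp (S T U : topologicalType) (A : set T) (B : set S) (f : T -> U)
    (phi : S -> T) : {within A, continuous f} -> continuous phi ->
  (forall x, B x -> A (phi x)) -> {within B, continuous (fun x => f (phi x))}.
Proof.
move=> /subspace_continuousP cf cphi BA; apply/subspace_continuousP => x Bx.
move=> V HV; have H := cf _ (BA _ Bx) V HV.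
have H' : nbhs x (fun y => A (phi y) -> V (f (phi y))) := cphi x _ H.
change (nbhs x (fun y => B y -> V (f (phi y)))).
by apply: filterS H' => y Hy By; exact/Hy/BA.
Qed.

Lemma within_interior_continuous (T U : topologicalType) (A : set T) (f : T -> U) x :
  {within A, continuous f} -> A° x -> {for x, continuous f}.
Proof.
move=> /subspace_continuousP cf Ax; have Ax' := nbhs_singleton Ax.
by have := cf x Ax'; rewrite within_interior.
Qed.

Lemma near_snd_gt (c x t : R) : c < t -> \forall z \near ((x, t) : R * R), c < z.2.
Proof.
move=> ct; exists ([set: R], [set s | c < s]); last by case=> a b /= [].
by split; [exact: filterT|exact: lt_nbhsr].
Qed.

Lemma near_snd_lt (c x t : R) : t < c -> \forall z \near ((x, t) : R * R), z.2 < c.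
Proof.
move=> ct; exists ([set: R], [set s | s < c]); last by case=> a b /= [].
by split; [exact: filterT|exact: lt_nbhsl].
Qed.

Lemma near_fst_gt (c x t : R) : c < x -> \forall z \near ((x, t) : R * R), c < z.1.
Proof.
move=> ct; exists ([set s | c < s], [set: R]); last by case=> a b /= [].
by split; [exact: lt_nbhsr|exact: filterT].
Qed.

Lemma near_fst_lt (c x t : R) : x < c -> \forall z \near ((x, t) : R * R), z.1 < c.
Proof.
move=> ct; exists ([set s | s < c], [set: R]); last by case=> a b /= [].
by split; [exact: lt_nbhsl|exact: filterT].
Qed.

Lemma continuous_pairl (y t : R) : {for y, continuous (fun y : R => (y, t))}.
Proof.
move=> V [[P Q] [/= Py Qt] PQV]; apply: filterS Py => z Pz; apply: PQV.
by split => //=; exact: nbhs_singleton.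
Qed.

Lemma continuous_pairr (y t : R) : {for t, continuous (fun t : R => (y, t))}.
Proof.
move=> V [[P Q] [/= Py Qt] PQV]; apply: filterS Qt => z Pz; apply: PQV.
by split => //=; exact: nbhs_singleton.
Qed.

Lemma rect_slice l h s t (f : R * R -> R) tau : {within rect l h s t, continuous f} ->
  s <= tau <= t -> {within `[l, h], continuous (fun y => f (y, tau))}.
Proof.
move=> cf taust; apply: (within_comp (phi := fun y => (y, tau)) cf).
  by move=> y; exact: continuous_pairl.
by move=> y; rewrite rectP /= in_itv/=.
Qed.

End segment_plane.

(** * Gaussian tails *)

Section gaussian_tail.
Variable R : realType.
Notation leb := (@lebesgue_measure R).
Implicit Types a b x y z : R.

Lemma cvg_expR1B : expR (1 - x : R) @[x --> +oo] --> (0 : R).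
Proof.
apply/cvgrPdist_lt => e e0; near=> x; rewrite sub0r normrN ger0_norm ?expR_ge0//.
rewrite -(lnK e0) ltr_expR ltrBlDr -ltrBlDl.
by near: x; exact/nbhs_pinfty_gt/num_real.
Unshelve. all: by end_near. Qed.

Lemma integral_expR1B a : (\int[leb]_(x in `[a, +oo[) (expR (1 - x))%:E)%E = (expR (1 - a))%:E.
Proof.
have d x : is_derive x 1 (fun x : R => - expR (1 - x)) (expR (1 - x)).
  have H : is_derive x 1 (fun x : R => 1 - x) (- 1) by apply: is_derive_eq; lra.
  have H2 : is_derive x 1 (fun x : R => expR (1 - x)) (- expR (1 - x)).
    by apply: (is_derive_compE (is_derive_expR _) H); rewrite mulrN1.
  by apply: is_derive_eq; rewrite opprK.
have c x : {for x, continuous (fun x : R => - expR (1 - x))}.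
  by have [H _] := d x; apply/differentiable_continuous/derivable1_diffP.
rewrite (@ge0_continuous_FTC2y _ (fun x => expR (1 - x)) (fun x => - expR (1 - x)) a 0)//.
- by rewrite sub0e EFinN oppeK.
- apply: continuous_subspaceT => x.
  apply: (@continuous_comp _ _ _ (fun x : R => 1 - x) expR); last exact: continuous_expR.
  by apply: cvgB; [exact: cvg_cst|exact: cvg_id].
- by rewrite -oppr0; apply: cvgN; exact: cvg_expR1B.
- exact/cvg_at_right_filter/c.
- by move=> x _; rewrite derive1E; have [_ ->] := d x.
Qed.

Variable G : R -> R.
Hypothesis cG : continuous G.
Hypothesis G0 : forall x, 0 < G x.
Hypothesis GE : forall x, G x <= expR (1 - x).

(** Kept abstract in [G] to serve both e^(- x^2 / 4), which gives psi, and e^(- x^2), which gives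
    erfc; both lie below e^(1 - x) by completing a square. *)
Definition tail a := \int[leb]_(x in `[a, +oo[) G x.

Lemma measurable_tail_fun : measurable_fun setT G.
Proof. exact: continuous_measurable_fun. Qed.

Lemma integrable_tail a : leb.-integrable `[a, +oo[ (EFin \o G).
Proof.
apply/integrableP; split.
  apply/measurable_EFinP; exact: (measurable_funTS measurable_tail_fun).
apply: (@le_lt_trans _ _ (\int[leb]_(x in `[a, +oo[) (expR (1 - x))%:E)%E).
  apply: ge0_le_integral => //=.
  - do 2 apply: measurableT_comp => //.
    exact: (measurable_funTS measurable_tail_fun).
  - apply/measurable_EFinP; apply: measurable_funTS.
    apply: continuous_measurable_fun => x.
    apply: (@continuous_comp _ _ _ (fun x : R => 1 - x) expR); last exact: continuous_expR.
    by apply: cvgB; [exact: cvg_cst|exact: cvg_id].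
  - by move=> x _; rewrite lee_fin (ger0_norm (ltW (G0 x))).
by rewrite integral_expR1B ltry.
Qed.

Lemma tail_ge0 a : 0 <= tail a.
Proof. by apply: Rintegral_ge0 => x _; exact: ltW. Qed.

Lemma tail_le_expR a : tail a <= expR (1 - a).
Proof.
rewrite -lee_fin -integral_expR1B /tail /Rintegral fineK; last first.
  exact/integrable_fin_num/integrable_tail.
apply: ge0_le_integral => //=.
- by move=> x _; rewrite lee_fin ltW.
- by apply/measurable_EFinP; exact: (measurable_funTS measurable_tail_fun).
- apply/measurable_EFinP; apply: measurable_funTS.
  apply: continuous_measurable_fun => x.
  apply: (@continuous_comp _ _ _ (fun x : R => 1 - x) expR); last exact: continuous_expR.
  by apply: cvgB; [exact: cvg_cst|exact: cvg_id].
- by move=> x _; rewrite lee_fin GE.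
Qed.

Lemma tail_itv b y : b <= y -> tail y = tail b - \int[leb]_(x in `[b, y]) G x.
Proof.
move=> by_; rewrite /tail (@Rintegral_itvB _ _ (BLeft b) +oo%O y)//.
- rewrite Rintegral_itv_obnd_cbnd//.
  by apply: integrableS (integrable_tail y) => //; apply: subset_itvr; rewrite bnd_simp.
- exact: integrable_tail.
Qed.

Lemma is_derive_tail a : is_derive a 1 tail (- G a).
Proof.
have ab : a - 1 < a by rewrite ltrBlDr ltrDl.
have ab1 : a < a + 1 by rewrite ltrDl.
have ig : leb.-integrable `[a - 1, a + 1] (EFin \o G).
  apply: continuous_compact_integrable; first exact: segment_compact.
  exact: continuous_subspaceT.
have [D1 D2] := @continuous_FTC1_closed _ G (a - 1) a (a + 1) ab1 ig ab (@cG a).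
apply: (@near_eq_is_derive _ _ _ (fun y => tail (a - 1) - \int[leb]_(x in `[a - 1, y]) G x)).
  near=> y; rewrite [RHS](@tail_itv (a - 1))//.
  by near: y; exact: lt_le_nbhsr.
have H : is_derive a 1 (fun y : R => \int[leb]_(x in `[a - 1, y]) G x) (G a).
  by split; [exact: D1|rewrite -derive1E D2].
by have := is_deriveB (is_derive_cst (tail (a - 1)) a 1) H; rewrite sub0r.
Unshelve. all: by end_near. Qed.

Lemma continuous_tail : continuous tail.
Proof.
by move=> a; have [H _] := is_derive_tail a; apply/differentiable_continuous/derivable1_diffP.
Qed.

Lemma tail_lt a b : a < b -> tail b < tail a.
Proof.
move=> ab; rewrite -subr_gt0.
have [c _ E] := @MVT _ tail (fun y => - G y) a b ab (fun x _ => is_derive_tail x)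
  (continuous_subspaceT continuous_tail).
by rewrite -opprB E mulNr opprK mulr_gt0// subr_gt0.
Qed.

Lemma le_tail a b : a <= b -> tail b <= tail a.
Proof. by rewrite le_eqVlt => /predU1P[->//|/tail_lt/ltW]. Qed.

Lemma tail_gt0 a : 0 < tail a.
Proof. by rewrite (le_lt_trans (tail_ge0 (a + 1)))// tail_lt// ltrDl. Qed.

Lemma cvg_tail : tail a @[a --> +oo] --> 0.
Proof.
apply: (@squeeze_cvgr _ _ _ _ (cst 0) (fun a => expR (1 - a))).
- by near=> a; rewrite tail_ge0 tail_le_expR.
- exact: cvg_cst.
- exact: cvg_expR1B.
Unshelve. all: by end_near. Qed.

End gaussian_tail.

Section gauss4.
Variable R : realType.
Implicit Types a b x y z : R.

Definition gauss4 x := expR (- (x ^+ 2 / 4)).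

Lemma gauss4_gt0 x : 0 < gauss4 x. Proof. exact: expR_gt0. Qed.

Lemma gauss4_le x : gauss4 x <= expR (1 - x).
Proof. by rewrite ler_expR; have := sqr_ge0 (x / 2 - 1); rewrite !expr2; lra. Qed.

Lemma is_derive_gauss4 x : is_derive x 1 gauss4 (- (x / 2) * gauss4 x).
Proof.
have H : is_derive x 1 (fun x : R => - (x ^+ 2 / 4)) (- (x / 2)).
  by apply: is_derive_eq; rewrite /GRing.scale/=; field.
by apply: (is_derive_compE (is_derive_expR _) H); rewrite mulrC.
Qed.

Lemma continuous_gauss4 : continuous gauss4.
Proof.
by move=> a; have [H _] := is_derive_gauss4 a; apply/differentiable_continuous/derivable1_diffP.
Qed.

Definition tail4 := tail gauss4.

Lemma tail4_gt0 a : 0 < tail4 a.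
Proof. exact: (tail_gt0 continuous_gauss4 gauss4_gt0 gauss4_le). Qed.

Lemma is_derive_tail4 a : is_derive a 1 tail4 (- gauss4 a).
Proof. exact: (is_derive_tail continuous_gauss4 gauss4_gt0 gauss4_le). Qed.

Lemma le_tail4 a b : a <= b -> tail4 b <= tail4 a.
Proof. exact: (le_tail continuous_gauss4 gauss4_gt0 gauss4_le). Qed.

Lemma cvg_tail4 : tail4 a @[a --> +oo] --> (0 : R).
Proof. exact: (cvg_tail continuous_gauss4 gauss4_gt0 gauss4_le). Qed.

Lemma continuous_tail4 : continuous tail4.
Proof. exact: (continuous_tail continuous_gauss4 gauss4_gt0 gauss4_le). Qed.

Lemma cvg_gauss4 : gauss4 a @[a --> +oo] --> (0 : R).
Proof.
apply: (@squeeze_cvgr _ _ _ _ (cst 0) (fun a => expR (1 - a))).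
- by near=> a; rewrite gauss4_le ltW// gauss4_gt0.
- exact: cvg_cst.
- exact: cvg_expR1B.
Unshelve. all: by end_near. Qed.

(** The difference of the two sides has derivative [(1 - c / a) * gauss4 c], which is at most 0
    beyond [a], and it tends to 0 at infinity; so it cannot be negative at [b]. *)
Lemma tail4_le_gauss4 a b : 0 < a -> a <= b -> tail4 b <= 2 / a * gauss4 b.
Proof.
move=> a0 ab.
pose D x := 2 / a * gauss4 x - tail4 x.
have dD x : is_derive x 1 D (2 / a * (- (x / 2) * gauss4 x) + gauss4 x).
  have H1 := is_derive_gauss4 x; have H2 := is_derive_tail4 x.
  by rewrite /D; apply: is_derive_eq; rewrite /GRing.scale/= opprK.
have cD : D x @[x --> +oo] --> 0.
  rewrite -[0 in X in _ --> X]subr0; apply: cvgB; last exact: cvg_tail4.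
  by rewrite -(mulr0 (2 / a)); apply: cvgM; [exact: cvg_cst|exact: cvg_gauss4].
rewrite -subr_ge0 -/(D b) leNgt; apply/negP => Db.
have : \forall x \near +oo, D b < D x by apply: (cvgr_gt 0).
have : \forall x \near +oo, b < x by apply: nbhs_pinfty_gt; exact: num_real.
move=> H1 H2; near +oo_R => x.
have bx : b < x by near: x.
have : D b < D x by near: x.
apply/negP; rewrite -leNgt -subr_le0.
have [c cbx ->] := @MVT _ D _ b x bx (fun x _ => dD x)
  (derivable_within_continuous (fun z _ => @ex_derive _ _ _ _ _ _ _ (dD z))).
move: cbx; rewrite in_itv/= => /andP[bc _].
rewrite mulr_le0_ge0 ?subr_ge0 ?(ltW bx)//.
rewrite (_ : _ + _ = (1 - c / a) * gauss4 c); last by field; rewrite gt_eqF.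
rewrite mulr_le0_ge0 ?ltW ?gauss4_gt0// subr_lt0 ltr_pdivlMr// mul1r.
by rewrite (le_lt_trans ab).
Unshelve. all: by end_near. Qed.

End gauss4.

(** * The weak equation tested with bumps *)

Lemma PsiE (R : realType) (alpha beta eta : R) :
  Psi alpha beta eta = alpha * beta / 2 * expR (alpha ^+ 2 / 4) * tail4 (Num.max `|eta| alpha).
Proof. by []. Qed.

Section weak.
Variable R : realType.
Notation leb := (@lebesgue_measure R).
Variables (alpha beta ustar : R) (u p : R -> R -> R).
Hypotheses (alpha_gt0 : 0 < alpha) (beta_gt0 : 0 < beta).
Hypothesis W : weak_solution alpha beta ustar u p.

Implicit Types x y t s l h eta T : R.
Local Notation c0 := (alpha * beta / 2 * expR (alpha ^+ 2 / 4)).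
Let c0_gt0 : 0 < c0.
Proof. by rewrite !mulr_gt0// expR_gt0. Qed.

Definition wfun (x t : R) := u x t - psi alpha beta x t.
Local Notation w := wfun.
Local Notation wx := (d_x w).

Lemma Psi_ge0 eta : 0 <= Psi alpha beta eta.
Proof. by rewrite PsiE mulr_ge0// ltW// tail4_gt0. Qed.

Lemma Psi_le eta : Psi alpha beta eta <= Psi alpha beta alpha.
Proof.
rewrite !PsiE ler_pM2l// le_tail4//.
by rewrite (ger0_norm (ltW alpha_gt0)) maxxx le_max lexx orbT.
Qed.

Lemma psi_ge0 x t : 0 <= psi alpha beta x t.
Proof. by rewrite /psi; case: ifP => // _; [case: ifP => // _|]; exact: Psi_ge0. Qed.

Lemma psi_le x t : psi alpha beta x t <= Psi alpha beta alpha.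
Proof.
rewrite /psi; case: ifP => _; last exact: Psi_le.
by case: ifP => // _; exact: Psi_ge0.
Qed.

Lemma continuous_Psi : continuous (Psi alpha beta).
Proof.
have -> : Psi alpha beta = fun eta => c0 * tail4 (Num.max `|eta| alpha) by apply/funext.
move=> x; apply: cvgM; first exact: cvg_cst.
apply: (@continuous_comp _ _ _ (fun eta : R => Num.max `|eta| alpha)); last exact: continuous_tail4.
by apply: continuous_max; [exact: norm_continuous|exact: cst_continuous].
Qed.

Lemma continuous_psi x t : 0 < t ->
  {for (x, t), continuous (fun z : R * R => psi alpha beta z.1 z.2)}.
Proof.
move=> t0.
have : {for (x, t), continuous (fun z : R * R => Psi alpha beta (z.1 / Num.sqrt z.2))}.
  apply: (@continuous_comp _ _ _ (fun z : R * R => z.1 / Num.sqrt z.2)); last exact: continuous_Psi.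
  apply: cvgM; first exact: cvg_fst.
  apply: cvgV; first by rewrite gt_eqF// sqrtr_gt0.
  apply: (@continuous_comp _ _ _ snd Num.sqrt); first exact: cvg_snd.
  exact: sqrt_continuous.
move=> H; suff : psi alpha beta z.1 z.2 @[z --> (x, t)] --> psi alpha beta x t by [].
rewrite {2}/psi gt_eqF//.
apply: cvg_trans H; apply: near_eq_cvg.
have : \forall z \near ((x, t) : R * R), 0 < z.2.
  exact: near_snd_gt.
by apply: filterS => z z0; rewrite /psi gt_eqF.
Qed.

Lemma strip_w T : {within strip T, continuous (fun z : R * R => w z.1 z.2)}.
Proof.
have [T0|T0] := ltP 0 T; first by have [] := weak_regular W T0.
have [_ c _ _] := weak_regular W ltr01.
by apply: continuous_subspaceW c => z /= /andP[z0 zT]; rewrite /strip/= z0 (le_trans zT)// (le_trans T0).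
Qed.

Lemma strip_wx T : {within strip T, continuous (fun z : R * R => wx z.1 z.2)}.
Proof.
have [T0|T0] := ltP 0 T; first by have [] := weak_regular W T0.
have [_ _ _ c] := weak_regular W ltr01.
by apply: continuous_subspaceW c => z /= /andP[z0 zT]; rewrite /strip/= z0 (le_trans zT)// (le_trans T0).
Qed.

Lemma rect_w l h s t : 0 <= s -> {within rect l h s t, continuous (fun z : R * R => w z.1 z.2)}.
Proof.
move=> s0; apply: continuous_subspaceW (@strip_w t) => z /rectP[_ /andP[sz zt]].
by rewrite /strip /= (le_trans s0).
Qed.

Lemma rect_wx l h s t : 0 <= s -> {within rect l h s t, continuous (fun z : R * R => wx z.1 z.2)}.
Proof.
move=> s0; apply: continuous_subspaceW (@strip_wx t) => z /rectP[_ /andP[sz zt]].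
by rewrite /strip /= (le_trans s0).
Qed.

Lemma strip_interior x t : 0 < t -> interior (strip (t + 1)) ((x, t) : R * R).
Proof.
move=> t0; have : \forall z \near ((x, t) : R * R), 0 < z.2.
  exact: near_snd_gt.
have : \forall z \near ((x, t) : R * R), z.2 < t + 1.
  by apply: near_snd_lt; rewrite ltrDl.
by apply: filterS2 => z z1 z0; rewrite /strip /= !ltW.
Qed.

Lemma continuous_w x t : 0 < t -> {for (x, t), continuous (fun z : R * R => w z.1 z.2)}.
Proof.
by move=> t0; exact: within_interior_continuous (@strip_w (t + 1)) (strip_interior x t0).
Qed.

Lemma continuous_u x t : 0 < t -> {for (x, t), continuous (fun z : R * R => u z.1 z.2)}.
Proof.
move=> t0; rewrite (_ : (fun z => _) = (fun z : R * R => w z.1 z.2 + psi alpha beta z.1 z.2)).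
  by apply: cvgD; [exact: continuous_w|exact: continuous_psi].
by apply/funext => z; rewrite /wfun subrK.
Qed.

Lemma is_derive_w x t : 0 <= t -> is_derive x 1 (w ^~ t) (wx x t).
Proof.
move=> t0; have t1 : 0 < t + 1 by rewrite ltr_wpDl.
have [_ _ d _] := weak_regular W t1.
split; last by rewrite /d_x derive1E.
by apply: d; rewrite t0 lerDl ler01.
Qed.

Lemma p01 x t : 0 <= t -> 0 <= p x t <= 1.
Proof.
move=> t0; have [p0 p1 p2] := weak_precipitation W x t0.
have [/p0->|/p2->|/p1//] := ltgtP (running_sup u x t) ustar%:E.
  by rewrite lexx ler01.
by rewrite lexx ler01.
Qed.

Lemma u_slice l h t : 0 < t -> {within `[l, h], continuous (fun y => u y t)}.
Proof.
move=> t0; apply: continuous_subspaceT => y.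
apply: (@continuous_comp _ _ _ (fun y => (y, t)) (fun z : R * R => u z.1 z.2)).
  exact: continuous_pairl.
exact: continuous_u.
Qed.

Section tensor.
Variables (x d l h T : R) (b b' : R -> R).
Hypotheses (d_gt0 : 0 < d) (lh : l < h) (lxd : l <= x - d) (xdh : x + d <= h) (T0 : 0 < T).
Hypotheses (db : forall s, is_derive s 1 b (b' s)) (cb' : continuous b').
Hypotheses (b_ge0 : forall s, 0 <= b s) (bT : b T = 0).

Let phi (y s : R) := bump d (y - x) * b s.
Let phit (y s : R) := bump d (y - x) * b' s.
Let cb : continuous b. Proof. by move=> s; exact: is_derive_continuous (db s). Qed.

Let cbump : continuous (fun y => bump d (y - x)).
Proof.
by move=> y; exact: is_derive_continuous (is_derive_bump_shift d x y).
Qed.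

Let cdbump : continuous (fun y => dbump d (y - x)).
Proof.
move=> z; apply: (@continuous_comp _ _ _ (fun z : R => z - x) (dbump d)); last exact: continuous_dbump.
by apply: cvgB; [exact: cvg_id|exact: cvg_cst].
Qed.

Let out y : ~~ (l <= y <= h) -> d <= `|y - x|.
Proof.
have := d_gt0; have := lxd; have := xdh => H1 H2 H3.
rewrite negb_and -!ltNge => /orP[yl|hy].
  rewrite ler0_norm; lra.
rewrite ger0_norm; lra.
Qed.

Lemma d_x_tensor y s : d_x phi y s = dbump d (y - x) * b s.
Proof.
rewrite /d_x derive1E.
have H := is_derive_bump_shift d x y.
have : is_derive y 1 (fun y => phi y s) (dbump d (y - x) * b s).
  by rewrite /phi; apply: is_derive_eq; rewrite /GRing.scale/=; ring.
by case.
Qed.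

Let ctensor (f g : R -> R) A : continuous f -> continuous g ->
  {within A, continuous (fun z : R * R => f z.1 * g z.2)}.
Proof.
move=> cf cg; apply: continuous_subspaceT => z; apply: cvgM.
  by apply: (@continuous_comp _ _ _ fst f); [exact: cvg_fst|exact: cf].
by apply: (@continuous_comp _ _ _ snd g); [exact: cvg_snd|exact: cg].
Qed.

Lemma test_tensor : test_function T phi phit.
Proof.
split.
- exact: (ctensor (f := fun y => bump d (y - x)) (g := b)).
- split.
  + move=> y s _; have H := is_derive_bump_shift d x y.
    have : is_derive y 1 (fun y => phi y s) (dbump d (y - x) * b s).
      by rewrite /phi; apply: is_derive_eq; rewrite /GRing.scale/=; ring.
    by case.
  + rewrite /continuous_on_strip (_ : (fun z => _) = (fun z : R * R => dbump d (z.1 - x) * b z.2)).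
      exact: (ctensor (f := fun y => dbump d (y - x)) (g := b)).
    by apply/funext => z; rewrite d_x_tensor.
- split; last exact: (ctensor (f := fun y => bump d (y - x)) (g := b')).
  (* Caratheodory's continuous slope function gives the limit of the difference quotient within the
     segment, including the end points 0 and [T]. *)
  move=> y s _; have /is_derive1_caratheodory[g [gE cg gs]] := db s.
  rewrite /phit -gs.
  have H : bump d (y - x) * g r @[r --> within `[0, T] s^'] --> bump d (y - x) * g s.
    apply: cvgM; first exact: cvg_cst.
    move=> A HA; have H : nbhs s (fun r => A (g r)) := cg A HA.
    change (nbhs s (fun r => r != s -> `[0, T]%classic r -> A (g r))).
    by apply: filterS H.
  apply: cvg_trans H; apply: near_eq_cvg; near=> r.
  rewrite /phi -mulrBr gE mulrA mulfK// subr_eq0.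
  near: r; change (nbhs s (fun r : R => r != s -> `[0, T]%classic r -> r != s)).
  by apply: filterS (@filterT _ (nbhs s) _).
- exists (`|x| + d) => y s _ yK; rewrite /phi bump_out ?mul0r ?(ltW d_gt0)//.
  have := ler_normD (y - x) x; rewrite subrK => H; lra.
- by move=> y; rewrite /phi bT mulr0.
Unshelve. all: by end_near. Qed.

Definition inner s := \int[leb]_y (d_x phi y s * wx y s + p y s * u y s * phi y s).
(** The weight is not normalised; its total is called [mass] below. *)
Definition avg q := \int[leb]_(y in `[l, h]) (bump d (y - x) * q y).

Lemma weak_tensor :
  \int[leb]_(s in `[0, T]) (b' s * avg (w ^~ s)) = \int[leb]_(s in `[0, T]) inner s.
Proof.
rewrite -(weak_equation W T0 test_tensor); apply: eq_Rintegral => s.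
rewrite inE/= in_itv/= => /andP[s0 _].
rewrite (@Rintegral_supp _ l h); last first.
  by move=> y /out ?; rewrite /phit bump_out ?mul0r// ltW.
rewrite /avg -RintegralZl//; last first.
  apply: integrable_segment; apply: within_continuous_bumpM.
  by apply: (@rect_slice _ l h 0 s (fun z : R * R => w z.1 z.2) s); [exact: rect_w|rewrite s0 lexx].
by apply: eq_Rintegral => y _; rewrite /phit /wfun; ring.
Qed.

Lemma inner_segment s : inner s = \int[leb]_(y in `[l, h])
  (b s * (dbump d (y - x) * wx y s + p y s * u y s * bump d (y - x))).
Proof.
rewrite /inner (@Rintegral_supp _ l h).
  by apply: eq_Rintegral => y _; rewrite d_x_tensor /phi; ring.
move=> y /out ?; rewrite d_x_tensor /phi dbump_out ?bump_out ?(ltW d_gt0)//; ring.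
Qed.

Lemma bounded_integrand : exists2 K : R, 0 < K & forall y s, l <= y <= h -> 0 <= s <= T ->
  `|dbump d (y - x) * wx y s| <= K /\ `|u y s * bump d (y - x)| <= K.
Proof.
have [M1 M10 HM1] := bounded_rect (@rect_wx l h 0 T (lexx 0)).
have [M2 M20 HM2] := bounded_rect (@rect_w l h 0 T (lexx 0)).
have [M3 M30 HM3] := bounded_segment (continuous_subspaceT cbump (A := `[l, h])).
have [M4 M40 HM4] := bounded_segment (continuous_subspaceT cdbump (A := `[l, h])).
exists (M4 * M1 + (M2 + Psi alpha beta alpha) * M3).
  by rewrite addr_gt0 ?mulr_gt0// ltr_wpDr// Psi_ge0.
move=> y s ylh sT; split.
  rewrite normrM -[leLHS]addr0 lerD//.
    by rewrite ler_pM ?HM4// (HM1 y s).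
  by rewrite mulr_ge0 ?addr_ge0 ?Psi_ge0// ltW.
apply: (@le_trans _ _ ((M2 + Psi alpha beta alpha) * M3)); last first.
  by rewrite lerDr mulr_ge0// ltW.
rewrite normrM.
rewrite ler_pM ?HM3// (_ : u y s = w y s + psi alpha beta y s); last by rewrite /wfun subrK.
rewrite (le_trans (ler_normD _ _))// lerD ?(HM2 y s)//.
by rewrite ger0_norm ?psi_ge0// psi_le.
Qed.

(** Slices of [p] may be non-measurable, so the bound rests on [0 <= p <= 1] and on monotonicity of
    the integral, applied once from each side. *)
Lemma inner_le (K s : R) : 0 < K -> 0 <= s ->
  (forall y, l <= y <= h -> `|dbump d (y - x) * wx y s| <= K /\ `|u y s * bump d (y - x)| <= K) ->
  `|inner s| <= 2 * K * (h - l) * b s.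
Proof.
move=> K0 s0 HK; rewrite inner_segment.
have bnd y : l <= y <= h ->
   `|b s * (dbump d (y - x) * wx y s + p y s * u y s * bump d (y - x))| <= 2 * K * b s.
  move=> ylh; have [H1 H2] := HK y ylh.
  have /andP[p0 p1] : 0 <= p y s <= 1 by apply: p01.
  rewrite normrM ger0_norm// mulrC ler_wpM2r// (le_trans (ler_normD _ _))//.
  rewrite mulr_natl mulr2n lerD// -mulrA normrM -[leRHS]mul1r ler_pM//.
  by rewrite ger0_norm.
have ic (c : R) : leb.-integrable `[l, h] (EFin \o (fun _ => c)).
  by apply: integrable_segment; apply: continuous_subspaceT => z; exact: cvg_cst.
have cE (c : R) : \int[leb]_(y in `[l, h]) c = c * (h - l).
  exact: Rintegral_segment_cst.
have Kb0 : 0 <= 2 * K * b s by rewrite !mulr_ge0// ltW.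
rewrite ler_norml; apply/andP; split.
  rewrite (_ : - _ = \int[leb]_(y in `[l, h]) (- (2 * K * b s))); last first.
    by rewrite cE; ring.
  apply: (le_Rintegral_negligible _ (negligible_set0 _) (ic (2 * K * b s))) => //.
  - by move=> y _ _; rewrite normrN ger0_norm.
  - by move=> y; rewrite /= in_itv/= => ylh _; exact: bnd.
  - by move=> y; rewrite /= in_itv/= => /bnd + _; rewrite ler_norml => /andP[].
rewrite (_ : 2 * K * (h - l) * b s = \int[leb]_(y in `[l, h]) (2 * K * b s)); last first.
  by rewrite cE; ring.
apply: (le_Rintegral_negligible _ (negligible_set0 _) (ic (2 * K * b s))) => //.
- by move=> y; rewrite /= in_itv/= => ylh _; exact: bnd.
- by move=> y _ _; rewrite ger0_norm.
- by move=> y; rewrite /= in_itv/= => /bnd + _; rewrite ler_norml => /andP[].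
Qed.

Lemma inner_bounded : exists2 K : R, 0 < K & forall s, 0 <= s <= T -> `|inner s| <= K * b s.
Proof.
have [K K0 HK] := bounded_integrand.
exists (2 * K * (h - l)); first by rewrite !mulr_gt0// subr_gt0.
move=> s sT; apply: inner_le => //; first by case/andP: sT.
by move=> y yl; exact: HK.
Qed.

(** The place where [p] is traded for a measurable [pi], in either direction and up to a null set.
    The time must be positive because psi, and with it [u], is discontinuous at the origin. *)
Lemma inner_compare (N : set R) (pi : R -> R) s : 0 < s <= T -> leb.-negligible N ->
  measurable_fun setT pi -> (forall y, 0 <= pi y <= 1) ->
  ((forall y, l <= y <= h -> ~ N y -> p y s * u y s <= pi y * u y s) ->
  inner s <= b s * \int[leb]_(y in `[l, h])
    (dbump d (y - x) * wx y s + pi y * (u y s * bump d (y - x)))) /\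
  ((forall y, l <= y <= h -> ~ N y -> pi y * u y s <= p y s * u y s) ->
  b s * \int[leb]_(y in `[l, h])
    (dbump d (y - x) * wx y s + pi y * (u y s * bump d (y - x))) <= inner s).
Proof.
move=> /andP[s0 sT] N0 mpi pi01.
have [K K0 HK] := bounded_integrand.
have sT' : 0 <= s <= T by rewrite ltW.
have ic (c : R) : leb.-integrable `[l, h] (EFin \o (fun _ => c)).
  by apply: integrable_segment; apply: continuous_subspaceT => z; exact: cvg_cst.
have cwx : {within `[l, h], continuous (fun y => dbump d (y - x) * wx y s)}.
  apply: within_continuous_dbumpM.
  by apply: (@rect_slice _ l h 0 s (fun z : R * R => wx z.1 z.2) s); [exact: rect_wx|rewrite (ltW s0) lexx].
have cu : {within `[l, h], continuous (fun y => u y s * bump d (y - x))}.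
  rewrite (_ : (fun y => _) = (fun y => bump d (y - x) * u y s)).
    by apply: within_continuous_bumpM; exact: u_slice.
  by apply/funext => y; rewrite mulrC.
have iQ : leb.-integrable `[l, h]
    (EFin \o (fun y => dbump d (y - x) * wx y s + pi y * (u y s * bump d (y - x)))).
  rewrite (_ : _ \o _ = ((EFin \o (fun y => (dbump d (y - x) * wx y s)%R)) \+
     (EFin \o (fun y => (pi y * (u y s * bump d (y - x)))%R)))%E)//.
  by apply: integrableD => //; [exact: integrable_segment|exact: integrable_segmentM].
have bnd (q : R) y : 0 <= q <= 1 -> l <= y <= h ->
   `|b s * (dbump d (y - x) * wx y s + q * (u y s * bump d (y - x)))| <= 2 * K * b s.
  move=> /andP[q0 q1] ylh; have [H1 H2] := HK y s ylh sT'.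
  rewrite normrM ger0_norm// mulrC ler_wpM2r// (le_trans (ler_normD _ _))//.
  rewrite mulr_natl mulr2n lerD// normrM -[leRHS]mul1r ler_pM//.
  by rewrite ger0_norm.
rewrite inner_segment -RintegralZl//; split => cmp.
all: apply: (le_Rintegral_negligible _ N0 (ic (2 * K * b s))) => //.
all: try by move=> y; rewrite /= in_itv/= => ylh _; exact: bnd.
all: try by move=> y; rewrite /= in_itv/= => ylh _; rewrite -[p _ _ * _ * _]mulrA; apply: bnd => //; exact/p01/ltW.
all: move=> y; rewrite /= in_itv/= => ylh Ny; rewrite ler_wpM2l// lerD2l mulrA.
all: by rewrite ler_wpM2r ?bump_ge0// cmp.
Qed.

End tensor.

End weak.

Section mollifier_estimates.
Variable R : realType.
Notation leb := (@lebesgue_measure R).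
Implicit Types l h x y d s t e r : R.

Lemma RintegralD_segment l h (f g : R -> R) : {within `[l, h], continuous f} ->
  {within `[l, h], continuous g} ->
  \int[leb]_(y in `[l, h]) (f y + g y) =
  \int[leb]_(y in `[l, h]) f y + \int[leb]_(y in `[l, h]) g y.
Proof. by move=> cf cg; rewrite RintegralD//; exact: integrable_segment. Qed.

Lemma le_Rintegral_segment l h (f g : R -> R) : {within `[l, h], continuous f} ->
  {within `[l, h], continuous g} -> (forall y, l <= y <= h -> f y <= g y) ->
  \int[leb]_(y in `[l, h]) f y <= \int[leb]_(y in `[l, h]) g y.
Proof.
move=> cf cg fg; apply: le_Rintegral; [by []|exact: integrable_segment|exact: integrable_segment|].
by move=> y; rewrite /= in_itv/=; exact: fg.

Qed.

Lemma RintegralZ_segment l h (f : R -> R) (k : R) : {within `[l, h], continuous f} ->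
  \int[leb]_(y in `[l, h]) (k * f y) = k * \int[leb]_(y in `[l, h]) f y.
Proof. by move=> cf; rewrite RintegralZl//; exact: integrable_segment. Qed.

Definition mass d l h x := avg x d l h (fun _ => 1).

Lemma within_cst l h (c : R) : {within `[l, h], continuous (fun _ : R => c)}.
Proof. by apply: continuous_subspaceT => z; exact: cvg_cst. Qed.
Hint Resolve within_cst : core.

Lemma avg_cst x d l h (c : R) : avg x d l h (fun _ => c) = c * mass d l h x.
Proof.
rewrite /mass /avg -RintegralZ_segment; last exact: within_continuous_bumpM.
by apply: eq_Rintegral => y _; ring.
Qed.

Lemma avg_le x d l h (q r : R -> R) : {within `[l, h], continuous q} ->
  {within `[l, h], continuous r} ->
  (forall y, l <= y <= h -> `|y - x| < d -> q y <= r y) -> 0 <= d ->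
  avg x d l h q <= avg x d l h r.
Proof.
move=> cq cr qr d0; apply: le_Rintegral_segment; [exact: within_continuous_bumpM..|].
move=> y ylh; have [dy|yd] := leP d `|y - x|.
  by rewrite bump_out// !mul0r.
by rewrite ler_wpM2l ?bump_ge0// qr.
Qed.

Lemma avgD x d l h (q r : R -> R) : {within `[l, h], continuous q} ->
  {within `[l, h], continuous r} ->
  avg x d l h (fun y => q y + r y) = avg x d l h q + avg x d l h r.
Proof.
move=> cq cr; rewrite /avg -RintegralD_segment; [|exact: within_continuous_bumpM..].
by apply: eq_Rintegral => y _; ring.
Qed.

Lemma avgZ x d l h (k : R) (q : R -> R) : {within `[l, h], continuous q} ->
  avg x d l h (fun y => k * q y) = k * avg x d l h q.
Proof.
move=> cq; rewrite /avg -RintegralZ_segment; last exact: within_continuous_bumpM.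
by apply: eq_Rintegral => y _; ring.
Qed.

Lemma mass_gt0 d l h x : 0 < d -> l <= x - d -> x + d <= h -> 0 < mass d l h x.
Proof.
move=> d0 lx xh.
have lh : l < h by lra.
have cb : {within `[l, h], continuous (fun y => bump d (y - x) * 1)}.
  exact: within_continuous_bumpM.
have m0 : 0 < bump d (d / 2) by apply: bump_gt0; rewrite ger0_norm; lra.
pose k := bump d (d / 2).
have sub : `[x - d / 2, x + d / 2] `<=` `[l, h] by apply: subset_itv; rewrite bnd_simp; lra.
have step1 : \int[leb]_(y in `[x - d / 2, x + d / 2]) (bump d (y - x) * 1) <= mass d l h x.
  rewrite Rintegral_mkcond /mass /avg [leRHS]Rintegral_mkcond.
  apply: le_Rintegral => //.
  - have /integrable_mkcond := integrable_segment (continuous_subspaceW sub cb).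
    by move=> /(_ (measurable_itv _)); rewrite restrict_EFin.
  - have /integrable_mkcond := integrable_segment cb.
    by move=> /(_ (measurable_itv _)); rewrite restrict_EFin.
  - move=> y _; rewrite !patchE; case: ifPn => [/set_mem/sub yd|_]; first by rewrite mem_set.
    by case: ifPn => // _; rewrite mulr1 bump_ge0.
apply: lt_le_trans step1.
apply: (@lt_le_trans _ _ (\int[leb]_(y in `[x - d / 2, x + d / 2]) k)).
  rewrite Rintegral_segment_cst; last by lra.
  by rewrite mulr_gt0//; lra.
apply: le_Rintegral_segment => //; first exact: continuous_subspaceW sub cb.
move=> y yd; rewrite mulr1 /k /bump ler_pXn2r ?nnegrE//; last 2 first.
- by rewrite le_max lexx.
- by rewrite le_max lexx.
rewrite ge_max le_max lexx/= le_max; apply/orP; right.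
have : `|y - x| <= d / 2 by rewrite ler_norml; lra.
rewrite lerD2l lerN2 -[(y - x) ^+ 2](real_normK (num_real _)) => ?.
by rewrite ler_pXn2r ?nnegrE//; lra.
Qed.

Lemma is_derive_avg x d l h (q : R -> R) : 0 < d -> {within `[l, h], continuous q} ->
  is_derive x 1 (fun x : R => avg x d l h q)
    (- \int[leb]_(y in `[l, h]) (dbump d (y - x) * q y)).
Proof. exact: is_derive_mollify. Qed.

(** The derivative in [x] is minus the integral of the derivative of the bump, that is 0 after
    integration by parts against the constant 1. *)
Lemma mass_cst d l h x x' : 0 < d -> l <= x - d -> x + d <= h ->
  l <= x' - d -> x' + d <= h -> mass d l h x = mass d l h x'.
Proof.
wlog xx' : x x' / x < x'.
  move=> H d0 lx xh lx' xh'; have [xx'|xx'|->//] := ltgtP x x'; first exact: H.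
  by apply/esym; exact: H.
move=> d0 lx xh lx' xh'.
have dm (z : R) : is_derive z 1 (mass d l h) (- \int[leb]_(y in `[l, h]) (dbump d (y - z) * 1)).
  exact: is_derive_avg.
have [z] := @MVT _ (mass d l h) _ x x' xx' (fun z _ => dm z)
  (derivable_within_continuous (fun z _ => @ex_derive _ _ _ _ _ _ _ (dm z))).
rewrite in_itv/= => /andP[xz zx'].
rewrite (@mollify_by_parts _ l h d z (fun _ => 1) (fun _ => 0)) ?ltW//; try lra.
- rewrite (_ : (fun y => _) = (fun y => 0 * 0)); last by apply/funext => y; rewrite !mulr0.
  rewrite Rintegral_segment_cst; last by lra.
  by rewrite !(mul0r, oppr0) => /eqP; rewrite subr_eq0 => /eqP.
Qed.

Lemma Rintegral_ftc a b (f f' : R -> R) : a < b -> {within `[a, b], continuous f'} ->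
  (forall r, is_derive r 1 f (f' r)) -> \int[leb]_(r in `[a, b]) f' r = f b - f a.
Proof.
move=> ab cf' df; rewrite /Rintegral (@continuous_FTC2 _ f' f)//.
- have cf r := is_derive_continuous (df r).
  split; first by move=> r _; have [] := df r.
  + by apply: cvg_at_right_filter; exact: cf.
  + by apply: cvg_at_left_filter; exact: cf.
- by move=> r _; rewrite derive1E; have [_ ->] := df r.
Qed.

Lemma within_mul l h (f g : R -> R) : {within `[l, h], continuous f} ->
  {within `[l, h], continuous g} -> {within `[l, h], continuous (fun r => f r * g r)}.
Proof. by move=> cf cg r; apply: cvgM; [exact: cf|exact: cg]. Qed.

Lemma within_id l h : {within `[l, h], continuous (fun r : R => r)}.
Proof. by apply: continuous_subspaceT => r; exact: cvg_id. Qed.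

(** A C^1 indicator of the time interval, rising on [s, s + e] and falling on [t, t + e]; tested
    with it, the weak equation yields an increment between [s] and [t]. *)
Definition pulse s t e r := step ((r - s) / e) - step ((r - t) / e).
Definition dpulse s t e r := dstep ((r - s) / e) / e - dstep ((r - t) / e) / e.

Lemma is_derive_step_scale a e r :
  is_derive r 1 (fun r : R => step ((r - a) / e)) (dstep ((r - a) / e) / e).
Proof.
have H : is_derive r 1 (fun r : R => (r - a) / e) e^-1.
  by apply: is_derive_eq; rewrite /GRing.scale/=; ring.
exact: (is_derive_compE (is_derive_step _) H).
Qed.

Lemma continuous_dstep_scale a e : continuous (fun r : R => dstep ((r - a) / e) / e).
Proof.
move=> r; apply: cvgM; last exact: cvg_cst.
apply: (@continuous_comp _ _ _ (fun r : R => (r - a) / e) (@dstep R)); last exact: continuous_dstep.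
by apply: cvgM; [apply: cvgB; [exact: cvg_id|exact: cvg_cst]|exact: cvg_cst].
Qed.

Lemma is_derive_pulse s t e r : is_derive r 1 (pulse s t e) (dpulse s t e r).
Proof.
have H1 := is_derive_step_scale s e r; have H2 := is_derive_step_scale t e r.
exact: is_deriveB.
Qed.

Lemma continuous_dpulse s t e : continuous (dpulse s t e).
Proof. by move=> r; apply: cvgB; exact: continuous_dstep_scale. Qed.

Lemma pulse_ge0 s t e r : 0 < e -> s <= t -> 0 <= pulse s t e r.
Proof. by move=> e0 st; rewrite subr_ge0 le_step// ler_pM2r ?invr_gt0//; lra. Qed.

Lemma pulse_out s t e r : 0 < e -> s <= t -> ~~ (s <= r <= t + e) -> pulse s t e r = 0.
Proof.
move=> e0 st; rewrite negb_and -!ltNge => /orP[rs|rt].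
  by rewrite /pulse !step_le0 ?subrr// pmulr_lle0 ?invr_gt0//; lra.
by rewrite /pulse !step_ge1 ?subrr// ler_pdivlMr//; lra.
Qed.

Lemma pulse_end s t e T : 0 < e -> s <= t -> t + e <= T -> pulse s t e T = 0.
Proof. by move=> e0 st tT; rewrite /pulse !step_ge1 ?subrr// ler_pdivlMr//; lra. Qed.

Lemma pulse_by_parts s t e T : 0 < e -> s <= t -> t + e <= T -> 0 < T ->
  \int[leb]_(r in `[0, T]) (dpulse s t e r * r) = - \int[leb]_(r in `[0, T]) pulse s t e r.
Proof.
move=> e0 st tT T0.
have cb : {within `[0, T], continuous (pulse s t e)}.
  by apply: continuous_subspaceT => r; exact: is_derive_continuous (is_derive_pulse s t e r).
have cb' := continuous_subspaceT (@continuous_dpulse s t e) (A := `[0, T]).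
have cbr : {within `[0, T], continuous (fun r => dpulse s t e r * r)}.
  exact: within_mul cb' (@within_id _ _).
apply/eqP; rewrite -addr_eq0 -RintegralD_segment//.
have df r : is_derive r 1 (fun r : R => pulse s t e r * r) (dpulse s t e r * r + pulse s t e r).
  by have H := is_derive_pulse s t e r; apply: is_derive_eq; rewrite /GRing.scale/=; ring.
rewrite (Rintegral_ftc T0 _ df).
  by rewrite pulse_end// mul0r mulr0 subrr.
by move=> r; apply: cvgD; [exact: cbr|exact: cb].
Qed.

(** [dpulse] is a unit mass just after [s] minus a unit mass just after [t]. *)
Lemma pulse_decrease (J : R -> R) (m1 m2 : R) s t e T : 0 < e -> 0 <= s -> s <= t -> t + e <= T ->
  {within `[0, T], continuous J} ->
  (forall r, s <= r <= s + e -> J r <= m1) -> (forall r, t <= r <= t + e -> m2 <= J r) ->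
  \int[leb]_(r in `[0, T]) (dpulse s t e r * J r) <= m1 - m2.
Proof.
move=> e0 s0 st tT cJ Js Jt; have T0 : 0 < T by lra.
have cb' := continuous_subspaceT (@continuous_dpulse s t e) (A := `[0, T]).
pose k a r := dstep ((r - a) / e) / e.
have ck : {within `[0, T], continuous (fun r => m1 * k s r - m2 * k t r)}.
  by apply: continuous_subspaceT => r; apply: cvgB; (apply: cvgM; [exact: cvg_cst|exact: continuous_dstep_scale]).
apply: (@le_trans _ _ (\int[leb]_(r in `[0, T]) (m1 * k s r - m2 * k t r))).
  apply: le_Rintegral_segment => //; first exact: within_mul.
  move=> r rT; rewrite /dpulse mulrBl lerB//.
  - rewrite [leLHS]mulrC; have [H|/dstep_out H] := boolP (0 < (r - s) / e < 1); last first.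
      by rewrite /k H mul0r !mulr0.
    rewrite ler_wpM2r ?divr_ge0 ?dstep_ge0 ?(ltW e0)// Js//.
    by move: H; rewrite pmulr_lgt0 ?invr_gt0// ltr_pdivrMr// mul1r; lra.
  - rewrite [leLHS]mulrC; have [H|/dstep_out H] := boolP (0 < (r - t) / e < 1); last first.
      by rewrite /k H !mul0r.
    rewrite ler_wpM2l ?divr_ge0 ?dstep_ge0 ?(ltW e0)// Jt//.
    by move: H; rewrite pmulr_lgt0 ?invr_gt0// ltr_pdivrMr// mul1r; lra.
have df r : is_derive r 1 (fun r : R => m1 * step ((r - s) / e) - m2 * step ((r - t) / e))
    (m1 * k s r - m2 * k t r).
  have H1 := is_derive_step_scale s e r; have H2 := is_derive_step_scale t e r.
  by apply: is_derive_eq; rewrite /GRing.scale/= /k; ring.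
rewrite (Rintegral_ftc T0 ck df).
rewrite !(step_ge1 (z := (T - _) / e)) ?ler_pdivlMr//; try lra.
rewrite !(step_le0 (z := (0 - _) / e)); try (by rewrite pmulr_lle0 ?invr_gt0//; lra).
lra.
Qed.

Lemma unif_slice l h t0 r0 (f : R * R -> R) (e : R) : 0 < r0 -> 0 < e ->
  {within rect l h (t0 - r0) (t0 + r0), continuous f} ->
  exists2 k : R, 0 < k <= r0 & forall s y, `|s - t0| < k -> l <= y <= h ->
    `|f (y, s) - f (y, t0)| < e.
Proof.
move=> r00 e0 cf.
have [r r0' Hr] := compact_unif_continuous (@compact_rect _ _ _ _ _) cf e0.
exists (Num.min r r0); first by rewrite lt_min r0' r00 ge_min lexx orbT.
move=> s y; rewrite lt_min => /andP[sr sr0] ylh; apply: Hr => //=.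
- apply/rectP; split => //=; move: sr0; rewrite ltr_norml; lra.
- apply/rectP; split => //=; lra.
- by rewrite subrr normr0.
Qed.

End mollifier_estimates.

Section weak.
Variable R : realType.
Notation leb := (@lebesgue_measure R).
Variables (alpha beta ustar : R) (u p : R -> R -> R).
Hypotheses (alpha_gt0 : 0 < alpha) (beta_gt0 : 0 < beta).
Hypothesis W : weak_solution alpha beta ustar u p.
Implicit Types x y t s l h d e r tau eta T : R.
Local Notation w := (wfun alpha beta u).
Local Notation wx := (d_x w).

Lemma w_slice l h t : 0 <= t -> {within `[l, h], continuous (w ^~ t)}.
Proof.
move=> t0; apply: (@rect_slice _ l h 0 t (fun z : R * R => w z.1 z.2) t).
  exact: (rect_w W).
by rewrite t0 lexx.
Qed.

Lemma wx_slice l h t : 0 <= t -> {within `[l, h], continuous (wx ^~ t)}.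
Proof.
move=> t0; apply: (@rect_slice _ l h 0 t (fun z : R * R => wx z.1 z.2) t).
  exact: (rect_wx W).
by rewrite t0 lexx.
Qed.

Lemma within_avg_w x d l h T : 0 <= d -> l < h ->
  {within `[0, T], continuous (fun t => avg x d l h (w ^~ t))}.
Proof.
move=> d0 lh; have cw := @rect_w _ _ _ _ _ _ W l h 0 T (lexx 0).
apply/subspace_continuousP => r; rewrite /= in_itv/= => /andP[r0 rT].
apply/cvgrPdist_le => e1 e10.
have [M1 M10 HM1] := bounded_segment (@within_continuous_bumpM _ l h d x _ (@within_cst _ l h 1)).
have e'0 : 0 < e1 / (M1 * (h - l)) by rewrite divr_gt0// mulr_gt0// subr_gt0.
have [k k0 Hk] := compact_unif_continuous (@compact_rect _ _ _ _ _) cw e'0.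
rewrite near_withinE; near=> r' => r'T.
have rk : `|r - r'| < k by near: r'; apply: cvgr_dist_lt => //; exact: cvg_id.
move: r'T; rewrite /= in_itv/= => /andP[r'0 r'T].
have cc : {within `[l, h], continuous (fun y => bump d (y - x) * (w y r - w y r'))}.
  apply: within_continuous_bumpM => y; apply: cvgB.
    exact: (@w_slice l h r r0).
  exact: (@w_slice l h r' r'0).
have -> : avg x d l h (w ^~ r) - avg x d l h (w ^~ r') =
    \int[leb]_(y in `[l, h]) (bump d (y - x) * (w y r - w y r')).
  rewrite /avg -RintegralB//; last 2 first.
  - apply: integrable_segment; apply: within_continuous_bumpM; exact: w_slice.
  - apply: integrable_segment; apply: within_continuous_bumpM; exact: w_slice.
  by apply: eq_Rintegral => y _; exact: esym (mulrBr _ _ _).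
apply: le_trans (le_normr_Rintegral _ (integrable_segment cc)) _ => //.
apply: (@le_trans _ _ (\int[leb]_(y in `[l, h]) (e1 / (h - l)))); last first.
  by rewrite Rintegral_segment_cst// divfK// subr_eq0 gt_eqF.
apply: le_Rintegral_segment.
- by move=> y; apply: cvg_norm; exact: cc.
- exact: within_cst.
-  move=> y ylh; rewrite normrM.
  rewrite (_ : e1 / (h - l) = M1 * (e1 / (M1 * (h - l)))); last first.
    by rewrite invfM; field; rewrite subr_eq0 !gt_eqF.
  rewrite ler_pM//; first by have := HM1 y ylh; rewrite mulr1.
  rewrite ltW//; apply: (Hk (y, r) (y, r')) => //=.
  - by apply/rectP; rewrite /= ylh r0 rT.
  - by apply/rectP; rewrite /= ylh r'0 r'T.
  - by rewrite subrr normr0.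
Unshelve. all: by end_near. Qed.

Lemma continuous_avg_w x d l h t : 0 <= d -> l < h -> 0 < t ->
  {for t, continuous (fun t => avg x d l h (w ^~ t))}.
Proof.
move=> d0 lh t0.
have tt1 : t < t + 1 by rewrite ltrDl.
apply: (within_interior_continuous (@within_avg_w x d l h (t + 1) d0 lh)).
apply: (@filterS2 _ _ _ (fun s => 0 < s) (fun s => s < t + 1)); last 2 first.
- exact: lt_nbhsr.
- exact: lt_nbhsl.
by move=> s s0 st; rewrite /= in_itv/= !ltW.
Qed.

Definition flux (pi : R -> R) x d l h t := \int[leb]_(y in `[l, h])
    (dbump d (y - x) * wx y t + pi y * (u y t * bump d (y - x))).

(** Formally d/dt avg(w) = - inner flux, and this is its integrated form. If
    [J r = sg * F r - M * r] were larger at [t] than at [s], testing with a narrow pulse would make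
    the integral of [dpulse * J] negative, while the weak equation and the bound on the flux make it
    nonnegative. *)
Lemma time_increment (sg M : R) (N : set R) (pi : R -> R) x d l h s t T :
  (sg = 1 \/ sg = -1) -> 0 < d -> l < h -> l <= x - d -> x + d <= h ->
  0 < s -> s < t -> t < T -> leb.-negligible N ->
  measurable_fun setT pi -> (forall y, 0 <= pi y <= 1) ->
  (forall tau y, s <= tau <= T -> l <= y <= h -> ~ N y ->
     sg * (pi y * u y tau) <= sg * (p y tau * u y tau)) ->
  (forall tau, s <= tau <= T -> - (sg * flux pi x d l h tau) <= M) ->
  sg * (avg x d l h (w ^~ t) - avg x d l h (w ^~ s)) <= M * (t - s).
Proof.
move=> sgE d0 lh lx xh s0 st tT N0 mpi pi01 Hp HM.
have [F FE] : exists F, F = (fun t => avg x d l h (w ^~ t)) by eexists.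
have key (a b : R) : sg * b - M * t <= sg * a - M * s -> sg * (b - a) <= M * (t - s) by lra.
have avE r : avg x d l h (w ^~ r) = F r by rewrite FE.
rewrite !avE; apply: key.
pose J t := sg * F t - M * t.
suff : J t <= J s by [].
rewrite leNgt; apply/negP => Jst.
(* Values a third of the way from either end leave room for continuity on the short ramps of the
   pulse. *)
pose m1 := (2 * J s + J t) / 3; pose m2 := (J s + 2 * J t) / 3.
have [Jm1 Jm2 m12] : [/\ J s < m1, m2 < J t & m1 < m2].
  by rewrite /m1 /m2; move: (J s) (J t) Jst => a b ab; split; lra.
have T0 : 0 < T by lra.
have cF : {within `[0, T], continuous F} by rewrite FE; exact: within_avg_w (ltW d0) lh.
have cJT : {within `[0, T], continuous J}.
  move=> r; apply: cvgB; (apply: cvgM; [exact: cvg_cst|]); first exact: cF.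
  exact: within_id.
have cJ r : 0 < r -> {for r, continuous J}.
  move=> r0; apply: cvgB; (apply: cvgM; [exact: cvg_cst|]); last exact: cvg_id.
  by rewrite FE; exact: continuous_avg_w (ltW d0) lh r0.
have Js : \forall r \near s, J r < m1.
  by apply: (@cvgr_lt _ _ _ _ J (J s) (cJ s s0)).
have Jt : \forall r \near t, m2 < J r.
  by apply: (@cvgr_gt _ _ _ _ J (J t) (cJ t (lt_trans s0 st))).
have [e [e0 eT es' et']] : exists e, [/\ 0 < e, t + e <= T,
    forall r, s <= r <= s + e -> J r <= m1 & forall r, t <= r <= t + e -> m2 <= J r].
  move/nbhs_ballP : Js => [r1 /= r10 H1]; move/nbhs_ballP : Jt => [r2 /= r20 H2].
  pose e := Num.min (Num.min (r1 / 2) (r2 / 2)) (T - t).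
  have e0 : 0 < e by rewrite !lt_min; apply/andP; split; [apply/andP; split|]; lra.
  have [e1 e2 e4] : [/\ e <= r1 / 2, e <= r2 / 2 & e <= T - t].
    by rewrite /e !ge_min !lexx !orbT.
  clearbody e; clear - e0 e1 e2 e4 H1 H2.
  exists e; split => //; first by lra.
    by move=> r rs; apply/ltW/H1; rewrite /ball/= distrC ger0_norm; lra.
  by move=> r rs; apply/ltW/H2; rewrite /ball/= distrC ger0_norm; lra.
pose b := pulse s t e; pose b' := dpulse s t e.
have st' := ltW st.
have b0 r : 0 <= b r by exact: pulse_ge0.
have bT : b T = 0 by exact: pulse_end.
have Wt := weak_tensor W d0 lx xh T0 (is_derive_pulse s t e) (@continuous_dpulse _ s t e) bT.
have cb : {within `[0, T], continuous b}.
  by apply: continuous_subspaceT => r; exact: is_derive_continuous (is_derive_pulse s t e r).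
have cb'T := continuous_subspaceT (@continuous_dpulse _ s t e) (A := `[0, T]).
have [K K0 HK] := inner_bounded alpha_gt0 beta_gt0 W T d0 lh lx xh b0.
have ccst (c : R) : {within `[0, T], continuous (fun _ : R => c)} by exact: within_cst.
have iKM : leb.-integrable `[0, T] (EFin \o (fun r => K * b r + `|M| * b r)).
  by apply: integrable_segment => r; apply: cvgD; [exact: (within_mul (ccst K) cb)|exact: (within_mul (ccst `|M|) cb)].
have bnd1 r : 0 <= r <= T -> `|inner alpha beta u p x d b r| <= K * b r + `|M| * b r.
  by move=> rT; rewrite (le_trans (HK r rT))// lerDl mulr_ge0.
have bnd2 r : `|M * b r| <= K * b r + `|M| * b r.
  by rewrite normrM (ger0_norm (b0 r)) lerDr mulr_ge0// ltW.
have aux (G c1 : R) : 0 <= c1 -> - (sg * G) <= M -> - (M * c1) <= sg * (c1 * G).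
  by move=> c10 /(ler_wpM2l c10); lra.
(* The flux is bounded only from time [s] on. Outside the support of the pulse [inner] vanishes,
   since it is bounded by a multiple of [b]. *)
have cmp : - (M * \int[leb]_(r in `[0, T]) b r) <= sg * \int[leb]_(r in `[0, T]) (b' r * F r).
  rewrite FE Wt.
  have key r : 0 <= r <= T -> - (M * b r) <= sg * inner alpha beta u p x d b r.
    move=> /andP[r0 rT].
    have [sr|rs] := boolP (s <= r <= t + e); last first.
      have -> : inner alpha beta u p x d b r = 0.
        by apply/eqP; rewrite -normr_le0 (le_trans (HK r _)) ?r0 ?rT// /b pulse_out// mulr0.
      by rewrite /b pulse_out// !mulr0 oppr0.
    have sr' : s <= r <= T by move: sr => /andP[-> _].
    have r00 : 0 < r <= T by move: sr => /andP[? ?]; rewrite rT andbT (lt_le_trans s0).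
    have [C1 C2] := inner_compare alpha_gt0 beta_gt0 W d0 lx xh b0 r00 N0 mpi pi01.
    have := HM r sr'; rewrite /flux.
    set G := \int[leb]_(y in _) _ => HG.
    have HG' : - (M * b r) <= sg * (b r * G).
      exact: aux.
    apply: (le_trans HG'); case: sgE => sgE; subst sg.
    - rewrite !mul1r; apply: C2 => y ylh Ny.
      by have := Hp r y sr' ylh Ny; rewrite !mul1r.
    - rewrite !mulN1r lerN2; apply: C1 => y ylh Ny.
      by have := Hp r y sr' ylh Ny; rewrite !mulN1r lerN2.
  have bE : \int[leb]_(r in `[0, T]) (M * b r) = M * \int[leb]_(r in `[0, T]) b r.
    exact: RintegralZ_segment.
  have bE2 : \int[leb]_(r in `[0, T]) (- (M * b r)) = - (M * \int[leb]_(r in `[0, T]) b r).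
    rewrite -mulNr -RintegralZ_segment//.
    by apply: eq_Rintegral => r _; rewrite mulNr.
  case: sgE => sgE; subst sg.
  - rewrite mul1r -bE2.
    apply: (le_Rintegral_negligible _ (negligible_set0 _) iKM) => //.
    + by move=> r _ _; rewrite normrN; exact: bnd2.
    + by move=> r; rewrite /= in_itv/= => rT _; exact: bnd1.
    + by move=> r; rewrite /= in_itv/= => /key + _; rewrite mul1r.
  - rewrite mulN1r lerN2 -bE.
    apply: (le_Rintegral_negligible _ (negligible_set0 _) iKM) => //.
    + by move=> r; rewrite /= in_itv/= => rT _; exact: bnd1.
    + by move=> r; rewrite /= in_itv/= => /key + _; rewrite mulN1r lerN2.
have bi : \int[leb]_(r in `[0, T]) (b' r * r) = - \int[leb]_(r in `[0, T]) b r.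
  exact: pulse_by_parts.
have pos : 0 <= \int[leb]_(r in `[0, T]) (b' r * J r).
  have cbF := within_mul cb'T cF.
  have cbr := within_mul cb'T (@within_id _ 0 T).
  have -> : \int[leb]_(r in `[0, T]) (b' r * J r) = \int[leb]_(r in `[0, T])
     (sg * (b' r * F r) + (- M) * (b' r * r)).
    apply: eq_Rintegral => r _; rewrite /J; move: (b' r) (F r) => c1 c2; ring.
  rewrite RintegralD_segment; [|exact: within_mul|exact: within_mul].
  rewrite !RintegralZ_segment// bi mulrNN.
  by rewrite -lerBlDr sub0r.
have := pulse_decrease e0 (ltW s0) st' eT cJT es' et'.
by move=> /(le_trans pos); rewrite leNgt subr_lt0 m12.
Unshelve. all: by end_near. Qed.

End weak.

(** * The local maximum principle *)

Section touching.
Variable R : realType.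
Notation leb := (@lebesgue_measure R).
Variables (alpha beta ustar : R) (u p : R -> R -> R).
Hypotheses (alpha_gt0 : 0 < alpha) (beta_gt0 : 0 < beta).
Hypothesis W : weak_solution alpha beta ustar u p.
Implicit Types x y t s l h d e r tau eta T k : R.
Local Notation w := (wfun alpha beta u).
Local Notation wx := (d_x w).

(* Mollified weak form of g_t - g_xx - sg * pi * u <= - c. *)
Definition subsol_ineq (sg c : R) (pi : R -> R) (gx gt : R -> R -> R) l h x d tau :=
  avg x d l h (gt ^~ tau) - sg * \int[leb]_(y in `[l, h]) (pi y * (u y tau * bump d (y - x)))
  + \int[leb]_(y in `[l, h]) (dbump d (y - x) * gx y tau) <= - c * mass d l h x.

Section mollified_max.
Variables (sg c x1 t1 R0 : R) (N : set R) (pi : R -> R) (g gx gt : R -> R -> R).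
Hypotheses (sgE : sg = 1 \/ sg = -1) (c_gt0 : 0 < c) (R0_gt0 : 0 < R0) (R0t1 : R0 < t1).
Local Notation l := (x1 - R0).
Local Notation h := (x1 + R0).
Local Notation ta := (t1 - R0).
Local Notation tb := (t1 + R0).
Hypotheses (cg : {within rect l h ta tb, continuous (fun z : R * R => g z.1 z.2)})
  (cgx : {within rect l h ta tb, continuous (fun z : R * R => gx z.1 z.2)})
  (cgt : {within rect l h ta tb, continuous (fun z : R * R => gt z.1 z.2)}).
Hypotheses
  (dgx : forall y tau, l <= y <= h -> ta <= tau <= tb -> is_derive y (1 : R) (g ^~ tau) (gx y tau))
  (dgt : forall y tau, l <= y <= h -> ta <= tau <= tb -> is_derive tau (1 : R) (g y) (gt y tau)).
Hypotheses (N0 : leb.-negligible N) (mpi : measurable_fun setT pi)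
  (pi01 : forall y : R, 0 <= pi y <= 1).
Hypothesis Hp : forall y tau, l <= y <= h -> ta <= tau <= tb -> ~ N y ->
     sg * (pi y * u y tau) <= sg * (p y tau * u y tau).
Hypothesis Hsub : forall x d tau, 0 < d -> l <= x - d -> x + d <= h -> ta <= tau <= tb ->
  subsol_ineq sg c pi gx gt l h x d tau.

Let v y tau := sg * w y tau + g y tau.
Let vx y tau := sg * wx y tau + gx y tau.
Let V d x tau := avg x d l h (v ^~ tau).

Let slice (f : R -> R -> R) tau : {within rect l h ta tb, continuous (fun z : R * R => f z.1 z.2)} ->
  ta <= tau <= tb -> {within `[l, h], continuous (f ^~ tau)}.
Proof. by move=> cf; exact: (@rect_slice _ l h ta tb (fun z : R * R => f z.1 z.2)). Qed.

Let ta_gt0 : 0 < ta. Proof. by rewrite subr_gt0. Qed.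

Let cv : {within rect l h ta tb, continuous (fun z : R * R => v z.1 z.2)}.
Proof.
move=> z; apply: cvgD; last exact: cg.
apply: cvgM; first exact: cvg_cst.
exact: (@rect_w _ _ _ _ _ _ W l h ta tb (ltW ta_gt0)).
Qed.

Let cvx : {within rect l h ta tb, continuous (fun z : R * R => vx z.1 z.2)}.
Proof.
move=> z; apply: cvgD; last exact: cgx.
apply: cvgM; first exact: cvg_cst.
exact: (@rect_wx _ _ _ _ _ _ W l h ta tb (ltW ta_gt0)).
Qed.

Let dvx y tau : l <= y <= h -> ta <= tau <= tb -> is_derive y 1 (v ^~ tau) (vx y tau).
Proof.
move=> yl tl; have t0 : 0 <= tau by case/andP: tl => + _; apply: le_trans; exact: ltW.
have H1 := is_derive_w W y t0; have H2 := dgx yl tl.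
by rewrite /v; apply: is_derive_eq.
Qed.

Let lh : l < h.
Proof. by have := R0_gt0 => H; lra. Qed.

(** The first derivative of the mollification is the average of [vx], by parts; differentiating the
    bump once more gives the second, which cannot be positive at a maximum. *)
Lemma mollified_second_variation d x tau : 0 < d -> l < x - d -> x + d < h -> ta <= tau <= tb ->
  (\forall y \near x, V d y tau <= V d x tau) ->
  - (\int[leb]_(y in `[l, h]) (dbump d (y - x) * vx y tau)) <= 0.
Proof.
move=> d0 lx xh tl mx; rewrite leNgt; apply/negP => pos; move: mx.
have cvs := slice cv tl; have cvxs := slice cvx tl.
apply: (@no_max_of_deriv2_gt0 _ (fun x => V d x tau)
  (fun x => avg x d l h (vx ^~ tau)) x (- (\int[leb]_(y in `[l, h]) (dbump d (y - x) * vx y tau)))) => //.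
- near=> y.
  have H := is_derive_avg y d0 cvs.
  rewrite /V; apply: (is_derive_eq H).
  rewrite (@mollify_by_parts _ l h d y (v ^~ tau) (vx ^~ tau) (ltW d0) lh _ _ cvxs (fun z zl => dvx zl tl)).
  + by rewrite opprK.
  + have : l + d < y by near: y; apply: lt_nbhsr; rewrite -ltrBrDr.
    by move=> ?; rewrite lerBrDr ltW.
  + have : y < h - d by near: y; apply: lt_nbhsl; rewrite ltrBrDr.
    by move=> ?; rewrite -lerBrDr ltW.
- exact: is_derive_avg.
Unshelve. all: by end_near. Qed.

Let pointwise_aux (a b W1 W2 U1 U2 q kap M3 M4 : R) : 0 <= q <= 1 -> `|a| <= M4 -> `|b| <= M3 ->
  `|W2 - W1| < kap -> `|U2 - U1| < kap ->
  `|a * W1 + q * (U1 * b) - (a * W2 + q * (U2 * b))| <= (M3 + M4) * kap.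
Proof.
move=> /andP[q0 q1] aM bM W12 U12.
have -> : a * W1 + q * (U1 * b) - (a * W2 + q * (U2 * b)) = a * (W1 - W2) + q * (b * (U1 - U2)) by ring.
have T1 : `|a * (W1 - W2)| <= M4 * kap by rewrite normrM ler_pM// distrC ltW.
have T2 : `|q * (b * (U1 - U2))| <= M3 * kap.
  rewrite normrM -[leRHS]mul1r ler_pM//; first by rewrite ger0_norm.
  by rewrite normrM ler_pM// distrC ltW.
by rewrite (le_trans (ler_normD _ _))// mulrDl addrC lerD.
Qed.

Let integrable_flux d x q : 0 < q -> leb.-integrable `[l, h]
    (EFin \o (fun y => dbump d (y - x) * wx y q + pi y * (u y q * bump d (y - x)))).
Proof.
move=> q0.
rewrite (_ : _ \o _ = ((EFin \o (fun y => (dbump d (y - x) * wx y q)%R)) \+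
     (EFin \o (fun y => (pi y * (u y q * bump d (y - x)))%R)))%E)//.
apply: integrableD => //.
  by apply: integrable_segment; apply: within_continuous_dbumpM; exact/(wx_slice W)/ltW.
apply: integrable_segmentM => //.
rewrite (_ : (fun y => _) = (fun y => bump d (y - x) * u y q)).
  by apply: within_continuous_bumpM; exact: (u_slice W).
by apply/funext => y; rewrite mulrC.
Qed.

Lemma flux_close d x r tau kap M3 M4 : 0 < r -> 0 < tau -> 0 <= kap ->
  (forall y, l <= y <= h -> `|bump d (y - x)| <= M3) ->
  (forall y, l <= y <= h -> `|dbump d (y - x)| <= M4) ->
  (forall y, l <= y <= h -> `|wx y r - wx y tau| < kap) ->
  (forall y, l <= y <= h -> `|u y r - u y tau| < kap) ->
  `|flux alpha beta u pi x d l h tau - flux alpha beta u pi x d l h r| <=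
  (M3 + M4) * kap * (h - l).
Proof.
move=> r0 tau0 kap0 HM3 HM4 Hw Hu.
have bound y : l <= y <= h ->
    `|dbump d (y - x) * wx y tau + pi y * (u y tau * bump d (y - x)) -
      (dbump d (y - x) * wx y r + pi y * (u y r * bump d (y - x)))| <= (M3 + M4) * kap.
  by move=> yl; apply: pointwise_aux; [exact: pi01|exact: HM4|exact: HM3|exact: Hw|exact: Hu].
rewrite /flux -RintegralB//; [|exact: integrable_flux|exact: integrable_flux].
apply: le_trans (le_normr_Rintegral _ _) _ => //.
  rewrite (_ : _ \o _ = ((EFin \o (fun y => (dbump d (y - x) * wx y tau + pi y * (u y tau * bump d (y - x)))%R)) \-
    (EFin \o (fun y => (dbump d (y - x) * wx y r + pi y * (u y r * bump d (y - x)))%R)))%E)//.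
  by apply: integrableB => //; exact: integrable_flux.
apply: (@le_trans _ _ (\int[leb]_(y in `[l, h]) ((M3 + M4) * kap))); last first.
  by rewrite Rintegral_segment_cst.
apply: (le_Rintegral_negligible _ (negligible_set0 _)
   (integrable_segment (@within_cst _ l h ((M3 + M4) * kap)))) => //.
- move=> y; rewrite /= in_itv/= normr_id => yl _; exact: (bound y yl).
- move=> y; rewrite /= in_itv/= => yl _.
  by rewrite ger0_norm// (le_trans _ (bound y yl)).
- move=> y; rewrite /= in_itv/= => yl _; exact: (bound y yl).
Qed.

Lemma avg_g_increment d x s tau kap : 0 < d -> ta <= s -> s < tau -> tau <= tb ->
  (forall r y, s <= r <= tau -> l <= y <= h -> `|gt y r - gt y tau| < kap) ->
  avg x d l h (g ^~ tau) - avg x d l h (g ^~ s) <=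
  (avg x d l h (gt ^~ tau) + kap * mass d l h x) * (tau - s).
Proof.
move=> d0 tas st ttb Hg.
have tI : ta <= tau <= tb by rewrite (le_trans tas (ltW st)).
have sI : ta <= s <= tb by rewrite tas (le_trans (ltW st)).
have cg1 := slice cg tI; have cg2 := slice cg sI; have cg3 := slice cgt tI.
have cgt' : {within `[l, h], continuous (fun y => gt y tau + kap)}.
  by move=> y; apply: cvgD; [exact: cg3|exact: cvg_cst].
have cZ : {within `[l, h], continuous (fun y => (tau - s) * (gt y tau + kap))}.
  by move=> y; apply: cvgM; [exact: cvg_cst|exact: cgt'].
rewrite lerBlDr.
apply: (@le_trans _ _ (avg x d l h (fun y => (tau - s) * (gt y tau + kap) + g y s))).
  apply: avg_le (ltW d0) => //.
    by move=> y; apply: cvgD; [exact: cZ|exact: cg2].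
  move=> y yl _; rewrite -lerBlDr.
  have dg r : r \in `[s, tau] -> is_derive r 1 (g y) (gt y r).
    rewrite in_itv/= => /andP[sr rt]; apply: dgt => //.
    by rewrite (le_trans tas)// (le_trans rt).
  have [r] := @MVT _ (g y) (gt y) s tau st (fun r rI => dg r (subset_itv_oo_cc rI))
    (derivable_within_continuous (fun r rI => @ex_derive _ _ _ _ _ _ _ (dg r rI))).
  rewrite in_itv/= => /andP[sr rt] ->; rewrite mulrC ler_pM2l ?subr_gt0//.
  have rI : s <= r <= tau by rewrite (ltW sr) (ltW rt).
  have := Hg r y rI yl; rewrite ltr_norml => /andP[_ /ltW].
  by rewrite lerBlDl.
rewrite (avgD _ _ cZ cg2) lerD2r (avgZ _ _ _ cgt') (avgD _ _ cg3 (@within_cst _ l h kap)) avg_cst.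
by rewrite mulrC.
Qed.

Let first_variation_aux (sg' a1 a2 a3 a4 b1 b2 eta k : R) : sg' * (a1 - a2) <= (- b1 + eta) * k ->
    a3 - a4 <= (b2 + eta) * k -> b2 - b1 = - (3 * eta) ->
    sg' * a2 + a4 <= sg' * a1 + a3 -> 0 < eta -> 0 < k -> False.
Proof.
move=> e1 e2 e3 e4 eta0 k0; have ek : 0 < eta * k by rewrite mulr_gt0.
have e5 : b2 * k = b1 * k - 3 * (eta * k) by rewrite -[b2](subrK b1) e3; ring.
move: e1 e2 e4; rewrite mulrBr !mulrDl e5 mulNr.
move: (sg' * a1) (sg' * a2) (b1 * k) (eta * k) ek => A B C D; lra.
Qed.

(** The expression stands for the time derivative of the mollification, which may not exist. If it
    were [- 3 * eta], the increments of the [w] and [g] parts over a short interval before [tau]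
    would each lose at most [eta] per unit of time, and the mollification would still decrease
    there. *)
Lemma mollified_first_variation d x s_ tau : 0 < d -> l <= x - d -> x + d <= h ->
  ta <= s_ -> s_ < tau -> tau < tb ->
  (forall s, s_ < s -> s < tau -> V d x s <= V d x tau) ->
  0 <= avg x d l h (gt ^~ tau) - sg * flux alpha beta u pi x d l h tau.
Proof.
move=> d0 lx xh tas stau tT mx; have tt := le_lt_trans tas stau; rewrite leNgt; apply/negP => neg.
have tau0 : 0 < tau by exact: lt_trans ta_gt0 tt.
have tI : ta <= tau <= tb by rewrite !ltW.
have [eta [eta0 etaE]] : exists eta, 0 < eta /\
  avg x d l h (gt ^~ tau) - sg * flux alpha beta u pi x d l h tau = - (3 * eta).
  exists (- (avg x d l h (gt ^~ tau) - sg * flux alpha beta u pi x d l h tau) / 3).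
  by split; [rewrite divr_gt0// oppr_gt0|field].
have hl : 0 < h - l by rewrite subr_gt0.
have [M3 M30 HM3] := bounded_segment (continuous_subspaceT
  (fun y => is_derive_continuous (is_derive_bump_shift d x y)) (A := `[l, h])).
have cdb : continuous (fun y : R => dbump d (y - x)).
  move=> z; apply: (@continuous_comp _ _ _ (fun z : R => z - x) (@dbump R d)); last exact: continuous_dbump.
  by apply: cvgB; [exact: cvg_id|exact: cvg_cst].
have [M4 M40 HM4] := bounded_segment (continuous_subspaceT cdb (A := `[l, h])).
(* [kap] is the modulus of continuity for which the errors in the flux and in the average of [gt]
   are both at most [eta]. *)
have [kap [kap0 kapE kapM]] : exists kap, [/\ 0 < kap, (M3 + M4) * kap * (h - l) = eta
  & kap * (M3 * (h - l)) <= eta].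
  have MM : 0 < M3 + M4 by rewrite addr_gt0.
  exists (eta / ((M3 + M4) * (h - l))); split.
  - by rewrite divr_gt0// mulr_gt0.
  - by field; rewrite !gt_eqF.
  - rewrite mulrAC ler_pdivrMr ?mulr_gt0// ler_pM2l// ler_pM2r// lerDl; exact: ltW.
have [r0 [r00 r01 r02]] : exists r0, [/\ 0 < r0, r0 <= tau - ta & r0 <= tb - tau].
  exists (Num.min (tau - ta) (tb - tau)); split; last 2 first.
  - by rewrite ge_min lexx.
  - by rewrite ge_min lexx orbT.
  by rewrite lt_min !subr_gt0 tt.
have sub : rect l h (tau - r0) (tau + r0) `<=` rect l h ta tb.
  move=> z /rectP[zl /andP[z1 z2]]; apply/rectP; split => //; apply/andP; split.
    by apply: le_trans z1; rewrite lerBrDr -lerBrDl.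
  by apply: (le_trans z2); rewrite -lerBrDl.
have cu : {within rect l h ta tb, continuous (fun z : R * R => u z.1 z.2)}.
  apply/subspace_continuousP => -[y s] /rectP[_ /= /andP[s1 _]].
  by apply: cvg_within_filter; apply: (@continuous_u _ _ _ _ _ _ W); exact: lt_le_trans ta_gt0 s1.
have [k1 /andP[k10 k1r] Hk1] := unif_slice r00 kap0 (continuous_subspaceW sub cgt).
have [k2 /andP[k20 k2r] Hk2] := unif_slice r00 kap0 (continuous_subspaceW sub
  (@rect_wx _ _ _ _ _ _ W l h ta tb (ltW ta_gt0))).
have [k3 /andP[k30 k3r] Hk3] := unif_slice r00 kap0 (continuous_subspaceW sub cu).
have [m [m0 mr ms]] : exists m, [/\ 0 < m, m <= r0 & m <= tau - s_].
  exists (Num.min r0 (tau - s_)).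
  by split; [rewrite lt_min r00 subr_gt0|rewrite ge_min lexx|rewrite ge_min lexx orbT].
have [k [k0 kk1 kk2 kk3 km]] : exists k, [/\ 0 < k, k < k1, k < k2, k < k3 & k < m].
  exists (Num.min (Num.min k1 m) (Num.min k2 k3) / 2).
  have mm : 0 < Num.min (Num.min k1 m) (Num.min k2 k3) by rewrite !lt_min k10 k20 m0.
  have hm : Num.min (Num.min k1 m) (Num.min k2 k3) / 2 < Num.min (Num.min k1 m) (Num.min k2 k3).
    by rewrite ltr_pdivrMr// ltr_pMr// ltr1n.
  by split; [rewrite divr_gt0//|apply: (lt_le_trans hm); rewrite !ge_min !lexx ?orbT..].
have kr0 := lt_le_trans km mr; have ks_ := lt_le_trans km ms.
have [s [sta ss_ st sE]] : exists s, [/\ ta < s, s_ < s, s < tau & tau - s = k].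
  exists (tau - k); split.
  - by rewrite ltrBrDl -ltrBrDr (lt_le_trans kr0).
  - by rewrite ltrBrDl -ltrBrDr.
  - by rewrite ltrBlDr ltrDl.
  - by rewrite opprB addrC subrK.
have winI r : s <= r <= tau + k -> ta <= r <= tb.
  move=> /andP[sr rt]; rewrite (le_trans (ltW sta) sr)/= (le_trans rt)//.
  by rewrite -lerBrDl (le_trans (ltW kr0)).
have s0 : 0 < s by exact: lt_trans sta.
have wink r : s <= r <= tau + k -> `|r - tau| <= k.
  move=> /andP[sr rt]; rewrite ler_norml lerBlDl rt andbT -sE opprB lerD2r//.
have I1 : sg * (avg x d l h (w ^~ tau) - avg x d l h (w ^~ s)) <=
    (- (sg * flux alpha beta u pi x d l h tau) + eta) * (tau - s).
  apply: (@time_increment _ _ _ _ _ _ alpha_gt0 beta_gt0 W _ _ N pi x d l h s tau (tau + k)) => //.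
  - by rewrite ltrDl.
  - by move=> r y rI yl Ny; apply: Hp => //; exact: winI.
  move=> r rI; rewrite -lerBlDl opprK addrC -mulrBr.
  have r_0 : 0 < r by case/andP: rI => sr _; exact: lt_le_trans s0 sr.
  have rk := wink r rI.
  have dif := flux_close r_0 tau0 (ltW kap0) HM3 HM4
    (fun y yl => Hk2 r y (le_lt_trans rk kk2) yl) (fun y yl => Hk3 r y (le_lt_trans rk kk3) yl).
  rewrite kapE in dif.
  have : `|sg * (flux alpha beta u pi x d l h tau - flux alpha beta u pi x d l h r)| <= eta.
    by case: sgE => ->; rewrite ?mul1r ?mulN1r ?normrN.
  by rewrite ler_norml => /andP[].
have I2 : avg x d l h (g ^~ tau) - avg x d l h (g ^~ s) <= (avg x d l h (gt ^~ tau) + eta) * (tau - s).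
  have H r y : s <= r <= tau -> l <= y <= h -> `|gt y r - gt y tau| < kap.
    move=> /andP[sr rt] yl.
    have rI : s <= r <= tau + k by rewrite sr (le_trans rt)// lerDl ltW.
    exact: (Hk1 r y (le_lt_trans (wink r rI) kk1) yl).
  apply: (le_trans (@avg_g_increment d x s tau kap d0 (ltW sta) st (ltW tT) H)).
  rewrite ler_pM2r ?subr_gt0// lerD2l (le_trans _ kapM)// ler_pM2l//.
  rewrite -Rintegral_segment_cst// /mass /avg; apply: le_Rintegral_segment.
  - by apply: within_continuous_bumpM; exact: within_cst.
  - exact: within_cst.
  - by move=> y yl; rewrite mulr1 (le_trans (ler_norm _))// HM3.
have VE r : ta <= r <= tb -> V d x r = sg * avg x d l h (w ^~ r) + avg x d l h (g ^~ r).
  move=> rI; have r_0 : 0 <= r by case/andP: rI => + _; apply: le_trans; exact: ltW.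
  rewrite /V /v avgD; last exact: slice.
    by rewrite avgZ//; exact: (w_slice W).
  by move=> y; apply: cvgM; [exact: cvg_cst|exact: (w_slice W r_0)].
have VV := mx s ss_ st; rewrite !VE// in VV; last first.
  by apply: winI; rewrite lexx/= (le_trans (ltW st))// lerDl ltW.
by apply: (first_variation_aux I1 I2 etaE VV eta0); rewrite subr_gt0.
Qed.

(** In the difference of the two variations the terms with [wx] cancel; what is left is the quantity
    that [subsol_ineq] makes negative. *)
Lemma mollified_no_max d x s_ tau : 0 < d -> l < x - d -> x + d < h -> ta <= s_ -> s_ < tau -> tau < tb ->
  (forall s, s_ < s -> s < tau -> V d x s <= V d x tau) ->
  ~ (\forall y \near x, V d y tau <= V d x tau).
Proof.
move=> d0 lx xh tas stau tT mxt mxx; have tt := le_lt_trans tas stau.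
have tI : ta <= tau <= tb by rewrite !ltW.
have tau0 : 0 < tau by exact: lt_trans ta_gt0 tt.
have H1 := mollified_first_variation d0 (ltW lx) (ltW xh) tas stau tT mxt.
have H2 := mollified_second_variation d0 lx xh tI mxx.
have H3 := Hsub d0 (ltW lx) (ltW xh) tI.
have m0 := mass_gt0 d0 (ltW lx) (ltW xh).
move: H1 H2 H3; rewrite /subsol_ineq.
have cwx : {within `[l, h], continuous (fun y => dbump d (y - x) * wx y tau)}.
  by apply: within_continuous_dbumpM; exact/(wx_slice W)/ltW.
have cgx' : {within `[l, h], continuous (fun y => dbump d (y - x) * gx y tau)}.
  by apply: within_continuous_dbumpM; exact: slice.
have cub : {within `[l, h], continuous (fun y => u y tau * bump d (y - x))}.
  rewrite (_ : (fun y => _) = (fun y => bump d (y - x) * u y tau)).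
    by apply: within_continuous_bumpM; exact: (u_slice W).
  by apply/funext => y; rewrite mulrC.
have -> : \int[leb]_(y in `[l, h]) (dbump d (y - x) * vx y tau) =
    sg * \int[leb]_(y in `[l, h]) (dbump d (y - x) * wx y tau) +
    \int[leb]_(y in `[l, h]) (dbump d (y - x) * gx y tau).
  rewrite -RintegralZ_segment// -RintegralD_segment//.
    by apply: eq_Rintegral => y _; rewrite /vx; ring.
  by move=> y; apply: cvgM; [exact: cvg_cst|exact: cwx].
have -> : flux alpha beta u pi x d l h tau =
    \int[leb]_(y in `[l, h]) (dbump d (y - x) * wx y tau) +
    \int[leb]_(y in `[l, h]) (pi y * (u y tau * bump d (y - x))).
  rewrite /flux RintegralD//; [exact: integrable_segment|exact: integrable_segmentM].
have mc : 0 < c * mass d l h x by rewrite mulr_gt0.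
have fin (a0 a1 a2 a3 a4 : R) : 0 < a0 -> 0 <= a1 - sg * (a2 + a3) ->
    - (sg * a2 + a4) <= 0 -> a1 - sg * a3 + a4 <= - a0 -> False by move=> *; lra.
by rewrite mulNr; exact: fin.
Qed.

Lemma V_close d x tau e : 0 < d -> l <= x - d -> x + d <= h -> ta <= tau <= tb ->
  (forall y, l <= y <= h -> `|y - x| < d -> `|v y tau - v x tau| <= e) ->
  `|V d x tau - v x tau * mass d l h x| <= e * mass d l h x.
Proof.
move=> d0 lx xh tI H; have cvs := slice cv tI.
have cc (a : R) : {within `[l, h], continuous (fun _ : R => a)} by exact: within_cst.
rewrite ler_norml; apply/andP; split.
- rewrite -subr_ge0 (_ : _ - _ = V d x tau - (v x tau - e) * mass d l h x); last by ring.
  rewrite subr_ge0 -avg_cst; apply: avg_le (ltW d0) => // y yl yd.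
  by have := H y yl yd; rewrite ler_norml => /andP[]; lra.
- rewrite -subr_ge0 (_ : _ - _ = (v x tau + e) * mass d l h x - V d x tau); last by ring.
  rewrite subr_ge0 -avg_cst; apply: avg_le (ltW d0) => // y yl yd.
  by have := H y yl yd; rewrite ler_norml => /andP[]; lra.
Qed.

(** Lipschitz in x by the bound on [dbump], uniformly in time, and continuous in time by uniform
    continuity of [v]. *)
Lemma V_continuous d (a b : R) (s1 s2 : R) : 0 < d -> ta <= s1 -> s2 <= tb ->
  {within rect a b s1 s2, continuous (fun z : R * R => V d z.1 z.2)}.
Proof.
move=> d0 ts1 s2t.
have [M M0 HM] := bounded_rect cv.
have hl : 0 < h - l by rewrite subr_gt0.
pose C := 4 * d ^+ 3 * M * (h - l).
have C0 : 0 < C by rewrite !mulr_gt0// exprn_gt0.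
have sI r : s1 <= r <= s2 -> ta <= r <= tb.
  by move=> /andP[r1 r2]; rewrite (le_trans ts1)// (le_trans r2).
have Lip x x' r : s1 <= r <= s2 -> `|V d x r - V d x' r| <= C * `|x - x'|.
  move=> rI; wlog xx : x x' / x < x'.
    move=> H; have [xx|xx|->] := ltgtP x x'; first exact: H.
      by rewrite distrC [`|x - x'|]distrC; exact: H.
    by rewrite !subrr normr0 mulr0.
  have cvs := slice cv (sI r rI).
  have dV (z : R) : is_derive z 1 (fun z => V d z r) (- \int[leb]_(y in `[l, h]) (dbump d (y - z) * v y r)).
    exact: is_derive_avg.
  have [z _ E] := @MVT _ (fun z => V d z r) _ x x' xx (fun z _ => dV z)
    (derivable_within_continuous (fun z _ => @ex_derive _ _ _ _ _ _ _ (dV z))).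
  rewrite distrC E normrM normrN [`|x' - x|]distrC ler_wpM2r//.
  have cc := within_continuous_dbumpM (d := d) (x := z) cvs.
  apply: le_trans (le_normr_Rintegral _ (integrable_segment cc)) _ => //.
  rewrite /C -Rintegral_segment_cst//; apply: le_Rintegral_segment.
  - by move=> y; apply: cvg_norm; exact: cc.
  - exact: within_cst.
  - move=> y yl; rewrite normrM ler_pM// ?ge_dbump//; apply: HM => //; exact: sI.
apply/subspace_continuousP => -[x r] /rectP[/= _ rI].
apply/cvgrPdist_le => e e0.
have [M3 M30 HM3] := bounded_segment (continuous_subspaceT
  (fun y => is_derive_continuous (is_derive_bump_shift d x y)) (A := `[l, h])).
have e'0 : 0 < e / 2 / (M3 * (h - l)) by rewrite !divr_gt0// mulr_gt0.
have [k k0 Hk] := compact_unif_continuous (@compact_rect _ _ _ _ _) cv e'0.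
rewrite near_withinE; near=> z => /rectP[_ zI].
have B1 : `|x - z.1| < e / 2 / C.
  near: z; apply: (@cvgr_dist_lt _ _ _ _ _ fst x) => //; first exact: cvg_fst.
  by rewrite !divr_gt0.
have B2 : `|r - z.2| < k.
  by near: z; apply: (@cvgr_dist_lt _ _ _ _ _ snd r) => //; exact: cvg_snd.
rewrite (splitr e) (le_trans (ler_distD (V d x z.2) _ _))// lerD//; last first.
  rewrite (le_trans (Lip _ _ _ zI))// -(@ler_pdivlMl _ C)// mulrC ltW//.
have cr := slice cv (sI r rI); have cz := slice cv (sI z.2 zI).
have -> : V d x r - V d x z.2 = \int[leb]_(y in `[l, h]) (bump d (y - x) * (v y r - v y z.2)).
  rewrite /V /avg -RintegralB//; last 2 first.
  - by apply: integrable_segment; apply: within_continuous_bumpM.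
  - by apply: integrable_segment; apply: within_continuous_bumpM.
  by apply: eq_Rintegral => y _; ring.
have cc : {within `[l, h], continuous (fun y => bump d (y - x) * (v y r - v y z.2))}.
  by apply: within_continuous_bumpM => y; apply: cvgB; [exact: cr|exact: cz].
apply: le_trans (le_normr_Rintegral _ (integrable_segment cc)) _ => //.
apply: (@le_trans _ _ (\int[leb]_(y in `[l, h]) (e / 2 / (h - l)))); last first.
  by rewrite Rintegral_segment_cst// divfK// gt_eqF.
apply: le_Rintegral_segment.
- by move=> y; apply: cvg_norm; exact: cc.
- exact: within_cst.
move=> y yl; rewrite normrM.
rewrite (_ : e / 2 / (h - l) = M3 * (e / 2 / (M3 * (h - l)))); last first.
  by rewrite !invfM; field; rewrite !gt_eqF.
rewrite ler_pM ?HM3// ltW//; apply: (Hk (y, r) (y, z.2)) => //=.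
- by apply/rectP; split => //=; exact: sI.
- by apply/rectP; split => //=; exact: sI.
- by rewrite subrr normr0.
Unshelve. all: by end_near. Qed.

(** Mollification with small radius moves values, relative to the mass, by at most [dl / 3]. So the
    maximum of the mollification over the small rectangle avoids the lateral and bottom sides, and
    [mollified_no_max] excludes every other position, the top side included. *)
Lemma no_strict_max (dl : R) : 0 < dl ->
  ~ (forall y tau, `|y - x1| <= R0 / 2 -> t1 - R0 / 2 <= tau <= t1 ->
      `|y - x1| = R0 / 2 \/ tau = t1 - R0 / 2 -> v y tau + dl <= v x1 t1).
Proof.
move=> dl0 Hb; have R00 := R0_gt0.
have e0 : 0 < dl / 3 by rewrite divr_gt0.
have [r r0 Hr] := compact_unif_continuous (@compact_rect _ _ _ _ _) cv e0.
pose d := Num.min (r / 2) (R0 / 4).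
have d0 : 0 < d by rewrite lt_min; apply/andP; split; lra.
have [dr dR] : d <= r / 2 /\ d <= R0 / 4 by rewrite /d !ge_min !lexx orbT.
clearbody d.
pose a := x1 - R0 / 2; pose b := x1 + R0 / 2; pose s := t1 - R0 / 2.
have cV : {within rect a b s t1, continuous (fun z : R * R => V d z.1 z.2)}.
  by apply: V_continuous => //; rewrite /s; lra.
have Q0 : rect a b s t1 !=set0.
  by exists (x1, t1); apply/rectP; rewrite /a /b /s /=; split; lra.
have [[x2 t2] /set_mem/rectP[/= x2I t2I] Vmax] := compact_EVT_max Q0 (@compact_rect _ _ _ _ _) cV.
have Vmax' x t : a <= x <= b -> s <= t <= t1 -> V d x t <= V d x2 t2.
  by move=> xI tI; apply: (Vmax (x, t)); apply/mem_set/rectP.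
have inI x : a <= x <= b -> [/\ l <= x - d, x + d <= h & l <= x <= h].
  by rewrite /a /b => H; split; lra.
have inT t : s <= t <= t1 -> ta <= t <= tb by rewrite /s; lra.
have mE x : a <= x <= b -> mass d l h x = mass d l h x1.
  have [k1 k2 _] : [/\ l <= x1 - d, x1 + d <= h & True] by split => //; lra.
  by move=> /inI[? ? _]; exact: mass_cst.
have m0 : 0 < mass d l h x1 by apply: mass_gt0 => //; lra.
have close x t : a <= x <= b -> s <= t <= t1 ->
    `|V d x t - v x t * mass d l h x1| <= dl / 3 * mass d l h x1.
  move=> xI tI; have [h1 h2 h3] := inI x xI; rewrite -(mE x xI).
  apply: V_close => //; first exact: inT.
  move=> y yl yd; apply/ltW; apply: (Hr (y, t) (x, t)) => //=.
  - by apply/rectP; split => //=; exact: inT.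
  - by apply/rectP; split => //=; exact: inT.
  - by rewrite (lt_trans yd)//; lra.
  - by rewrite subrr normr0.
have x1I : a <= x1 <= b by rewrite /a /b; lra.
have t1I : s <= t1 <= t1 by rewrite /s; lra.
have nb : ~ (`|x2 - x1| = R0 / 2 \/ t2 = t1 - R0 / 2).
  move=> bd; have vb : v x2 t2 + dl <= v x1 t1.
    by apply: Hb => //; rewrite ler_norml; move: x2I; rewrite /a /b; lra.
  have C1 := close x1 t1 x1I t1I; have C2 := close x2 t2 x2I t2I.
  have := Vmax' x1 t1 x1I t1I.
  have := ler_wpM2r (ltW m0) vb.
  have : 0 < dl * mass d l h x1 by rewrite mulr_gt0.
  move: C1 C2; rewrite !ler_norml.
  move: (V d x1 t1) (V d x2 t2) (v x1 t1) (v x2 t2) (mass d l h x1) => k1 k2 k3 k4 k5.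
  by rewrite mulrDl; move=> /andP[? ?] /andP[? ?] ? ? ?; lra.
have x2I' : a < x2 < b.
  move: x2I => /andP[]; rewrite !le_eqVlt => /orP[/eqP ax|->]; last first.
    move=> /orP[/eqP xb|->//]; exfalso; apply: nb; left.
    by rewrite xb /b ger0_norm; lra.
  exfalso; apply: nb; left; rewrite -ax /a ler0_norm; lra.
have st2 : s < t2.
  move: t2I => /andP[+ _]; rewrite le_eqVlt => /orP[/eqP st|//].
  by exfalso; apply: nb; right; rewrite -st.
have [H1 H2 _] := inI x2 x2I.
apply: (@mollified_no_max d x2 s t2 d0).
- by move: x2I'; rewrite /a; lra.
- by move: x2I'; rewrite /b; lra.
- by rewrite /s; lra.
- exact: st2.
- by move: t2I => /andP[_]; lra.
- move=> s' s'1 s't; apply: Vmax' => //.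
  by rewrite (ltW s'1) (le_trans (ltW s't))//; case/andP: t2I.
- move: x2I' => /andP[ax xb].
  near=> y; apply: Vmax' => //; apply/andP; split.
    by near: y; exact: lt_le_nbhsr.
  by near: y; exact: lt_le_nbhsl.
Unshelve. all: by end_near. Qed.

End mollified_max.
End touching.

(** * Integration by parts against a Lipschitz primitive *)

Section rough_by_parts.
Variable R : realType.
Notation leb := (@lebesgue_measure R).
Implicit Types x y l h r : R.

(** Cutting the interval into n equal pieces bounds the total increment by |K| (h - l)^2 / n. *)
Lemma quadratic_increment_cst (H : R -> R) (K l h : R) : l <= h ->
  (forall x y, l <= x -> x <= y -> y <= h -> `|H y - H x| <= K * (y - x) ^+ 2) -> H h = H l.
Proof.
move=> lh HK; apply/eqP; rewrite -subr_eq0 -normr_le0; apply/ler_addgt0Pr => e e0.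
rewrite add0r.
have K0 : 0 <= `|K| * (h - l) ^+ 2 by rewrite mulr_ge0// sqr_ge0.
pose n := (Num.truncn (`|K| * (h - l) ^+ 2 / e)).+1.
have nE : `|K| * (h - l) ^+ 2 / e < n%:R by rewrite truncnS_gt.
pose k := (h - l) / n%:R.
have k0 : 0 <= k by rewrite divr_ge0// subr_ge0.
have nk : n%:R * k = h - l by rewrite /k mulrC divfK// pnatr_eq0.
have step i : (i <= n)%N -> `|H (l + i%:R * k) - H l| <= i%:R * (`|K| * k ^+ 2).
  elim: i => [_|i IH iLn]; first by rewrite !mul0r addr0 subrr normr0.
  have -> : H (l + i.+1%:R * k) - H l = H (l + i.+1%:R * k) - H (l + i%:R * k) + (H (l + i%:R * k) - H l).
    by rewrite addrA subrK.
  have -> : i.+1%:R * (`|K| * k ^+ 2) = `|K| * k ^+ 2 + i%:R * (`|K| * k ^+ 2) by rewrite -natr1; ring.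
  apply: (le_trans (ler_normD _ _)); apply: lerD; last exact: IH (ltnW iLn).
  have HH := HK (l + i%:R * k) (l + i.+1%:R * k).
  have E : l + i.+1%:R * k - (l + i%:R * k) = k by rewrite -natr1; ring.
  rewrite (le_trans (HH _ _ _))//.
  - by rewrite lerDl mulr_ge0.
  - by rewrite -subr_ge0 E.
  - by rewrite -lerBrDl -nk ler_wpM2r// ler_nat.
  - by rewrite E ler_wpM2r ?sqr_ge0// ler_norm.
have := step n (leqnn n); rewrite nk (_ : l + (h - l) = h); last by ring.
move=> /le_trans; apply.
have -> : n%:R * (`|K| * k ^+ 2) = `|K| * (h - l) ^+ 2 / n%:R.
  by rewrite /k; field; rewrite pnatr_eq0.
rewrite ler_pdivrMr ?ltr0n//.
by move: nE; rewrite ltr_pdivrMr// [X in _ < X]mulrC => /ltW.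
Qed.

(** The sign is that of a tail integral: [P' = - pi] almost everywhere. *)
Definition is_primitive (P pi : R -> R) :=
  forall x y, x <= y -> P x - P y = \int[leb]_(r in `[x, y]) pi r.

Lemma Rintegral_ftc_segment l h (f f' : R -> R) : l < h -> {within `[l, h], continuous f'} ->
  (forall r, l <= r <= h -> is_derive r 1 f (f' r)) -> \int[leb]_(r in `[l, h]) f' r = f h - f l.
Proof.
move=> lh cf' df; have cf : {within `[l, h], continuous f}.
  by apply: derivable_within_continuous => y; rewrite in_itv/= => /df[].
have [_ cl ch] := (continuous_within_itvP f lh).1 cf.
rewrite /Rintegral (@continuous_FTC2 _ f' f)//.
- by split => // r; rewrite in_itv/= => /andP[lr rh]; have [] := df r; rewrite ?(ltW lr) ?(ltW rh).
- move=> r; rewrite in_itv/= => /andP[lr rh].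
  by rewrite derive1E; have [] := df r; rewrite ?(ltW lr) ?(ltW rh).
Qed.

Section primitive.
Variables (P pi : R -> R).
Hypotheses (mpi : measurable_fun setT pi) (pi01 : forall y, 0 <= pi y <= 1)
  (Ppi : is_primitive P pi).

Lemma integrable_pi x y : leb.-integrable `[x, y] (EFin \o pi).
Proof.
have := @integrable_segmentM _ x y (fun => 1) pi (@within_cst _ x y 1) mpi pi01.
by rewrite (_ : _ \o _ = EFin \o pi)//; apply/funext => z /=; rewrite mulr1.
Qed.

Lemma primitive_lip x y : x <= y -> 0 <= P x - P y <= y - x.
Proof.
move=> xy; rewrite Ppi//; apply/andP; split.
  by apply: Rintegral_ge0 => // z _; case/andP: (pi01 z).
move: xy; rewrite le_eqVlt => /orP[/eqP->|xy].
  by rewrite set_itv1 Rintegral_set1 subrr.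
rewrite -[leRHS]mul1r -Rintegral_segment_cst//; apply: le_Rintegral => //.
- exact: integrable_pi.
- by apply: integrable_segment; exact: within_cst.
- by move=> z _; case/andP: (pi01 z).
Qed.

Lemma continuous_primitive : continuous P.
Proof.
move=> x; apply/cvgrPdist_lt => e e0; near=> y.
have : `|x - y| < e.
  by near: y; apply: (@cvgr_dist_lt _ _ _ _ _ id x) => //; exact: cvg_id.
apply: le_lt_trans; have [xy|yx] := leP x y.
  have /andP[h0 h1] := primitive_lip xy.
  by rewrite ger0_norm// distrC ger0_norm ?subr_ge0.
have /andP[h0 h1] := primitive_lip (ltW yx).
by rewrite distrC ger0_norm// ger0_norm ?subr_ge0// ltW.
Unshelve. all: by end_near. Qed.

(** [P] is only Lipschitz. Instead of differentiating it almost everywhere, the proof shows that the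
    defect of the formula has quadratic increments and is therefore constant. *)
Lemma rough_by_parts l h (a a' : R -> R) : l < h -> {within `[l, h], continuous a'} ->
  (forall y, l <= y <= h -> is_derive y 1 a (a' y)) -> a l = 0 -> a h = 0 ->
  \int[leb]_(y in `[l, h]) (a' y * P y) = \int[leb]_(y in `[l, h]) (pi y * a y).
Proof.
move=> lh ca' da al ah.
have ca : {within `[l, h], continuous a}.
  by apply: derivable_within_continuous => y; rewrite in_itv/= => /da[].
have [M M0 HM] := bounded_segment ca'.
have cP x y : {within `[x, y], continuous P} by apply: continuous_subspaceT; exact: continuous_primitive.
pose f y := a' y * P y - pi y * a y.
have subI x y : l <= x -> y <= h -> `[x, y] `<=` `[l, h].
  by move=> lx yh z; rewrite /= !in_itv/= => /andP[xz zy]; rewrite (le_trans lx) ?(le_trans zy).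
have int1 x y : l <= x -> y <= h -> leb.-integrable `[x, y] (EFin \o (fun y => a' y * P y)).
  move=> lx yh; apply: integrable_segment; apply: within_mul => //.
  exact: continuous_subspaceW (subI _ _ lx yh) ca'.
have int2 x y : l <= x -> y <= h -> leb.-integrable `[x, y] (EFin \o (fun y => pi y * a y)).
  move=> lx yh; apply: integrable_segmentM => //.
  exact: continuous_subspaceW (subI _ _ lx yh) ca.
have intf x y : l <= x -> y <= h -> leb.-integrable `[x, y] (EFin \o f).
  move=> lx yh; rewrite (_ : _ \o _ = ((EFin \o (fun y => (a' y * P y)%R)) \-
     (EFin \o (fun y => (pi y * a y)%R)))%E)//.
  by apply: integrableB => //; [exact: int1|exact: int2].
(* On a piece [x, y] the increment of [H] is the integral of [a' * (P - P y) + pi * (a x - a)]; both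
   terms are at most [M * (y - x)]. *)
pose H z := \int[leb]_(y in `[l, z]) f y - a z * P z.
have HK x y : l <= x -> x <= y -> y <= h -> `|H y - H x| <= (2 * M) * (y - x) ^+ 2.
  move=> lx; rewrite le_eqVlt => /orP[/eqP->|xy] yh; first by rewrite !subrr normr0 expr0n mulr0.
  have -> : H y - H x = \int[leb]_(r in `[x, y]) (a' r * (P r - P y) + pi r * (a x - a r)).
    have E : \int[leb]_(r in `[l, y]) f r = \int[leb]_(r in `[l, x]) f r + \int[leb]_(r in `[x, y]) f r.
      rewrite -(@Rintegral_itv_obnd_cbnd _ x); last first.
        apply: (integrableS _ _ _ (intf x y lx yh)) => //.
        by apply: subset_itvr; rewrite bnd_simp.
      rewrite -(@Rintegral_itvB R f (BLeft l) (BRight y) x) ?bnd_simp ?(ltW xy)//.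
        by rewrite addrC subrK.
      exact: intf.
    have cxy : {within `[x, y], continuous a'} by exact: continuous_subspaceW (subI _ _ lx yh) ca'.
    have E2 : (a y - a x) * P y = \int[leb]_(r in `[x, y]) (a' r * P y).
      have dxy r : x <= r <= y -> is_derive r 1 a (a' r).
        by move=> /andP[xr ry]; apply: da; rewrite (le_trans lx) ?(le_trans ry).
      rewrite -(@Rintegral_ftc_segment x y a a' xy cxy dxy) mulrC -RintegralZ_segment//.
      by apply: eq_Rintegral => r _; rewrite mulrC.
    have E3 : a x * (P y - P x) = - \int[leb]_(r in `[x, y]) (pi r * a x).
      rewrite -opprB mulrN (Ppi (ltW xy)) -RintegralZl//; last exact: integrable_pi.
      by congr (- _); apply: eq_Rintegral => r _; rewrite mulrC.
    have -> : H y - H x = \int[leb]_(r in `[x, y]) f r - (a y - a x) * P y - a x * (P y - P x).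
      by rewrite /H E; ring.
    rewrite E2 E3 opprK -RintegralB//; [|exact: intf|]; last first.
      by apply: integrable_segment; apply: within_mul => //; exact: within_cst.
    rewrite -RintegralD//; last 2 first.
    - rewrite (_ : _ \o _ = ((EFin \o f) \- (EFin \o (fun r => (a' r * P y)%R)))%E)//.
      apply: integrableB => //; [exact: intf|].
      by apply: integrable_segment; apply: within_mul => //; exact: within_cst.
    - by apply: integrable_segmentM => //; exact: within_cst.
    by apply: eq_Rintegral => r _; rewrite /f; ring.
  have cxy : {within `[x, y], continuous a'} by exact: continuous_subspaceW (subI _ _ lx yh) ca'.
  have ib : leb.-integrable `[x, y] (EFin \o (fun r => a' r * (P r - P y) + pi r * (a x - a r))).
    rewrite (_ : _ \o _ = ((EFin \o (fun r => (a' r * (P r - P y))%R)) \+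
       (EFin \o (fun r => (pi r * (a x - a r))%R)))%E)//.
    apply: integrableD => //.
      apply: integrable_segment; apply: within_mul => // r; apply: cvgB; last exact: cvg_cst.
      exact: cP.
    apply: integrable_segmentM => // r; apply: cvgB; first exact: cvg_cst.
    exact: (continuous_subspaceW (subI _ _ lx yh) ca).
  apply: le_trans (le_normr_Rintegral _ ib) _ => //.
  have -> : 2 * M * (y - x) ^+ 2 = \int[leb]_(r in `[x, y]) (2 * M * (y - x)).
    by rewrite Rintegral_segment_cst//; ring.
  apply: le_Rintegral => //.
  - by move/integrable_abse: ib; rewrite /abse/comp.
  - by apply: integrable_segment; exact: within_cst.
  move=> r; rewrite /= in_itv/= => /andP[xr ry].
  have /andP[p0 p1] := primitive_lip ry.
  have rI : l <= r <= h by rewrite (le_trans lx) ?(le_trans ry).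
  have B1 : `|a' r * (P r - P y)| <= M * (y - x).
    rewrite normrM (ger0_norm p0) ler_pM ?HM// (le_trans p1)// lerD2l lerN2//.
  have B2 : `|pi r * (a x - a r)| <= M * (y - x).
    have /andP[q0 q1] := pi01 r.
    rewrite normrM (ger0_norm q0) -[leRHS]mul1r ler_pM//.
    move: xr; rewrite le_eqVlt => /orP[/eqP <-|xr].
      by rewrite subrr normr0 mulr_ge0 ?(ltW M0)// subr_ge0 ltW.
    have dz z : z \in `[x, r] -> is_derive z 1 a (a' z).
      rewrite in_itv/= => /andP[xz zr]; apply: da; rewrite (le_trans lx)//=.
      by rewrite (le_trans zr)// (le_trans ry).
    have [z] := @MVT _ a a' x r xr (fun z zI => dz z (subset_itv_oo_cc zI))
      (derivable_within_continuous (fun z zI => @ex_derive _ _ _ _ _ _ _ (dz z zI))).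
    rewrite in_itv/= => /andP[xz zr]; rewrite distrC => ->.
    have xr0 : 0 <= r - x by rewrite subr_ge0 ltW.
    rewrite normrM (ger0_norm xr0) ler_pM// ?lerD2r// HM//.
    by rewrite (le_trans lx (ltW xz)) (le_trans (ltW zr))// (le_trans ry).
  apply: (le_trans (ler_normD _ _)).
  by apply: (le_trans (lerD B1 B2)); rewrite -mulrA mulr_natl mulr2n.
have := quadratic_increment_cst (ltW lh) HK.
rewrite /H al ah !mul0r !subr0 set_itv1 Rintegral_set1 /f RintegralB//; [|exact: int1|exact: int2].
by move/eqP; rewrite subr_eq0 => /eqP.
Qed.

End primitive.
End rough_by_parts.

(** * Comparison functions and their heat residuals *)

Section heat.
Variable R : realType.
Implicit Types (f g D : R -> R -> R) (z : R * R) (P pi : R -> R).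

Definition cont2 f z := {for z, continuous (fun z : R * R => f z.1 z.2)}.

Lemma cont2D f g z : cont2 f z -> cont2 g z -> cont2 (fun x t => f x t + g x t) z.
Proof. by move=> cf cg; apply: cvgD. Qed.

Lemma cont2B f g z : cont2 f z -> cont2 g z -> cont2 (fun x t => f x t - g x t) z.
Proof. by move=> cf cg; apply: cvgB. Qed.

Lemma cont2M f g z : cont2 f z -> cont2 g z -> cont2 (fun x t => f x t * g x t) z.
Proof. by move=> cf cg; apply: cvgM. Qed.

Lemma cont2_cst (k : R) z : cont2 (fun _ _ => k) z.
Proof. exact: cvg_cst. Qed.

Lemma cont2_comp (h : R -> R) f z : {for f z.1 z.2, continuous h} -> cont2 f z ->
  cont2 (fun x t => h (f x t)) z.
Proof. by move=> ch cf; exact: (@continuous_comp _ _ _ (fun z : R * R => f z.1 z.2) h). Qed.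

Lemma cont2_fst (h : R -> R) z : {for z.1, continuous h} -> cont2 (fun x _ => h x) z.
Proof. by move=> ch; apply: (@cont2_comp h (fun x _ => x) z ch); exact: cvg_fst. Qed.

Lemma cont2_snd (h : R -> R) z : {for z.2, continuous h} -> cont2 (fun _ t => h t) z.
Proof. by move=> ch; apply: (@cont2_comp h (fun _ t => t) z ch); exact: cvg_snd. Qed.

Lemma cont2_x z : cont2 (fun x _ => x) z. Proof. exact: cvg_fst. Qed.

Lemma cont2_t z : cont2 (fun _ t => t) z. Proof. exact: cvg_snd. Qed.

Lemma near_fst (Q : R -> Prop) (a b : R) : (\forall x \near a, Q x) ->
  \forall z \near ((a, b) : R * R), Q z.1.
Proof.
move=> Qa; exists ([set x | Q x], [set: R]); last by case=> x y /= [].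
by split => //; exact: filterT.
Qed.

Lemma near_snd (Q : R -> Prop) (a b : R) : (\forall x \near b, Q x) ->
  \forall z \near ((a, b) : R * R), Q z.2.
Proof.
move=> Qa; exists ([set: R], [set x | Q x]); last by case=> x y /= [].
by split => //; exact: filterT.
Qed.

Lemma near_slicel (Q : R * R -> Prop) z : (\forall z' \near z, Q z') ->
  \forall x \near z.1, Q (x, z.2).
Proof. by case: z => a b Qz; exact: (@continuous_pairl R a b). Qed.

Lemma near_slicer (Q : R * R -> Prop) z : (\forall z' \near z, Q z') ->
  \forall t \near z.2, Q (z.1, t).
Proof. by case: z => a b Qz; exact: (@continuous_pairr R a b). Qed.

(* Encodes g_x = s1 - P s2 and D = g_t - g_xx, where P' = - pi almost everywhere. *)
Definition heat_jet P pi g s1 s2 s1x s2x gt D z :=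
  [/\ [/\ cont2 g z, cont2 gt z & cont2 s1 z], [/\ cont2 s2 z, cont2 s1x z & cont2 s2x z],
      [/\ is_derive z.1 1 (g ^~ z.2) (s1 z.1 z.2 - P z.1 * s2 z.1 z.2),
        is_derive z.1 1 (s1 ^~ z.2) (s1x z.1 z.2), is_derive z.1 1 (s2 ^~ z.2) (s2x z.1 z.2)
        & is_derive z.2 1 (g z.1) (gt z.1 z.2)] &
      D z.1 z.2 = gt z.1 z.2 - (s1x z.1 z.2 - P z.1 * s2x z.1 z.2 + pi z.1 * s2 z.1 z.2)].

(** The jet is hidden because comparison depends on [g] and its residual [D] only; this makes the
    notion closed under sums and multiples. *)
Definition heat_near P pi g D z0 := exists s1 s2 s1x s2x gt : R -> R -> R,
  \forall z \near z0, heat_jet P pi g s1 s2 s1x s2x gt D z.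

Lemma heat_nearD P pi g g' D D' z0 : heat_near P pi g D z0 -> heat_near P pi g' D' z0 ->
  heat_near P pi (fun x t => g x t + g' x t) (fun x t => D x t + D' x t) z0.
Proof.
move=> [s1 [s2 [s1x [s2x [gt H]]]]] [s1' [s2' [s1x' [s2x' [gt' H']]]]].
exists (fun x t => s1 x t + s1' x t), (fun x t => s2 x t + s2' x t),
  (fun x t => s1x x t + s1x' x t), (fun x t => s2x x t + s2x' x t), (fun x t => gt x t + gt' x t).
near=> z.
have [[c1 c2 c3] [c4 c5 c6] [d1 d2 d3 d4] DE] : heat_jet P pi g s1 s2 s1x s2x gt D z by near: z.
have [[c1' c2' c3'] [c4' c5' c6'] [d1' d2' d3' d4'] DE'] :
  heat_jet P pi g' s1' s2' s1x' s2x' gt' D' z by near: z.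
split; [by split; apply: cvgD|by split; apply: cvgD| |by rewrite DE DE'; ring].
split; [by apply: is_derive_eq; ring|exact: is_deriveD..].
Unshelve. all: by end_near. Qed.

Lemma heat_nearZ P pi g D z0 (k : R) : heat_near P pi g D z0 ->
  heat_near P pi (fun x t => k * g x t) (fun x t => k * D x t) z0.
Proof.
move=> [s1 [s2 [s1x [s2x [gt H]]]]].
exists (fun x t => k * s1 x t), (fun x t => k * s2 x t),
  (fun x t => k * s1x x t), (fun x t => k * s2x x t), (fun x t => k * gt x t).
near=> z.
have [[c1 c2 c3] [c4 c5 c6] [d1 d2 d3 d4] DE] : heat_jet P pi g s1 s2 s1x s2x gt D z by near: z.
split; [by split; apply: cvgM => //; exact: cvg_cst|by split; apply: cvgM => //; exact: cvg_cst| |by rewrite DE; ring].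
by split; apply: is_derive_eq; rewrite /GRing.scale/=; ring.
Unshelve. all: by end_near. Qed.

Lemma heat_near_eq P pi g g' D D' z0 : (\forall z \near z0, g z.1 z.2 = g' z.1 z.2) ->
  (\forall z \near z0, D z.1 z.2 = D' z.1 z.2) -> heat_near P pi g D z0 -> heat_near P pi g' D' z0.
Proof.
move=> gg DD [s1 [s2 [s1x [s2x [gt H]]]]]; exists s1, s2, s1x, s2x, gt.
have gg2 : \forall z \near z0, \forall z' \near z, g z'.1 z'.2 = g' z'.1 z'.2 by exact/near_join.
near=> z.
have [[c1 c2 c3] [c4 c5 c6] [d1 d2 d3 d4] DE] : heat_jet P pi g s1 s2 s1x s2x gt D z by near: z.
have Dz : D z.1 z.2 = D' z.1 z.2 by near: z.
have gz : \forall z' \near z, g z'.1 z'.2 = g' z'.1 z'.2 by near: z.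
split; [split => //|by split| |by rewrite -Dz].
  move=> V; rewrite /= -(nbhs_singleton gz) => /c1; apply: filterS2 gz => z' /= gz'.
  by rewrite gz'.
split => //.
  by apply: (@near_eq_is_derive _ _ _ (g ^~ z.2)) => //; exact: near_slicel gz.
by apply: (@near_eq_is_derive _ _ _ (g z.1)) => //; exact: near_slicer gz.
Unshelve. all: by end_near. Qed.

Definition smooth_near g gx gxx gt z0 := \forall z \near z0,
  [/\ cont2 g z, cont2 gt z, cont2 gx z & cont2 gxx z] /\
  [/\ is_derive z.1 (1 : R) (g ^~ z.2) (gx z.1 z.2),
     is_derive z.1 (1 : R) (gx ^~ z.2) (gxx z.1 z.2) & is_derive z.2 (1 : R) (g z.1) (gt z.1 z.2)].

Lemma heat_near_smooth P pi g gx gxx gt z0 :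
  smooth_near g gx gxx gt z0 ->
  heat_near P pi g (fun x t => gt x t - gxx x t) z0.
Proof.
move=> H; exists gx, (fun _ _ => 0), gxx, (fun _ _ => 0), gt; near=> z.
have [[c1 c2 c3 c4] [d1 d2 d3]] : [/\ cont2 g z, cont2 gt z, cont2 gx z & cont2 gxx z] /\
  [/\ is_derive z.1 (1 : R) (g ^~ z.2) (gx z.1 z.2),
     is_derive z.1 (1 : R) (gx ^~ z.2) (gxx z.1 z.2) & is_derive z.2 (1 : R) (g z.1) (gt z.1 z.2)].
  by near: z.
have c0 : cont2 (fun _ _ => 0) z by exact: cvg_cst.
split => //; last by ring.
by split; [rewrite mulr0 subr0|exact: d2|exact: is_derive_cst|exact: d3].
Unshelve. all: by end_near. Qed.

(* The product of a smooth F with exp (A t - E x), where E' = P - q. *)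
Lemma heat_near_expM P pi F Fx Fxx Ft (A A' E q q' : R -> R) z0 : is_primitive P pi ->
  smooth_near F Fx Fxx Ft z0 ->
  continuous P ->
  (\forall x \near z0.1, [/\ is_derive x (1 : R) E (P x - q x), is_derive x (1 : R) q (q' x)
     & {for x, continuous q'}]) ->
  (\forall t \near z0.2, is_derive t (1 : R) A (A' t) /\ {for t, continuous A'}) ->
  heat_near P pi (fun x t => F x t * expR (A t - E x))
   (fun x t => expR (A t - E x) * (Ft x t + A' t * F x t - Fxx x t - q' x * F x t
      + 2 * (P x - q x) * Fx x t - (P x - q x) ^+ 2 * F x t - pi x * F x t)) z0.
Proof.
move=> Ppi H cP HE HA.
exists (fun x t => (Fx x t + q x * F x t) * expR (A t - E x)),
  (fun x t => F x t * expR (A t - E x)),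
  (fun x t => (Fxx x t + (q' x * F x t + q x * Fx x t) + (Fx x t + q x * F x t) * (q x - P x)) * expR (A t - E x)),
  (fun x t => (Fx x t + F x t * (q x - P x)) * expR (A t - E x)),
  (fun x t => (Ft x t + A' t * F x t) * expR (A t - E x)).
have HE' := near_fst z0.2 HE; have HA' := near_snd z0.1 HA.
rewrite -surjective_pairing in HE' HA'.
near=> z.
have [[c1 c2 c3 c4] [d1 d2 d3]] : [/\ cont2 F z, cont2 Ft z, cont2 Fx z & cont2 Fxx z] /\
  [/\ is_derive z.1 (1 : R) (F ^~ z.2) (Fx z.1 z.2),
     is_derive z.1 (1 : R) (Fx ^~ z.2) (Fxx z.1 z.2) & is_derive z.2 (1 : R) (F z.1) (Ft z.1 z.2)].
  by near: z.
have [e1 e2 e3] : [/\ is_derive z.1 (1 : R) E (P z.1 - q z.1), is_derive z.1 (1 : R) q (q' z.1)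
     & {for z.1, continuous q'}] by near: z.
have [a1 a2] : is_derive z.2 (1 : R) A (A' z.2) /\ {for z.2, continuous A'} by near: z.
have cq := cont2_fst (is_derive_continuous e2); have cq' := cont2_fst e3.
have cPz := cont2_fst (cP z.1).
have cA := cont2_snd (is_derive_continuous a1); have cA' := cont2_snd a2.
have cE := cont2_fst (is_derive_continuous e1).
have cX : cont2 (fun x t => expR (A t - E x)) z.
  apply: (@continuous_comp _ _ _ (fun z : R * R => A z.2 - E z.1) (@expR R)); last exact: continuous_expR.
  by apply: cvgB.
have dXx : is_derive z.1 (1 : R) (fun x => expR (A z.2 - E x)) ((q z.1 - P z.1) * expR (A z.2 - E z.1)).
  have dd : is_derive z.1 (1 : R) (fun x => A z.2 - E x) (q z.1 - P z.1).
    by apply: is_derive_eq; ring.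
  by apply: (is_derive_compE (is_derive_expR _) dd); ring.
have dXt : is_derive z.2 (1 : R) (fun t => expR (A t - E z.1)) (A' z.2 * expR (A z.2 - E z.1)).
  have dd : is_derive z.2 (1 : R) (fun t => A t - E z.1) (A' z.2).
    by apply: is_derive_eq; ring.
  by apply: (is_derive_compE (is_derive_expR _) dd); ring.
split.
- by split; [exact: cont2M|apply: cont2M => //; apply: cont2D => //; exact: cont2M|apply: cont2M => //; apply: cont2D => //; exact: cont2M].
- split; [exact: cont2M| |]; apply: cont2M => //.
    apply: cont2D; first by apply: cont2D => //; apply: cont2D; exact: cont2M.
    by apply: cont2M; [apply: cont2D => //; exact: cont2M|exact: cont2B].
  by apply: cont2D => //; apply: cont2M => //; exact: cont2B.
- split.
  + by apply: is_derive_eq; rewrite /GRing.scale/=; ring.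
  + by apply: is_derive_eq; rewrite /GRing.scale/=; ring.
  + by apply: is_derive_eq; rewrite /GRing.scale/=; ring.
  + by apply: is_derive_eq; rewrite /GRing.scale/=; ring.
- by ring.
Unshelve. all: by end_near. Qed.

End heat.

Section touching_points.
Variable R : realType.
Notation leb := (@lebesgue_measure R).
Variables (alpha beta ustar : R) (u p : R -> R -> R).
Hypotheses (alpha_gt0 : 0 < alpha) (beta_gt0 : 0 < beta).
Hypothesis W : weak_solution alpha beta ustar u p.
Implicit Types x y t s l h d e r tau : R.
Local Notation w := (wfun alpha beta u).

Lemma within_rect l h ta tb (f : R -> R -> R) :
  (forall z, rect l h ta tb z -> cont2 f z) ->
  {within rect l h ta tb, continuous (fun z : R * R => f z.1 z.2)}.
Proof. by move=> cf; apply: continuous_in_subspaceT => z /set_mem; exact: cf. Qed.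

Section subsolution.
Variables (sg c l h ta tb : R) (P pi : R -> R) (g s1 s2 s1x s2x gt D : R -> R -> R).
Hypotheses (lh : l < h) (ta0 : 0 < ta) (mpi : measurable_fun setT pi)
  (pi01 : forall y : R, 0 <= pi y <= 1) (Ppi : is_primitive P pi).
Hypothesis jet : forall z, rect l h ta tb z -> heat_jet P pi g s1 s2 s1x s2x gt D z.
Hypothesis Dc : forall z, rect l h ta tb z -> D z.1 z.2 - sg * (pi z.1 * u z.1 z.2) <= - c.

(** The pointwise inequality is integrated against the bump. The part [s1] of [g_x] is handled by
    ordinary integration by parts, the part [P * s2] by [rough_by_parts], which produces the term
    [pi * s2] of [D]. *)
Lemma heat_jet_subsol x d tau : 0 < d -> l <= x - d -> x + d <= h -> ta <= tau <= tb ->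
  subsol_ineq u sg c pi (fun x t => s1 x t - P x * s2 x t) gt l h x d tau.
Proof.
move=> d0 lx xh tI.
have tau0 : 0 < tau by case/andP: tI => + _; exact: lt_le_trans.
have sl f : (forall z, rect l h ta tb z -> cont2 f z) -> {within `[l, h], continuous (f ^~ tau)}.
  by move=> cf; exact: (rect_slice (within_rect cf) tI).
have cgt := sl gt (fun z rz => let: And4 (And3 _ k _) _ _ _ := jet rz in k).
have cs1 := sl s1 (fun z rz => let: And4 (And3 _ _ k) _ _ _ := jet rz in k).
have cs2 := sl s2 (fun z rz => let: And4 _ (And3 k _ _) _ _ := jet rz in k).
have cs1x := sl s1x (fun z rz => let: And4 _ (And3 _ k _) _ _ := jet rz in k).
have cs2x := sl s2x (fun z rz => let: And4 _ (And3 _ _ k) _ _ := jet rz in k).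
have cP : {within `[l, h], continuous P}.
  by apply: continuous_subspaceT; exact: (continuous_primitive mpi pi01 Ppi).
have cu := u_slice W tau0 (l := l) (h := h).
have jt y : l <= y <= h -> heat_jet P pi g s1 s2 s1x s2x gt D (y, tau).
  by move=> yl; apply: jet; apply/rectP.
have cb : {within `[l, h], continuous (fun y => bump d (y - x))}.
  apply: continuous_subspaceT => y; exact: is_derive_continuous (is_derive_bump_shift d x y).
have cdb q : {within `[l, h], continuous q} -> {within `[l, h], continuous (fun y => dbump d (y - x) * q y)}.
  exact: within_continuous_dbumpM.
have cbb q : {within `[l, h], continuous q} -> {within `[l, h], continuous (fun y => bump d (y - x) * q y)}.
  exact: within_continuous_bumpM.
have wD (f k : R -> R) : {within `[l, h], continuous f} -> {within `[l, h], continuous k} ->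
    {within `[l, h], continuous (fun y => f y + k y)}.
  by move=> cf ck y; apply: cvgD; [exact: cf|exact: ck].
have wN (f : R -> R) : {within `[l, h], continuous f} -> {within `[l, h], continuous (fun y => - f y)}.
  by move=> cf y; apply: cvgN; exact: cf.
have out y : d <= `|y - x| -> bump d (y - x) = 0 by apply: bump_out; exact: ltW.
have I1 : \int[leb]_(y in `[l, h]) (dbump d (y - x) * s1 y tau) =
    - (\int[leb]_(y in `[l, h]) (bump d (y - x) * s1x y tau)).
  apply: mollify_by_parts (ltW d0) lh lx xh cs1x _ => y yl.
  by have [_ _ [_ k _ _] _] := jt y yl.
pose a y := bump d (y - x) * s2 y tau.
pose a' y := dbump d (y - x) * s2 y tau + bump d (y - x) * s2x y tau.
have ca' : {within `[l, h], continuous a'} by apply: (wD); [exact: cdb|exact: cbb].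
have I2 : \int[leb]_(y in `[l, h]) (a' y * P y) = \int[leb]_(y in `[l, h]) (pi y * a y).
  apply: (rough_by_parts mpi pi01 Ppi lh ca').
  - move=> y yl; have [_ _ [_ _ k _] _] := jt y yl.
    have k' := is_derive_bump_shift d x y.
    by apply: is_derive_eq; rewrite /GRing.scale/=/a'; ring.
  - by rewrite /a out ?mul0r// distrC (le_trans _ (ler_norm _))// lerBrDr -lerBrDl; move: lx; rewrite lerBrDr -lerBrDl.
  - by rewrite /a out ?mul0r// (le_trans _ (ler_norm _))// lerBrDl.
rewrite /subsol_ineq /avg.
have -> : \int[leb]_(y in `[l, h]) (dbump d (y - x) * (s1 y tau - P y * s2 y tau)) =
    - (\int[leb]_(y in `[l, h]) (bump d (y - x) * s1x y tau)) -
    \int[leb]_(y in `[l, h]) (pi y * a y) +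
    \int[leb]_(y in `[l, h]) (bump d (y - x) * (s2x y tau * P y)).
  rewrite -I1 -I2 -RintegralB//; [|by apply: integrable_segment; exact: cdb|]; last first.
    by apply: integrable_segment; exact: within_mul.
  rewrite -RintegralD//; last 2 first.
  - apply: integrable_segment.
    by apply: (wD); [exact: cdb|apply: (wN); exact: within_mul].
  - by apply: integrable_segment; apply: (cbb); exact: within_mul.
  by apply: eq_Rintegral => y _; rewrite /a'; ring.
pose C y := bump d (y - x) * (gt y tau - s1x y tau + s2x y tau * P y).
pose K y := bump d (y - x) * (- sg * u y tau - s2 y tau).
have cC : {within `[l, h], continuous C}.
  by apply: (cbb); apply: (wD); [apply: (wD) => //; exact: wN|exact: within_mul].
have cK : {within `[l, h], continuous K}.
  apply: (cbb); apply: (wD); last exact: wN.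
  by apply: within_mul => //; exact: within_cst.
have ia : leb.-integrable `[l, h] (EFin \o (fun y => pi y * a y)).
  by apply: integrable_segmentM => //; exact: cbb.
have cub : {within `[l, h], continuous (fun y => u y tau * bump d (y - x))}.
  by apply: within_mul.
have iu : leb.-integrable `[l, h] (EFin \o (fun y => pi y * (u y tau * bump d (y - x)))).
  exact: integrable_segmentM.
have iC := integrable_segment cC.
have iK : leb.-integrable `[l, h] (EFin \o (fun y => pi y * K y)) by exact: integrable_segmentM.
have EC : \int[leb]_(y in `[l, h]) C y = \int[leb]_(y in `[l, h]) (bump d (y - x) * gt y tau)
   - \int[leb]_(y in `[l, h]) (bump d (y - x) * s1x y tau)
   + \int[leb]_(y in `[l, h]) (bump d (y - x) * (s2x y tau * P y)).
  rewrite -RintegralB//; [|by apply: integrable_segment; exact: cbb..].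
  rewrite -RintegralD//; last 2 first.
  - by apply: integrable_segment; apply: (wD); [exact: cbb|apply: (wN); exact: cbb].
  - by apply: integrable_segment; apply: (cbb); exact: within_mul.
  by apply: eq_Rintegral => y _; rewrite /C; ring.
have EK : \int[leb]_(y in `[l, h]) (pi y * K y) =
    - sg * \int[leb]_(y in `[l, h]) (pi y * (u y tau * bump d (y - x)))
    - \int[leb]_(y in `[l, h]) (pi y * a y).
  rewrite -RintegralZl// -RintegralB//; last first.
    rewrite (_ : _ \o _ = (EFin \o (fun y => pi y * (- sg * (u y tau * bump d (y - x)))))).
      by apply: integrable_segmentM => //; apply: within_mul => //; exact: within_cst.
    by apply/funext => y /=; congr (_%:E); ring.
  by apply: eq_Rintegral => y _; rewrite /K /a; ring.
rewrite (_ : _ + _ = \int[leb]_(y in `[l, h]) C y + \int[leb]_(y in `[l, h]) (pi y * K y)); last first.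
  by rewrite EC EK; ring.
rewrite -RintegralD// -avg_cst; apply: le_Rintegral => //.
- rewrite (_ : _ \o _ = ((EFin \o C) \+ (EFin \o (fun y => (pi y * K y)%R)))%E)//.
  exact: integrableD.
- by apply: integrable_segment; apply: (cbb); exact: within_cst.
move=> y; rewrite /= in_itv/= => yl.
have [_ _ _ DE] := jt y yl.
have H : D y tau - sg * (pi y * u y tau) <= - c by apply: (@Dc (y, tau)); apply/rectP.
rewrite (_ : _ + _ = bump d (y - x) * (D y tau - sg * (pi y * u y tau))).
  by apply: ler_wpM2l => //; exact: bump_ge0.
by rewrite /= in DE; rewrite /C /K DE; ring.
Qed.

End subsolution.

Lemma near_rect (Q : R * R -> Prop) (x1 t1 : R) : 0 < t1 -> (\forall z \near ((x1, t1) : R * R), Q z) ->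
  exists r : R, [/\ 0 < r, r < t1 & forall z, rect (x1 - r) (x1 + r) (t1 - r) (t1 + r) z -> Q z].
Proof.
move=> t0 /nbhs_ballP[r /= r0 Hr]; exists (Num.min (r / 2) (t1 / 2)).
have [mr mt] : Num.min (r / 2) (t1 / 2) <= r / 2 /\ Num.min (r / 2) (t1 / 2) <= t1 / 2.
  by rewrite !ge_min !lexx orbT.
have m0 : 0 < Num.min (r / 2) (t1 / 2) by rewrite lt_min !divr_gt0.
split => //; first by lra.
move: (Num.min _ _) mr mt m0 => m mr mt m0 z /rectP[/andP[a1 a2] /andP[a3 a4]].
by apply: Hr; split; rewrite /ball/= /ball_ ltr_norml; apply/andP; split; lra.
Qed.

(** The local maximum principle in the form in which it is applied everywhere: pointwise residual,
    weak maximum, earlier times only. *)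
Lemma touching (sg c x1 t1 : R) (N : set R) (P pi : R -> R) (g D : R -> R -> R) :
  sg = 1 \/ sg = -1 -> 0 < c -> 0 < t1 -> leb.-negligible N -> measurable_fun setT pi ->
  (forall y : R, 0 <= pi y <= 1) -> is_primitive P pi -> heat_near P pi g D (x1, t1) ->
  (\forall z \near ((x1, t1) : R * R), ~ N z.1 ->
     sg * (pi z.1 * u z.1 z.2) <= sg * (p z.1 z.2 * u z.1 z.2)) ->
  (\forall z \near ((x1, t1) : R * R), D z.1 z.2 - sg * (pi z.1 * u z.1 z.2) <= - c) ->
  ~ (\forall z \near ((x1, t1) : R * R), z.2 <= t1 ->
      sg * w z.1 z.2 + g z.1 z.2 <= sg * w x1 t1 + g x1 t1).
Proof.
move=> sgE c0 t0 N0 mpi pi01 Ppi Hg Hp HD Hmax.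
(* Subtracting [th * ((x - x1)^2 + (t1 - t))] makes the maximum strict on the lateral and bottom
   sides. Its heat residual is 3 th = c / 2, so half of the margin survives. *)
pose th := c / 6.
have th0 : 0 < th by rewrite divr_gt0.
pose k x t := - th * ((x - x1) ^+ 2 + (t1 - t)).
have Hk : heat_near P pi k (fun _ _ => th - (- (2 * th))) (x1, t1).
  apply: (@heat_near_smooth _ P pi k (fun x t => - th * (2 * (x - x1))) (fun _ _ => - (2 * th)) (fun _ _ => th)).
  near=> z; split.
    split; [|exact: cont2_cst| |exact: cont2_cst].
      apply: cont2M; first exact: cont2_cst.
      apply: cont2D; last by apply: cont2B; [exact: cont2_cst|exact: cont2_t].
      by apply: (@cont2_fst _ (fun x => (x - x1) ^+ 2)); apply: is_derive_continuous.
    apply: cont2M; first exact: cont2_cst.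
    by apply: (@cont2_fst _ (fun x => 2 * (x - x1))); apply: is_derive_continuous.
  split.
  - by rewrite /k; apply: is_derive_eq; rewrite /GRing.scale/=; ring.
  - by apply: is_derive_eq; rewrite /GRing.scale/=; ring.
  - by rewrite /k; apply: is_derive_eq; rewrite /GRing.scale/=; ring.
have [s1 [s2 [s1x [s2x [gt Hj]]]]] := heat_nearD Hg Hk.
have [r [r0 rt Hr]] := near_rect t0 (filterI (filterI Hj Hp) (filterI HD Hmax)).
pose l := x1 - r; pose h := x1 + r; pose ta := t1 - r; pose tb := t1 + r.
have jet z (rz : rect l h ta tb z) := (Hr z rz).1.1.
have lh : l < h by rewrite /l /h; lra.
have ta0 : 0 < ta by rewrite subr_gt0.
have c20 : 0 < c / 2 by rewrite divr_gt0.
have Dc z : rect l h ta tb z -> D z.1 z.2 + (th - (- (2 * th))) - sg * (pi z.1 * u z.1 z.2) <= - (c / 2).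
  by move=> /Hr[_ []]; rewrite /th; lra.
have cP := continuous_primitive mpi pi01 Ppi.
have jt y tau : l <= y <= h -> ta <= tau <= tb -> rect l h ta tb (y, tau) by move=> *; apply/rectP.
apply: (@no_strict_max _ _ _ _ _ _ alpha_gt0 beta_gt0 W sg (c / 2) x1 t1 r N pi
   (fun x t => g x t + k x t) (fun x t => s1 x t - P x * s2 x t) gt sgE c20 r0 rt _ _ _ _ _ N0 mpi pi01 _ _
   (th * Num.min (r ^+ 2 / 4) (r / 2))).
- by apply: (@within_rect l h ta tb (fun x t => g x t + k x t)) => z /jet[[]].
- apply: (@within_rect l h ta tb (fun x t => s1 x t - P x * s2 x t)) => z /jet[[_ _ c1] [c2 _ _] _ _].
  by apply: cont2B => //; apply: cont2M => //; apply: cont2_fst; exact: cP.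
- by apply: (@within_rect l h ta tb gt) => z /jet[[]].
- by move=> y tau yl tl; have [_ _ [d1 _ _ _] _] := jet _ (jt _ _ yl tl).
- by move=> y tau yl tl; have [_ _ [_ _ _ d1] _] := jet _ (jt _ _ yl tl).
- by move=> y tau yl tl Ny; exact: ((Hr _ (jt _ _ yl tl)).1.2 Ny).
- move=> x d tau d0 lx xh tI.
  exact: (heat_jet_subsol lh ta0 mpi pi01 Ppi jet Dc).
- by rewrite mulr_gt0// lt_min !divr_gt0// exprn_gt0.
move=> y tau yr taur bd.
have yl : l <= y <= h by move: yr; rewrite /l /h ler_norml; lra.
have tl : ta <= tau <= tb by move: taur; rewrite /ta /tb; lra.
have /= Hm := (Hr _ (jt _ _ yl tl)).2.2.
have {}Hm := Hm (proj2 (andP taur)).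
have kE : k x1 t1 = 0 by rewrite /k !subrr expr0n addr0 mulr0.
rewrite kE addr0; apply: le_trans Hm.
rewrite (_ : _ + _ + _ = sg * w y tau + g y tau + (k y tau + th * Num.min (r ^+ 2 / 4) (r / 2))); last by ring.
rewrite gerDl /k mulNr addrC subr_le0 ler_pM2l//.
case: bd => [yE|->].
  rewrite ge_min; apply/orP; left.
  rewrite -(real_normK (num_real (y - x1))) yE; move: taur => /andP[_ tt].
  rewrite (_ : (r / 2) ^+ 2 = r ^+ 2 / 4); last by field.
  by rewrite lerDl subr_ge0.
rewrite ge_min; apply/orP; right; rewrite opprB addrC (addrC t1) subrK lerDl.
exact: sqr_ge0.
Unshelve. all: by end_near. Qed.

End touching_points.

(** * Elementary exclusion of maxima *)

Section maxima.
Variable R : realType.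

Lemma is_derive_gt0_near (f : R -> R) (x a : R) : is_derive x 1 f a -> 0 < a ->
  \forall y \near x, y != x -> 0 < (f y - f x) * (y - x).
Proof.
move=> [df fE] a0.
have : \forall h \near 0^', 0 < h^-1 *: ((f \o shift x) (h *: 1) - f x).
  have := df; rewrite /derivable => /cvg_ex[l Hl].
  have la : l = a by rewrite -fE /derive; exact/esym/cvg_lim.
  by rewrite la in Hl; exact: (cvgr_gt a Hl).
move=> /nbhs_ballP[e /= e0 He]; apply/nbhs_ballP; exists e => //= y yx ynx.
have h0 : y - x != 0 by rewrite subr_eq0.
have /= := He (y - x) _ h0; rewrite /GRing.scale/= mulr1 subrK.
have yx' : ball 0 e (y - x) by rewrite /ball/= sub0r opprB.
move=> /(_ yx') H.
rewrite (_ : _ * _ = (y - x) ^+ 2 * ((y - x)^-1 * (f y - f x))); last by field.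
by rewrite mulr_gt0// exprn_even_gt0.
Qed.

(** Either the left slope is negative or the right slope is positive, and on that side the minorant
    touching at [x] already exceeds [f x]. *)
Lemma no_max_convex_kink (f f1 f2 : R -> R) (x a1 a2 : R) :
  is_derive x 1 f1 a1 -> is_derive x 1 f2 a2 -> a1 < a2 -> f x = f1 x -> f x = f2 x ->
  (\forall y \near x, y <= x -> f1 y <= f y) -> (\forall y \near x, x <= y -> f2 y <= f y) ->
  ~ (\forall y \near x, f y <= f x).
Proof.
move=> d1 d2 a12 fx1 fx2 n1 n2 mx.
have [a10|a10] := ltP a1 0.
  have dN : is_derive x 1 (fun y => - f1 y) (- a1) by apply: is_derive_eq.
  have := is_derive_gt0_near dN; rewrite oppr_gt0 => /(_ a10) HN.
  have [e /= e0 He] := (nbhs_ballP x _).1 (filterI (filterI HN n1) mx).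
  have ye : ball x e (x - e / 2) by rewrite /ball/= opprB addrC subrK gtr0_norm; lra.
  have [[+ h2] h3] := He _ ye.
  have h4 : f1 (x - e / 2) <= f (x - e / 2) by apply: h2; lra.
  have ex : x - e / 2 - x < 0 by lra.
  rewrite -subr_eq0 lt_eqF// => /(_ isT); rewrite nmulr_lgt0// => h5.
  lra.
have [e /= e0 He] := (nbhs_ballP x _).1 (filterI (filterI (is_derive_gt0_near d2 (le_lt_trans a10 a12)) n2) mx).
have ye : ball x e (x + e / 2) by rewrite /ball/= opprD addrA subrr sub0r normrN gtr0_norm; lra.
have [[+ h2] h3] := He _ ye.
have h4 : f2 (x + e / 2) <= f (x + e / 2) by apply: h2; lra.
have ex : 0 < x + e / 2 - x by lra.
rewrite -subr_eq0 gt_eqF// => /(_ isT); rewrite pmulr_lgt0// => h5.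
lra.
Qed.

(* The time slice through a point is only controlled backwards, as for parabolic equations. *)
Lemma compact_no_backward_max (Q : set (R * R)) (v : R * R -> R) : compact Q ->
  {within Q, continuous v} ->
  (forall z, Q z -> 0 < v z -> (\forall z' \near z, z'.2 <= z.2 -> Q z') /\
     ~ (\forall z' \near z, z'.2 <= z.2 -> v z' <= v z)) ->
  forall z, Q z -> v z <= 0.
Proof.
move=> cQ cv H z0 Qz0; have [z /set_mem Qz zmax] := compact_EVT_max (ex_intro _ z0 Qz0) cQ cv.
have zz : v z0 <= v z by exact/zmax/mem_set.
rewrite leNgt; apply/negP => vz0; have [nQ nm] := H z Qz (lt_le_trans vz0 zz).
by apply: nm; apply: filterS nQ => z' Qz' z't; exact/zmax/mem_set/Qz'.
Qed.

End maxima.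

(** * Self-similar functions *)

Section selfsimilar.
Variable R : realType.
Implicit Types (f : R -> R) (z : R * R).

Lemma cont2N (f : R -> R -> R) z : cont2 f z -> cont2 (fun x t => - f x t) z.
Proof. by move=> cf; apply: cvgN. Qed.

Lemma cont2_div_sqrt z : 0 < z.2 -> cont2 (fun x t : R => x / Num.sqrt t) z.
Proof.
move=> z0; apply: cont2M; first exact: cont2_x.
apply: (@cont2_snd _ (fun t => (Num.sqrt t)^-1)); apply: cvgV; last exact: sqrt_continuous.
by rewrite gt_eqF// sqrtr_gt0.
Qed.

Lemma near_div_sqrt (Q : R -> Prop) (x1 t1 : R) : 0 < t1 ->
  (\forall h \near x1 / Num.sqrt t1, Q h) ->
  \forall z \near ((x1, t1) : R * R), Q (z.1 / Num.sqrt z.2).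
Proof. by move=> t0 HQ; exact: (@cont2_div_sqrt (x1, t1) t0 _ HQ). Qed.

Lemma is_derive_div_sqrt_x (x t : R) :
  is_derive x (1 : R) (fun x => x / Num.sqrt t) (Num.sqrt t)^-1.
Proof. by apply: is_derive_eq; rewrite /GRing.scale/=; ring. Qed.

Lemma is_derive_div_sqrt_t (x t : R) : 0 < t ->
  is_derive t (1 : R) (fun t => x / Num.sqrt t) (- (x / Num.sqrt t / (2 * t))).
Proof.
move=> t0; have s0 : 0 < Num.sqrt t by rewrite sqrtr_gt0.
have H := is_derive1_sqrt t0.
have HV : is_derive t (1 : R) (fun t => (Num.sqrt t)^-1)
    (- (Num.sqrt t) ^- 2 *: (2 * Num.sqrt t)^-1) := is_deriveV (lt0r_neq0 s0) H.
apply: is_derive_eq; rewrite /GRing.scale/=.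
move: (Num.sqrt t) s0 (sqr_sqrtr (ltW t0)) => s s0 <-; field.
by rewrite gt_eqF.
Qed.

(* This is t^(-a) for t > 0: note the sign. *)
Definition scale_pow (a t : R) : R := expR (- a * ln t).

Lemma is_derive_scale_pow a (t : R) : 0 < t ->
  is_derive t (1 : R) (scale_pow a) (- a / t * scale_pow a t).
Proof.
move=> t0; have H := is_derive1_ln t0.
have H' : is_derive t (1 : R) (fun t => - a * ln t) (- a / t).
  by apply: is_derive_eq; rewrite /GRing.scale/=; ring.
by apply: (is_derive_compE (is_derive_expR _) H'); rewrite /scale_pow mulrC.
Qed.

Lemma smooth_selfsimilar a f f' f'' (x1 t1 : R) : 0 < t1 ->
  (\forall h \near x1 / Num.sqrt t1, [/\ is_derive h (1 : R) f (f' h),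
     is_derive h (1 : R) f' (f'' h) & {for h, continuous f''}]) ->
  smooth_near (fun x t => scale_pow a t * f (x / Num.sqrt t))
    (fun x t => scale_pow a t * (f' (x / Num.sqrt t) / Num.sqrt t))
    (fun x t => scale_pow a t * (f'' (x / Num.sqrt t) / t))
    (fun x t => - (scale_pow a t / t * (a * f (x / Num.sqrt t) + x / Num.sqrt t / 2 * f' (x / Num.sqrt t))))
    (x1, t1).
Proof.
move=> t0 Hf; have Hz := near_div_sqrt t0 Hf; near=> z.
have z0 : 0 < z.2 by near: z; exact: near_snd_gt.
have s0 : 0 < Num.sqrt z.2 by rewrite sqrtr_gt0.
have [d1 d2 c3] : [/\ is_derive (z.1 / Num.sqrt z.2) (1 : R) f (f' (z.1 / Num.sqrt z.2)),
     is_derive (z.1 / Num.sqrt z.2) (1 : R) f' (f'' (z.1 / Num.sqrt z.2)) &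
     {for (z.1 / Num.sqrt z.2), continuous f''}] by near: z.
have ce := @cont2_div_sqrt z z0.
have cf := @cont2_comp _ f _ z (is_derive_continuous d1) ce.
have cf' := @cont2_comp _ f' _ z (is_derive_continuous d2) ce.
have cf'' := @cont2_comp _ f'' _ z c3 ce.
have cp := @cont2_snd _ (scale_pow a) z (is_derive_continuous (is_derive_scale_pow a z0)).
have ctV : cont2 (fun _ t : R => t^-1) z.
  by apply: (@cont2_snd _ (fun t : R => t^-1)); apply: cvgV; [rewrite gt_eqF|exact: cvg_id].
have csV : cont2 (fun _ t : R => (Num.sqrt t)^-1) z.
  by apply: (@cont2_snd _ (fun t => (Num.sqrt t)^-1)); apply: cvgV; [rewrite gt_eqF|exact: sqrt_continuous].
have dx := is_derive_div_sqrt_x z.1 z.2; have dt := is_derive_div_sqrt_t z.1 z0.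
have dp := is_derive_scale_pow a z0.
split.
  split.
  - exact: cont2M.
  - apply: cont2N; apply: cont2M; first exact: cont2M.
    apply: cont2D; first by apply: cont2M => //; exact: cont2_cst.
    by apply: cont2M => //; apply: cont2M => //; exact: cont2_cst.
  - by apply: cont2M => //; exact: cont2M.
  - by apply: cont2M => //; exact: cont2M.
have dfx : is_derive z.1 (1 : R) (fun x => f (x / Num.sqrt z.2)) (f' (z.1 / Num.sqrt z.2) / Num.sqrt z.2).
  exact: (@is_derive_compE _ f (fun x => x / Num.sqrt z.2) z.1 _ _ _ d1 dx).
have dfxx : is_derive z.1 (1 : R) (fun x => f' (x / Num.sqrt z.2)) (f'' (z.1 / Num.sqrt z.2) / Num.sqrt z.2).
  exact: (@is_derive_compE _ f' (fun x => x / Num.sqrt z.2) z.1 _ _ _ d2 dx).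
have dft : is_derive z.2 (1 : R) (fun t => f (z.1 / Num.sqrt t)) (- (f' (z.1 / Num.sqrt z.2) * (z.1 / Num.sqrt z.2 / (2 * z.2)))).
  by apply: (@is_derive_compE _ f (fun t => z.1 / Num.sqrt t) z.2 _ _ _ d1 dt); rewrite mulrN.
split.
- by apply: is_derive_eq.
- apply: is_derive_eq; rewrite /GRing.scale/=.
  move: (f'' _) (scale_pow _ _) => F e.
  move: (Num.sqrt z.2) s0 (sqr_sqrtr (ltW z0)) => s s0 <-; field; by rewrite gt_eqF.
- apply: is_derive_eq; rewrite /GRing.scale/=; field; by rewrite !gt_eqF.
Unshelve. all: by end_near. Qed.

(** For t^(-a) f(x / sqrt t) the heat operator becomes the ordinary differential operator f'' + (h /
    2) f' + a f, up to the factor - t^(-a-1). *)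
Lemma heat_selfsimilar P pi a f f' f'' (x1 t1 : R) : 0 < t1 ->
  (\forall h \near x1 / Num.sqrt t1, [/\ is_derive h (1 : R) f (f' h),
     is_derive h (1 : R) f' (f'' h) & {for h, continuous f''}]) ->
  heat_near P pi (fun x t => scale_pow a t * f (x / Num.sqrt t))
    (fun x t => - (scale_pow a t / t * (f'' (x / Num.sqrt t) + x / Num.sqrt t / 2 * f' (x / Num.sqrt t)
       + a * f (x / Num.sqrt t)))) (x1, t1).
Proof.
move=> t0 Hf; have := heat_near_smooth P pi (@smooth_selfsimilar a f f' f'' x1 t1 t0 Hf).
apply: heat_near_eq; near=> z => //.
by ring.
Unshelve. all: by end_near. Qed.

End selfsimilar.

(** * First bounds on u *)

Section first_bounds.
Variable R : realType.
Notation leb := (@lebesgue_measure R).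
Variables (alpha beta ustar : R) (u p : R -> R -> R).
Hypotheses (alpha_gt0 : 0 < alpha) (beta_gt0 : 0 < beta).
Hypothesis W : weak_solution alpha beta ustar u p.
Implicit Types x y t s l h d e r T th : R.
Local Notation w := (wfun alpha beta u).

(** The initial condition is encoded in the weak equation, whose test functions may be nonzero at t
    = 0. A cutoff living on [0, T] turns the left side into the average of [w] near time 0, whereas
    the right side is O(T). *)
Lemma avg_w_initial x d : 0 < d -> avg x d (x - d) (x + d) (w ^~ 0) = 0.
Proof.
move=> d0; set l := x - d; set h := x + d.
have lh : l < h by rewrite /l /h; lra.
apply/eqP; apply: contraT => A0.
pose A s := avg x d l h (w ^~ s).
have [sg sgE A0'] : exists2 sg : R, sg = 1 \/ sg = -1 & 0 < sg * A 0.
  have [a0|a0] := ltP 0 (A 0); first by exists 1; [left|rewrite mul1r].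
  by exists (-1); [right|rewrite mulN1r oppr_gt0 lt_neqAle A0].
have cA := @within_avg_w _ _ _ _ _ _ W x d l h 1 (ltW d0) lh.
have m0 : 0 < sg * A 0 / 2 by rewrite divr_gt0.
have [K K0 HK] := @bounded_integrand _ _ _ _ _ _ alpha_gt0 beta_gt0 W x d l h 1.
have [e [e0 e1 He]] : exists e, [/\ 0 < e, e <= 1 & forall s, 0 <= s <= e -> sg * A 0 / 2 <= sg * A s].
  have cA0 : sg * A s @[s --> within `[0, 1] (nbhs (0 : R))] --> sg * A 0.
    apply: cvgM; first exact: cvg_cst.
    move/subspace_continuousP : cA => /(_ 0); apply.
    by rewrite /= in_itv/= lexx ler01.
  have : \forall s \near within `[0, 1] (nbhs (0 : R)), sg * A 0 / 2 < sg * A s.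
    by apply: (cvgr_gt _ cA0); rewrite ltr_pdivrMr// ltr_pMr// ltr1n.
  rewrite near_withinE => /nbhs_ballP[e /= e0 He].
  exists (Num.min (e / 2) 1); split.
  - by rewrite lt_min divr_gt0/=.
  - by rewrite ge_min lexx orbT.
  move=> s; rewrite le_min => /andP[s0 /andP[s1 s2]]; apply/ltW/He; last first.
    by rewrite /= in_itv/= s0.
  by rewrite /ball/= sub0r normrN ger0_norm//; lra.
have [M [M0 ME HM]] : exists M, [/\ 0 < M, M = 2 * K * (h - l) & True].
  by exists (2 * K * (h - l)); split => //; rewrite !mulr_gt0// subr_gt0.
have [T [T0 Te TM]] : exists T, [/\ 0 < T, T <= e & M * T < sg * A 0 / 2].
  exists (Num.min e (sg * A 0 / 2 / M / 2)); split.
  - by rewrite lt_min e0 !divr_gt0.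
  - by rewrite ge_min lexx.
  rewrite -ltr_pdivlMl// (le_lt_trans (y := sg * A 0 / 2 / M / 2))//.
    by rewrite ge_min lexx orbT.
  by rewrite [ltRHS]mulrC ltr_pdivrMr// ltr_pMr ?ltr1n// divr_gt0.
(* Equal to 1 at time 0 and to 0 at [T], so [- b'] is a unit mass on [0, T]. *)
pose b s := 1 - step ((s - 0) / T).
pose b' s := - (dstep ((s - 0) / T) / T).
have db s : is_derive s 1 b (b' s).
  have H := is_derive_step_scale 0 T s.
  by rewrite /b /b'; apply: is_derive_eq; ring.
have cb' : continuous b' by move=> z; apply: cvgN; exact: continuous_dstep_scale.
have step01 (z : R) : 0 <= step z <= 1.
  apply/andP; split.
    by rewrite -(@step_le0 _ (Num.min z 0)) ?ge_min ?lexx ?orbT// le_step// ge_min lexx.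
  by rewrite -(@step_ge1 _ (Num.max z 1)) ?le_max ?lexx ?orbT// le_step// le_max lexx.
have b0 s : 0 <= b s by rewrite subr_ge0; case/andP: (step01 ((s - 0) / T)).
have b1 s : b s <= 1 by rewrite gerBl; case/andP: (step01 ((s - 0) / T)).
have bT : b T = 0 by rewrite /b subr0 divff ?gt_eqF// step_ge1// subrr.
have bz : b 0 = 1 by rewrite /b subr0 mul0r step_le0// subr0.
have H := @weak_tensor R alpha beta ustar u p W x d l h T b b' d0 (lexx l) (lexx h) T0 db cb' bT.
have inB s : 0 <= s <= T -> `|inner alpha beta u p x d b s| <= M.
  move=> /andP[s0 sT]; apply: (@le_trans _ _ (M * b s)); last first.
    by rewrite -[leRHS]mulr1 ler_wpM2l// ltW.
  rewrite ME; apply: (@inner_le _ _ _ _ _ _ W x d l h b d0 lh (lexx l) (lexx h) b0 K s K0 s0).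
  by move=> y yl; apply: HK => //; rewrite s0 (le_trans sT)// (le_trans Te).
have icM (k : R) : leb.-integrable `[0, T] (EFin \o (fun _ => k)).
  by apply: integrable_segment; exact: within_cst.
have I1 : `|\int[leb]_(s in `[0, T]) inner alpha beta u p x d b s| <= M * T.
  have MT (k : R) : \int[leb]_(s in `[0, T]) k = k * T by rewrite Rintegral_segment_cst// subr0.
  rewrite ler_norml -mulNr -!MT; apply/andP; split.
  - apply: (le_Rintegral_negligible _ (negligible_set0 _) (icM M)) => //.
    + by move=> s _ _; rewrite normrN ger0_norm// ltW.
    + by move=> s; rewrite /= in_itv/= => /inB.
    + by move=> s; rewrite /= in_itv/= => /inB + _; rewrite ler_norml => /andP[].
  - apply: (le_Rintegral_negligible _ (negligible_set0 _) (icM M)) => //.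
    + by move=> s; rewrite /= in_itv/= => /inB.
    + by move=> s _ _; rewrite ger0_norm// ltW.
    + by move=> s; rewrite /= in_itv/= => /inB + _; rewrite ler_norml => /andP[].
have cAT : {within `[0, T], continuous A}.
  apply: continuous_subspaceW cA => s; rewrite /= !in_itv/= => /andP[-> sT].
  by rewrite (le_trans sT)// (le_trans Te).
have cb'T := continuous_subspaceT cb' (A := `[0, T]).
have I2 : sg * A 0 / 2 <= - (sg * \int[leb]_(s in `[0, T]) (b' s * A s)).
  have E : \int[leb]_(s in `[0, T]) (- (sg * A 0 / 2) * b' s) = sg * A 0 / 2.
    by rewrite RintegralZ_segment// (Rintegral_ftc T0 cb'T db) bT bz; ring.
  have E2 : - (sg * \int[leb]_(s in `[0, T]) (b' s * A s)) =
      \int[leb]_(s in `[0, T]) (- sg * (b' s * A s)).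
    by rewrite -mulNr RintegralZ_segment//; exact: within_mul.
  rewrite -[leLHS]E E2.
  apply: le_Rintegral_segment.
  - by apply: within_mul => //; exact: within_cst.
  - by apply: within_mul; [exact: within_cst|exact: within_mul].
  move=> s /andP[s0 sT]; rewrite (_ : - sg * _ = - b' s * (sg * A s)); last by ring.
  have bs : 0 <= - b' s by rewrite opprK divr_ge0 ?dstep_ge0// ltW.
  have As : sg * A 0 / 2 <= sg * A s by apply: He; rewrite s0 (le_trans sT).
  have -> : - (sg * A 0 / 2) * b' s = - b' s * (sg * A 0 / 2) by ring.
  exact: ler_wpM2l bs _ _ As.
have := lt_le_trans TM I2; rewrite H -/A.
case: sgE => ->; rewrite ?mul1r ?mulN1r ?opprK => k.
  by have := le_lt_trans I1 k; rewrite ltNge ler_normr lexx orbT.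
by have := le_lt_trans I1 k; rewrite ltNge ler_normr lexx.
Qed.

Lemma w_initial x : w x 0 = 0.
Proof.
apply/eqP; apply: contraT => w0.
have [sg sgE w0'] : exists2 sg : R, sg = 1 \/ sg = -1 & 0 < sg * w x 0.
  have [a0|a0] := ltP 0 (w x 0); first by exists 1; [left|rewrite mul1r].
  by exists (-1); [right|rewrite mulN1r oppr_gt0 lt_neqAle w0].
have := is_derive_continuous (is_derive_w W x (lexx 0)) => cw.
have cw' : sg * w y 0 @[y --> x] --> sg * w x 0 by apply: cvgM; [exact: cvg_cst|exact: cw].
have : \forall y \near x, sg * w x 0 / 2 < sg * w y 0.
  by apply: (cvgr_gt _ cw'); rewrite ltr_pdivrMr// ltr_pMr// ltr1n.
move=> /nbhs_ballP[d /= d0 Hd].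
have d20 : 0 < d / 2 by rewrite divr_gt0.
have dd : x - d / 2 < x + d / 2 by lra.
have cs : {within `[x - d / 2, x + d / 2], continuous (w ^~ 0)} by exact: (w_slice W (lexx 0)).
have : sg * w x 0 / 2 * mass (d / 2) (x - d / 2) (x + d / 2) x <=
    avg x (d / 2) (x - d / 2) (x + d / 2) (fun y => sg * w y 0).
  rewrite -avg_cst; apply: avg_le.
  - exact: within_cst.
  - by apply: within_mul => //; exact: within_cst.
  - by move=> y _ yd; apply/ltW/Hd; rewrite /ball/= distrC; lra.
  - exact: ltW.
by rewrite avgZ// avg_w_initial// mulr0 leNgt mulr_gt0 ?divr_gt0// mass_gt0.
Qed.

End first_bounds.

Section strip_maximum.
Variable R : realType.
Implicit Types (v : R -> R -> R) (x t : R).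

Lemma near_reflect (Q : R * R -> Prop) x t : (\forall z \near ((x, t) : R * R), Q z) ->
  \forall z \near ((- x, t) : R * R), Q (- z.1, z.2).
Proof.
move=> [[A B] [/= Ax Bt] AB]; exists (fun y => A (- y), B); last first.
  by move=> [y s] [/= Ay Bs]; exact: (AB (- y, s)).
split => //=; have c : - y @[y --> - x] --> x by rewrite -[x in _ --> x]opprK; apply: cvgN; exact: cvg_id.
exact: c Ax.
Qed.

(** The bounds for large |x| and for small t confine the positive values to a compact rectangle;
    evenness transfers the local exclusion from x >= 0 to all x. *)
Lemma even_strip_max v (T X r : R) : 0 < X -> 0 < r ->
  (forall x t, 0 < t -> cont2 v (x, t)) ->
  (forall x t, 0 < t -> v (- x) t = v x t) ->
  (forall x t, 0 < t <= T -> X <= `|x| -> v x t <= 0) ->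
  (forall x t, 0 < t <= T -> `|x| <= X -> t <= r -> v x t <= 0) ->
  (forall x t, 0 <= x -> 0 < t -> 0 < v x t ->
     ~ (\forall z \near ((x, t) : R * R), z.2 <= t -> v z.1 z.2 <= v x t)) ->
  forall x t, 0 < t <= T -> v x t <= 0.
Proof.
move=> X0 r0 cv ev vX vr nm x t /andP[t0 tT].
have nm' y s : 0 < s -> 0 < v y s ->
    ~ (\forall z \near ((y, s) : R * R), z.2 <= s -> v z.1 z.2 <= v y s).
  move=> s0 v0; have [y0|y0] := leP 0 y; first exact: nm.
  have := nm (- y) s; rewrite oppr_ge0 (ltW y0) ev// => /(_ isT s0 v0) H H'.
  apply: H; have := near_reflect H'; apply: filterS2 (near_snd_gt (- y) s0) => z /= z0 h zs.
  by have := h zs; rewrite ev.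
have [xX|Xx] := leP X `|x|; first by apply: vX => //; rewrite t0.
have [tr|rt] := leP t r; first by apply: vr => //; [rewrite t0|exact: ltW].
pose Q := rect (- X) X r T.
apply: (@compact_no_backward_max _ Q (fun z => v z.1 z.2) (@compact_rect _ _ _ _ _) _ _ (x, t)).
- apply: continuous_in_subspaceT => -[y s] /set_mem /rectP[/= _ /andP[rs _]].
  by apply: cv; exact: lt_le_trans rs.
- move=> [y s] /= /rectP[/= yX /andP[rs sT]] v0.
  have s0 : 0 < s by exact: lt_le_trans rs.
  have y1 : `|y| < X by rewrite ltNge; apply/negP => H; move: v0; rewrite ltNge vX// s0.
  have rs' : r < s.
    rewrite ltNge; apply/negP => H; move: v0; rewrite ltNge vr// ?s0//.
    exact: ltW.
  split; last exact: nm'.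
  move: y1; rewrite ltr_norml => /andP[y1 y2].
  near=> z => zs; apply/rectP; split.
    apply/andP; split; apply: ltW; near: z; [exact: near_fst_gt|exact: near_fst_lt].
  by rewrite (le_trans zs)// andbT; apply: ltW; near: z; exact: near_snd_gt.
- apply/rectP; split => /=; first by rewrite -ler_norml ltW.
  by rewrite (ltW rt).
Unshelve. all: by end_near. Qed.

End strip_maximum.

Section first_bounds2.
Variable R : realType.
Variables (alpha beta ustar : R) (u p : R -> R -> R).
Hypotheses (alpha_gt0 : 0 < alpha) (beta_gt0 : 0 < beta).
Hypothesis W : weak_solution alpha beta ustar u p.
Implicit Types x y t s l h d e r T th : R.
Local Notation w := (wfun alpha beta u).
Local Notation wx := (d_x w).
Local Notation c0 := (alpha * beta / 2 * expR (alpha ^+ 2 / 4)).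

Lemma psi_even x t : psi alpha beta (- x) t = psi alpha beta x t.
Proof. by rewrite /psi oppr_eq0 /Psi mulNr normrN. Qed.

Lemma w_even x t : 0 <= t -> w (- x) t = w x t.
Proof. by move=> t0; rewrite /wfun psi_even; have [-> _] := weak_even W x t0. Qed.

Lemma psi_in x t : 0 < t -> `|x| <= alpha * Num.sqrt t ->
  psi alpha beta x t = Psi alpha beta alpha.
Proof.
move=> t0 xt; have s0 : 0 < Num.sqrt t by rewrite sqrtr_gt0.
rewrite /psi gt_eqF// !PsiE (ger0_norm (ltW alpha_gt0)) maxxx max_r//.
by rewrite normrM normfV (ger0_norm (ltW s0)) ler_pdivrMr.
Qed.

Lemma psi_out x t : 0 < t -> alpha * Num.sqrt t <= x ->
  psi alpha beta x t = c0 * tail4 (x / Num.sqrt t).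
Proof.
move=> t0 xt; have s0 : 0 < Num.sqrt t by rewrite sqrtr_gt0.
have x0 : 0 < x by apply: lt_le_trans xt; rewrite mulr_gt0.
rewrite /psi gt_eqF// PsiE max_l// ger0_norm ?divr_ge0 ?(ltW x0) ?(ltW s0)//.
by rewrite ler_pdivlMr.
Qed.

(** Constant inside the source and a multiple of the Gaussian tail of x / sqrt t outside; both solve
    the heat equation. *)
Lemma heat_psi P pi x t : 0 <= x -> 0 < t -> x != alpha * Num.sqrt t ->
  heat_near P pi (psi alpha beta) (fun _ _ => 0) (x, t).
Proof.
move=> x0 t0 xa; have s0 : 0 < Num.sqrt t by rewrite sqrtr_gt0.
have [xt|xt|xt] := ltgtP x (alpha * Num.sqrt t); last by rewrite xt eqxx in xa.
- apply: (@heat_near_eq _ P pi (fun _ _ => Psi alpha beta alpha) _ (fun _ _ => 0 - 0)).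
  + have H : \forall h \near x / Num.sqrt t, `|h| < alpha.
      have cn : {for x / Num.sqrt t, continuous (fun h : R => `|h|)} by exact: norm_continuous.
      apply: (cvgr_lt _ cn); rewrite ger0_norm ?divr_ge0 ?(ltW s0)//.
      by rewrite ltr_pdivrMr.
    apply: filterS2 (near_snd_gt x t0) (near_div_sqrt t0 H) => z z0 zx; rewrite psi_in//.
    have s0' : 0 < Num.sqrt z.2 by rewrite sqrtr_gt0.
    by move: zx; rewrite normrM normfV (ger0_norm (ltW s0')) ltr_pdivrMr// => /ltW.
  + by near=> z; rewrite subr0.
  + apply: (@heat_near_smooth _ P pi _ (fun _ _ => 0) (fun _ _ => 0) (fun _ _ => 0)).
    near=> z; split; first by split; exact: cont2_cst.
    by split; exact: is_derive_cst.
- have H := @heat_selfsimilar _ P pi 0 (@tail4 R) (fun h => - gauss4 h) (fun h => h / 2 * gauss4 h) x t t0.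
  have : heat_near P pi (fun x t => c0 * (scale_pow 0 t * tail4 (x / Num.sqrt t)))
     (fun x t => c0 * (- (scale_pow 0 t / t * (x / Num.sqrt t / 2 * gauss4 (x / Num.sqrt t) +
       x / Num.sqrt t / 2 * (- gauss4 (x / Num.sqrt t)) + 0 * tail4 (x / Num.sqrt t))))) (x, t).
    apply: heat_nearZ; apply: H; near=> h; split.
    + exact: is_derive_tail4.
    + have Hg := is_derive_gauss4 h.
      by apply: is_derive_eq; ring.
    + apply: cvgM; last exact: continuous_gauss4.
      by apply: cvgM; [exact: cvg_id|exact: cvg_cst].
  apply: heat_near_eq.
  + have H' : \forall h \near x / Num.sqrt t, alpha < h.
      by apply: lt_nbhsr; rewrite ltr_pdivlMr.
    apply: filterS2 (near_snd_gt x t0) (near_div_sqrt t0 H') => z z0 zx; rewrite psi_out//.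
      by rewrite /scale_pow oppr0 mul0r expR0 mul1r.
    by move: zx; rewrite ltr_pdivlMr ?sqrtr_gt0// => /ltW.
  + by near=> z; ring.
Unshelve. all: by end_near. Qed.

(** A strict supersolution with residual th. The quadratic term dominates the bounded [w] for large
    |x|, the constant dominates it for small times. *)
Definition growth th x t := th * (x ^+ 2 + 3 * t + 1).

Lemma heat_growth P pi th x t : heat_near P pi (growth th) (fun _ _ => 3 * th - 2 * th) (x, t).
Proof.
apply: (@heat_near_smooth _ P pi (growth th) (fun x _ => th * (2 * x)) (fun _ _ => 2 * th) (fun _ _ => 3 * th)).
near=> z; split.
  split; [|exact: cont2_cst| |exact: cont2_cst].
    apply: cont2M; first exact: cont2_cst.
    apply: cont2D; last exact: cont2_cst.
    apply: cont2D; last by apply: cont2M; [exact: cont2_cst|exact: cont2_t].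
    by apply: (@cont2_fst _ (fun x => x ^+ 2)); apply: is_derive_continuous.
  by apply: cont2M; [exact: cont2_cst|apply: cont2M; [exact: cont2_cst|exact: cont2_x]].
by split; rewrite /growth; apply: is_derive_eq; rewrite /GRing.scale/=; ring.
Unshelve. all: by end_near. Qed.

Lemma primitive0 : is_primitive (fun _ : R => 0) (fun _ => 0).
Proof. by move=> x y xy; rewrite subrr Rintegral_cst ?mul0r. Qed.

Lemma primitive1 : is_primitive (fun x : R => - x) (fun _ => 1).
Proof.
move=> x y; rewrite le_eqVlt => /orP[/eqP->|xy]; first by rewrite subrr set_itv1 Rintegral_set1.
by rewrite Rintegral_segment_cst// mul1r opprK addrC.
Qed.

Lemma touching0 sg c x t (g D : R -> R -> R) : sg = 1 \/ sg = -1 -> 0 < c -> 0 < t ->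
  heat_near (fun _ => 0) (fun _ => 0) g D (x, t) ->
  (\forall z \near ((x, t) : R * R), 0 <= sg * (p z.1 z.2 * u z.1 z.2)) ->
  (\forall z \near ((x, t) : R * R), D z.1 z.2 <= - c) ->
  ~ (\forall z \near ((x, t) : R * R), z.2 <= t ->
      sg * w z.1 z.2 + g z.1 z.2 <= sg * w x t + g x t).
Proof.
move=> sgE c0' t0 Hg Hp HD.
apply: (@touching _ _ _ _ _ _ alpha_gt0 beta_gt0 W sg c x t set0 (fun _ => 0) (fun _ => 0) g D) => //.
- exact: negligible_set0.
- by move=> y; rewrite lexx ler01.
- exact: primitive0.
- by apply: filterS Hp => z h _; rewrite mul0r mulr0.
- by apply: filterS HD => z h; rewrite mul0r mulr0 subr0.
Qed.

Lemma touching1 sg c x t (g D : R -> R -> R) : sg = 1 \/ sg = -1 -> 0 < c -> 0 < t ->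
  heat_near (fun x => - x) (fun _ => 1) g D (x, t) ->
  (\forall z \near ((x, t) : R * R), sg * u z.1 z.2 <= sg * (p z.1 z.2 * u z.1 z.2)) ->
  (\forall z \near ((x, t) : R * R), D z.1 z.2 - sg * u z.1 z.2 <= - c) ->
  ~ (\forall z \near ((x, t) : R * R), z.2 <= t ->
      sg * w z.1 z.2 + g z.1 z.2 <= sg * w x t + g x t).
Proof.
move=> sgE c0' t0 Hg Hp HD.
apply: (@touching _ _ _ _ _ _ alpha_gt0 beta_gt0 W sg c x t set0 (fun x => - x) (fun _ => 1) g D) => //.
- exact: negligible_set0.
- by move=> y; rewrite lexx ler01.
- exact: primitive1.
- by apply: filterS Hp => z h _; rewrite mul1r.
- by apply: filterS HD => z h; rewrite mul1r.
Qed.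

Lemma psi_kink_lower x t : 0 < t -> x = alpha * Num.sqrt t ->
  [/\ is_derive x (1 : R) (fun y => c0 * tail4 (y / Num.sqrt t)) (- (c0 * gauss4 alpha / Num.sqrt t)),
   psi alpha beta x t = Psi alpha beta alpha & psi alpha beta x t = c0 * tail4 (x / Num.sqrt t)].
Proof.
move=> t0 xE; have s0 : 0 < Num.sqrt t by rewrite sqrtr_gt0.
split.
- have H : is_derive x (1 : R) (fun y => tail4 (y / Num.sqrt t)) (- (gauss4 alpha / Num.sqrt t)).
    have H := @is_derive_compE _ (@tail4 R) (fun y => y / Num.sqrt t) x _ _ _ (is_derive_tail4 (x / Num.sqrt t))
      (is_derive_div_sqrt_x x t) (erefl _).
    by apply: (is_derive_eq H); rewrite [in LHS]xE mulfK ?gt_eqF// mulNr.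
  by apply: is_derive_eq; rewrite /GRing.scale/=; ring.
- by rewrite psi_in// xE ger0_norm// mulr_ge0// ltW.
- by rewrite psi_out// xE.
Qed.

Lemma strip_bound T th : 0 < T -> 0 < th -> exists X r, [/\ 0 < X, 0 < r,
  (forall x t, 0 < t <= T -> X <= `|x| -> `|w x t| <= th * x ^+ 2) &
  (forall x t, 0 < t <= T -> `|x| <= X -> t <= r -> `|w x t| <= th)].
Proof.
move=> T0 th0; have [[K HK] _ _ _] := weak_regular W T0.
pose K' := Num.max K 0.
have K'0 : 0 <= K' by rewrite le_max lexx orbT.
have KK' x t : 0 <= t <= T -> `|w x t| <= K'.
  by move=> tT; rewrite (le_trans (HK x t tT))// le_max lexx.
pose X := K' / th + 1.
have X1 : 1 <= X by rewrite lerDr divr_ge0// ltW.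
have X0 : 0 < X by exact: lt_le_trans ltr01 X1.
have [r r0 Hr] := compact_unif_continuous (@compact_rect _ _ _ _ _) (@rect_w _ _ _ _ _ _ W (- X) X 0 T (lexx 0)) th0.
exists X, (r / 2); split => //; first by rewrite divr_gt0.
- move=> x t /andP[t0 tT] Xx; apply: (@le_trans _ _ K').
    by apply: KK'; rewrite (ltW t0).
  rewrite -ler_pdivrMl// mulrC (@le_trans _ _ X)//; first by rewrite lerDl.
  rewrite -(real_normK (num_real x)) (le_trans Xx)//.
  by rewrite -[leLHS]mulr1 expr2 ler_wpM2l// (le_trans X1).
- move=> x t /andP[t0 tT] xX tr.
  have /= := Hr (x, t) (x, 0); rewrite subrr normr0 subr0 (w_initial alpha_gt0 beta_gt0 W) subr0.
  move=> H; apply/ltW/H => //.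
  + by apply/rectP; rewrite /= -ler_norml xX (ltW t0).
  + by apply/rectP; rewrite /= -ler_norml xX lexx (ltW T0).
  + by rewrite ger0_norm ?(ltW t0)//; lra.
Qed.

Lemma u_cont x t : 0 < t -> cont2 u (x, t).
Proof. by move=> t0; exact: (continuous_u W t0). Qed.

(** Maximum principle for [- u - growth]: where [u < 0] the absorption pushes [u] upwards. At the
    source -psi has a convex corner, which cannot carry a maximum. The growth term disappears as e
    -> 0. *)
Lemma u_ge0 x t : 0 < t -> 0 <= u x t.
Proof.
move=> t0; rewrite -oppr_le0; apply/ler_addgt0Pr => e e0; rewrite add0r.
pose th := e / (x ^+ 2 + 3 * t + 1).
have q0 : 0 < x ^+ 2 + 3 * t + 1 by rewrite ltr_wpDr// ltr_wpDl ?sqr_ge0// mulr_gt0.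
have th0 : 0 < th by rewrite divr_gt0.
suff : - u x t - growth th x t <= 0 by rewrite /growth /th divfK ?gt_eqF// subr_le0.
have [X [r [X0 r0 H1 H2]]] := strip_bound t0 th0.
have uE y s : - u y s = - w y s - psi alpha beta y s by rewrite /wfun; ring.
have gE y s : 0 < s -> th <= growth th y s /\ th * y ^+ 2 <= growth th y s.
  move=> s0; rewrite /growth; split; last by rewrite ler_pM2l// -addrA lerDl addr_ge0// mulr_ge0// ltW.
  by rewrite -[leLHS]mulr1 ler_pM2l// lerDr addr_ge0 ?sqr_ge0// mulr_ge0// ltW.
apply: (@even_strip_max _ (fun x t => - u x t - growth th x t) t X r X0 r0) => //; last by rewrite t0 lexx.
- move=> y s s0; apply: cont2B; first by apply: cont2N; exact: u_cont.
  apply: cont2M; first exact: cont2_cst.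
  apply: cont2D; last exact: cont2_cst.
  apply: cont2D; last by apply: cont2M; [exact: cont2_cst|exact: cont2_t].
  by apply: (@cont2_fst _ (fun x => x ^+ 2)); apply: is_derive_continuous.
- by move=> y s s0; rewrite /growth sqrrN; have [-> _] := weak_even W y (ltW s0).
- move=> y s sI Xy; case/andP: (sI) => s0 _; rewrite uE.
  have := H1 _ _ sI Xy; have [_ g] := gE y s s0; have := psi_ge0 alpha_gt0 beta_gt0 y s.
  by rewrite ler_norml => a /andP[b _]; lra.
- move=> y s sI yX sr; case/andP: (sI) => s0 _; rewrite uE.
  have := H2 _ _ sI yX sr; have [g _] := gE y s s0; have := psi_ge0 alpha_gt0 beta_gt0 y s.
  by rewrite ler_norml => a /andP[b _]; lra.
move=> y s y0 s0 v0 mx.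
(* On the source line psi is not smooth, and the exclusion comes from the jump of its slope instead
   of the equation. *)
have [yE|yE] := eqVneq y (alpha * Num.sqrt s).
  have sq0 : 0 < Num.sqrt s by rewrite sqrtr_gt0.
  have [d2 e1 e2] := psi_kink_lower s0 yE.
  have dw := is_derive_w W y (ltW s0).
  have dg : is_derive y (1 : R) (growth th ^~ s) (th * (2 * y)).
    by rewrite /growth; apply: is_derive_eq; rewrite /GRing.scale/=; ring.
  apply: (@no_max_convex_kink _ (fun y => - u y s - growth th y s)
    (fun y => - w y s - Psi alpha beta alpha - growth th y s)
    (fun y => - w y s - c0 * tail4 (y / Num.sqrt s) - growth th y s) y
    (- wx y s - th * (2 * y)) (- wx y s + c0 * gauss4 alpha / Num.sqrt s - th * (2 * y))).
  - by apply: is_derive_eq; ring.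
  - by apply: is_derive_eq; ring.
  - by rewrite ltrD2r ltrDl divr_gt0// mulr_gt0 ?gauss4_gt0// !mulr_gt0// expR_gt0.
  - by rewrite uE e1.
  - by rewrite uE e2.
  - by near=> y' => _; rewrite uE lerD2r lerD2l lerN2; exact: psi_le.
  - near=> y' => yy; rewrite uE psi_out// -yE//.
  - have := near_slicel mx => /=; apply: filterS => y' H; exact: H.
have [e1 e2] : [/\ 0 < - u y s & True].
  by split => //; move: v0; have [g _] := gE y s s0; rewrite subr_gt0; apply: lt_trans; exact: lt_le_trans g.
apply: (@touching0 (-1) th y s (fun x t => (-1) * psi alpha beta x t + (-1) * growth th x t)
   (fun x t => (-1) * 0 + (-1) * (3 * th - 2 * th))) => //.
- by right.
- by apply: heat_nearD; apply: heat_nearZ; [exact: heat_psi|exact: heat_growth].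
- have : \forall z \near ((y, s) : R * R), 0 < - u z.1 z.2.
    exact: (cvgr_gt _ (cont2N (@u_cont y s s0))).
  apply: filterS2 (near_snd_gt y s0) => z z0 uz.
  have /andP[p0 _] := p01 W z.1 (ltW z0).
  by rewrite mulN1r -mulrN mulr_ge0// ltW.
- by near=> z; lra.
- have vE a b : -1 * w a b + (-1 * psi alpha beta a b + -1 * growth th a b) = - u a b - growth th a b.
    by rewrite uE; ring.
  by apply: filterS mx => z H zs; rewrite [leLHS](vE z.1 z.2) (vE y s); exact: H.
Unshelve. all: by end_near. Qed.

(** By [u_ge0] the absorption is nonnegative, so [w] is a subsolution of the heat equation; being
    differentiable in x, it has no corner to treat. *)
Lemma u_le_psi x t : 0 < t -> u x t <= psi alpha beta x t.
Proof.
move=> t0; rewrite -subr_le0 -/(w x t); apply/ler_addgt0Pr => e e0; rewrite add0r.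
pose th := e / (x ^+ 2 + 3 * t + 1).
have q0 : 0 < x ^+ 2 + 3 * t + 1 by rewrite ltr_wpDr// ltr_wpDl ?sqr_ge0// mulr_gt0.
have th0 : 0 < th by rewrite divr_gt0.
suff : w x t - growth th x t <= 0 by rewrite /growth /th divfK ?gt_eqF// subr_le0.
have [X [r [X0 r0 H1 H2]]] := strip_bound t0 th0.
have gE y s : 0 < s -> th <= growth th y s /\ th * y ^+ 2 <= growth th y s.
  move=> s0; rewrite /growth; split; last by rewrite ler_pM2l// -addrA lerDl addr_ge0// mulr_ge0// ltW.
  by rewrite -[leLHS]mulr1 ler_pM2l// lerDr addr_ge0 ?sqr_ge0// mulr_ge0// ltW.
apply: (@even_strip_max _ (fun x t => w x t - growth th x t) t X r X0 r0) => //; last by rewrite t0 lexx.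
- move=> y s s0; apply: cont2B; first exact: (continuous_w W s0).
  apply: cont2M; first exact: cont2_cst.
  apply: cont2D; last exact: cont2_cst.
  apply: cont2D; last by apply: cont2M; [exact: cont2_cst|exact: cont2_t].
  by apply: (@cont2_fst _ (fun x => x ^+ 2)); apply: is_derive_continuous.
- by move=> y s s0; rewrite /growth sqrrN w_even// ltW.
- move=> y s sI Xy; case/andP: (sI) => s0 _.
  have := H1 _ _ sI Xy; have [_ g] := gE y s s0.
  by rewrite ler_norml => /andP[_ b]; lra.
- move=> y s sI yX sr; case/andP: (sI) => s0 _.
  have := H2 _ _ sI yX sr; have [g _] := gE y s s0.
  by rewrite ler_norml => /andP[_ b]; lra.
move=> y s y0 s0 v0 mx.
apply: (@touching0 1 th y s (fun x t => (-1) * growth th x t) (fun x t => (-1) * (3 * th - 2 * th))) => //.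
- by left.
- by apply: heat_nearZ; exact: heat_growth.
- apply: filterS (near_snd_gt y s0) => z z0.
  have /andP[p0 _] := p01 W z.1 (ltW z0).
  by rewrite mul1r mulr_ge0// u_ge0.
- by near=> z; lra.
- have vE a b : 1 * w a b + -1 * growth th a b = w a b - growth th a b by ring.
  by apply: filterS mx => z H zs; rewrite [leLHS](vE z.1 z.2) (vE y s); exact: H.
Unshelve. all: by end_near. Qed.

End first_bounds2.

(** * Where precipitation is absent and where it is complete *)

Section crude_decay.
Variable R : realType.
Variables (alpha beta ustar : R) (u p : R -> R -> R).
Hypotheses (alpha_gt0 : 0 < alpha) (beta_gt0 : 0 < beta) (ustar_gt0 : 0 < ustar).
Hypothesis W : weak_solution alpha beta ustar u p.
Implicit Types x y t s l d e r T th L : R.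
Local Notation w := (wfun alpha beta u).
Local Notation c0 := (alpha * beta / 2 * expR (alpha ^+ 2 / 4)).

Lemma near_half (h : R -> R -> R) x t : cont2 h (x, t) -> 0 < h x t ->
  \forall z \near ((x, t) : R * R), h x t / 2 < h z.1 z.2.
Proof.
by move=> ch h0; apply: (cvgr_gt _ ch); rewrite /= ltr_pdivrMr// ltr_pMr// ltr1n.
Qed.

Lemma touching0h sg x t (g D h : R -> R -> R) : sg = 1 \/ sg = -1 -> 0 < t ->
  heat_near (fun _ => 0) (fun _ => 0) g D (x, t) ->
  (\forall z \near ((x, t) : R * R), 0 <= sg * (p z.1 z.2 * u z.1 z.2)) ->
  cont2 h (x, t) -> 0 < h x t -> (\forall z \near ((x, t) : R * R), D z.1 z.2 <= - h z.1 z.2) ->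
  ~ (\forall z \near ((x, t) : R * R), z.2 <= t ->
      sg * w z.1 z.2 + g z.1 z.2 <= sg * w x t + g x t).
Proof.
move=> sgE t0 Hg Hp ch h0 HD; have hh : 0 < h x t / 2 by rewrite divr_gt0.
apply: (touching0 alpha_gt0 beta_gt0 W sgE hh t0 Hg Hp).
by apply: filterS2 HD (near_half ch h0) => z D1 h1; rewrite (le_trans D1)// lerN2 ltW.
Qed.

Lemma touching1h sg x t (g D h : R -> R -> R) : sg = 1 \/ sg = -1 -> 0 < t ->
  heat_near (fun x => - x) (fun _ => 1) g D (x, t) ->
  (\forall z \near ((x, t) : R * R), sg * u z.1 z.2 <= sg * (p z.1 z.2 * u z.1 z.2)) ->
  cont2 h (x, t) -> 0 < h x t ->
  (\forall z \near ((x, t) : R * R), D z.1 z.2 - sg * u z.1 z.2 <= - h z.1 z.2) ->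
  ~ (\forall z \near ((x, t) : R * R), z.2 <= t ->
      sg * w z.1 z.2 + g z.1 z.2 <= sg * w x t + g x t).
Proof.
move=> sgE t0 Hg Hp ch h0 HD; have hh : 0 < h x t / 2 by rewrite divr_gt0.
apply: (touching1 alpha_gt0 beta_gt0 W sgE hh t0 Hg Hp).
by apply: filterS2 HD (near_half ch h0) => z D1 h1; rewrite (le_trans D1)// lerN2 ltW.
Qed.

Lemma heat_near_x P pi (a a' a'' : R -> R) x t :
  (\forall y \near x, [/\ is_derive y (1 : R) a (a' y), is_derive y (1 : R) a' (a'' y) &
     {for y, continuous a''}]) ->
  heat_near P pi (fun x _ => a x) (fun x _ => 0 - a'' x) (x, t).
Proof.
move=> H; apply: (@heat_near_smooth _ P pi _ (fun x _ => a' x) (fun x _ => a'' x) (fun _ _ => 0)).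
apply: filterS (near_fst t H) => z [d1 d2 c3]; split; last by split; [exact: d1|exact: d2|exact: is_derive_cst].
by split; [exact: cont2_fst (is_derive_continuous d1)|exact: cont2_cst|
  exact: cont2_fst (is_derive_continuous d2)|exact: cont2_fst].
Qed.

Lemma heat_near_pow P pi (a a' a'' : R -> R) sig x t : 0 < t ->
  (\forall y \near x, [/\ is_derive y (1 : R) a (a' y), is_derive y (1 : R) a' (a'' y) &
     {for y, continuous a''}]) ->
  heat_near P pi (fun x t => a x * scale_pow sig t)
    (fun x t => a x * (- sig / t * scale_pow sig t) - a'' x * scale_pow sig t) (x, t).
Proof.
move=> t0 H; apply: (@heat_near_smooth _ P pi _ (fun x t => a' x * scale_pow sig t)
  (fun x t => a'' x * scale_pow sig t) (fun x t => a x * (- sig / t * scale_pow sig t))).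
apply: filterS2 (near_fst t H) (near_snd_gt x t0) => z [d1 d2 c3] z0.
have dp := is_derive_scale_pow sig z0.
have cp := cont2_snd (is_derive_continuous dp).
have ca := cont2_fst (is_derive_continuous d1).
split; last by split; apply: is_derive_eq; rewrite /GRing.scale/=; ring.
split.
- exact: cont2M.
- apply: cont2M => //; apply: cont2M => //; apply: cont2M; first exact: cont2_cst.
  by apply: (@cont2_snd _ (fun t : R => t^-1)); apply: cvgV; [rewrite gt_eqF|exact: cvg_id].
- by apply: cont2M => //; exact: cont2_fst (is_derive_continuous d2).
- by apply: cont2M => //; exact: cont2_fst.
Qed.

Lemma running_sup_ge x t s : 0 <= s <= t -> ((u x s)%:E <= running_sup u x t)%E.
Proof. by move=> st; apply: ereal_sup_ubound; exists s. Qed.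

(* Comparison on [y, y + D] with ustar (1 - (x - y)^2 / (2 D^2)). *)
Lemma no_precipitation y x t : 0 < y -> (forall s, 0 < s -> u y s <= ustar) -> 0 < t ->
  alpha * Num.sqrt t < y -> y < x -> p x t = 0.
Proof.
move=> y0 uy t0 ty yx.
have st0 : 0 < Num.sqrt t by rewrite sqrtr_gt0.
have c00 : 0 < c0 by rewrite !mulr_gt0// expR_gt0.
have eu : 0 < ustar / 2 / c0 by rewrite !divr_gt0.
(* Beyond [A * sqrt s] the bound psi alone keeps [u] below ustar / 2, which is the least value of
   the comparison function on the interval. *)
have [A [A0 HA]] : exists A, 0 < A /\ forall a, A <= a -> c0 * tail4 a <= ustar / 2.
  have : \forall a \near +oo, tail4 a < ustar / 2 / c0.
    by apply: (cvgr_lt _ (@cvg_tail4 R)).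
  move=> /= [A [Ar HA]]; exists (Num.max A 0 + 1); split.
    by rewrite ltr_pwDr// le_max lexx orbT.
  move=> a aA; rewrite -ler_pdivlMl// mulrC ltW//; apply: HA.
  by rewrite (lt_le_trans _ aA)// ltr_pwDr// le_max lexx.
have psiA z s : 0 < s -> alpha * Num.sqrt s <= z -> A * Num.sqrt s <= z ->
    psi alpha beta z s <= ustar / 2.
  by move=> s0 zs zA; rewrite psi_out//; apply: HA; rewrite ler_pdivlMr// sqrtr_gt0.
have ss s : 0 < s -> s <= t -> alpha * Num.sqrt s < y.
  move=> s0 s1; apply: le_lt_trans ty; rewrite ler_pM2l// ler_wsqrtr//.
(* The right end [y + D] lies beyond both [x] and [A * sqrt t], so psi controls it up to time
   [t]. *)
pose D := A * Num.sqrt t + (x - y).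
have D0 : 0 < D by rewrite addr_gt0 ?mulr_gt0// subr_gt0.
have xD : x < y + D by rewrite (_ : y + D = x + A * Num.sqrt t) ?ltrDl ?mulr_gt0// /D; ring.
(* Up to time [s0] the whole interval lies beyond [A * sqrt s], which replaces an initial
   condition. *)
pose s0 := Num.min t ((y / (A + 1)) ^+ 2).
have s00 : 0 < s0 by rewrite lt_min t0 exprn_gt0// divr_gt0// addr_gt0.
have s0A s : 0 < s -> s <= s0 -> A * Num.sqrt s <= y.
  move=> sp; rewrite le_min => /andP[_ /ler_wsqrtr]; rewrite sqrtr_sqr ger0_norm; last first.
    by rewrite divr_ge0 ?addr_ge0// ltW.
  move=> sA; apply: (@le_trans _ _ (A * (y / (A + 1)))); first by rewrite ler_pM2l.
  by rewrite mulrCA ler_piMr ?(ltW y0)// ler_pdivrMr ?addr_gt0// mul1r lerDl.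
(* Strictly concave, hence a strict supersolution of the heat equation; it equals ustar at [y] only
   and is still ustar / 2 at [y + D]. *)
pose b z := ustar * (1 - (z - y) ^+ 2 / (2 * D ^+ 2)).
have D20 : 0 < 2 * D ^+ 2 by rewrite mulr_gt0// exprn_gt0.
have Dn : D != 0 by rewrite gt_eqF.
have db z : is_derive z (1 : R) b (- (ustar * (z - y) / D ^+ 2)).
  by rewrite /b; apply: is_derive_eq; rewrite /GRing.scale/=; field.
have bhalf z : y <= z <= y + D -> ustar / 2 <= b z.
  move=> /andP[yz zD]; rewrite /b ler_pM2l// lerBrDl -lerBrDr (_ : 1 - 2^-1 = 2^-1); last by field.
  by rewrite ler_pdivrMr// mulKf ?gt_eqF// ler_pXn2r ?nnegrE ?subr_ge0 ?(ltW D0)// lerBlDr addrC.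
have comp z s : y <= z <= y + D -> 0 < s <= t -> u z s <= b z.
  move=> zI /andP[sp st]; have [ss0|s0s] := leP s s0.
    apply: (le_trans (u_le_psi alpha_gt0 beta_gt0 W z sp)).
    apply: (le_trans _ (bhalf z zI)); case/andP: zI => yz _; apply: psiA => //.
      by apply: le_trans yz; exact/ltW/ss.
    by apply: le_trans yz; exact: s0A.
  rewrite -subr_le0.
  apply: (@compact_no_backward_max _ (rect y (y + D) s0 t) (fun z => u z.1 z.2 - b z.1)
     (@compact_rect _ _ _ _ _) _ _ (z, s)); last by apply/rectP; rewrite /= zI (ltW s0s).
    apply: continuous_in_subspaceT => -[z' s'] /set_mem/rectP[/= _ /andP[s1 _]].
    have sp' : 0 < s' by exact: lt_le_trans s1.
    apply: (@cont2B _ u (fun x _ => b x) (z', s')); first exact: (u_cont W).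
    by apply: (@cont2_fst _ b); exact: is_derive_continuous (db z').
  move=> [z' s'] /rectP[/= z'I /andP[s1 s2]] v0.
  have sp' : 0 < s' by exact: lt_le_trans s1.
  have uz : b z' < u z' s' by rewrite -subr_gt0.
  have s0s' : s0 < s'.
    rewrite ltNge; apply/negP => s's0; move: uz; rewrite ltNge => /negP; apply.
    apply: (le_trans (u_le_psi alpha_gt0 beta_gt0 W z' sp')).
    apply: (le_trans _ (bhalf z' z'I)); case/andP: (z'I) => yz _; apply: psiA => //.
      by apply: le_trans yz; exact/ltW/ss.
    by apply: le_trans yz; exact: s0A.
  have yz : y < z'.
    case/andP: (z'I) => + _; rewrite le_eqVlt => /orP[/eqP yE|//]; move: uz.
    by rewrite -yE /b subrr expr0n mul0r subr0 mulr1 ltNge uy.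
  have zD : z' < y + D.
    case/andP: (z'I) => _; rewrite le_eqVlt => /orP[/eqP yE|//]; move: uz.
    rewrite ltNge => /negP[]; apply: (le_trans (u_le_psi alpha_gt0 beta_gt0 W z' sp')).
    apply: (le_trans _ (bhalf z' z'I)); apply: psiA => //.
      by apply/ltW/(lt_trans _ yz)/ss.
    rewrite yE (_ : y + D = A * Num.sqrt t + x); last by rewrite /D; ring.
    by rewrite -[leLHS]addr0 lerD// ?(ltW (lt_trans y0 yx))// ler_pM2l// ler_wsqrtr.
  split.
    near=> q => qs; apply/rectP; split.
      by apply/andP; split; apply: ltW; near: q; [exact: near_fst_gt|exact: near_fst_lt].
    by rewrite (le_trans qs)// andbT; apply: ltW; near: q; exact: near_snd_gt.
  move=> mx; have sz : alpha * Num.sqrt s' < z' by exact: lt_trans (ss s' sp' s2) yz.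
  have zp : 0 < z' by exact: lt_trans yz.
  apply: (@touching0h 1 z' s' (fun x t => psi alpha beta x t + (-1) * b x)
     (fun x t => 0 + (-1) * (0 - (- (ustar / D ^+ 2)))) (fun _ _ => ustar / D ^+ 2)) => //.
  - by left.
  - apply: heat_nearD; first by apply: heat_psi => //; [exact: ltW|rewrite gt_eqF].
    apply: heat_nearZ; apply: (@heat_near_x _ _ b (fun z => - (ustar * (z - y) / D ^+ 2)) (fun _ => - (ustar / D ^+ 2))).
    near=> q; split; [exact: db| |exact: cvg_cst].
    by apply: is_derive_eq; rewrite /GRing.scale/=; field.
  - apply: filterS (near_snd_gt z' sp') => q q0.
    by have /andP[p0 _] := p01 W q.1 (ltW q0); rewrite mul1r mulr_ge0// (u_ge0 alpha_gt0 beta_gt0 W).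
  - exact: cont2_cst.
  - by rewrite divr_gt0// exprn_gt0.
  - by near=> q; rewrite add0r sub0r opprK mulN1r.
  - have vE a c : 1 * w a c + (psi alpha beta a c + -1 * b a) = u a c - b a by rewrite /wfun; ring.
    by apply: filterS mx => q H qs; rewrite [leLHS](vE q.1 q.2) (vE z' s'); exact: H.
(* The strict inequality must hold for the supremum, so a bound independent of time is used: [b x],
   or 0 for the initial value. *)
have [lt_sup _ _] := weak_precipitation W x (ltW t0); apply: lt_sup.
have bx : b x < ustar.
  by rewrite /b gtr_pMr// ltrBlDr ltrDl divr_gt0// exprn_gt0// subr_gt0.
apply: (@le_lt_trans _ _ (Num.max (b x) 0)%:E); last first.
  by rewrite lte_fin gt_max bx.
apply: ge_ereal_sup => _ [s /= + <-]; rewrite in_itv/= => /andP[+ st].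
rewrite lee_fin le_max le_eqVlt => /orP[/eqP <-|s1].
  have -> : u x 0 = w x 0 + psi alpha beta x 0 by rewrite /wfun subrK.
  rewrite (w_initial alpha_gt0 beta_gt0 W) add0r /psi eqxx gt_eqF ?lexx ?orbT//.
  exact: lt_trans yx.
by rewrite comp// ?s1// (ltW yx) (ltW xD).
Unshelve. all: by end_near. Qed.

(** At a small time [u] is uniformly close to Psi(alpha) > u* on |x| <= alpha sqrt t0, since [w] is
    continuous and starts at 0; the running supremum then keeps p = 1 for ever. *)
Lemma precipitation_core : ustar < Psi alpha beta alpha ->
  exists x0 t0, [/\ 0 < x0, x0 <= 1, 0 < t0 & forall x t, `|x| <= x0 -> t0 <= t -> p x t = 1].
Proof.
move=> uP; have e0 : 0 < Psi alpha beta alpha - ustar by rewrite subr_gt0.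
have [r r0 Hr] := compact_unif_continuous (@compact_rect _ _ _ _ _)
  (@rect_w _ _ _ _ _ _ W (- 1) 1 0 1 (lexx 0)) e0.
pose t0 := Num.min (Num.min (r / 2) 1) (alpha ^- 2).
have t00 : 0 < t0 by rewrite !lt_min ltr01 divr_gt0// invr_gt0 exprn_gt0.
have t0r : t0 < r by rewrite !gt_min ltr_pdivrMr// ltr_pMr// ltr1n.
have t01 : t0 <= 1 by rewrite !ge_min lexx orbT.
have s0 : 0 < Num.sqrt t0 by rewrite sqrtr_gt0.
have x01 : alpha * Num.sqrt t0 <= 1.
  rewrite -ler_pdivlMl// mulr1 -[leRHS]ger0_norm ?invr_ge0 ?(ltW alpha_gt0)// -sqrtr_sqr.
  by rewrite ler_wsqrtr// exprVn /t0 ge_min lexx orbT.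
exists (alpha * Num.sqrt t0), t0; split => //; first by rewrite mulr_gt0.
move=> x t xx tt; have [_ _ gt_sup] := weak_precipitation W x (ltW (lt_le_trans t00 tt)).
apply: gt_sup; apply: (@lt_le_trans _ _ (u x t0)%:E); last first.
  by apply: running_sup_ge; rewrite (ltW t00).
have x1 : `|x| <= 1 by exact: le_trans xx x01.
have /= := Hr (x, t0) (x, 0); rewrite subrr normr0 subr0 (w_initial alpha_gt0 beta_gt0 W) subr0.
have x1' : - 1 <= x <= 1 by rewrite -ler_norml.
move=> H; have {}H : `|w x t0| < Psi alpha beta alpha - ustar.
  apply: H => //.
  + by apply/rectP; rewrite /= x1' (ltW t00).
  + by apply/rectP; rewrite /= x1' lexx ler01.
  + by rewrite ger0_norm// ltW.
rewrite lte_fin; move: H; rewrite /wfun psi_in// ltr_norml => /andP[+ _]; lra.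
Qed.

End crude_decay.

(** * Decay near the origin *)

Section scale_pow_facts.
Variable R : realType.
Implicit Types a x t : R.

Lemma scale_pow_gt0 a t : 0 < scale_pow a t. Proof. exact: expR_gt0. Qed.

Lemma le_scale_pow a x t : 0 <= a -> 0 < x -> x <= t -> scale_pow a t <= scale_pow a x.
Proof.
move=> a0 x0 xt; rewrite ler_expR !mulNr lerN2 ler_wpM2l// ler_ln// posrE//.
exact: lt_le_trans xt.
Qed.

Lemma scale_powM a x t : 0 < x -> 0 < t -> scale_pow a (x * t) = scale_pow a x * scale_pow a t.
Proof. by move=> x0 t0; rewrite /scale_pow lnM ?posrE// mulrDr expRD. Qed.

Lemma scale_pow_sqrt a t : 0 < t -> scale_pow a (Num.sqrt t) = scale_pow (a / 2) t.
Proof.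
by move=> t0; rewrite /scale_pow -powR12_sqrt ?ltW// ln_powR mulrA mulNr.
Qed.

Lemma scale_powN a t : scale_pow (- a) t * scale_pow a t = 1.
Proof. by rewrite /scale_pow opprK -expRD -mulrDl subrr mul0r expR0. Qed.

Lemma scale_pow_le1r a x : 0 <= a <= 1 -> 0 <= x -> scale_pow (- a) (1 + x) <= 1 + x.
Proof.
move=> /andP[a0 a1] x0; have x1 : 0 < 1 + x by rewrite ltr_wpDr.
rewrite -[leRHS](lnK x1) ler_expR opprK ler_piMl//.
by rewrite ln_ge0// lerDl.
Qed.

Lemma scale_pow_ge1 a x : 0 <= a -> 1 <= x -> 1 <= scale_pow (- a) x.
Proof. by move=> a0 x1; rewrite -expR0 ler_expR opprK mulr_ge0// ln_ge0. Qed.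

Lemma cont2_scale_pow a z : 0 < z.2 -> cont2 (fun _ t => scale_pow a t) z.
Proof. by move=> z0; exact: cont2_snd (is_derive_continuous (is_derive_scale_pow a z0)). Qed.

End scale_pow_facts.

Section crude_decay2.
Variable R : realType.
Variables (alpha beta ustar : R) (u p : R -> R -> R).
Hypotheses (alpha_gt0 : 0 < alpha) (beta_gt0 : 0 < beta).
Hypothesis W : weak_solution alpha beta ustar u p.
Implicit Types x y t s d e r T th : R.
Local Notation w := (wfun alpha beta u).
Local Notation wx := (d_x w).
Variables (x0 t0 : R).
Hypotheses (x0_gt0 : 0 < x0) (x0_le1 : x0 <= 1) (t0_gt0 : 0 < t0)
  (core : forall x t, `|x| <= x0 -> t0 <= t -> p x t = 1).
(** The comparison profile is the minimum of [q1], convex, for the core where p = 1, and [q2], a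
    concave power whose curvature pays for the decay in time. The constant [k] < 1 puts [q1] below
    [q2] at 0, and its value is set so that [q1] is above from [x0] on; a large [L] makes [q2] flat,
    so that they cross with the right slopes. *)
Local Notation L := (16 / x0).
Local Notation k := ((1 + x0 ^+ 2 / 8) / (1 + x0 ^+ 2 / 4)).
Local Notation A := (k * scale_pow (- (3 / 4)) L).
Let q1 x := A * (1 + x ^+ 2 / 4).
Let q2 x := scale_pow (- (3 / 4)) (x + L).

Let L16 : 16 <= L. Proof. by rewrite ler_pdivlMr// -[leRHS]mulr1 ler_pM2l. Qed.
Let L0 : 0 < L. Proof. by rewrite (lt_le_trans _ L16). Qed.
Let den0 : 0 < 1 + x0 ^+ 2 / 4. Proof. by rewrite ltr_wpDr// divr_ge0// sqr_ge0. Qed.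
Let kden : k * (1 + x0 ^+ 2 / 4) = 1 + x0 ^+ 2 / 8.
Proof. by rewrite divfK// gt_eqF. Qed.
Let k_half : 1 / 2 <= k.
Proof. by rewrite ler_pdivlMr//; have := sqr_ge0 x0; lra. Qed.
Let k_lt1 : k < 1.
Proof. by rewrite ltr_pdivrMr// mul1r ltrD2l ltr_pM2l ?exprn_gt0//; lra. Qed.
Let A0 : 0 < A. Proof. by rewrite mulr_gt0 ?scale_pow_gt0//; have := k_half; lra. Qed.
Let q2_gt0 x : 0 < q2 x. Proof. exact: scale_pow_gt0. Qed.
Let q1_geA x : A <= q1 x.
Proof. by rewrite -[leLHS]mulr1 ler_pM2l// lerDl divr_ge0// sqr_ge0. Qed.
Let Ls1 : 1 <= scale_pow (- (3 / 4)) L.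
Proof. by apply: scale_pow_ge1; [lra|apply: le_trans L16; lra]. Qed.
Let A_half : 1 / 2 <= A.
Proof. by rewrite -[leLHS]mulr1 ler_pM ?k_half ?Ls1// divr_ge0. Qed.

Let q2E x : 0 <= x -> q2 x = scale_pow (- (3 / 4)) L * scale_pow (- (3 / 4)) (1 + x / L).
Proof.
move=> xp; have h : 0 < 1 + x / L by rewrite ltr_wpDr// divr_ge0// ltW.
rewrite -scale_powM// /q2; congr scale_pow.
by field; rewrite gt_eqF.
Qed.

Let q2_ge1 x : 0 <= x -> 1 <= q2 x.
Proof. by move=> xp; apply: scale_pow_ge1; [lra|have := L16; lra]. Qed.

Let q12_out x : x0 <= x -> q2 x < q1 x.
Proof.
move=> xx; have xp : 0 < x by exact: lt_le_trans xx.
rewrite q2E ?(ltW xp)// /q1 mulrAC [ltRHS]mulrC ltr_pM2l ?scale_pow_gt0//.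
apply: (@le_lt_trans _ _ (1 + x / L)).
  by apply: scale_pow_le1r; [lra|rewrite divr_ge0// ltW].
rewrite (_ : x / L = x * x0 / 16); last by field; rewrite gt_eqF.
have kd := kden; have kh := k_half; move: (k) kd kh => k' kd kh.
have -> : k' * (1 + x ^+ 2 / 4) = 1 + x0 ^+ 2 / 8 + k' * ((x - x0) * x0 / 2 + (x - x0) ^+ 2 / 4).
  by rewrite -kd; field.
have : 1 / 2 * ((x - x0) * x0 / 2 + (x - x0) ^+ 2 / 4) <= k' * ((x - x0) * x0 / 2 + (x - x0) ^+ 2 / 4).
  by apply: ler_wpM2r kh; rewrite addr_ge0 ?divr_ge0 ?sqr_ge0// mulr_ge0 ?subr_ge0// ltW.
have h1 : 0 <= (x - x0) * x0 by rewrite mulr_ge0 ?subr_ge0// ltW.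
have h2 := sqr_ge0 (x - x0); have h3 : 0 < x0 * x0 by rewrite mulr_gt0.
by rewrite !expr2; lra.
Qed.

Let q12_0 : q1 0 < q2 0.
Proof.
rewrite /q1 /q2 expr0n mul0r addr0 mulr1 add0r -[ltRHS]mul1r.
by rewrite ltr_pM2r ?scale_pow_gt0.
Qed.

(** A crossing must lie in [x0 / 2, x0), where [x * L >= 8]; there [q1] is steeper, so the minimum
    has a concave corner. *)
Let cross x : 0 <= x -> q1 x = q2 x -> 3 / 4 / (x + L) * q2 x < A * (x / 2).
Proof.
move=> xp E; have xx : x < x0.
  by rewrite ltNge; apply/negP => /q12_out; rewrite E ltxx.
have h : 1 <= k * (1 + x ^+ 2 / 4).
  rewrite -(@ler_pM2l _ (scale_pow (- (3 / 4)) L)) ?scale_pow_gt0// mulr1.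
  rewrite mulrCA mulrA -/(q1 x) E /q2.
  by rewrite /scale_pow !opprK ler_expR ler_wpM2l// ler_ln ?posrE ?ltr_wpDl// lerDr.
have xh : x0 / 2 <= x.
  rewrite leNgt; apply/negP => xlt; move: h; apply/negP; rewrite -ltNge.
  have x2 : x ^+ 2 <= x0 ^+ 2 / 4.
    rewrite (_ : x0 ^+ 2 / 4 = (x0 / 2) ^+ 2); last by field.
    by rewrite ler_pXn2r ?nnegrE ?(ltW xlt)// ltW// divr_gt0.
  have k0 : 0 < k by have := k_half; lra.
  apply: (@le_lt_trans _ _ (k * (1 + x0 ^+ 2 / 16))); first by rewrite ler_pM2l//; lra.
  rewrite mulrAC ltr_pdivrMr// mul1r.
  have x02 : 0 < x0 ^+ 2 by rewrite exprn_gt0.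
  have : x0 ^+ 2 <= 1 by rewrite exprn_ile1// ltW.
  have : x0 ^+ 2 * x0 ^+ 2 <= x0 ^+ 2 by rewrite ler_piMr ?exprn_ile1// ltW.
  by move: (x0 ^+ 2) x02 => X *; lra.
have q10 : 0 < q1 x by exact: lt_le_trans A0 (q1_geA x).
have d1 : 0 < 1 + x ^+ 2 / 4 by rewrite ltr_wpDr// divr_ge0// sqr_ge0.
have -> : A * (x / 2) = x / 2 / (1 + x ^+ 2 / 4) * q1 x.
  by rewrite /q1; move: (A) => A'; field; rewrite gt_eqF//; lra.
rewrite -E ltr_pM2r// ltr_pdivlMr// mulrAC ltr_pdivrMr ?ltr_wpDl//.
have xL : x0 / 2 * L <= x * L by rewrite ler_pM2r.
have e : x0 / 2 * L = 8 by field; rewrite gt_eqF.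
have x1 : x ^+ 2 <= 1 by rewrite exprn_ile1// (le_trans (ltW xx)).
have x2 := sqr_ge0 x; rewrite e in xL.
move: (L) xL => L' xL; have -> : x / 2 * (x + L') = (x ^+ 2 + x * L') / 2 by field.
by lra.
Qed.

(* Compares with C g(x) t^(-3/8), where g is quadratic for |x| <= x0, where p = 1, and (|x| + L)^(3/4) farther out. *)
Lemma crude_bound X : exists C T1, [/\ 0 < C, 0 < T1 &
  forall x t, `|x| <= X -> T1 <= t -> u x t <= C * scale_pow (3 / 8) t].
Proof.
(* The comparison is confined to |x| < c sqrt t. There c <= 1 / 4 gives (x + L)^2 <= t / 4, so the
   curvature 3/16 (x + L)^(-2) beats the rate 3/8 t^(-1); c < alpha keeps away from the source. *)
have [c [cp c4 ca]] : exists c, [/\ 0 < c, c <= 1 / 4 & c <= alpha / 2].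
  by exists (Num.min (1 / 4) (alpha / 2)); rewrite lt_min !ge_min !lexx orbT !divr_gt0.
have [T1 [T11 T1t TL]] : exists T1 : R, [/\ 1 <= T1, t0 <= T1 & L <= c * Num.sqrt T1].
  exists (Num.max (Num.max 1 t0) ((L / c) ^+ 2)); split.
  - by rewrite !le_max lexx.
  - by rewrite !le_max lexx !orbT.
  - rewrite -ler_pdivrMl// mulrC -[leLHS]ger0_norm; last by apply: divr_ge0; exact: ltW.
    by rewrite -sqrtr_sqr ler_wsqrtr// le_max lexx orbT.
have T10 : 0 < T1 by exact: lt_le_trans T11.
pose Pa := Psi alpha beta alpha.
have Pa0 : 0 <= Pa by exact: Psi_ge0.
have cs0 := scale_pow_gt0 (3 / 4) c.
(* The first term covers times up to [T1], where the profile is at least 1/2; the second covers |x|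
   >= c sqrt t, where [q2] is at least (c sqrt t)^(3/4). *)
pose C := 2 * Pa * scale_pow (- (3 / 8)) T1 + Pa * scale_pow (3 / 4) c + 1.
have e1 := ltW (scale_pow_gt0 (- (3 / 8)) T1); have e2 := ltW cs0.
have e3 : 0 <= 2 * Pa * scale_pow (- (3 / 8)) T1 by rewrite mulr_ge0// mulr_ge0.
have e4 : 0 <= Pa * scale_pow (3 / 4) c by rewrite mulr_ge0.
have C0 : 0 < C by rewrite ltr_wpDl// addr_ge0.
have C1 : 2 * Pa * scale_pow (- (3 / 8)) T1 <= C by rewrite /C -addrA lerDl addr_ge0.
have C2 : Pa * scale_pow (3 / 4) c <= C by rewrite /C addrAC lerDr addr_ge0.
clearbody C.
pose g x := Num.min (q1 x) (q2 `|x|).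
pose v x t := u x t - C * (g x * scale_pow (3 / 8) t).
have u_le x t : 0 < t -> u x t <= Pa.
  by move=> tp; rewrite (le_trans (u_le_psi alpha_gt0 beta_gt0 W x tp))// psi_le.
have out x t : T1 <= t -> c * Num.sqrt t <= `|x| -> v x t <= 0.
  move=> tt xt; have tp : 0 < t by exact: lt_le_trans tt.
  have st : 0 < Num.sqrt t by rewrite sqrtr_gt0.
  have gx : q2 `|x| <= g x.
    rewrite /g le_min lexx andbT ltW//.
    have : x0 <= `|x|.
      rewrite (le_trans x0_le1)// (le_trans _ xt)// (le_trans _ (ler_wpM2l (ltW cp) (ler_wsqrtr tt)))//.
      by rewrite (le_trans _ TL)//; have := L16; lra.
    by move=> /q12_out; rewrite /q1 real_normK// num_real.
  rewrite /v subr_le0 (le_trans (u_le x t tp))// (le_trans (y := C * (q2 `|x| * scale_pow (3 / 8) t)))//; last first.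
    by rewrite ler_pM2l// ler_pM2r// scale_pow_gt0.
  have qc : scale_pow (- (3 / 4)) c * scale_pow (- (3 / 8)) t <= q2 `|x|.
    rewrite (_ : - (3 / 8) = - (3 / 4) / 2); last by field.
    rewrite -scale_pow_sqrt// -scale_powM// /q2 /scale_pow !opprK ler_expR ler_pM2l// ler_ln ?posrE ?mulr_gt0//.
      by rewrite (le_trans xt)// lerDl ltW.
    by rewrite ltr_wpDl.
  apply: (@le_trans _ _ (C * scale_pow (- (3 / 4)) c)).
    have e5 := ltW (scale_pow_gt0 (- (3 / 4)) c).
    by apply: le_trans (ler_wpM2r e5 C2); rewrite -mulrA (mulrC _ (scale_pow _ _)) scale_powN mulr1.
  rewrite ler_pM2l//; apply: (@le_trans _ _ (scale_pow (- (3 / 4)) c * scale_pow (- (3 / 8)) t * scale_pow (3 / 8) t)).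
    by rewrite -mulrA scale_powN mulr1.
  by rewrite ler_pM2r ?scale_pow_gt0.
have dq1 z : is_derive z (1 : R) q1 (A * (z / 2)).
  have d1 : is_derive z (1 : R) (fun x : R => 1 + x ^+ 2 / 4) (z / 2).
    by apply: is_derive_eq; rewrite /GRing.scale/=; field.
  by rewrite /q1; apply: is_derive_eq; rewrite /GRing.scale/=; ring.
have dq1' z : is_derive z (1 : R) (fun z => A * (z / 2)) (A / 2).
  by apply: is_derive_eq; rewrite /GRing.scale/=; ring.
have dq2 z : 0 < z + L -> is_derive z (1 : R) q2 (3 / 4 / (z + L) * q2 z).
  move=> zL; have d1 : is_derive z (1 : R) (fun z => z + L) 1 by apply: is_derive_eq; rewrite addr0.
  have H := @is_derive_compE _ (scale_pow (- (3 / 4))) (fun z => z + L) z _ _ _ (is_derive_scale_pow _ zL) d1 (erefl _).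
  by apply: (is_derive_eq H); rewrite /q2 opprK mulr1.
have cq1 z : cont2 (fun x _ => q1 x) z by exact: cont2_fst (is_derive_continuous (dq1 z.1)).
have cq2 z : cont2 (fun x _ => q2 `|x|) z.
  apply: (@cont2_comp _ q2 (fun x _ => `|x|)).
    have zL : 0 < `|z.1| + L by rewrite ltr_wpDl.
    exact: is_derive_continuous (dq2 _ zL).
  by apply: (@cont2_fst _ Num.norm); exact: norm_continuous.
have cg z : cont2 (fun x _ => g x) z by apply: continuous_min; [exact: cq1|exact: cq2].
have cv y s : 0 < s -> cont2 v (y, s).
  move=> sp; apply: (@cont2B _ u (fun x t => C * (g x * scale_pow (3 / 8) t)) (y, s)).
    exact: (u_cont W).
  apply: cont2M; first exact: cont2_cst.
  by apply: cont2M; [exact: cg|exact: cont2_scale_pow].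
have main x t : 0 < t -> v x t <= 0.
  move=> tp; have c00 : 0 < c * Num.sqrt t + 1 by rewrite ltr_wpDl// mulr_ge0 ?sqrtr_ge0// ltW.
  have vr y s : 0 < s -> s <= T1 -> v y s <= 0.
    move=> sp sT; rewrite /v subr_le0 (le_trans (u_le y s sp))//.
    have gh : 1 / 2 <= g y.
      rewrite /g le_min (le_trans A_half (q1_geA y))/=.
      by apply: le_trans (q2_ge1 (normr_ge0 y)); lra.
    apply: (@le_trans _ _ (2 * Pa * scale_pow (- (3 / 8)) T1 * (1 / 2 * scale_pow (3 / 8) s))); last first.
      have e5 := ltW (scale_pow_gt0 (3 / 8) s).
      apply: ler_pM => //; first by apply: mulr_ge0 => //; rewrite divr_ge0.
      by apply: ler_wpM2r.
    rewrite (_ : _ * _ = Pa * (scale_pow (- (3 / 8)) T1 * scale_pow (3 / 8) s)); last by field.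
    apply: ler_peMr => //; rewrite -[leLHS](scale_powN (3 / 8) T1) ler_pM2l ?scale_pow_gt0//.
    by apply: le_scale_pow => //; lra.
  apply: (@even_strip_max _ v t (c * Num.sqrt t + 1) T1) => //; last by rewrite tp lexx.
  - move=> y s sp; rewrite /v /g /q1 sqrrN normrN.
    by have [-> _] := weak_even W y (ltW sp).
  - move=> y s /andP[sp st] Hy; have [sT|Ts] := leP s T1; first exact: vr.
    apply: out; first exact: ltW.
    apply: le_trans Hy; rewrite (le_trans (y := c * Num.sqrt t)) ?lerDl//.
    by rewrite ler_pM2l// ler_wsqrtr.
  - by move=> y s /andP[sp _] _ sT; exact: vr.
  move=> y s y0 sp v0 mx.
  have Ts : T1 < s by rewrite ltNge; apply/negP => sT; move: v0; rewrite ltNge vr.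
  have s1 : 1 <= s by rewrite (le_trans T11)// ltW.
  have ys : y < c * Num.sqrt s.
    by rewrite ltNge; apply/negP => H; move: v0; rewrite ltNge out// ?(ltW Ts)// ger0_norm.
  have ss : 0 < Num.sqrt s by rewrite sqrtr_gt0.
  have ya : y < alpha * Num.sqrt s.
    by apply: (lt_le_trans ys); rewrite ler_pM2r//; move: ca cp; lra.
  have Ls : L <= c * Num.sqrt s by rewrite (le_trans TL)// ler_pM2l// ler_wsqrtr// ltW.
  have psiE P pi := @heat_psi _ alpha beta alpha_gt0 P pi y s y0 sp (negbT (lt_eqF ya)).
  have cvy : \forall z \near ((y, s) : R * R), 0 < v z.1 z.2 by exact: (cvgr_gt _ (cv y s sp)).
  have tau0 := scale_pow_gt0 (3 / 8) s.
  have near_s : \forall z \near ((y, s) : R * R), T1 < z.2 by exact: near_snd_gt.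
  have u0 z : 0 < z.2 -> 0 <= 1 * (p z.1 z.2 * u z.1 z.2).
    by move=> z0; have /andP[p0 _] := p01 W z.1 (ltW z0); rewrite mul1r mulr_ge0// (u_ge0 alpha_gt0 beta_gt0 W).
  have [qq|qq|qq] := ltgtP (q1 y) (q2 y).
  - have near_q : \forall z \near ((y, s) : R * R), q1 z.1 < q2 `|z.1|.
      have cd := cont2B (cq2 (y, s)) (cq1 (y, s)).
      have : \forall z \near ((y, s) : R * R), 0 < q2 `|z.1| - q1 z.1.
        by apply: (cvgr_gt _ cd); rewrite /= ger0_norm// subr_gt0.
      by apply: filterS => z; rewrite subr_gt0.
    have yx : y < x0 by rewrite ltNge; apply/negP => /q12_out; rewrite ltNge (ltW qq).
    have near_x : \forall z \near ((y, s) : R * R), `|z.1| < x0.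
      apply: filterS2 (near_fst_lt s yx) (@near_fst_gt _ (- x0) y s _) => [z z1 z2|].
        by rewrite ltr_norml z1 z2.
      by apply: lt_le_trans y0; rewrite oppr_lt0.
    (* With p = 1, t > 1 and u > C q1 t^(-3/8), the absorption outweighs the costs 3/8 q1 of the
       decay and A / 2 of the curvature; [q1 >= A] leaves A / 8. *)
    apply: (@touching1h _ _ _ _ _ _ alpha_gt0 beta_gt0 W 1 y s
      (fun x t => psi alpha beta x t + (- C) * (q1 x * scale_pow (3 / 8) t))
      (fun x t => 0 + (- C) * (q1 x * (- (3 / 8) / t * scale_pow (3 / 8) t) - A / 2 * scale_pow (3 / 8) t))
      (fun _ t => C * scale_pow (3 / 8) t * A / 8)) => //.
    + by left.
    + apply: heat_nearD; first exact: psiE.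
      apply: heat_nearZ; apply: (@heat_near_pow _ _ _ q1 (fun z => A * (z / 2)) (fun _ => A / 2)) => //.
      by near=> z; split; [exact: dq1|exact: dq1'|exact: cvg_cst].
    + apply: filterS2 near_x near_s => z zx zs; rewrite core ?mul1r//; first exact: ltW.
      by rewrite (le_trans T1t)// ltW.
    + apply: cont2M; last exact: cont2_cst.
      apply: cont2M; last exact: cont2_cst.
      by apply: cont2M; [exact: cont2_cst|exact: cont2_scale_pow].
    + by rewrite divr_gt0// mulr_gt0 ?A0// mulr_gt0.
    + near=> z.
      have zs : T1 < z.2 by near: z.
      have zq : q1 z.1 < q2 `|z.1| by near: z.
      have : 0 < v z.1 z.2 by near: z.
      rewrite /v /g min_l ?(ltW zq)// subr_gt0 mul1r => uz.
      have z2 : 1 < z.2 by exact: le_lt_trans zs.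
      have z20 : 0 < z.2 by exact: lt_trans z2.
      have tz := scale_pow_gt0 (3 / 8) z.2.
      move: (q1_geA z.1) tz uz A0; move: (A) (q1 _) (scale_pow (3 / 8) _) => A' Q tau QA tz uz A'0.
      have inv1 : z.2^-1 <= 1 by rewrite invf_le1// ltW.
      have e5 : 0 < C * tau by rewrite mulr_gt0.
      have e6 : C * tau * A' <= C * tau * Q by rewrite ler_pM2l.
      have e7 : C * tau * Q * z.2^-1 <= C * tau * Q.
        by rewrite ler_piMr// mulr_ge0 ?(ltW e5)// (le_trans (ltW A'0)).
      have -> : 0 + - C * (Q * (- (3 / 8) / z.2 * tau) - A' / 2 * tau) =
        3 / 8 * (C * tau * Q * z.2^-1) + C * tau * A' / 2 by field; rewrite gt_eqF.
      have e8 : C * (Q * tau) = C * tau * Q by ring.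
      rewrite e8 in uz; have e9 : 0 < C * tau * A' by rewrite mulr_gt0.
      move: (C * tau * Q) (C * tau * A') e6 e7 uz e9 => a1 a2 e6 e7 uz e9.
      move: (a1 * _) e7 => a3 e7; lra.
    + have vE a b : q1 a < q2 `|a| ->
          1 * w a b + (psi alpha beta a b + - C * (q1 a * scale_pow (3 / 8) b)) = v a b.
        by move=> ab; rewrite /v /g min_l ?(ltW ab)// /wfun; ring.
      apply: filterS2 mx near_q => z H zq zs; rewrite [leLHS](vE z.1 z.2 zq) [leRHS](vE y s); first exact: H.
      by rewrite ger0_norm.
  - have yp : 0 < y by rewrite lt_neqAle y0 andbT; apply: contraTneq qq => <-; rewrite -leNgt ltW.
    have near_q : \forall z \near ((y, s) : R * R), q2 `|z.1| < q1 z.1.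
      have cd := cont2B (cq1 (y, s)) (cq2 (y, s)).
      have : \forall z \near ((y, s) : R * R), 0 < q1 z.1 - q2 `|z.1|.
        by apply: (cvgr_gt _ cd); rewrite /= ger0_norm// subr_gt0.
      by apply: filterS => z; rewrite subr_gt0.
    have near_y : \forall z \near ((y, s) : R * R), 0 < z.1 by exact: near_fst_gt.
    have yL : 0 < y + L by rewrite addr_gt0.
    have dsq (z : R) : is_derive z (1 : R) (fun x => (x + L) ^+ 2) (2 * (z + L)).
      have d3 : is_derive z (1 : R) (fun z => z + L) 1 by apply: is_derive_eq; rewrite addr0.
      by apply: is_derive_eq; rewrite /GRing.scale/=; ring.
    pose b := fun z => (3 / 4 / (z + L)) * q2 z.
    have db (z : R) : 0 < z -> is_derive z (1 : R) b (- (3 / 16) / (z + L) ^+ 2 * q2 z).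
      move=> zp; have zL : 0 < z + L by rewrite addr_gt0.
      have d1 := dq2 z zL.
      have d2 : is_derive z (1 : R) (fun z => (z + L)^-1) (- (z + L) ^- 2).
        have d3 : is_derive z (1 : R) (fun z => z + L) 1 by apply: is_derive_eq; rewrite addr0.
        have HV : is_derive z (1 : R) (fun z => (z + L)^-1) (- (z + L) ^- 2 *: (1 : R)) :=
          is_deriveV (f := fun z : R => z + L) (lt0r_neq0 zL) d3.
        by apply: (is_derive_eq HV); rewrite /GRing.scale/= mulr1.
      rewrite /b; apply: is_derive_eq; rewrite /GRing.scale/=.
      by move: (z + L) (q2 z) zL => a1 a2 a10; field; rewrite gt_eqF.
    (* On this branch only [p * u >= 0] enters; the margin comes from the concavity of [q2]. *)
    apply: (@touching0h _ _ _ _ _ _ alpha_gt0 beta_gt0 W 1 y s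
      (fun x t => psi alpha beta x t + (- C) * (q2 x * scale_pow (3 / 8) t))
      (fun x t => 0 + (- C) * (q2 x * (- (3 / 8) / t * scale_pow (3 / 8) t) -
          (- (3 / 16) / (x + L) ^+ 2 * q2 x) * scale_pow (3 / 8) t))
      (fun x t => C * scale_pow (3 / 8) t * q2 x * (3 / 16 / (x + L) ^+ 2 - 3 / 8 / t))) => //.
    + by left.
    + apply: heat_nearD; first exact: psiE.
      apply: heat_nearZ; apply: (@heat_near_pow _ _ _ q2 b (fun z => - (3 / 16) / (z + L) ^+ 2 * q2 z)) => //.
      near=> z; have zp : 0 < z by near: z; exact: lt_nbhsr.
      have zL : 0 < z + L by rewrite addr_gt0.
      split; [exact: dq2|exact: db|].
      apply: cvgM; last exact: is_derive_continuous (dq2 z zL).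
      apply: cvgM; first exact: cvg_cst.
      apply: cvgV; first by rewrite gt_eqF// exprn_gt0.
      exact: is_derive_continuous (dsq z).
    + by apply: filterS (near_snd_gt y sp) => z z0; exact: u0.
    + apply: cont2M.
        apply: cont2M; first by apply: cont2M; [exact: cont2_cst|exact: cont2_scale_pow].
        have cy : {for y, continuous q2} := is_derive_continuous (dq2 y yL).
        exact: (@cont2_fst R q2 (y, s) cy).
      apply: cont2B.
        apply: (@cont2_fst _ (fun x => 3 / 16 / (x + L) ^+ 2)); apply: cvgM; first exact: cvg_cst.
        apply: cvgV; first by rewrite gt_eqF// exprn_gt0.
        exact: is_derive_continuous (dsq y).
      apply: (@cont2_snd _ (fun t => 3 / 8 / t)); apply: cvgM; first exact: cvg_cst.
      by apply: cvgV; [rewrite gt_eqF|exact: cvg_id].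
    + rewrite !mulr_gt0// subr_gt0 ltr_pdivrMr// mulrAC ltr_pdivlMr ?exprn_gt0//.
      have e5 : y + L <= Num.sqrt s / 2.
        apply: (@le_trans _ _ (c * Num.sqrt s + c * Num.sqrt s)); first by rewrite lerD// ltW.
        by have := ler_wpM2r (ltW ss) c4; lra.
      have e6 : (y + L) ^+ 2 <= s / 4.
        rewrite -[s in s / 4](sqr_sqrtr (ltW sp)) (_ : _ / 4 = (Num.sqrt s / 2) ^+ 2); last by field.
        by rewrite ler_pXn2r ?nnegrE ?(ltW yL)// divr_ge0// ltW.
      by move: ((y + L) ^+ 2) e6 => a1 e6; lra.
    + near=> z; have zp : 0 < z.1 by near: z.
      have z20 : 0 < z.2 by near: z; exact: near_snd_gt.
      have zL : 0 < z.1 + L by rewrite addr_gt0.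
      by move: (z.1 + L) (q2 _) (scale_pow _ _) zL => a1 a2 a3 a10; rewrite le_eqVlt; apply/orP; left; apply/eqP; field; rewrite !gt_eqF.
    + have vE a r : 0 <= a -> q2 `|a| < q1 a ->
          1 * w a r + (psi alpha beta a r + - C * (q2 a * scale_pow (3 / 8) r)) = v a r.
        by move=> a_ge0 ab; rewrite /v /g min_r ?(ltW ab)// /wfun (ger0_norm a_ge0); ring.
      apply: filterS2 mx (filterI near_q near_y) => z H [zq zy] zs.
      rewrite [leLHS](vE z.1 z.2 (ltW zy) zq) [leRHS](vE y s y0); first exact: H.
      by rewrite ger0_norm.
  - have yL : 0 < y + L by rewrite ltr_wpDl.
    have gy : g y = q1 y by rewrite /g ger0_norm// -qq minxx.
    have dw := is_derive_w W y (ltW sp).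
    have d1 := dq1 y; have d2 := dq2 y yL.
    pose tau := scale_pow (3 / 8) s.
    have near_psi : \forall z \near y, psi alpha beta z s = Psi alpha beta alpha.
      near=> z; rewrite psi_in// ler_norml; apply/andP; split; apply: ltW.
        by near: z; apply: lt_nbhsr; rewrite (lt_le_trans _ y0)// oppr_lt0 mulr_gt0.
      by near: z; exact: lt_nbhsl.
    have near_0 : \forall z \near y, - x0 < z by apply: lt_nbhsr; rewrite (lt_le_trans _ y0)// oppr_lt0.
    (* At the crossing [- C * g] has a convex corner by [cross], and psi is constant nearby. *)
    apply: (@no_max_convex_kink _ (fun z => v z s)
      (fun z => w z s + Psi alpha beta alpha - C * (q1 z * tau))
      (fun z => w z s + Psi alpha beta alpha - C * (q2 z * tau)) y
      (wx y s - C * (A * (y / 2) * tau)) (wx y s - C * (3 / 4 / (y + L) * q2 y * tau))).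
    + by apply: is_derive_eq; rewrite /GRing.scale/=; ring.
    + by apply: is_derive_eq; rewrite /GRing.scale/=; ring.
    + by rewrite ltrD2l ltrN2 ltr_pM2l// ltr_pM2r// cross.
    + by rewrite /v gy /wfun (nbhs_singleton near_psi) /tau; ring.
    + by rewrite /v gy qq /wfun (nbhs_singleton near_psi) /tau; ring.
    + apply: filterS near_psi => z zpsi _; rewrite /v /wfun zpsi subrK lerD2l lerN2 ler_pM2l// ler_pM2r//.
      by rewrite /g ge_min lexx.
    + apply: filterS near_psi => z zpsi yz; rewrite /v /wfun zpsi subrK lerD2l lerN2 ler_pM2l// ler_pM2r//.
      by rewrite /g ger0_norm ?(le_trans y0)// ge_min lexx orbT.
    + by have := near_slicel mx; apply: filterS => z H; exact: H.
exists (C * q2 (Num.max X 0)), T1; split => //; first by rewrite mulr_gt0.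
move=> x t xX tt; have tp : 0 < t by exact: lt_le_trans tt.
have := main x t tp; rewrite /v subr_le0 => /le_trans; apply.
rewrite mulrA ler_pM2r ?scale_pow_gt0// ler_pM2l// /g ge_min; apply/orP; right.
rewrite /q2 /scale_pow !opprK ler_expR ler_pM2l// ler_ln ?posrE ?ltr_wpDl// ?le_max ?lexx ?orbT//.
by rewrite lerD2r le_max xX.
Unshelve. all: by end_near. Qed.

End crude_decay2.

(** * Kummer's function and the limit profile *)

Section exponentially_bounded_series.
Variable R : realType.
Implicit Types (c d : nat -> R) (z : R).

(** Domination by an exponential series: an everywhere convergent class that is stable under
    termwise differentiation. *)
Definition exp_bounded c := exists A B : R, [/\ 0 <= A, 0 <= B &
  forall n, `|c n| <= A * B ^+ n / n`!%:R].

Lemma exp_bounded_cvg c z : exp_bounded c -> cvgn (pseries c z).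
Proof.
move=> [A [B [A0 B0 H]]]; apply: normed_cvg.
apply: (@series_le_cvg _ _ (fun n => A * exp_coeff (B * `|z|) n)).
- by move=> n; rewrite normr_ge0.
- by move=> n; rewrite mulr_ge0// divr_ge0// ?ler0n// exprn_ge0// mulr_ge0.
- move=> n /=; rewrite normrM normrX /exp_coeff/= exprMn.
  rewrite (_ : A * _ = A * B ^+ n / n`!%:R * `|z| ^+ n); last by ring.
  by rewrite ler_wpM2r// exprn_ge0.
- exact/is_cvg_seriesZ/is_cvg_series_exp_coeff.
Qed.

Lemma exp_bounded_diffs c : exp_bounded c -> exp_bounded (pseries_diffs c).
Proof.
move=> [A [B [A0 B0 H]]]; exists (A * B), B; split => //; first exact: mulr_ge0.
move=> n; rewrite /pseries_diffs normrM ger0_norm//.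
apply: (le_trans (ler_wpM2l (ler0n _ _) (H n.+1))).
rewrite factS natrM exprS le_eqVlt; apply/orP; left; apply/eqP; field.
by rewrite pnatr_eq0 -lt0n fact_gt0 nat1r pnatr_eq0.
Qed.

Lemma is_derive_pseries c z : exp_bounded c ->
  is_derive z (1 : R) (fun z => limn (pseries c z)) (limn (pseries (pseries_diffs c) z)).
Proof.
move=> cE; have cE' := exp_bounded_diffs cE; have cE'' := exp_bounded_diffs cE'.
apply: (@pseries_snd_diffs _ _ (`|z| + 1)); try exact: exp_bounded_cvg.
by rewrite [ltRHS]ger0_norm ?ltrDl// addr_ge0.
Qed.

Lemma cvg_pseries_mul c z : exp_bounded c ->
  pseries (fun n => n%:R * c n) z @ \oo --> z * limn (pseries (pseries_diffs c) z).
Proof.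
move=> cE; have H := pseries_diffs_equiv (exp_bounded_cvg (z := z) (exp_bounded_diffs cE)).
rewrite (_ : pseries _ z = fun n => z * series (fun i => i%:R * c i * z ^+ i.-1) n).
  by apply: cvgM; [exact: cvg_cst|exact: H].
apply/funext => n; rewrite /pseries /series /= mulr_sumr; apply: eq_bigr => i _.
by case: i => [|i]; [rewrite !mul0r mulr0|rewrite exprS /=; ring].
Qed.

Lemma cvg_pseries_shift c z : exp_bounded c ->
  pseries (fun n => if n is m.+1 then c m else 0) z @ \oo --> z * limn (pseries c z).
Proof.
move=> cE; rewrite -cvg_shiftS.
rewrite (_ : [sequence _]_ _ = fun n => z * pseries c z n); last first.
  apply/funext => n; rewrite /pseries /series /= big_nat_recl//= mul0r add0r mulr_sumr.
  by apply: eq_bigr => i _; rewrite exprS; ring.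
by apply: cvgM; [exact: cvg_cst|exact: exp_bounded_cvg].
Qed.

End exponentially_bounded_series.

Section kummer.
Variable R : realType.
Variables (a b : R).
Hypotheses (a_gt0 : 0 < a) (ab : a + 1 <= b).
Implicit Types z : R.

Let cf := fun n => pochhammer a n / pochhammer b n / n`!%:R.
Let cg := fun n => pochhammer (a + 1) n / pochhammer b n / n`!%:R.
Local Notation f := (kummerM a b).
Local Notation g := (kummerM (a + 1) b).

Let b_gt0 : 0 < b. Proof. by rewrite (lt_le_trans _ ab)// addr_gt0. Qed.

Lemma pochhammer_gt0 (x : R) n : 0 < x -> 0 < pochhammer x n.
Proof. by move=> x0; apply: prodr_gt0 => i _; rewrite ltr_wpDr. Qed.

Lemma pochhammer_le (x y : R) n : 0 < x -> x <= y -> pochhammer x n <= pochhammer y n.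
Proof.
by move=> x0 xy; apply: ler_prod => i _; rewrite ltW ?ltr_wpDr//= lerD2r.
Qed.

Lemma pochhammer_shift (x : R) n : x * pochhammer (x + 1) n = pochhammer x n * (x + n%:R).
Proof.
rewrite /pochhammer.
have -> : \prod_(i < n) (x + i%:R) * (x + n%:R) = \prod_(i < n.+1) (x + i%:R) by rewrite big_ord_recr.
rewrite big_ord_recl /= addr0; congr (_ * _).
by apply: eq_bigr => i _; rewrite /bump/= natrD addrA.
Qed.

Lemma exp_bounded_kummer (x : R) : 0 < x -> x <= b ->
  exp_bounded (fun n => pochhammer x n / pochhammer b n / n`!%:R).
Proof.
move=> x0 xb; exists 1, 1; split => // n.
have p1 := pochhammer_gt0 n x0; have p2 := pochhammer_gt0 n b_gt0.
have f0 : 0 < n`!%:R :> R by rewrite ltr0n fact_gt0.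
rewrite ger0_norm ?divr_ge0 ?(ltW p1) ?(ltW p2) ?(ltW f0)// expr1n mulr1 ler_pM2r ?invr_gt0//.
by rewrite ler_pdivrMr// mul1r pochhammer_le.
Qed.

Let cfE : exp_bounded cf.
Proof. by apply: exp_bounded_kummer => //; rewrite (le_trans _ ab)// lerDl. Qed.
Let cgE : exp_bounded cg.
Proof. by apply: exp_bounded_kummer => //; rewrite addr_gt0. Qed.

Let cg_cf n : a * (cg n - cf n) = n%:R * cf n.
Proof.
transitivity ((a * pochhammer (a + 1) n - a * pochhammer a n) / pochhammer b n / n`!%:R).
  by rewrite /cg /cf; ring.
by rewrite pochhammer_shift /cf; ring.
Qed.

(** Coefficient form of z g' = (b - a - 1) f + (a + 1 - b + z) g; the shifted coefficient is the
    multiplication by z. *)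
Let cg_rec n : n%:R * cg n = (b - a - 1) * cf n + (a + 1 - b) * cg n +
  (if n is m.+1 then cg m else 0).
Proof.
have a0 := a_gt0; have b0 := b_gt0.
case: n => [|n].
  by rewrite /cg /cf /pochhammer !big_ord0; ring.
have E : cf n.+1 = a / (a + n.+1%:R) * cg n.+1.
  have an : 0 < a + n.+1%:R by rewrite ltr_wpDr.
  have := cg_cf n.+1; rewrite mulrBr => H.
  have -> : cg n.+1 = (a + n.+1%:R) / a * cf n.+1.
    apply: (@mulfI _ a); first by rewrite gt_eqF.
    rewrite -[LHS](subrK (a * cf n.+1)) H; field; by rewrite gt_eqF.
  by move: (cf _) (a + _) an => q s s0; field; rewrite !gt_eqF.
have E2 : cg n = cg n.+1 * (n.+1%:R * (b + n%:R) / (a + n.+1%:R)).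
  rewrite /cg /pochhammer !big_ord_recr /= factS natrM.
  have an : 0 < a + n.+1%:R by rewrite ltr_wpDr.
  have bn : 0 < b + n%:R by rewrite ltr_wpDr.
  have f0 : 0 < n`!%:R :> R by rewrite ltr0n fact_gt0.
  have n0 : 0 < n.+1%:R :> R by rewrite ltr0n.
  have p2 := pochhammer_gt0 n b_gt0; rewrite /pochhammer in p2.
  have e : a + 1 + n%:R = a + n.+1%:R by rewrite -natr1; ring.
  rewrite e; move: (\prod_(_ < _) (a + 1 + _)) (\prod_(_ < _) _) p2 => q1 q2 q20.
  move: (n.+1%:R : R) n0 an => k2 k20 an.
  by field; rewrite !gt_eqF.
rewrite E E2; have an : 0 < a + n.+1%:R by rewrite ltr_wpDr.
by move: (cg n.+1) an; rewrite -natr1 => q an; field; rewrite gt_eqF.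
Qed.

(** One of two contiguous relations. With the next one, f = M(a, b, .) and g = M(a + 1, b, .)
    satisfy a closed first-order system, which serves in place of Kummer's second-order equation. *)
Lemma is_derive_kummer_f z : exists2 f' : R, is_derive z (1 : R) f f' &
  z * f' = a * (g z - f z).
Proof.
exists (limn (pseries (pseries_diffs cf) z)); first exact: is_derive_pseries.
have H := cvg_pseries_mul (z := z) cfE.
apply/esym; apply: (@cvg_unique _ (@norm_hausdorff _ _)) H.
rewrite (_ : pseries _ z = fun n => a * (pseries cg z n - pseries cf z n)).
  apply: cvgM; first exact: cvg_cst.
  by apply: cvgB; exact: exp_bounded_cvg.
apply/funext => n; rewrite /pseries /series /= -sumrB mulr_sumr; apply: eq_bigr => i _.
by rewrite -cg_cf; ring.
Qed.

Lemma is_derive_kummer_g z : exists2 g' : R, is_derive z (1 : R) g g' &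
  z * g' = (b - a - 1) * f z + (a + 1 - b + z) * g z.
Proof.
exists (limn (pseries (pseries_diffs cg) z)); first exact: is_derive_pseries.
have H := cvg_pseries_mul (z := z) cgE.
apply/esym; apply: (@cvg_unique _ (@norm_hausdorff _ _)) H.
rewrite (_ : pseries _ z = fun n => (b - a - 1) * pseries cf z n + (a + 1 - b) * pseries cg z n
  + pseries (fun n => if n is m.+1 then cg m else 0) z n).
  rewrite (_ : _ + _ = (b - a - 1) * f z + (a + 1 - b) * g z + z * g z); last by ring.
  apply: cvgD; last exact: cvg_pseries_shift.
  by apply: cvgD; (apply: cvgM; [exact: cvg_cst|exact: exp_bounded_cvg]).
apply/funext => n; rewrite /pseries /series /= !mulr_sumr -!big_split; apply: eq_bigr => i _ /=.
by rewrite cg_rec; case: i => [|i] /=; ring.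
Qed.

(** Covers a minimum at the right end, where only the values to the left are available. *)
Lemma min_deriv_le0 (h : R -> R) (y1 c h' : R) : 0 < c <= y1 -> is_derive c (1 : R) h h' ->
  (forall y, 0 <= y <= y1 -> h c <= h y) -> h' <= 0.
Proof.
move=> /andP[c0 cy] dh mn; rewrite leNgt; apply/negP => h'0.
have [e /= e0 He] := (nbhs_ballP c _).1 (is_derive_gt0_near dh h'0).
pose y := c - Num.min (e / 2) c.
have m0 : 0 < Num.min (e / 2) c by rewrite lt_min divr_gt0.
have yc : y < c by rewrite ltrBlDr ltrDl.
have y0 : 0 <= y by rewrite subr_ge0 ge_min lexx orbT.
have yb : ball c e y by rewrite /ball/= opprB addrCA subrr addr0 gtr0_norm// gt_min; lra.
have := He y yb (negbT (lt_eqF yc)); rewrite nmulr_lgt0 ?subr_lt0// ltNge mn//.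
by rewrite y0 (le_trans (ltW yc)).
Qed.

Let F y := expR (- y) * f (- y).
Let G y := expR (- y) * g (- y).

Let is_derive_comp_opp (h : R -> R) y k : is_derive (- y) (1 : R) h k ->
  is_derive y (1 : R) (fun y => h (- y)) (- k).
Proof.
move=> dh; have dN : is_derive y (1 : R) (fun y : R => - y) (- 1) by apply: is_derive_eq.
by apply: (is_derive_compE dh dN); rewrite mulrN1.
Qed.

Let is_derive_F y : exists2 F' : R, is_derive y (1 : R) F F' & y * F' = - (a + y) * F y + a * G y.
Proof.
have [f' df E] := is_derive_kummer_f (- y).
have df' := is_derive_comp_opp df.
have dN : is_derive y (1 : R) (fun y : R => - y) (- 1) by apply: is_derive_eq.
have dE : is_derive y (1 : R) (fun y : R => expR (- y)) (- expR (- y)).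
  by apply: (is_derive_compE (is_derive_expR _) dN); rewrite mulrN1.
exists (- expR (- y) * f (- y) - expR (- y) * f').
  by rewrite /F; apply: is_derive_eq; rewrite /GRing.scale/=; ring.
have E' : y * f' = - (a * (g (- y) - f (- y))) by rewrite -E; ring.
have -> : y * (- expR (- y) * f (- y) - expR (- y) * f') = - y * expR (- y) * f (- y) - expR (- y) * (y * f') by ring.
by rewrite E' /F /G; ring.
Qed.

Let is_derive_G y : exists2 G' : R, is_derive y (1 : R) G G' &
  y * G' = - (b - a - 1 + 2 * y) * G y + (b - a - 1) * F y.
Proof.
have [g' dg E] := is_derive_kummer_g (- y).
have dg' := is_derive_comp_opp dg.
have dN : is_derive y (1 : R) (fun y : R => - y) (- 1) by apply: is_derive_eq.
have dE : is_derive y (1 : R) (fun y : R => expR (- y)) (- expR (- y)).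
  by apply: (is_derive_compE (is_derive_expR _) dN); rewrite mulrN1.
exists (- expR (- y) * g (- y) - expR (- y) * g').
  by rewrite /G; apply: is_derive_eq; rewrite /GRing.scale/=; ring.
have E' : y * g' = - ((b - a - 1) * f (- y) + (a + 1 - b - y) * g (- y)) by rewrite -E; ring.
have -> : y * (- expR (- y) * g (- y) - expR (- y) * g') = - y * expR (- y) * g (- y) - expR (- y) * (y * g') by ring.
by rewrite E' /F /G; ring.
Qed.

Let kummer0 (x : R) : kummerM x b 0 = 1.
Proof.
rewrite /kummerM; apply: cvg_lim => //; rewrite -cvg_shiftS.
rewrite (_ : [sequence _]_ _ = fun=> 1); first exact: cvg_cst.
apply/funext => n; rewrite /pseries /series /= big_nat_recl//= /pochhammer !big_ord0 big1 ?addr0.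
  by rewrite expr0 mulr1 fact0 !divr1.
by move=> i _; rewrite expr0n mulr0.
Qed.

Let exists_min (h : R -> R) (y1 : R) : 0 <= y1 -> (forall y, {for y, continuous h}) ->
  exists2 c : R, 0 <= c <= y1 & forall y, 0 <= y <= y1 -> h c <= h y.
Proof.
move=> y10 ch; have ch' : {within `[0, y1], continuous h} by exact: continuous_subspaceT.
by have [c cI H] := EVT_min y10 ch'; exists c => // y yI; apply: H.
Qed.

(** Maximum principle for the system: the weight e^(-y) adds a damping term. A negative minimum of
    [F] forces a lower minimum of [G]; at a negative minimum of [G] the equation would give d G(d)
    >= 0. *)
Let FG_ge0 y : 0 <= y -> 0 <= F y /\ 0 <= G y.
Proof.
move=> y0.
have cF x : {for x, continuous F}.
  by have [F' dF _] := is_derive_F x; exact: is_derive_continuous dF.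
have cG x : {for x, continuous G}.
  by have [G' dG _] := is_derive_G x; exact: is_derive_continuous dG.
have [c /andP[c0 cy] Hc] := exists_min y0 cF.
have [d /andP[d0 dy] Hd] := exists_min y0 cG.
have F0 : F 0 = 1 by rewrite /F oppr0 expR0 kummer0 mulr1.
have G0 : G 0 = 1 by rewrite /G oppr0 expR0 kummer0 mulr1.
have m0 : 0 <= b - a - 1 by have := ab; lra.
have FG : F c < 0 -> G d < F c.
  move=> Fc; have cp : 0 < c.
    by rewrite lt_neqAle c0 andbT; apply: contraTneq Fc => <-; rewrite F0 -leNgt ler01.
  have [F' dF E] := is_derive_F c.
  have F'0 : F' <= 0 by apply: (min_deriv_le0 (y1 := y) _ dF Hc); rewrite cp.
  have H1 : c * F' <= 0 by rewrite mulr_ge0_le0.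
  have H2 : G d <= G c by apply: Hd; rewrite c0.
  rewrite E in H1.
  have H3 : a * G d <= a * G c by rewrite ler_wpM2l// ltW.
  have H4 : c * F c < 0 by rewrite nmulr_llt0.
  rewrite -(@ltr_pM2l _ a)//; lra.
have Gd0 : 0 <= G d.
  rewrite leNgt; apply/negP => Gd.
  have dp : 0 < d.
    by rewrite lt_neqAle d0 andbT; apply: contraTneq Gd => <-; rewrite G0 -leNgt ler01.
  have [G' dG E] := is_derive_G d.
  have G'0 : G' <= 0 by apply: (min_deriv_le0 (y1 := y) _ dG Hd); rewrite dp.
  have H1 : d * G' <= 0 by rewrite mulr_ge0_le0.
  rewrite E in H1.
  have GF : G d <= F d.
    apply: (@le_trans _ _ (F c)); last by apply: Hc; rewrite d0.
    have [Fc|Fc] := ltP (F c) 0; first exact: ltW (FG Fc).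
    by rewrite (le_trans (ltW Gd)).
  have H2 : (b - a - 1) * G d <= (b - a - 1) * F d by rewrite ler_wpM2l.
  have H3 : d * G d < 0 by rewrite nmulr_llt0.
  lra.
have Fc0 : 0 <= F c by rewrite leNgt; apply/negP => /[dup] /FG; lra.
by split; [apply: le_trans Fc0 _; apply: Hc|apply: le_trans Gd0 _; apply: Hd]; rewrite y0 lexx.
Qed.

(* f1 y = e^y f(-y) and g1 y = e^y g(-y) satisfy y (f1 - g1)' + (b - 1) (f1 - g1) = y f1 and y g1' = (b - a - 1) (f1 - g1). *)
Lemma kummer_bounds y : 0 <= y -> expR (- y) <= g (- y) /\ g (- y) <= f (- y).
Proof.
move=> y0; have m0 : 0 <= b - a - 1 by have := ab; lra.
pose f1 y := expR y * f (- y); pose g1 y := expR y * g (- y).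
have f1E x : f1 x = expR (2 * x) * F x.
  by rewrite /f1 /F mulrA -expRD; congr (expR _ * _); ring.
have d1 x : exists2 k : R, is_derive x (1 : R) f1 k & x * k = x * f1 x + a * (g1 x - f1 x).
  have [f' df E] := is_derive_kummer_f (- x); have df' := is_derive_comp_opp df.
  exists (expR x * f (- x) - expR x * f').
    by rewrite /f1; apply: is_derive_eq; rewrite /GRing.scale/=; ring.
  have -> : x * (expR x * f (- x) - expR x * f') = x * f1 x + expR x * (- x * f') by rewrite /f1; ring.
  by rewrite E /f1 /g1; ring.
have d2 x : exists2 k : R, is_derive x (1 : R) g1 k & x * k = (b - a - 1) * (f1 x - g1 x).
  have [g' dg E] := is_derive_kummer_g (- x); have dg' := is_derive_comp_opp dg.
  exists (expR x * g (- x) - expR x * g').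
    by rewrite /g1; apply: is_derive_eq; rewrite /GRing.scale/=; ring.
  have -> : x * (expR x * g (- x) - expR x * g') = x * g1 x + expR x * (- x * g') by rewrite /g1; ring.
  by rewrite E /f1 /g1; ring.
have f10 x : 0 <= x -> 0 <= f1 x.
  by move=> x0; rewrite f1E mulr_ge0 ?expR_ge0//; have [] := FG_ge0 x0.
have dpos x : 0 <= x -> g1 x <= f1 x.
  move=> x0; rewrite -subr_ge0.
  have cd z : {for z, continuous (fun z => f1 z - g1 z)}.
    have [k1 k1d _] := d1 z; have [k2 k2d _] := d2 z.
    by apply: cvgB; [exact: is_derive_continuous k1d|exact: is_derive_continuous k2d].
  have [c /andP[c0 cx] Hc] := exists_min x0 cd.
  apply: (@le_trans _ _ (f1 c - g1 c)); last by apply: Hc; rewrite x0 lexx.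
  rewrite leNgt; apply/negP => dc.
  have cp : 0 < c.
    rewrite lt_neqAle c0 andbT; apply: contraTneq dc => <-.
    by rewrite /f1 /g1 oppr0 !kummer0 subrr ltxx.
  have [k1 k1d E1] := d1 c; have [k2 k2d E2] := d2 c.
  have kk : k1 - k2 <= 0.
    have dd : is_derive c (1 : R) (fun z => f1 z - g1 z) (k1 - k2) by apply: is_derive_eq.
    by apply: (@min_deriv_le0 (fun z => f1 z - g1 z) x c) => //; rewrite cp.
  have H1 : c * (k1 - k2) <= 0 by rewrite mulr_ge0_le0.
  have H2 : 0 <= c * f1 c by rewrite mulr_ge0// f10.
  rewrite mulrBr E1 E2 in H1.
  have H3 : (b - 1) * (f1 c - g1 c) < 0 by rewrite nmulr_llt0//; have := ab; have := a_gt0; lra.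
  lra.
have g11 : 1 <= g1 y.
  have -> : 1 = g1 0 by rewrite /g1 oppr0 expR0 kummer0 mulr1.
  move: y0; rewrite le_eqVlt => /orP[/eqP <-//|y0].
  apply: (@ger0_derive1_le_cc _ g1 0 y); rewrite ?in_itv/= ?lexx ?ltW//.
  - by move=> x _; have [k dk _] := d2 x; exact: ex_derive.
  - move=> x; rewrite in_itv/= => /andP[x0 _]; have [k dk E] := d2 x.
    rewrite derive1E; have [_ ->] := dk; rewrite -(@pmulr_rge0 _ x)// E.
    by rewrite mulr_ge0// subr_ge0 dpos// ltW.
  - apply: continuous_subspaceT => x; have [k dk _] := d2 x; exact: is_derive_continuous dk.
split.
  by rewrite expRN -[leLHS]mul1r ler_pdivrMr ?expR_gt0// mulrC.
by rewrite -(@ler_pM2l _ (expR y)) ?expR_gt0//; exact: dpos.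
Qed.

End kummer.

(** * The complementary error function as a Gaussian tail *)

Section erfc_tail.
Variable R : realType.
Implicit Types x y : R.

Let gauss (x : R) : R := expR (- x ^+ 2).

Let is_derive_gauss x : is_derive x (1 : R) gauss (- (2 * x) * gauss x).
Proof.
have H : is_derive x (1 : R) (fun x : R => - x ^+ 2) (- (2 * x)).
  by apply: is_derive_eq; rewrite /GRing.scale/=; ring.
by apply: (is_derive_compE (is_derive_expR _) H); rewrite mulrC.
Qed.

Let cgauss : continuous gauss.
Proof. by move=> x; exact: is_derive_continuous (is_derive_gauss x). Qed.

Let gauss_gt0 x : 0 < gauss x. Proof. exact: expR_gt0. Qed.

Let gauss_le x : gauss x <= expR (1 - x).
Proof. by rewrite ler_expR; have := sqr_ge0 (x - 1 / 2); rewrite !expr2; lra. Qed.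

(** The substitution zeta = 2 y, done by comparing derivatives and limits at infinity. *)
Lemma erfc_half y : erfc (y / 2) = tail4 y / Num.sqrt pi.
Proof.
rewrite /erfc -/(tail gauss (y / 2)).
pose D y := 2 * tail gauss (y / 2) - tail4 y.
have dD x : is_derive x (1 : R) D 0.
  have dh : is_derive x (1 : R) (fun x : R => x / 2) 2^-1.
    by apply: is_derive_eq; rewrite /GRing.scale/=; ring.
  have H := @is_derive_compE _ (tail gauss) (fun x => x / 2) x _ _ _
    (is_derive_tail cgauss gauss_gt0 gauss_le (x / 2)) dh (erefl _).
  have H2 := is_derive_tail4 x.
  have E : gauss4 x = gauss (x / 2) by congr expR; field.
  by rewrite /D; apply: is_derive_eq; rewrite E /GRing.scale/=; field.
have Dc z : D z = D 0 by apply: is_derive_0_is_cst.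
have cD : D x @[x --> +oo] --> 0.
  rewrite -[0 in X in _ --> X]subr0; apply: cvgB; last exact: cvg_tail4.
  rewrite -[0 in X in _ --> X](mulr0 2); apply: cvgM; first exact: cvg_cst.
  have hoo : (x / 2 : R) @[x --> +oo] --> +oo.
    by apply: gt0_cvgMly.
  exact: (cvg_comp _ _ hoo (cvg_tail cgauss gauss_gt0 gauss_le)).
have D0 : D y = 0.
  rewrite Dc; have : D x @[x --> +oo] --> D 0.
    by rewrite (_ : D = fun=> D 0); [exact: cvg_cst|apply/funext].
  by move=> h; exact: (cvg_unique (@norm_hausdorff _ _) h cD).
move: D0; rewrite /D => /eqP; rewrite subr_eq0 => /eqP <-; ring.
Qed.

End erfc_tail.

(** * The profile Phi_gamma *)

Section profile.
Variable R : realType.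
Variables alpha beta gamma : R.
Hypotheses (alpha_gt0 : 0 < alpha) (beta_gt0 : 0 < beta) (gamma_ge0 : 0 <= gamma).
Implicit Types eta : R.
Local Notation k := (kappa gamma).
Local Notation f := (kummerM (k / 2) (k + 1 / 2)).
Local Notation g := (kummerM (k / 2 + 1) (k + 1 / 2)).
Local Notation U := (ustar_gamma alpha beta gamma).

Lemma kappa_ge1 : 1 <= k.
Proof.
rewrite /kappa ler_pdivlMr// mul1r (_ : 2 = 1 + 1)// lerD2l -[leLHS]sqrtr1 ler_wsqrtr// lerDr.
by rewrite mulr_ge0.
Qed.

Lemma kappaE : k * (k - 1) = gamma.
Proof.
have s2 : Num.sqrt (4 * gamma + 1) ^+ 2 = 4 * gamma + 1.
  by rewrite sqr_sqrtr// addr_ge0// mulr_ge0.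
rewrite /kappa; move: (Num.sqrt _) s2 => s s2.
have -> : gamma = (s ^+ 2 - 1) / 4 by rewrite s2; field.
by field.
Qed.

Let k0 : 0 < k. Proof. exact: lt_le_trans ltr01 kappa_ge1. Qed.
Let a0 : 0 < k / 2. Proof. by rewrite divr_gt0. Qed.
Let ab : k / 2 + 1 <= k + 1 / 2. Proof. by have := kappa_ge1; lra. Qed.

Let zpos eta : 0 <= eta ^+ 2 / 4. Proof. by rewrite divr_ge0// sqr_ge0. Qed.
Let g_gt0 eta : 0 < g (- (eta ^+ 2 / 4)).
Proof. by have [H _] := kummer_bounds a0 ab (zpos eta); exact: lt_le_trans (expR_gt0 _) H. Qed.
Let g_le_f eta : g (- (eta ^+ 2 / 4)) <= f (- (eta ^+ 2 / 4)).
Proof. by have [_ H] := kummer_bounds a0 ab (zpos eta). Qed.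
Let f_gt0 eta : 0 < f (- (eta ^+ 2 / 4)).
Proof. exact: lt_le_trans (g_gt0 eta) (g_le_f eta). Qed.

Let t0 : 0 < tail4 alpha. Proof. exact: tail4_gt0. Qed.
Let spi : 0 < Num.sqrt pi :> R. Proof. by rewrite sqrtr_gt0 pi_gt0. Qed.

(** The definition of u*_gamma read as the transmission condition at eta = alpha: inner slope minus
    outer slope equals the source strength alpha beta / 2. *)
Lemma ustar_gammaE : U * (k * g (- (alpha ^+ 2 / 4)) / (alpha * f (- (alpha ^+ 2 / 4)))
  + gauss4 alpha / tail4 alpha) = alpha * beta / 2.
Proof.
rewrite /ustar_gamma erfc_half (_ : Num.sqrt pi * (_ / _) = tail4 alpha); last first.
  by rewrite mulrC divfK// gt_eqF.
have q0 : 0 < k * g (- (alpha ^+ 2 / 4)) / (alpha * f (- (alpha ^+ 2 / 4))) + gauss4 alpha / tail4 alpha.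
  by apply: addr_gt0; apply: divr_gt0; [exact: mulr_gt0|exact: mulr_gt0|exact: gauss4_gt0|exact: t0].
move: q0; rewrite -/(gauss4 alpha); move: (_ + _) => A A0.
by rewrite mulrAC mulVf ?mul1r// gt_eqF.
Qed.

Lemma ustar_gamma_gt0 : 0 < U.
Proof.
have := ustar_gammaE; set q := _ + _ => E.
have q0 : 0 < q.
  by apply: addr_gt0; apply: divr_gt0; [exact: mulr_gt0|exact: mulr_gt0|exact: gauss4_gt0|exact: t0].
by rewrite -(@pmulr_lgt0 _ q)// E divr_gt0// mulr_gt0.
Qed.

(** [c] normalises the inner branch to the value [U] at alpha, and [P] is eta^kappa. By the
    contiguous relations [F1'] involves [g] alone, hence has a sign. *)
Let c := U / (alpha `^ k * f (- (alpha ^+ 2 / 4))).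
Let P eta := scale_pow (- k) eta.
Let F1 eta := c * (P eta * f (- (eta ^+ 2 / 4))).
Let F1' eta := c * k * (P eta / eta * g (- (eta ^+ 2 / 4))).
Let F1'' eta := c * k * (P eta / eta ^+ 2 * ((k - 1) * f (- (eta ^+ 2 / 4)) - eta ^+ 2 / 2 * g (- (eta ^+ 2 / 4)))).

Let PE eta : 0 < eta -> eta `^ k = P eta.
Proof. by move=> e0; rewrite /powR gt_eqF// /P /scale_pow opprK. Qed.

Let c0 : 0 < c.
Proof. by rewrite divr_gt0 ?ustar_gamma_gt0// mulr_gt0// powR_gt0. Qed.

Let is_derive_arg eta : is_derive eta (1 : R) (fun eta : R => - (eta ^+ 2 / 4)) (- (eta / 2)).
Proof. by apply: is_derive_eq; rewrite /GRing.scale/=; field. Qed.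

Let is_derive_comp_arg (h : R -> R) eta h' : is_derive (- (eta ^+ 2 / 4)) (1 : R) h h' ->
  is_derive eta (1 : R) (fun eta => h (- (eta ^+ 2 / 4))) (h' * - (eta / 2)).
Proof.
by move=> dh; exact: (@is_derive_compE _ h (fun eta => - (eta ^+ 2 / 4)) eta _ _ _ dh (is_derive_arg eta) (erefl _)).
Qed.

Let is_derive_f eta : 0 < eta -> is_derive eta (1 : R) (fun eta => f (- (eta ^+ 2 / 4)))
  (k / eta * (g (- (eta ^+ 2 / 4)) - f (- (eta ^+ 2 / 4)))).
Proof.
move=> e0; have [f' df E] := is_derive_kummer_f a0 ab (- (eta ^+ 2 / 4)).
apply: (is_derive_eq (is_derive_comp_arg df)).
have -> : f' * - (eta / 2) = 2 / eta * (- (eta ^+ 2 / 4) * f') by field; rewrite gt_eqF.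
by rewrite E; field; rewrite gt_eqF.
Qed.

Let is_derive_g eta : 0 < eta -> is_derive eta (1 : R) (fun eta => g (- (eta ^+ 2 / 4)))
  (eta^-1 * ((k - 1) * f (- (eta ^+ 2 / 4)) - (k - 1 + eta ^+ 2 / 2) * g (- (eta ^+ 2 / 4)))).
Proof.
move=> e0; have [g' dg E] := is_derive_kummer_g a0 ab (- (eta ^+ 2 / 4)).
apply: (is_derive_eq (is_derive_comp_arg dg)).
have -> : g' * - (eta / 2) = 2 / eta * (- (eta ^+ 2 / 4) * g') by field; rewrite gt_eqF.
by rewrite E; field; rewrite gt_eqF.
Qed.

Let dP eta : 0 < eta -> is_derive eta (1 : R) P (k / eta * P eta).
Proof. by move=> e0; have := is_derive_scale_pow (- k) e0; rewrite opprK. Qed.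

Let dF1 eta : 0 < eta -> is_derive eta (1 : R) F1 (F1' eta).
Proof.
move=> e0; have h1 := dP e0; have h2 := is_derive_f e0.
by rewrite /F1 /F1'; apply: is_derive_eq; rewrite /GRing.scale/=; ring.
Qed.

Let dV eta : 0 < eta -> is_derive eta (1 : R) (fun eta : R => eta^-1) (- eta ^- 2).
Proof.
move=> e0; have HV : is_derive eta (1 : R) (fun z : R => z^-1) (- eta ^- 2 *: (1 : R)) :=
  is_deriveV (f := fun z : R => z) (lt0r_neq0 e0) (is_derive_id _ _).
by apply: (is_derive_eq HV); rewrite /GRing.scale/= mulr1.
Qed.

Let dF1' eta : 0 < eta -> is_derive eta (1 : R) F1' (F1'' eta).
Proof.
move=> e0; have h1 := dP e0; have h2 := is_derive_g e0; have h3 := dV e0.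
rewrite /F1' /F1''; apply: is_derive_eq; rewrite /GRing.scale/=.
by move: (f _) (g _) (P _) => f1 g1 P1; field; rewrite gt_eqF.
Qed.

Let cF1'' eta : 0 < eta -> {for eta, continuous F1''}.
Proof.
move=> e0; have h1 := is_derive_continuous (dP e0).
have h2 := is_derive_continuous (is_derive_f e0); have h3 := is_derive_continuous (is_derive_g e0).
have csq : {for eta, continuous (fun x : R => x ^+ 2)} by exact: exprn_continuous.
apply: cvgM; first exact: cvg_cst.
apply: cvgM.
  by apply: cvgM; [exact: h1|apply: cvgV; [rewrite gt_eqF// exprn_gt0|exact: csq]].
apply: cvgB; first by apply: cvgM; [exact: cvg_cst|exact: h2].
by apply: cvgM; [apply: cvgM; [exact: csq|exact: cvg_cst]|exact: h3].
Qed.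

Let ode eta : 0 < eta -> F1'' eta + eta / 2 * F1' eta = gamma / eta ^+ 2 * F1 eta.
Proof.
move=> e0; rewrite -[X in X / eta ^+ 2]kappaE /F1 /F1' /F1''; by move: (f _) (g _) (P _) => f1 g1 P1; field; rewrite gt_eqF.
Qed.

(** Collects what the comparison uses of Phi_gamma: the profile equation, where kappa (kappa - 1) =
    gamma enters, the linear bound near 0 due to kappa >= 1, and the transmission condition. The
    case eta = 0 is separate because [F] is written with a logarithm, which takes a default value
    there. *)
Lemma profile_exists : exists (F F' F'' : R -> R) (C : R),
  [/\ forall eta, 0 < eta -> [/\ is_derive eta (1 : R) F (F' eta), is_derive eta (1 : R) F' (F'' eta),
         {for eta, continuous F''} & F'' eta + eta / 2 * F' eta = gamma / eta ^+ 2 * F eta],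
      forall eta, 0 < eta <= alpha -> 0 <= F eta <= C * eta /\ `|F' eta| <= C,
      F alpha = U, U * gauss4 alpha / tail4 alpha + F' alpha = alpha * beta / 2 &
      forall eta, 0 <= eta -> Phi alpha beta gamma eta =
         if eta == 0 then 0 else if eta < alpha then F eta else U / tail4 alpha * tail4 eta].
Proof.
have P0 : P alpha * f (- (alpha ^+ 2 / 4)) != 0 by rewrite gt_eqF// mulr_gt0// scale_pow_gt0.
have Fa : F1 alpha = U by rewrite /F1 /c PE// divfK.
have cf : {within `[0, alpha], continuous (fun eta => f (- (eta ^+ 2 / 4)))}.
  apply: continuous_subspaceT => eta.
  have [f' df _] := is_derive_kummer_f a0 ab (- (eta ^+ 2 / 4)).
  exact: (is_derive_continuous (is_derive_comp_arg df)).
have [M M0 HM] := bounded_segment cf.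
pose q := scale_pow (- (k - 1)) alpha.
have q0 : 0 < q by exact: scale_pow_gt0.
have Pq eta : 0 < eta <= alpha -> P eta <= q * eta.
  move=> /andP[e0 ea]; have -> : P eta = scale_pow (- (k - 1)) eta * eta.
    rewrite -[X in _ * X](lnK (_ : eta \is Num.pos)) ?posrE// /P /scale_pow -expRD; congr expR.
    by ring.
  rewrite ler_pM2r// /q /scale_pow !opprK ler_expR ler_wpM2l ?subr_ge0 ?kappa_ge1//.
  by rewrite ler_ln ?posrE.
exists F1, F1', F1'', (c * k * q * M); split.
- by move=> eta e0; split; [exact: dF1|exact: dF1'|exact: cF1''|exact: ode].
- move=> eta eI; case/andP: (eI) => e0 ea.
  have P1 : 0 < P eta by exact: scale_pow_gt0.
  have fM : f (- (eta ^+ 2 / 4)) <= M.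
    by rewrite (le_trans (ler_norm _))// HM// (ltW e0).
  have kq : P eta * f (- (eta ^+ 2 / 4)) <= q * eta * M.
    by rewrite ler_pM ?(ltW P1) ?(ltW (f_gt0 _))// Pq.
  split.
    apply/andP; split; first by rewrite /F1 mulr_ge0 ?(ltW c0)// mulr_ge0 ?(ltW P1)// ltW.
    rewrite /F1 (_ : _ * _ * _ * _ * eta = c * (k * (q * eta * M))); last by ring.
    rewrite ler_pM2l//; apply: (le_trans kq); apply: ler_peMl; last exact: kappa_ge1.
    by apply: mulr_ge0; [apply: mulr_ge0; exact: ltW|exact: ltW].
  have F'0 : 0 <= F1' eta.
    apply: mulr_ge0; first by apply: mulr_ge0; [exact: ltW c0|exact: ltW k0].
    by apply: mulr_ge0; [apply: divr_ge0; exact: ltW|exact: ltW (g_gt0 _)].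
  rewrite (ger0_norm F'0) /F1' (_ : c * k * q * M = c * k * (q * M)); last by ring.
  apply: ler_wpM2l; first by apply: mulr_ge0; exact: ltW.
  apply: ler_pM; [by apply: divr_ge0; exact: ltW|exact: ltW (g_gt0 _)|by rewrite ler_pdivrMr// Pq|].
  exact: le_trans (g_le_f _) fM.
- exact: Fa.
- rewrite -ustar_gammaE mulrDr addrC -mulrA; congr (_ + _).
  rewrite /F1' /c PE//; move: P0; rewrite mulf_eq0 negb_or => /andP[p1 p2].
  by field; rewrite p1 p2 gt_eqF.
- move=> eta e0; rewrite /Phi; case: eqVneq => [->|en0].
    by rewrite alpha_gt0 powR0 ?mulr0 ?mul0r// gt_eqF.
  have ep : 0 < eta by rewrite lt_neqAle eq_sym en0.
  case: ifP => _; first by rewrite /F1 /c !PE//; ring.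
  by rewrite !erfc_half; field; rewrite !gt_eqF.
Qed.

End profile.

(** * The precipitation profile *)

Section precipitation_profile.
Variable R : realType.
Notation leb := (@lebesgue_measure R).
Variables (alpha beta ustar gamma : R) (u p : R -> R -> R) (pstar : R -> R).
Hypotheses (alpha_gt0 : 0 < alpha).
Hypothesis W : weak_solution alpha beta ustar u p.
Hypothesis pP : condition_P alpha p pstar.
Hypothesis pstar_lim : (x%:E * \int[leb]_(xi in `[x, +oo[) (pstar xi)%:E)%E @[x --> +oo] --> gamma%:E.
Implicit Types x y t : R.

Lemma integrable_ray_shift (f : R -> R) (X y : R) : measurable_fun setT f -> (forall x, 0 <= f x <= 1) ->
  leb.-integrable `[X, +oo[ (EFin \o f) -> leb.-integrable `[y, +oo[ (EFin \o f).
Proof.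
move=> mf f01 iX; have [yX|Xy] := leP X y.
  by apply: integrableS iX => //; apply: subset_itvr; rewrite bnd_simp.
have mfE D : measurable_fun D (EFin \o f) by apply/measurable_EFinP; exact: measurable_funTS.
have iy : leb.-integrable `[y, X] (EFin \o f) by exact: (integrable_pi mf f01).
apply/integrableP; split; first exact: mfE.
rewrite (@itv_bndbnd_setU _ _ _ (BRight X)) ?bnd_simp ?(ltW Xy)//.
rewrite ge0_integral_setU//.
- apply: lte_add_pinfty; first by case/integrableP: iy.
  case/integrableP: iX => _; apply: le_lt_trans; apply: ge0_subset_integral => //.
    by apply: measurableT_comp => //; exact: mfE.
  by apply: subset_itvr; rewrite bnd_simp.
- by apply: measurableT_comp => //; exact: mfE.
- by apply/disj_setPS => x [/=]; rewrite !in_itv/= => /andP[_ xX]; rewrite andbT ltNge xX.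
Qed.

(** Replaces [pstar] by a Borel function with values in [0, 1] everywhere and its tail integral by a
    finite [P], so that all later statements concern real functions, off one null set. *)
Lemma precipitation_profile : exists (N : set R) (pi P : R -> R),
  [/\ leb.-negligible N, measurable_fun setT pi, forall x, 0 <= pi x <= 1, is_primitive P pi &
    [/\ forall x, 0 < x -> ~ N x -> pstar x = pi x,
      forall x t, 0 < x -> ~ N x -> x ^+ 2 / alpha ^+ 2 < t -> p x t = pi x &
      x * P x @[x --> +oo] --> gamma]].
Proof.
have [mp ap] := pP.
have [N1 [g1 [N10 mg1 g1E]]] := completed_lebesgue_measurable_funP (measurable_itv _) mp.
pose N2 := ~` [set x | 0 < x -> forall t, x ^+ 2 / alpha ^+ 2 < t -> p x t = pstar x].
have N2n : leb.-negligible N2 by exact: ap.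
pose N := N1 `|` N2.
pose pi (x : R) := (0 < x)%R%:R * Num.max 0 (Num.min 1 (g1 x)).
have pi01 x : 0 <= pi x <= 1.
  rewrite /pi; case: (0 < x); rewrite ?mul0r ?lexx ?ler01// mul1r.
  by rewrite le_max lexx/= ge_max ler01/= ge_min lexx.
have mpi : measurable_fun setT pi.
  apply: measurable_funM.
    have := @measurable_indic _ _ R setT _ (measurable_itv `]0 : R, +oo[).
    congr (measurable_fun _ _); apply/funext => x; rewrite indicE; congr (_%:R).
    by rewrite mem_setE in_itv/= andbT.
  apply: measurable_maxr; first exact: measurable_cst.
  by apply: measurable_minr; first exact: measurable_cst.
have p_pstar x t : 0 < x -> ~ N x -> x ^+ 2 / alpha ^+ 2 < t -> p x t = pstar x.
  move=> x0 Nx xt; have : ~ N2 x by move=> h; apply: Nx; right.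
  by move=> /contrapT/(_ x0 t xt).
have pstarE x : 0 < x -> ~ N x -> pstar x = pi x.
  (* Almost everywhere [pstar x] is a value of [p] at a late time, hence lies in [0, 1]. *)
  move=> x0 Nx; have /andP[s0 s1] : 0 <= pstar x <= 1.
    rewrite -(p_pstar x (x ^+ 2 / alpha ^+ 2 + 1)) ?ltrDl//; apply: (p01 W).
    by rewrite addr_ge0// divr_ge0// sqr_ge0.
  have E : pstar x = g1 x by apply: g1E; [rewrite /= in_itv/= x0|move=> h; apply: Nx; left].
  by rewrite /pi x0 mul1r -E min_r// max_r.
have IE x : 0 < x -> (\int[leb]_(xi in `[x, +oo[) (pstar xi)%:E = \int[leb]_(xi in `[x, +oo[) (pi xi)%:E)%E.
  move=> x0; rewrite integral_mkcond [RHS]integral_mkcond.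
  apply: (@integral_eq_negligible _ _ _ leb N); first exact: negligibleU.
  move=> y Ny; rewrite !patchE; case: ifPn => //; rewrite inE/= in_itv/= andbT => xy.
  by rewrite pstarE// (lt_le_trans x0).
have [H1 H2] := (fine_cvgP _ _).1 pstar_lim.
have [X [X0 iX]] : exists X : R, 0 < X /\ leb.-integrable `[X, +oo[ (EFin \o pi).
  have [M [Mr HM]] := H1.
  have [X [MX X0]] : exists X, M < X /\ 0 < X.
    exists (Num.max M 0 + 1); split; first by rewrite ltr_pwDr// le_max lexx.
    by rewrite ltr_wpDl// le_max lexx orbT.
  exists X; split => //; have := HM X MX; rewrite IE// => fin.
  apply/integrableP; split; first exact/measurable_EFinP/measurable_funTS.
  under eq_integral => x _ do rewrite /= ger0_norm ?(proj1 (andP (pi01 x)))//.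
  have I0 : (0 <= \int[leb]_(x in `[X, +oo[) (pi x)%:E)%E.
    by apply: integral_ge0 => x _; rewrite lee_fin; case/andP: (pi01 x).
  (* An infinite tail integral times a positive [x] would be infinite, against the finite limit. *)
  by case: (integral _ _ _) fin I0 => [r||] //; rewrite ?ltry//= gt0_muley ?lte_fin.
have ipi y : leb.-integrable `[y, +oo[ (EFin \o pi) by exact: integrable_ray_shift iX.
pose P x := \int[leb]_(r in `[x, +oo[) pi r.
exists N, pi, P; split => //; first exact: negligibleU.
- move=> x y xy; apply/eqP; rewrite subr_eq addrC -subr_eq; apply/eqP.
  rewrite /P (@Rintegral_itvB _ pi (BLeft x) +oo%O y)//.
  rewrite Rintegral_itv_obnd_cbnd//.
  by apply: integrableS (ipi y) => //; apply: subset_itvr; rewrite bnd_simp.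
- split => //.
    by move=> x t x0 Nx xt; rewrite p_pstar// pstarE.
  apply: cvg_trans H2; apply: near_eq_cvg; near=> x.
  have x0 : 0 < x by near: x; exact/nbhs_pinfty_gt/num_real.
  by rewrite /= IE// -[X in (_ * X)%E]fineK//; exact/integrable_fin_num/ipi.
Unshelve. all: by end_near. Qed.

Lemma is_derive_Rintegral0 (P : R -> R) x : continuous P -> 0 < x ->
  is_derive x (1 : R) (fun x => \int[leb]_(r in `[0, x]) P r) (P x).
Proof.
move=> cP x0; have x1 : x < x + 1 by rewrite ltrDl.
have ig : leb.-integrable `[0, x + 1] (EFin \o P).
  by apply: integrable_segment; exact: continuous_subspaceT.
have [D1 D2] := @continuous_FTC1_closed _ P 0 x (x + 1) x1 ig x0 (@cP x).
by split; [exact: D1|rewrite -derive1E D2].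
Qed.

End precipitation_profile.

(** * The barrier *)

Section barrier_tools.
Variable R : realType.
Implicit Types (x t h : R) (f : R -> R).

Lemma scale_pow0 t : scale_pow 0 t = 1 :> R.
Proof. by rewrite /scale_pow oppr0 mul0r expR0. Qed.

Lemma smooth_selfsimilar0 f f' f'' (x1 t1 : R) : 0 < t1 ->
  (\forall h \near x1 / Num.sqrt t1, [/\ is_derive h (1 : R) f (f' h),
     is_derive h (1 : R) f' (f'' h) & {for h, continuous f''}]) ->
  smooth_near (fun x t => f (x / Num.sqrt t)) (fun x t => f' (x / Num.sqrt t) / Num.sqrt t)
    (fun x t => f'' (x / Num.sqrt t) / t)
    (fun x t => - (x / Num.sqrt t / 2 * f' (x / Num.sqrt t) / t)) (x1, t1).
Proof.
move=> t0 Hf; have := @smooth_selfsimilar _ 0 f f' f'' x1 t1 t0 Hf.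
congr (smooth_near _ _ _ _ _); apply/funext => x; apply/funext => t; rewrite scale_pow0.
- by rewrite mul1r.
- by rewrite mul1r.
- by rewrite mul1r.
- by rewrite mul0r add0r; ring.
Qed.

Lemma heat_selfsimilar0 P pi f f' f'' (x1 t1 : R) : 0 < t1 ->
  (\forall h \near x1 / Num.sqrt t1, [/\ is_derive h (1 : R) f (f' h),
     is_derive h (1 : R) f' (f'' h) & {for h, continuous f''}]) ->
  heat_near P pi (fun x t => f (x / Num.sqrt t))
    (fun x t => - ((f'' (x / Num.sqrt t) + x / Num.sqrt t / 2 * f' (x / Num.sqrt t)) / t)) (x1, t1).
Proof.
move=> t0 Hf; have := heat_near_smooth P pi (@smooth_selfsimilar0 f f' f'' x1 t1 t0 Hf).
by apply: heat_near_eq; near=> z => //; ring.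
Unshelve. all: by end_near. Qed.

Lemma heat_tail4 P pi x t : 0 < t -> heat_near P pi (fun x t => tail4 (x / Num.sqrt t)) (fun _ _ => 0) (x, t).
Proof.
move=> t0; have : heat_near P pi (fun x t => tail4 (x / Num.sqrt t))
    (fun x t => - ((x / Num.sqrt t / 2 * gauss4 (x / Num.sqrt t) + x / Num.sqrt t / 2 * (- gauss4 (x / Num.sqrt t))) / t)) (x, t).
  apply: (@heat_selfsimilar0 P pi (@tail4 R) (fun h => - gauss4 h) (fun h => h / 2 * gauss4 h)) => //.
  near=> h; split; first exact: is_derive_tail4.
    have Hg := is_derive_gauss4 h.
    by apply: is_derive_eq; ring.
  apply: cvgM; last exact: continuous_gauss4.
  by apply: cvgM; [exact: cvg_id|exact: cvg_cst].
by apply: heat_near_eq; near=> z => //; ring.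
Unshelve. all: by end_near. Qed.

(** With exponent 1/2 this would be the heat kernel; the smaller exponent 1/4 makes it a positive
    supersolution that still decays. *)
Lemma heat_gauss4_pow P pi x t : 0 < t ->
  heat_near P pi (fun x t => scale_pow (1 / 4) t * gauss4 (x / Num.sqrt t))
    (fun x t => scale_pow (1 / 4) t * gauss4 (x / Num.sqrt t) / (4 * t)) (x, t).
Proof.
move=> t0.
have dG2 h : is_derive h (1 : R) (fun h => - (h / 2) * gauss4 h) ((h ^+ 2 / 4 - 1 / 2) * gauss4 h).
  have Hg := is_derive_gauss4 h.
  by apply: is_derive_eq; rewrite /GRing.scale/=; field.
have := @heat_selfsimilar R P pi (1 / 4) (@gauss4 R) (fun h => - (h / 2) * gauss4 h)
  (fun h => (h ^+ 2 / 4 - 1 / 2) * gauss4 h) x t t0.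
have H : \forall h \near x / Num.sqrt t, [/\ is_derive h (1 : R) (@gauss4 R) (- (h / 2) * gauss4 h),
     is_derive h (1 : R) (fun h => - (h / 2) * gauss4 h) ((h ^+ 2 / 4 - 1 / 2) * gauss4 h) &
     {for h, continuous (fun h : R => (h ^+ 2 / 4 - 1 / 2) * gauss4 h)}].
  near=> h; split; [exact: is_derive_gauss4|exact: dG2|].
  apply: cvgM; last exact: continuous_gauss4.
  apply: cvgB; last exact: cvg_cst.
  by apply: cvgM; [exact: exprn_continuous|exact: cvg_cst].
move=> /(_ H); apply: heat_near_eq; first by near=> z.
near=> z; have z0 : 0 < z.2 by near: z; exact: near_snd_gt.
by move: (z.1 / _) (gauss4 _) (scale_pow _ _) => a1 a2 a3; field; rewrite gt_eqF.
Unshelve. all: by end_near. Qed.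

Definition sqrt_gauss h : R := Num.sqrt h * gauss4 h.
Definition sqrt_gauss' h : R := gauss4 h / (2 * Num.sqrt h) - h * Num.sqrt h / 2 * gauss4 h.

Lemma is_derive_sqrt_gauss h : 0 < h -> is_derive h (1 : R) sqrt_gauss (sqrt_gauss' h).
Proof.
move=> h0; have s0 : 0 < Num.sqrt h by rewrite sqrtr_gt0.
have H := is_derive1_sqrt h0; have Hg := is_derive_gauss4 h.
rewrite /sqrt_gauss /sqrt_gauss'; apply: is_derive_eq; rewrite /GRing.scale/=.
by move: (Num.sqrt h) s0 => s s0; field; rewrite gt_eqF.
Qed.

(** The singular part 1 / (4 h^(3/2)) of this residual is of the same order as the error of the
    barrier near h = 0. *)
Lemma heat_sqrt_gauss P pi x t : 0 < x -> 0 < t ->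
  heat_near P pi (fun x t => sqrt_gauss (x / Num.sqrt t))
    (fun x t => let h := x / Num.sqrt t in
       gauss4 h * ((4 * (h * Num.sqrt h))^-1 + 3 / 4 * Num.sqrt h) / t) (x, t).
Proof.
move=> x0 t0.
pose f2 h := gauss4 h * (- (4 * (h * Num.sqrt h))^-1 - Num.sqrt h + h ^+ 2 * Num.sqrt h / 4).
have d2 h : 0 < h -> is_derive h (1 : R) sqrt_gauss' (f2 h).
  move=> h0; have s0 : 0 < Num.sqrt h by rewrite sqrtr_gt0.
  have H := is_derive1_sqrt h0; have Hg := is_derive_gauss4 h.
  have HV : is_derive h (1 : R) (fun h => (2 * Num.sqrt h)^-1) (- (4 * (h * Num.sqrt h))^-1).
    have H2 : is_derive h (1 : R) (fun h => 2 * Num.sqrt h) (2 * (2 * Num.sqrt h)^-1).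
      by apply: is_derive_eq; rewrite /GRing.scale/=; ring.
    have n0 : 2 * Num.sqrt h != 0 by rewrite mulf_neq0// gt_eqF.
    have HV := is_deriveV (f := fun h : R => 2 * Num.sqrt h) n0 H2.
    apply: (is_derive_eq HV); rewrite /GRing.scale/=.
    by move: (Num.sqrt h) s0 (sqr_sqrtr (ltW h0)) => s s0 <-; field; rewrite gt_eqF.
  rewrite /sqrt_gauss' /f2; apply: is_derive_eq; rewrite /GRing.scale/=.
  by move: (gauss4 h) (Num.sqrt h) s0 (sqr_sqrtr (ltW h0)) => k s s0 <-; field; rewrite gt_eqF.
have := @heat_selfsimilar0 P pi sqrt_gauss sqrt_gauss' f2 x t t0.
have H : \forall h \near x / Num.sqrt t, [/\ is_derive h (1 : R) sqrt_gauss (sqrt_gauss' h),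
     is_derive h (1 : R) sqrt_gauss' (f2 h) & {for h, continuous f2}].
  near=> h; have h0 : 0 < h.
    by near: h; apply: lt_nbhsr; rewrite divr_gt0// sqrtr_gt0.
  split; [exact: is_derive_sqrt_gauss|exact: d2|].
  have cs : {for h, continuous (@Num.sqrt R)} by exact: sqrt_continuous.
  have s0 : 0 < Num.sqrt h by rewrite sqrtr_gt0.
  apply: cvgM; first exact: continuous_gauss4.
  apply: cvgD; last first.
    by apply: cvgM; [apply: cvgM; [exact: exprn_continuous|exact: cs]|exact: cvg_cst].
  apply: cvgB; last exact: cs.
  apply: cvgN; apply: cvgV; first by rewrite mulf_neq0// mulf_neq0// gt_eqF.
  by apply: cvgM; [exact: cvg_cst|apply: cvgM; [exact: cvg_id|exact: cs]].
move=> /(_ H); apply: heat_near_eq; first by near=> z.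
near=> z; have z1 : 0 < z.1 by near: z; exact: near_fst_gt.
have z2 : 0 < z.2 by near: z; exact: near_snd_gt.
have h0 : 0 < z.1 / Num.sqrt z.2 by rewrite divr_gt0// sqrtr_gt0.
rewrite /f2 /sqrt_gauss' /=; move: (z.1 / _) h0 => h h0.
have s0 : 0 < Num.sqrt h by rewrite sqrtr_gt0.
by move: (gauss4 h) (Num.sqrt h) s0 (sqr_sqrtr (ltW h0)) => k s s0 <-; field; rewrite !gt_eqF.
Unshelve. all: by end_near. Qed.

End barrier_tools.

Section touching_variable.
Variable R : realType.
Notation leb := (@lebesgue_measure R).
Variables (alpha beta ustar : R) (u p : R -> R -> R).
Hypotheses (alpha_gt0 : 0 < alpha) (beta_gt0 : 0 < beta).
Hypothesis W : weak_solution alpha beta ustar u p.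
Local Notation w := (wfun alpha beta u).

Lemma touchingh (sg x1 t1 : R) (N : set R) (P pi : R -> R) (g D h : R -> R -> R) :
  sg = 1 \/ sg = -1 -> 0 < t1 -> leb.-negligible N -> measurable_fun setT pi ->
  (forall y : R, 0 <= pi y <= 1) -> is_primitive P pi -> heat_near P pi g D (x1, t1) ->
  (\forall z \near ((x1, t1) : R * R), ~ N z.1 ->
     sg * (pi z.1 * u z.1 z.2) <= sg * (p z.1 z.2 * u z.1 z.2)) ->
  cont2 h (x1, t1) -> 0 < h x1 t1 ->
  (\forall z \near ((x1, t1) : R * R), D z.1 z.2 - sg * (pi z.1 * u z.1 z.2) <= - h z.1 z.2) ->
  ~ (\forall z \near ((x1, t1) : R * R), z.2 <= t1 ->
      sg * w z.1 z.2 + g z.1 z.2 <= sg * w x1 t1 + g x1 t1).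
Proof.
move=> sgE t0 N0 mpi pi01 Ppi Hg Hp ch h0 HD; have hh : 0 < h x1 t1 / 2 by rewrite divr_gt0.
apply: (@touching _ _ _ _ _ _ alpha_gt0 beta_gt0 W sg _ x1 t1 N P pi g D sgE hh) => //.
by apply: filterS2 HD (near_half ch h0) => z D1 h1; rewrite (le_trans D1)// lerN2 ltW.
Qed.

End touching_variable.

Section barrier_estimates.
Variable R : realType.
Implicit Types x y t h : R.

Lemma sign_sub_le (sg x y c : R) : sg = 1 \/ sg = -1 -> 0 <= x <= c -> 0 <= y <= c -> sg * (x - y) <= c.
Proof. by move=> sg1 /andP[x0 xc] /andP[y0 yc]; case: sg1 => ->; rewrite ?mul1r ?mulN1r; lra. Qed.

Lemma sqrt_expR y : 0 < y -> expR (ln y / 2) = Num.sqrt y.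
Proof.
move=> y0; rewrite -[y in RHS](lnK (_ : y \is Num.pos)) ?posrE//.
rewrite [in RHS](_ : ln y = ln y / 2 + ln y / 2); last by field.
by rewrite expRD -expr2 sqrtr_sqr ger0_norm// expR_ge0.
Qed.

Section oscillation.
Variables (E P : R -> R) (gamma eb X : R).
Hypotheses (X0 : 0 < X) (dE : forall x, 0 < x -> is_derive x (1 : R) E (P x - gamma / x))
  (HP : forall x, X <= x -> `|x * P x - gamma| <= eb).

(** Since z E'(z) = z P(z) - gamma, adding [eb * ln] to E makes it nondecreasing on [X, oo), and
    subtracting it makes it nonincreasing. *)
Lemma le_E_ln x y : X <= x -> x <= y -> `|E y - E x| <= eb * ln (y / x).
Proof.
move=> Xx; have x0 : 0 < x by exact: lt_le_trans Xx.
rewrite le_eqVlt => /orP[/eqP <-|xy].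
  by rewrite subrr normr0 divff ?gt_eqF// ln1 mulr0.
have y0 : 0 < y by exact: lt_trans xy.
have D1 (k : R) : exists2 z, X <= z & E y - E x + k * ln (y / x) = (z * P z - gamma + k) * ((y - x) / z).
  pose D z := E z + k * ln z.
  have dD (z : R) : 0 < z -> is_derive z (1 : R) D ((z * P z - gamma + k) / z).
    move=> z0; have d1 := dE z0; have d2 := is_derive1_ln z0.
    by rewrite /D; apply: is_derive_eq; rewrite /GRing.scale/=; field; rewrite gt_eqF.
  have zI z : z \in `[x, y] -> 0 < z /\ X <= z.
    by rewrite in_itv/= => /andP[xz _]; rewrite (lt_le_trans x0)// (le_trans Xx).
  have [z zxy E1] := @MVT _ D (fun z => (z * P z - gamma + k) / z) x y xy
    (fun z zI' => dD z (proj1 (zI z (subset_itv_oo_cc zI'))))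
    (derivable_within_continuous (fun z zI' => @ex_derive _ _ _ _ _ _ _ (dD z (proj1 (zI z zI'))))).
  have [z0 Xz] := zI z (subset_itv_oo_cc zxy).
  exists z => //; transitivity (D y - D x); first by rewrite /D ln_div ?posrE//; ring.
  by rewrite E1; ring.
have nn z : X <= z -> 0 <= (y - x) / z.
  by move=> Xz; rewrite divr_ge0 ?subr_ge0 ?(ltW xy)// (le_trans (ltW X0)).
rewrite ler_norml; apply/andP; split.
- have [z Xz E1] := D1 eb; rewrite lerNl -subr_ge0 opprK addrC E1.
  rewrite mulr_ge0 ?nn//.
  by have := HP Xz; rewrite ler_norml => /andP[]; rewrite lerNl -subr_ge0 opprK addrC.
- have [z Xz E1] := D1 (- eb); rewrite -subr_le0 -mulNr E1.
  rewrite mulr_le0_ge0 ?nn//.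
  by have := HP Xz; rewrite ler_norml => /andP[_]; rewrite subr_le0.
Qed.

End oscillation.

(* The part of the residual of F(eta) exp (E(a sqrt t) - E(x)) that is due to x E'(x) <> 0. *)
Lemma residual_error (a eb C h f f' e e1 e2 : R) : 0 < h <= a -> 0 <= f <= C * h -> `|f'| <= C ->
  0 <= e -> e <= Num.sqrt a / Num.sqrt h -> `|e1| <= eb -> `|e2| <= eb -> eb <= 1 ->
  e * `|e1 * f / 2 + 2 * e2 * f' / h - e2 ^+ 2 * f / h ^+ 2| <=
  eb * (C * Num.sqrt a * (a ^+ 2 / 2 + 3)) / (h * Num.sqrt h).
Proof.
move=> /andP[h0 ha] /andP[f0 fC] f'C e0 ea b1 b2 eb1.
have s0 : 0 < Num.sqrt h by rewrite sqrtr_gt0.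
have eb0 : 0 <= eb by exact: le_trans b1.
have C0 : 0 <= C by exact: le_trans f'C.
have T1 : `|e1 * f / 2| <= eb * (C * h / 2).
  rewrite -mulrA normrM (ger0_norm (_ : 0 <= f / 2)) ?divr_ge0//.
  by apply: ler_pM; rewrite ?divr_ge0// ler_pM2r.
have T2 : `|2 * e2 * f' / h| <= eb * (2 * C / h).
  rewrite !normrM ger0_norm// (ger0_norm (_ : 0 <= h^-1)) ?invr_ge0 ?(ltW h0)//.
  rewrite (_ : eb * _ = 2 * eb * C / h); last by ring.
  rewrite ler_pM2r ?invr_gt0//.
  have H2 : 2 * `|e2| <= 2 * eb by rewrite ler_wpM2l.
  by apply: (ler_pM _ _ H2 f'C) => //; rewrite mulr_ge0.
have T3 : `|e2 ^+ 2 * f / h ^+ 2| <= eb * (C / h).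
  have h20 : 0 < h ^+ 2 by rewrite exprn_gt0.
  rewrite -mulrA normrM normrX (ger0_norm (_ : 0 <= f / h ^+ 2)) ?divr_ge0 ?(ltW h20)//.
  apply: ler_pM; rewrite ?sqr_ge0 ?divr_ge0 ?(ltW h20)//.
    rewrite expr2 -[leRHS]mulr1; apply: ler_pM => //; exact: le_trans b2 eb1.
  by rewrite ler_pdivrMr// expr2 mulrA divfK ?gt_eqF.
have T : `|e1 * f / 2 + 2 * e2 * f' / h - e2 ^+ 2 * f / h ^+ 2| <= eb * (C * (h ^+ 2 / 2 + 3)) / h.
  apply: (le_trans (ler_normB _ _)); apply: (le_trans (lerD (ler_normD _ _) (lexx _))).
  apply: (le_trans (lerD (lerD T1 T2) T3)).
  by rewrite le_eqVlt; apply/orP; left; apply/eqP; field; rewrite gt_eqF.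
apply: (le_trans (ler_pM e0 (normr_ge0 _) ea T)).
rewrite (_ : Num.sqrt a / Num.sqrt h * _ = eb * (C * Num.sqrt a * (h ^+ 2 / 2 + 3)) / (h * Num.sqrt h)); last first.
  by field; rewrite !gt_eqF.
rewrite ler_pM2r ?invr_gt0 ?mulr_gt0// ler_wpM2l// ler_wpM2l ?mulr_ge0 ?sqrtr_ge0// lerD2r ler_pM2r//.
by rewrite ler_pXn2r ?nnegrE ?(ltW h0)// (le_trans (ltW h0)).
Qed.

End barrier_estimates.

Section barrier.
Variable R : realType.
Variables (alpha beta ustar gamma : R) (u p : R -> R -> R).
Hypotheses (alpha_gt0 : 0 < alpha) (beta_gt0 : 0 < beta) (gamma_ge0 : 0 <= gamma).
Hypothesis W : weak_solution alpha beta ustar u p.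
Implicit Types x t h : R.

Section shape.
Variables (P pi E : R -> R) (a : R).
Hypotheses (mpi : measurable_fun setT pi) (pi01 : forall x : R, 0 <= pi x <= 1)
  (Ppi : is_primitive P pi) (a_gt0 : 0 < a)
  (dE : forall x : R, 0 < x -> is_derive x (1 : R) E (P x - gamma / x)).

(** Normalised to 1 on the curve x = a sqrt t. *)
Definition amplitude x t := expR (E (a * Num.sqrt t) - E x).

(** The reaction term [pi * f * amplitude] appears exactly. If [f] solves the profile equation,
    every other term carries a factor [e1] (from the time derivative) or [e2] (from the space
    derivative), and both are small by hypothesis on P. *)
Lemma heat_amplitude (f f' f'' : R -> R) x t : 0 < x -> 0 < t ->
  (forall h : R, 0 < h -> [/\ is_derive h (1 : R) f (f' h), is_derive h (1 : R) f' (f'' h) &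
    {for h, continuous f''}]) ->
  heat_near P pi (fun x t => f (x / Num.sqrt t) * amplitude x t)
    (fun x t => let h := x / Num.sqrt t in
       let e1 := a * Num.sqrt t * P (a * Num.sqrt t) - gamma in let e2 := x * P x - gamma in
       amplitude x t / t * (e1 * f h / 2 + 2 * e2 * f' h / h - e2 ^+ 2 * f h / h ^+ 2 -
         (f'' h + h / 2 * f' h - gamma / h ^+ 2 * f h)) - pi x * (f h * amplitude x t)) (x, t).
Proof.
move=> x0 t0 Hf; have cP := continuous_primitive mpi pi01 Ppi.
have h0 : 0 < x / Num.sqrt t by rewrite divr_gt0// sqrtr_gt0.
have Hf' : \forall h \near x / Num.sqrt t, [/\ is_derive h (1 : R) f (f' h),
     is_derive h (1 : R) f' (f'' h) & {for h, continuous f''}].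
  by apply: filterS (lt_nbhsr h0) => h; exact: Hf.
have := heat_near_expM (E := E) (q := fun x => gamma / x) (q' := fun x => - (gamma / x ^+ 2))
  (A := fun t => E (a * Num.sqrt t))
  (A' := fun t => (P (a * Num.sqrt t) - gamma / (a * Num.sqrt t)) * (a / (2 * Num.sqrt t)))
  Ppi (smooth_selfsimilar0 t0 Hf') cP.
have HE : \forall x \near x, [/\ is_derive x (1 : R) E (P x - gamma / x),
    is_derive x (1 : R) (fun x : R => gamma / x) (- (gamma / x ^+ 2)) &
    {for x, continuous (fun x : R => - (gamma / x ^+ 2))}].
  apply: filterS (lt_nbhsr x0) => y y0; split; first exact: dE.
    have dV := is_deriveV (f := fun z : R => z) (lt0r_neq0 y0) (is_derive_id y 1).
    by apply: is_derive_eq; rewrite /GRing.scale/=; field; rewrite gt_eqF.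
  apply: cvgN; apply: cvgM; first exact: cvg_cst.
  by apply: cvgV; [rewrite expf_eq0/= gt_eqF|exact: exprn_continuous].
have HA : \forall t \near t, is_derive t (1 : R) (fun t => E (a * Num.sqrt t))
    ((P (a * Num.sqrt t) - gamma / (a * Num.sqrt t)) * (a / (2 * Num.sqrt t))) /\
    {for t, continuous (fun t : R => (P (a * Num.sqrt t) - gamma / (a * Num.sqrt t)) * (a / (2 * Num.sqrt t)))}.
  apply: filterS (lt_nbhsr t0) => s s0; have r0 : 0 < Num.sqrt s by rewrite sqrtr_gt0.
  have as0 : 0 < a * Num.sqrt s by rewrite mulr_gt0.
  split.
    have ds := is_derive1_sqrt s0.
    have das : is_derive s (1 : R) (fun t => a * Num.sqrt t) (a / (2 * Num.sqrt s)).
      by apply: is_derive_eq; rewrite /GRing.scale/=; ring.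
    exact: (@is_derive_compE _ E (fun t => a * Num.sqrt t) s _ _ _ (dE as0) das (erefl _)).
  have cs : {for s, continuous (@Num.sqrt R)} by exact: sqrt_continuous.
  have ca : {for s, continuous (fun t => a * Num.sqrt t)} by apply: cvgM; [exact: cvg_cst|exact: cs].
  apply: cvgM; last first.
    apply: cvgM; [exact: cvg_cst|apply: cvgV; first by rewrite mulf_neq0// gt_eqF].
    by apply: cvgM; [exact: cvg_cst|exact: cs].
  apply: cvgB; first by apply: (@continuous_comp _ _ _ (fun t => a * Num.sqrt t) P) => //; exact: cP.
  by apply: cvgM; [exact: cvg_cst|apply: cvgV; [rewrite gt_eqF|exact: ca]].
move=> /(_ HE HA); apply: heat_near_eq; first by near=> z.
near=> z; have z1 : 0 < z.1 by near: z; exact: near_fst_gt.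
have z2 : 0 < z.2 by near: z; exact: near_snd_gt.
rewrite /amplitude/=; move: (P (_ * _)) (P z.1) (pi z.1) (expR _) => k1 k2 k3 k4.
have r0 : 0 < Num.sqrt z.2 by rewrite sqrtr_gt0.
move: (f _) (f' _) (f'' _) => k5 k6 k7.
move: (z.1) (z.2) (Num.sqrt z.2) z1 z2 r0 (sqr_sqrtr (ltW z2)) => y s r y0 s0 r0 <-.
by field; rewrite !gt_eqF.
Unshelve. all: by end_near. Qed.

End shape.

End barrier.

(* With sg = 1 and a = alpha the barrier bounds u from above; with sg = -1 and a > alpha it bounds u from below,
   the layer alpha < eta < a being needed since there p may be smaller than its final value. *)
Section comparison.
Variable R : realType.
Notation leb := (@lebesgue_measure R).
Variables (alpha beta ustar gamma : R) (u p : R -> R -> R).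
Hypotheses (alpha_gt0 : 0 < alpha) (beta_gt0 : 0 < beta) (gamma_ge0 : 0 <= gamma).
Hypothesis W : weak_solution alpha beta ustar u p.
Implicit Types x t h : R.
Local Notation w := (wfun alpha beta u).
Local Notation c0 := (alpha * beta / 2 * expR (alpha ^+ 2 / 4)).
Variables (F F' F'' : R -> R) (C U : R).
Hypotheses (dF : forall h : R, 0 < h -> [/\ is_derive h (1 : R) F (F' h), is_derive h (1 : R) F' (F'' h),
    {for h, continuous F''} & F'' h + h / 2 * F' h = gamma / h ^+ 2 * F h])
  (Fbound : forall h, 0 < h <= alpha -> 0 <= F h <= C * h /\ `|F' h| <= C)
  (FU : F alpha = U) (U_gt0 : 0 < U)
  (transmission : U * gauss4 alpha / tail4 alpha + F' alpha = alpha * beta / 2).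
Variables (N : set R) (P pi E : R -> R).
Hypotheses (N0 : leb.-negligible N) (mpi : measurable_fun setT pi) (pi01 : forall x : R, 0 <= pi x <= 1)
  (Ppi : is_primitive P pi) (dE : forall x : R, 0 < x -> is_derive x (1 : R) E (P x - gamma / x))
  (ppi : forall x t, 0 < x -> ~ N x -> x ^+ 2 / alpha ^+ 2 < t -> p x t = pi x).
Variables (sg a eps eb K A B X T0 : R).
Local Notation Q := (@tail4 R).
Local Notation G := (@gauss4 R).
Local Notation c2 := (U / tail4 alpha).
Local Notation C' := (C + U / alpha + c2).
(** [c1] lets the singular term of the error absorb the residual; [c2'] gives the corner at eta =
    alpha the right sign when alpha < a, and [c3] the corner at eta = a. [c4] lets the correction
    absorb the term gamma / x^2 in the layer and its own corner at eta = a. *)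
Hypotheses (sgE : (sg = 1 /\ a = alpha) \/ (sg = -1 /\ alpha < a))
  (eps_gt0 : 0 < eps) (K_ge0 : 0 <= K) (A_ge0 : 0 <= A) (B_ge0 : 0 <= B) (X_gt0 : 0 < X)
  (T0_gt0 : 0 < T0)
  (eb_le : eb <= 1 / 4) (Peb : forall x, X <= x -> `|x * P x - gamma| <= eb)
  (c1 : eb * (C' * Num.sqrt a * (a ^+ 2 / 2 + 3)) <= eps * G a / 8)
  (c2' : alpha * beta / 2 * (expR (eb * ln (a / alpha)) - 1) < eps * G alpha)
  (c3 : U * eb / alpha < eps * G a)
  (c4 : gamma / alpha ^+ 2 * U * (Num.sqrt a / Num.sqrt alpha) <= 2 * B /\ 2 * B <= A * G a)
  (dry : alpha < a -> forall x t, T0 <= t -> a * Num.sqrt t < x -> p x t = 0).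

(** The minima and maxima join the branches: the inner profile up to alpha, the Gaussian tail beyond
    it, and amplitude frozen at 1 beyond a sqrt t. *)
Definition guess x t := let h := x / Num.sqrt t in
  (F (Num.min h alpha) + c2 * (Q (Num.max h alpha) - Q alpha)) *
  expR (E (a * Num.sqrt t) - E (Num.min x (a * Num.sqrt t))).

(** The quadratic term acts only in the layer alpha < h < a, where the tail solves the profile
    equation without the term gamma / h^2; the tail term pays for the corner that the quadratic
    makes at h = a. Both vanish when a = alpha. *)
Definition correction h := A * (a - alpha) * Q (Num.max h a) +
  B * ((a - alpha) ^+ 2 - (Num.max alpha (Num.min h a) - alpha) ^+ 2).

(** The first term absorbs the residual and makes the corners strictly convex, the last one,
    decaying in time, covers the initial discrepancy at T0. *)
Definition error x t := let h := x / Num.sqrt t in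
  eps * (sqrt_gauss h + Q (Num.max h alpha) + Q (Num.max h a)) + correction h +
  K * (scale_pow (1 / 4) t * G h).

Definition gap x t := sg * (u x t - guess x t) - error x t.

Let alpha_le_a : alpha <= a. Proof. by case: sgE => -[_]; [move=> ->|move/ltW]. Qed.
Let a_gt0 : 0 < a. Proof. exact: lt_le_trans alpha_le_a. Qed.
Let sg1 : sg = 1 \/ sg = -1. Proof. by case: sgE => -[]; [left|right]. Qed.
Let tQ h : 0 < Q h. Proof. exact: tail4_gt0. Qed.
Let c2_gt0 : 0 < c2. Proof. by rewrite divr_gt0. Qed.
Let C_ge0 : 0 <= C.
Proof. by have [|_] := Fbound (h := alpha); [rewrite alpha_gt0 lexx|exact: le_trans]. Qed.
Let C'C : C <= C'. Proof. by rewrite -addrA lerDl addr_ge0// divr_ge0// ltW. Qed.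
Let c2Q : c2 * Q alpha = U. Proof. by rewrite divfK ?gt_eqF. Qed.
Let c0G : c0 * G alpha = alpha * beta / 2.
Proof. by rewrite -mulrA /gauss4 -expRD subrr expR0 mulr1. Qed.
Let eb_ge0 : 0 <= eb. Proof. exact: le_trans (normr_ge0 _) (Peb (lexx X)). Qed.

Let etaP x t h : 0 < t -> (x / Num.sqrt t <= h) = (x <= h * Num.sqrt t).
Proof. by move=> t0; rewrite ler_pdivrMr// sqrtr_gt0. Qed.
Let etaP' x t h : 0 < t -> (h <= x / Num.sqrt t) = (h * Num.sqrt t <= x).
Proof. by move=> t0; rewrite ler_pdivlMr// sqrtr_gt0. Qed.

Local Notation amp := (amplitude E a).

Lemma gap_inner x t : 0 < t -> x <= alpha * Num.sqrt t ->
  gap x t = sg * (u x t - F (x / Num.sqrt t) * amp x t) - (eps * (sqrt_gauss (x / Num.sqrt t) + Q alpha + Q a)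
   + (A * (a - alpha) * Q a + B * (a - alpha) ^+ 2) + K * (scale_pow (1 / 4) t * G (x / Num.sqrt t))).
Proof.
move=> t0 xt; have s0 : 0 < Num.sqrt t by rewrite sqrtr_gt0.
have ha : x / Num.sqrt t <= alpha by rewrite etaP.
have xa : x <= a * Num.sqrt t by rewrite (le_trans xt)// ler_pM2r.
have ha' := le_trans ha alpha_le_a.
rewrite /gap /guess /error /correction /= (min_l ha) (min_l ha') (max_r ha) (max_r ha') (min_l xa) (max_l ha).
by rewrite !subrr mulr0 addr0 expr0n/= subr0.
Qed.

Lemma gap_layer x t : 0 < t -> alpha * Num.sqrt t <= x -> x <= a * Num.sqrt t ->
  gap x t = sg * (u x t - c2 * Q (x / Num.sqrt t) * amp x t) -
   (eps * (sqrt_gauss (x / Num.sqrt t) + Q (x / Num.sqrt t) + Q a)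
   + (A * (a - alpha) * Q a + B * ((a - alpha) ^+ 2 - (x / Num.sqrt t - alpha) ^+ 2)) +
   K * (scale_pow (1 / 4) t * G (x / Num.sqrt t))).
Proof.
move=> t0 xt xa; have s0 : 0 < Num.sqrt t by rewrite sqrtr_gt0.
have ha : alpha <= x / Num.sqrt t by rewrite etaP'.
have ha' : x / Num.sqrt t <= a by rewrite etaP.
rewrite /gap /guess /error /correction /= (min_r ha) (min_l ha') (max_l ha) (max_r ha') (min_l xa) (max_r ha).
by rewrite (mulrBr c2) c2Q FU addrCA subrr addr0.
Qed.

Lemma gap_outer x t : 0 < t -> a * Num.sqrt t <= x ->
  gap x t = sg * (u x t - c2 * Q (x / Num.sqrt t)) -
   (eps * (sqrt_gauss (x / Num.sqrt t) + Q (x / Num.sqrt t) + Q (x / Num.sqrt t))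
   + A * (a - alpha) * Q (x / Num.sqrt t) + K * (scale_pow (1 / 4) t * G (x / Num.sqrt t))).
Proof.
move=> t0 xa; have s0 : 0 < Num.sqrt t by rewrite sqrtr_gt0.
have ha' : a <= x / Num.sqrt t by rewrite etaP'.
have ha := le_trans alpha_le_a ha'.
rewrite /gap /guess /error /correction /= (min_r ha) (min_r ha') (max_l ha) (max_l ha') (min_r xa) (max_r alpha_le_a).
by rewrite (mulrBr c2) c2Q FU addrCA !subrr addr0 mulr0 expR0 mulr1 addr0.
Qed.

Lemma correction_ge0 h : 0 <= correction h.
Proof.
apply: addr_ge0; first by apply: mulr_ge0; [apply: mulr_ge0; rewrite ?subr_ge0|exact: ltW].
have /andP[l1 l2] : alpha <= Num.max alpha (Num.min h a) <= a.
  by rewrite le_max lexx/= ge_max alpha_le_a ge_min lexx orbT.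
by apply: mulr_ge0 => //; rewrite subr_ge0 ler_pXn2r ?nnegrE ?subr_ge0// lerB.
Qed.

(** The error is nonnegative; so where [gap] is positive the difference of the two reaction terms
    has the favourable sign. *)
Lemma gap_le x t : gap x t <= sg * (u x t - guess x t).
Proof.
rewrite lerBlDr lerDl; apply: addr_ge0; last first.
  by apply: mulr_ge0 => //; apply: mulr_ge0; apply: ltW; [exact: scale_pow_gt0|exact: gauss4_gt0].
apply: addr_ge0; last exact: correction_ge0.
apply: mulr_ge0; first exact: ltW.
apply: addr_ge0; last exact/ltW/tQ.
apply: addr_ge0; last exact/ltW/tQ.
by apply: mulr_ge0; [exact: sqrtr_ge0|exact/ltW/gauss4_gt0].
Qed.

Lemma cont2_guess x t : 0 < x -> 0 < t -> cont2 guess (x, t).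
Proof.
move=> x0 t0; have s0 : 0 < Num.sqrt t by rewrite sqrtr_gt0.
have ch : cont2 (fun x t => x / Num.sqrt t) (x, t) by exact: cont2_div_sqrt.
have cF h : 0 < h -> {for h, continuous F}.
  by move=> h0; have [d _ _ _] := dF h0; exact: is_derive_continuous d.
have cE h : 0 < h -> {for h, continuous E} by move=> h0; exact: is_derive_continuous (dE h0).
have cs : cont2 (fun _ t => a * Num.sqrt t) (x, t).
  by apply: cont2M; [exact: cont2_cst|apply: (@cont2_snd _ (@Num.sqrt R)); exact: sqrt_continuous].
apply: cont2M.
  apply: cont2D.
    apply: (@cont2_comp _ F (fun x t => Num.min (x / Num.sqrt t) alpha)).
      by apply: cF; rewrite lt_min alpha_gt0 divr_gt0.
    by apply: continuous_min; [exact: ch|exact: cvg_cst].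
  apply: cont2M; first exact: cont2_cst.
  apply: cont2B; last exact: cont2_cst.
  apply: (@cont2_comp _ Q (fun x t => Num.max (x / Num.sqrt t) alpha)); first exact: continuous_tail4.
  by apply: continuous_max; [exact: ch|exact: cvg_cst].
apply: (@cont2_comp _ expR (fun x t => E (a * Num.sqrt t) - E (Num.min x (a * Num.sqrt t)))).
  exact: continuous_expR.
apply: cont2B; apply: (@cont2_comp _ E).
- by apply: cE; rewrite mulr_gt0.
- exact: cs.
- by apply: cE; rewrite lt_min x0 mulr_gt0.
- by apply: continuous_min; [exact: cvg_fst|exact: cs].
Qed.

Lemma cont2_gap x t : 0 < x -> 0 < t -> cont2 gap (x, t).
Proof.
move=> x0 t0; have s0 : 0 < Num.sqrt t by rewrite sqrtr_gt0.
have ch : cont2 (fun x t => x / Num.sqrt t) (x, t) by exact: cont2_div_sqrt.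
have cmax b : cont2 (fun x t => Num.max (x / Num.sqrt t) b) (x, t).
  by apply: continuous_max; [exact: ch|exact: cvg_cst].
have cmin b : cont2 (fun x t => Num.min (x / Num.sqrt t) b) (x, t).
  by apply: continuous_min; [exact: ch|exact: cvg_cst].
have cQm b : cont2 (fun x t => Q (Num.max (x / Num.sqrt t) b)) (x, t).
  by apply: (@cont2_comp _ Q _ _ _ (cmax b)); exact: continuous_tail4.
have cG : cont2 (fun x t => G (x / Num.sqrt t)) (x, t).
  by apply: (@cont2_comp _ G _ _ _ ch); exact: continuous_gauss4.
apply: cont2B.
  apply: cont2M; first exact: cont2_cst.
  by apply: cont2B; [exact: (u_cont W)|exact: cont2_guess].
apply: cont2D; last first.
  apply: cont2M; first exact: cont2_cst.
  by apply: cont2M; [exact: cont2_scale_pow|exact: cG].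
apply: cont2D.
  apply: cont2M; first exact: cont2_cst.
  apply: cont2D; last exact: cQm.
  apply: cont2D; last exact: cQm.
  apply: (@cont2_comp _ (@sqrt_gauss R) _ _ _ ch) => /=.
  by apply: is_derive_continuous (is_derive_sqrt_gauss _); rewrite divr_gt0.
apply: cont2D; first by apply: cont2M; [exact: cont2_cst|exact: cQm].
apply: cont2M; first exact: cont2_cst.
apply: cont2B; first exact: cont2_cst.
apply: (@cont2_comp _ (fun h => (Num.max alpha h - alpha) ^+ 2) _ _ _ (cmin a)).
apply: (@continuous_comp _ _ _ (fun h => Num.max alpha h - alpha) (fun h => h ^+ 2)); last exact: exprn_continuous.
apply: cvgB; last exact: cvg_cst.
by apply: (@continuous_max _ _ (fun => alpha) id); [exact: cvg_cst|exact: cvg_id].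
Qed.

Let k_ h : R := (4 * (h * Num.sqrt h))^-1.
(** Half of the singular heat production of [eps * sqrt_gauss]; the other half is reserved for the
    residual. *)
Let margin x t := eps * G (x / Num.sqrt t) * k_ (x / Num.sqrt t) / (2 * t).

Let cont2_margin x t : 0 < x -> 0 < t -> cont2 margin (x, t) /\ 0 < margin x t.
Proof.
move=> x0 t0; have s0 : 0 < Num.sqrt t by rewrite sqrtr_gt0.
have h0 : 0 < x / Num.sqrt t by rewrite divr_gt0.
have r0 : 0 < Num.sqrt (x / Num.sqrt t) by rewrite sqrtr_gt0.
have hr0 : 0 < 4 * (x / Num.sqrt t * Num.sqrt (x / Num.sqrt t)) by rewrite mulr_gt0// mulr_gt0.
have ch : cont2 (fun x t => x / Num.sqrt t) (x, t) by exact: cont2_div_sqrt.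
split; last first.
  rewrite /margin; apply: divr_gt0; last by rewrite mulr_gt0.
  by apply: mulr_gt0; [apply: mulr_gt0; [|exact: gauss4_gt0]|rewrite invr_gt0].
apply: cont2M; last first.
  apply: (@cont2_snd _ (fun t => (2 * t)^-1)); apply: cvgV; first by rewrite mulf_neq0// gt_eqF.
  by apply: cvgM; [exact: cvg_cst|exact: cvg_id].
apply: cont2M.
  apply: cont2M; first exact: cont2_cst.
  by apply: (@cont2_comp _ G _ _ _ ch); exact: continuous_gauss4.
apply: (@cont2_comp _ k_ _ _ _ ch) => /=.
apply: cvgV; first by rewrite gt_eqF.
apply: cvgM; first exact: cvg_cst.
by apply: cvgM; [exact: cvg_id|exact: sqrt_continuous].
Qed.

Let heat_rest P' pi' x t : 0 < x -> 0 < t -> heat_near P' pi'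
  (fun x t => - eps * sqrt_gauss (x / Num.sqrt t) + - K * (scale_pow (1 / 4) t * G (x / Num.sqrt t)))
  (fun x t => - eps * (G (x / Num.sqrt t) * (k_ (x / Num.sqrt t) + 3 / 4 * Num.sqrt (x / Num.sqrt t)) / t)
     + - K * (scale_pow (1 / 4) t * G (x / Num.sqrt t) / (4 * t))) (x, t).
Proof.
by move=> x0 t0; apply: heat_nearD; apply: heat_nearZ; [exact: heat_sqrt_gauss|exact: heat_gauss4_pow].
Qed.

Let heat_cst P' pi' (k : R) x t : heat_near P' pi' (fun _ _ => k) (fun _ _ => 0 - 0) (x, t).
Proof.
apply: (@heat_near_smooth _ P' pi' _ (fun _ _ => 0) (fun _ _ => 0) (fun _ _ => 0)).
near=> z; split; first by split; exact: cont2_cst.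
by split; exact: is_derive_cst.
Unshelve. all: by end_near. Qed.

Let near_gap_gt0 x t : 0 < x -> 0 < t -> 0 < gap x t ->
  \forall z \near ((x, t) : R * R), 0 < sg * (u z.1 z.2 - guess z.1 z.2).
Proof.
move=> x0 t0 g0; apply: filterS (cvgr_gt _ (cont2_gap x0 t0) _ g0) => z zg.
exact: lt_le_trans zg (gap_le _ _).
Qed.

Let amp_le x t : 0 < t -> X <= x -> x <= a * Num.sqrt t ->
  amp x t <= Num.sqrt a / Num.sqrt (x / Num.sqrt t).
Proof.
move=> t0 Xx xa; have s0 : 0 < Num.sqrt t by rewrite sqrtr_gt0.
have x0 : 0 < x by exact: lt_le_trans Xx.
have := le_E_ln X_gt0 dE Peb Xx xa => /(le_trans (ler_norm _)) H.
have q0 : 0 < a * Num.sqrt t / x by rewrite divr_gt0// mulr_gt0.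
have l0 : 0 <= ln (a * Num.sqrt t / x) by rewrite ln_ge0// ler_pdivlMr// mul1r.
rewrite /amplitude (@le_trans _ _ (expR (ln (a * Num.sqrt t / x) / 2)))//.
  rewrite ler_expR (le_trans H)// mulrC ler_wpM2l// (le_trans eb_le)//; lra.
rewrite sqrt_expR// (_ : a * Num.sqrt t / x = a / (x / Num.sqrt t)); last first.
  by field; rewrite !gt_eqF.
by rewrite sqrtrM; [rewrite sqrtrV; [|apply: ltW; rewrite divr_gt0]|exact: ltW].
Qed.

(** Here [s] stands for the barrier and [v] for [u]: the reaction terms combine to
    [- pi0 * (sg * (v - s))], which is at most 0. *)
Let residual_margin (h t q r s v pi0 : R) : 0 < t -> 0 <= q -> 0 <= pi0 ->
  q * `|r| <= eps * G h * k_ h / 2 -> 0 <= sg * (v - s) ->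
  - sg * (q / t * r - pi0 * s) + (- eps * (G h * (k_ h + 3 / 4 * Num.sqrt h) / t)
     + - K * (scale_pow (1 / 4) t * G h / (4 * t))) - sg * (pi0 * v) <= - (eps * G h * k_ h / (2 * t)).
Proof.
move=> t0 q0 p0 qr vs.
have g0 := gauss4_gt0 h; have sp0 := scale_pow_gt0 (1 / 4) t.
have H1 : 0 <= pi0 * (sg * (v - s)) by exact: mulr_ge0.
have H2 : 0 <= eps * (G h * (3 / 4 * Num.sqrt h)) / t.
  apply: divr_ge0; last exact: ltW.
  apply: mulr_ge0; first exact: ltW.
  by apply: mulr_ge0; [exact: ltW|rewrite mulr_ge0// sqrtr_ge0].
have H3 : 0 <= K * (scale_pow (1 / 4) t * G h / (4 * t)).
  apply: mulr_ge0 => //; apply: divr_ge0; last by rewrite mulr_ge0// ltW.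
  by apply: mulr_ge0; exact: ltW.
have H4 : - sg * (q * r) <= eps * G h * k_ h / 2.
  rewrite (le_trans _ qr)// mulrCA ler_wpM2l//.
  by case: sg1 => ->; rewrite ?opprK ?mulN1r ?mul1r; [rewrite lerNl lerNnormlW|exact: ler_norm].
have H5 : - sg * (q * r) / t <= eps * G h * k_ h / 2 / t by rewrite ler_pM2r ?invr_gt0.
have -> : - sg * (q / t * r - pi0 * s) + (- eps * (G h * (k_ h + 3 / 4 * Num.sqrt h) / t)
     + - K * (scale_pow (1 / 4) t * G h / (4 * t))) - sg * (pi0 * v) =
   - sg * (q * r) / t - pi0 * (sg * (v - s)) - eps * (G h * k_ h) / t - eps * (G h * (3 / 4 * Num.sqrt h)) / t
   - K * (scale_pow (1 / 4) t * G h / (4 * t)) by ring.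
have -> : eps * G h * k_ h / (2 * t) = eps * (G h * k_ h) / t - eps * G h * k_ h / 2 / t.
  by field; rewrite gt_eqF.
by move: H1 H2 H3 H5; lra.
Qed.

Let le_gauss4 h h' : 0 <= h -> h <= h' -> G h' <= G h.
Proof.
move=> h0 hh; rewrite ler_expR lerN2 ler_pM2r// ler_pXn2r// nnegrE//; exact: le_trans hh.
Qed.

Let residual_small h f f' q e1 e2 : 0 < h <= a -> 0 <= f <= C' * h -> `|f'| <= C' ->
  0 <= q -> q <= Num.sqrt a / Num.sqrt h -> `|e1| <= eb -> `|e2| <= eb ->
  q * `|e1 * f / 2 + 2 * e2 * f' / h - e2 ^+ 2 * f / h ^+ 2| <= eps * G h * k_ h / 2.
Proof.
move=> /[dup] hI /andP[h0 ha] fI f'I q0 qI e1I e2I.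
have eb1 : eb <= 1 by rewrite (le_trans eb_le)//; lra.
apply: le_trans (residual_error hI fI f'I q0 qI e1I e2I eb1) _.
have s0 : 0 < h * Num.sqrt h by rewrite mulr_gt0// sqrtr_gt0.
rewrite [leRHS](_ : _ = (eps * G h / 8) / (h * Num.sqrt h)).
  have GG : G a <= G h by apply: le_gauss4 => //; exact: ltW.
  by rewrite ler_pM2r ?invr_gt0//; apply: (le_trans c1); rewrite ler_pM2r// ler_pM2l.
by rewrite /k_; move: (h * _) s0 => y y0; field; rewrite ?gt_eqF.
Qed.

Let near_inside (h1 h2 : R) x t : 0 < t -> h1 * Num.sqrt t < x -> x < h2 * Num.sqrt t ->
  \forall z \near ((x, t) : R * R), h1 * Num.sqrt z.2 < z.1 /\ z.1 < h2 * Num.sqrt z.2.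
Proof.
move=> t0 x1 x2; have s0 : 0 < Num.sqrt t by rewrite sqrtr_gt0.
have H1 : \forall h \near x / Num.sqrt t, h1 < h by apply: lt_nbhsr; rewrite ltr_pdivlMr.
have H2 : \forall h \near x / Num.sqrt t, h < h2 by apply: lt_nbhsl; rewrite ltr_pdivrMr.
apply: filterS2 (near_snd_gt x t0) (near_div_sqrt t0 (filterI H1 H2)) => z z0 /= [].
by rewrite ltr_pdivlMr ?sqrtr_gt0// ltr_pdivrMr ?sqrtr_gt0.
Qed.

Let near_XT x t : X < x -> T0 < t -> \forall z \near ((x, t) : R * R), X < z.1 /\ T0 < z.2.
Proof.
by move=> Xx Tt; apply: filterS2 (near_fst t (lt_nbhsr Xx)) (near_snd x (lt_nbhsr Tt)).
Qed.

Let ppi_inner x t : 0 < x -> 0 < t -> ~ N x -> x < alpha * Num.sqrt t -> p x t = pi x.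
Proof.
move=> x0 t0 Nx xt; apply: ppi => //; rewrite ltr_pdivrMr ?exprn_gt0//.
rewrite -[t in ltRHS]sqr_sqrtr ?ltW// -exprMn ltr_pXn2r// ?nnegrE ?(ltW x0)// mulrC//.
by rewrite ltW// (lt_trans x0).
Qed.

(** [p] is nondecreasing in time and [pi x] is its final value. *)
Let p_le_pi x t : 0 < x -> 0 < t -> ~ N x -> p x t <= pi x.
Proof.
move=> x0 t0 Nx; pose s := Num.max t (x ^+ 2 / alpha ^+ 2 + 1).
rewrite -(@ppi x s)//; last by rewrite /s lt_max ltrDl ltr01 orbT.
by apply: (weak_nondecreasing W) => //; [exact: ltW|rewrite /s le_max lexx].
Qed.

(** Behind the source [p] already has its final value [pi], so the reaction terms match for either
    sign. *)
Lemma no_touch_inner x t : X < x -> T0 < t -> x < alpha * Num.sqrt t -> 0 < gap x t ->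
  ~ (\forall z \near ((x, t) : R * R), z.2 <= t -> gap z.1 z.2 <= gap x t).
Proof.
move=> Xx Tt xt g0 mx; have x0 : 0 < x by exact: lt_trans Xx.
have t0 : 0 < t by exact: lt_trans Tt.
have s0 : 0 < Num.sqrt t by rewrite sqrtr_gt0.
have Hin : \forall z \near ((x, t) : R * R), 0 * Num.sqrt z.2 < z.1 /\ z.1 < alpha * Num.sqrt z.2.
  by apply: near_inside; rewrite ?mul0r.
have HXT := near_XT Xx Tt.
pose k0 := - (eps * (Q alpha + Q a) + (A * (a - alpha) * Q a + B * (a - alpha) ^+ 2)).
have hpsi : heat_near P pi (psi alpha beta) (fun _ _ => 0) (x, t).
  by apply: heat_psi => //; [exact: ltW|rewrite lt_eqF].
have dF' (h : R) : 0 < h -> [/\ is_derive h (1 : R) F (F' h), is_derive h (1 : R) F' (F'' h) &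
    {for h, continuous F''}] by move=> /dF[].
have Hg := heat_nearD (heat_nearD (heat_nearZ sg hpsi)
   (heat_nearZ (- sg) (heat_amplitude mpi pi01 Ppi a_gt0 dE x0 t0 dF')))
   (heat_nearD (heat_rest P pi x0 t0) (heat_cst P pi k0 x t)).
have [cm m0] := cont2_margin x0 t0.
have Hp : \forall z \near ((x, t) : R * R), ~ N z.1 ->
     sg * (pi z.1 * u z.1 z.2) <= sg * (p z.1 z.2 * u z.1 z.2).
  apply: filterS2 Hin HXT => z [_ zt] [Xz Tz] Nz.
  by rewrite ppi_inner//; [exact: lt_trans Xz|exact: lt_trans Tz].
apply: (touchingh alpha_gt0 beta_gt0 W sg1 t0 N0 mpi pi01 Ppi Hg Hp cm m0) => /=.
  apply: filterS3 Hin HXT (near_gap_gt0 x0 t0 g0) => z [_ zt] [Xz Tz].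
  have z1 : 0 < z.1 by exact: lt_trans Xz.
  have z2 : 0 < z.2 by exact: lt_trans Tz.
  have r0 : 0 < Num.sqrt z.2 by rewrite sqrtr_gt0.
  have h0 : 0 < z.1 / Num.sqrt z.2 by rewrite divr_gt0.
  have ha : z.1 / Num.sqrt z.2 <= alpha by rewrite ler_pdivrMr// ltW.
  have za : z.1 <= a * Num.sqrt z.2 by rewrite (le_trans (ltW zt))// ler_pM2r.
  rewrite /guess /= (min_l ha) (max_r ha) subrr mulr0 addr0 (min_l za) -/(amp _ _).
  have -> : F'' (z.1 / Num.sqrt z.2) + z.1 / Num.sqrt z.2 / 2 * F' (z.1 / Num.sqrt z.2) -
     gamma / (z.1 / Num.sqrt z.2) ^+ 2 * F (z.1 / Num.sqrt z.2) = 0.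
    by have [_ _ _ ->] := dF h0; rewrite subrr.
  move=> us; rewrite !subr0 mulr0 add0r addr0.
  have [/andP[f0 fC] f'C] : 0 <= F (z.1 / Num.sqrt z.2) <= C * (z.1 / Num.sqrt z.2) /\ `|F' (z.1 / Num.sqrt z.2)| <= C.
    by apply: Fbound; rewrite h0.
  have /andP[p0 _] := pi01 z.1.
  apply: residual_margin => //; [exact/expR_ge0| |exact: ltW].
  have hI : 0 < z.1 / Num.sqrt z.2 <= a by rewrite h0 (le_trans ha).
  have fI : 0 <= F (z.1 / Num.sqrt z.2) <= C' * (z.1 / Num.sqrt z.2).
    by rewrite f0 (le_trans fC)// ler_pM2r.
  apply: residual_small hI fI (le_trans f'C C'C) (expR_ge0 _) (amp_le z2 (ltW Xz) za) _ (Peb (ltW Xz)).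
  by apply: Peb; apply: le_trans za; exact: ltW.
apply: filterS3 Hin HXT mx => z [_ zt] [Xz Tz] mz /mz.
have z2 : 0 < z.2 by exact: lt_trans Tz.
have gE y s : 0 < s -> y <= alpha * Num.sqrt s -> gap y s = sg * wfun alpha beta u y s +
    (sg * psi alpha beta y s + - sg * (F (y / Num.sqrt s) * amp y s) + (- eps * sqrt_gauss (y / Num.sqrt s) +
     - K * (scale_pow (1 / 4) s * G (y / Num.sqrt s)) + k0)).
  by move=> s1 ys; rewrite gap_inner// /wfun /k0; ring.
by rewrite !gE// ltW.
Qed.

(** The layer exists only for sg = -1, and then [p <= pi] is the inequality in the right
    direction. *)
Lemma no_touch_layer x t : X < x -> T0 < t -> alpha * Num.sqrt t < x -> x < a * Num.sqrt t -> 0 < gap x t ->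
  ~ (\forall z \near ((x, t) : R * R), z.2 <= t -> gap z.1 z.2 <= gap x t).
Proof.
move=> Xx Tt tx xa g0 mx; have x0 : 0 < x by exact: lt_trans Xx.
have t0 : 0 < t by exact: lt_trans Tt.
have s0 : 0 < Num.sqrt t by rewrite sqrtr_gt0.
have sgN : sg = -1.
  by case: sgE => -[//]; move=> _ aE; move: tx; rewrite -aE => /(lt_trans xa); rewrite ltxx.
have Hin := near_inside t0 tx xa.
have HXT := near_XT Xx Tt.
pose k0 := - (eps * Q a + (A * (a - alpha) * Q a + B * (a - alpha) ^+ 2)).
have hpsi : heat_near P pi (psi alpha beta) (fun _ _ => 0) (x, t).
  by apply: heat_psi => //; [exact: ltW|rewrite gt_eqF].
have dQ (h : R) : 0 < h -> [/\ is_derive h (1 : R) (fun h => c2 * Q h) (- (c2 * G h)),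
    is_derive h (1 : R) (fun h => - (c2 * G h)) (c2 * (h / 2 * G h)) &
    {for h, continuous (fun h => c2 * (h / 2 * G h))}].
  move=> h0; have d1 := is_derive_tail4 h; have d2 := is_derive_gauss4 h.
  split; [by apply: is_derive_eq; rewrite /GRing.scale/=; ring|by apply: is_derive_eq; rewrite /GRing.scale/=; ring|].
  apply: cvgM; first exact: cvg_cst.
  apply: cvgM; last exact: continuous_gauss4.
  by apply: cvgM; [exact: cvg_id|exact: cvg_cst].
have dB : \forall h \near x / Num.sqrt t, [/\ is_derive h (1 : R) (fun h => B * (h - alpha) ^+ 2) (2 * B * (h - alpha)),
    is_derive h (1 : R) (fun h => 2 * B * (h - alpha)) (2 * B) & {for h, continuous (fun _ : R => 2 * B)}].
  near=> h; split; [by apply: is_derive_eq; rewrite /GRing.scale/=; ring| |exact: cvg_cst].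
  by apply: is_derive_eq; rewrite /GRing.scale/=; ring.
have Hg := heat_nearD (heat_nearD (heat_nearD (heat_nearZ sg hpsi)
   (heat_nearZ (- sg) (heat_amplitude mpi pi01 Ppi a_gt0 dE x0 t0 dQ)))
   (heat_nearD (heat_rest P pi x0 t0) (heat_cst P pi k0 x t)))
   (heat_nearD (heat_nearZ (- eps) (heat_tail4 P pi x t0)) (heat_selfsimilar0 P pi t0 dB)).
have [cm m0] := cont2_margin x0 t0.
have Hp : \forall z \near ((x, t) : R * R), ~ N z.1 ->
     sg * (pi z.1 * u z.1 z.2) <= sg * (p z.1 z.2 * u z.1 z.2).
  apply: filterS HXT => z [Xz Tz] Nz; rewrite sgN !mulN1r lerN2.
  apply: ler_wpM2r; first by apply: (u_ge0 alpha_gt0 beta_gt0 W); exact: lt_trans Tz.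
  by apply: p_le_pi => //; [exact: lt_trans Xz|exact: lt_trans Tz].
apply: (touchingh alpha_gt0 beta_gt0 W sg1 t0 N0 mpi pi01 Ppi Hg Hp cm m0) => /=.
  apply: filterS3 Hin HXT (near_gap_gt0 x0 t0 g0) => z [tz za] [Xz Tz].
  have z1 : 0 < z.1 by exact: lt_trans Xz.
  have z2 : 0 < z.2 by exact: lt_trans Tz.
  have r0 : 0 < Num.sqrt z.2 by rewrite sqrtr_gt0.
  have h0 : 0 < z.1 / Num.sqrt z.2 by rewrite divr_gt0.
  have ha : alpha <= z.1 / Num.sqrt z.2 by rewrite ler_pdivlMr// ltW.
  have hI : 0 < z.1 / Num.sqrt z.2 <= a by rewrite h0 ler_pdivrMr// ltW.
  rewrite /guess /= (min_r ha) (max_l ha) (min_l (ltW za)) -/(amp _ _) FU (mulrBr c2) c2Q (addrCA U) subrr addr0 => us.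
  have /andP[p0 _] := pi01 z.1.
  have cQ0 : 0 <= c2 * Q (z.1 / Num.sqrt z.2) by rewrite mulr_ge0 ?ltW.
  have cQU : c2 * Q (z.1 / Num.sqrt z.2) <= U by rewrite -[leRHS]c2Q ler_pM2l// le_tail4.
  have fI : 0 <= c2 * Q (z.1 / Num.sqrt z.2) <= C' * (z.1 / Num.sqrt z.2).
    rewrite cQ0 (le_trans cQU)// (le_trans (y := U / alpha * (z.1 / Num.sqrt z.2)))//.
      by rewrite -mulrA ler_pMr// mulrC ler_pdivlMr// mul1r.
    by rewrite ler_pM2r// addrAC lerDr addr_ge0// ltW.
  have f'I : `|- (c2 * G (z.1 / Num.sqrt z.2))| <= C'.
    have cG0 : 0 <= c2 * G (z.1 / Num.sqrt z.2) by apply: mulr_ge0; apply: ltW => //; exact: gauss4_gt0.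
    rewrite normrN (ger0_norm cG0) (@le_trans _ _ c2)//.
      by rewrite -[leRHS]mulr1 ler_pM2l// /gauss4 -expR0 ler_expR oppr_le0 divr_ge0// sqr_ge0.
    by rewrite lerDr addr_ge0// divr_ge0// ltW.
  have q0 := amp_le z2 (ltW Xz) (ltW za).
  have eI : `|a * Num.sqrt z.2 * P (a * Num.sqrt z.2) - gamma| <= eb.
    by apply: Peb; apply: le_trans (ltW za); exact: ltW.
  have rs := residual_small hI fI f'I (expR_ge0 _) q0 eI (Peb (ltW Xz)).
  have := residual_margin z2 (expR_ge0 _) p0 rs (ltW us).
  move: (rs) => _; rewrite /margin.
  (* The unmatched term of the profile equation, covered by the second derivative 2 B of the
     quadratic correction. *)
  have layer : amp z.1 z.2 * (gamma / (z.1 / Num.sqrt z.2) ^+ 2 * (c2 * Q (z.1 / Num.sqrt z.2))) <= 2 * B.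
    apply: le_trans c4.1; rewrite mulrC; apply: ler_pM; [|exact: expR_ge0| |].
    - by apply: mulr_ge0 => //; rewrite divr_ge0// sqr_ge0.
    - apply: ler_pM => //; first by rewrite divr_ge0// sqr_ge0.
      by rewrite ler_wpM2l// lef_pV2 ?posrE ?exprn_gt0// ler_pXn2r// nnegrE ltW.
    - by apply: (le_trans q0); rewrite ler_pM2l ?sqrtr_gt0// lef_pV2 ?posrE ?sqrtr_gt0// ler_wsqrtr.
  rewrite sgN !opprK !mul1r.
  move: layer ha; rewrite /amplitude; move: (expR _) (z.1 / _) h0 => q h h0 layer ha H.
  apply: le_trans H; rewrite -subr_ge0.
  rewrite [leRHS](_ : _ = ((2 * B - q * (gamma / h ^+ 2 * (c2 * Q h))) + h * (B * (h - alpha))) / z.2); last first.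
    by move: (k_ h) (Num.sqrt h) (G h) (Q h) (scale_pow _ _) => k1 k2 k3 k4 k5; field; rewrite !gt_eqF.
  apply: divr_ge0; last exact: ltW.
  apply: addr_ge0; first by rewrite subr_ge0.
  by apply: mulr_ge0; [exact: ltW|rewrite mulr_ge0// subr_ge0].
apply: filterS3 Hin HXT mx => z [tz za] [Xz Tz] mz /mz.
have z2 : 0 < z.2 by exact: lt_trans Tz.
have gE y s : 0 < s -> alpha * Num.sqrt s <= y -> y <= a * Num.sqrt s -> gap y s = sg * wfun alpha beta u y s +
    (sg * psi alpha beta y s + - sg * (c2 * Q (y / Num.sqrt s) * amp y s) + (- eps * sqrt_gauss (y / Num.sqrt s) +
     - K * (scale_pow (1 / 4) s * G (y / Num.sqrt s)) + k0) +
    (- eps * Q (y / Num.sqrt s) + B * (y / Num.sqrt s - alpha) ^+ 2)).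
  by move=> s1 ys ys'; rewrite gap_layer// /wfun /k0; ring.
by rewrite !gE// ltW.
Unshelve. all: by end_near. Qed.

(** Here the barrier solves the heat equation. For the upper bound [p * u >= 0] has the right sign,
    for the lower one [p] vanishes by dryness. *)
Lemma no_touch_outer x t : X < x -> T0 < t -> a * Num.sqrt t < x ->
  ~ (\forall z \near ((x, t) : R * R), z.2 <= t -> gap z.1 z.2 <= gap x t).
Proof.
move=> Xx Tt ax mx; have x0 : 0 < x by exact: lt_trans Xx.
have t0 : 0 < t by exact: lt_trans Tt.
have s0 : 0 < Num.sqrt t by rewrite sqrtr_gt0.
have Hin : \forall z \near ((x, t) : R * R), a * Num.sqrt z.2 < z.1 /\ z.1 < (x / Num.sqrt t + 1) * Num.sqrt z.2.
  by apply: near_inside => //; rewrite mulrDl divfK ?gt_eqF// ltrDl mul1r.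
have HXT := near_XT Xx Tt.
pose O := fun _ : R => 0 : R; pose cQ := - sg * c2 - 2 * eps - A * (a - alpha).
have hpsi : heat_near O O (psi alpha beta) (fun _ _ => 0) (x, t).
  apply: heat_psi => //; first exact: ltW.
  by rewrite gt_eqF// (le_lt_trans _ ax)// ler_pM2r.
have Hg := heat_nearD (heat_nearZ sg hpsi)
   (heat_nearD (heat_nearZ cQ (heat_tail4 O O x t0)) (heat_rest O O x0 t0)).
have [cm m0] := cont2_margin x0 t0.
have Hp : \forall z \near ((x, t) : R * R), 0 <= sg * (p z.1 z.2 * u z.1 z.2).
  apply: filterS2 Hin HXT => z [az _] [Xz Tz]; have z2 : 0 < z.2 by exact: lt_trans Tz.
  case: sgE => -[sE aE]; last by rewrite (dry aE _ az) ?mul0r ?mulr0// ltW.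
  rewrite sE mul1r mulr_ge0//; last exact: (u_ge0 alpha_gt0 beta_gt0 W).
  by case/andP: (p01 W z.1 (ltW z2)).
apply: (touching0h alpha_gt0 beta_gt0 W sg1 t0 Hg Hp cm m0) => /=.
  apply: filterS2 Hin HXT => z [az _] [Xz Tz].
  have z1 : 0 < z.1 by exact: lt_trans Xz.
  have z2 : 0 < z.2 by exact: lt_trans Tz.
  have r0 : 0 < Num.sqrt z.2 by rewrite sqrtr_gt0.
  rewrite /margin; move: (z.1 / _) (divr_gt0 z1 r0) => h h0.
  rewrite !mulr0 !add0r -subr_ge0.
  have sh : 0 < Num.sqrt h by rewrite sqrtr_gt0.
  have k0 : 0 <= k_ h by rewrite invr_ge0 mulr_ge0// mulr_ge0 ?(ltW h0) ?(ltW sh).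
  have g0 := gauss4_gt0 h; have sp := scale_pow_gt0 (1 / 4) z.2.
  rewrite [leRHS](_ : _ = (eps * (G h * (k_ h / 2 + 3 / 4 * Num.sqrt h)) + K * (scale_pow (1 / 4) z.2 * G h) / 4) / z.2).
    apply: divr_ge0; last exact: ltW.
    apply: addr_ge0.
      apply: mulr_ge0; first exact: ltW.
      by apply: mulr_ge0; [exact: ltW|rewrite addr_ge0 ?divr_ge0// mulr_ge0// ltW].
    by apply: divr_ge0 => //; apply: mulr_ge0 => //; apply: mulr_ge0; exact: ltW.
  by move: (k_ h) (Num.sqrt h) => k1 k2; field; rewrite gt_eqF.
apply: filterS3 Hin HXT mx => z [az _] [Xz Tz] mz /mz.
have z2 : 0 < z.2 by exact: lt_trans Tz.
have gE y s : 0 < s -> a * Num.sqrt s <= y -> gap y s = sg * wfun alpha beta u y s +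
    (sg * psi alpha beta y s + (cQ * Q (y / Num.sqrt s) + (- eps * sqrt_gauss (y / Num.sqrt s) +
     - K * (scale_pow (1 / 4) s * G (y / Num.sqrt s))))).
  by move=> s1 ys; rewrite gap_outer// /wfun /cQ; ring.
by rewrite !gE// ltW.
Qed.

Let slice_derivatives x t : 0 < x -> 0 < t -> let s := Num.sqrt t in
  [/\ is_derive x (1 : R) (fun y => w y t) (d_x w x t),
      is_derive x (1 : R) (fun y => eps * sqrt_gauss (y / s) + K * (scale_pow (1 / 4) t * G (y / s)))
       (eps * (sqrt_gauss' (x / s) / s) + K * (scale_pow (1 / 4) t * (- (x / s / 2) * G (x / s) / s))),
      is_derive x (1 : R) (fun y => Q (y / s)) (- (G (x / s) / s)),
      is_derive x (1 : R) (fun y => amp y t) (- ((P x - gamma / x) * amp x t)) &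
      is_derive x (1 : R) (fun y => F (y / s)) (F' (x / s) / s)].
Proof.
move=> x0 t0 s; have s0 : 0 < s by rewrite sqrtr_gt0.
have h0 : 0 < x / s by rewrite divr_gt0.
have comp (f : R -> R) (f' : R) : is_derive (x / s) (1 : R) f f' -> is_derive x (1 : R) (fun y => f (y / s)) (f' / s).
  by move=> df; exact: (@is_derive_compE _ f (fun y => y / s) x _ _ _ df (is_derive_div_sqrt_x x t) (erefl _)).
have dG := comp _ _ (is_derive_gauss4 (x / s)); have dS := comp _ _ (is_derive_sqrt_gauss h0).
split.
- exact: (is_derive_w W x (ltW t0)).
- by apply: is_derive_eq; rewrite /GRing.scale/=; ring.
- by apply: (is_derive_eq (comp _ _ (is_derive_tail4 (x / s)))); rewrite mulNr.
- have dEx := dE x0.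
  have d1 : is_derive x (1 : R) (fun y => E (a * s) - E y) (- (P x - gamma / x)).
    by apply: is_derive_eq; ring.
  have dexp := is_derive_expR (E (a * s) - E x).
  have := @is_derive_compE _ expR (fun y => E (a * s) - E y) x _ _ _ dexp d1 (erefl _).
  by move=> d2; apply: (is_derive_eq d2); rewrite mulrN mulrC.
- by have [d _ _ _] := dF h0; exact: comp.
Qed.

Let Gc2 : c2 * G alpha + F' alpha = alpha * beta / 2.
Proof. by rewrite -transmission; congr (_ + _); rewrite mulrAC. Qed.

Let rate x t : X <= x -> `|x * (P x - gamma / x)| <= eb.
Proof.
move=> Xx; have x0 : 0 < x by exact: lt_le_trans Xx.
by rewrite mulrBr (mulrC x (_ / _)) divfK ?gt_eqF// Peb.
Qed.

(* The slope of gap jumps up by ((alpha beta / 2) sg (amp - 1) + eps G(alpha)) / sqrt t. *)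
Let kink_alpha x t : X < x -> T0 < t -> alpha < a -> x = alpha * Num.sqrt t ->
  ~ (\forall y \near x, gap y t <= gap x t).
Proof.
move=> Xx Tt aa xE; have x0 : 0 < x by exact: lt_trans Xx.
have t0 : 0 < t by exact: lt_trans Tt.
have s0 : 0 < Num.sqrt t by rewrite sqrtr_gt0.
have sgN : sg = -1 by case: sgE => -[//]; move=> _ aE; move: aa; rewrite aE ltxx.
have [dw dr dQ da dF1] := slice_derivatives x0 t0.
have [_ _ psix] := psi_kink_lower beta alpha_gt0 t0 xE.
have hE : x / Num.sqrt t = alpha by rewrite xE mulfK ?gt_eqF.
have ampe : amp x t <= expR (eb * ln (a / alpha)).
  rewrite ler_expR (_ : a / alpha = a * Num.sqrt t / x).
    apply: le_trans (ler_norm _) _; apply: (le_E_ln X_gt0 dE Peb (ltW Xx)).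
    by rewrite xE ler_pM2r// ltW.
  by rewrite xE; field; rewrite !gt_eqF.
have as_ : alpha * Num.sqrt t < a * Num.sqrt t by rewrite ltr_pM2r.
pose s := Num.sqrt t.
pose rest y := eps * sqrt_gauss (y / s) + K * (scale_pow (1 / 4) t * G (y / s)).
pose f1 y := sg * (w y t + Psi alpha beta alpha - F (y / s) * amp y t) -
  (rest y + (eps * (Q alpha + Q a) + (A * (a - alpha) * Q a + B * (a - alpha) ^+ 2))).
pose f2 y := sg * (w y t + c0 * Q (y / s) - c2 * Q (y / s) * amp y t) -
  (rest y + (eps * (Q (y / s) + Q a) + (A * (a - alpha) * Q a + B * ((a - alpha) ^+ 2 - (y / s - alpha) ^+ 2)))).
have f1E y : 0 < y -> y <= alpha * s -> gap y t = f1 y.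
  by move=> y0 ys; rewrite gap_inner// /f1 /rest /wfun psi_in ?gtr0_norm//; rewrite /s; ring.
have f2E y : alpha * s <= y -> y <= a * s -> gap y t = f2 y.
  by move=> ys ya; rewrite gap_layer// /f2 /rest /wfun psi_out//; rewrite /s; ring.
have h' := is_derive_div_sqrt_x x t.
have D1 : is_derive x (1 : R) f1 (sg * (d_x w x t - (F' alpha / s * amp x t - U * ((P x - gamma / x) * amp x t))) -
   (eps * (sqrt_gauss' (x / s) / s) + K * (scale_pow (1 / 4) t * (- (x / s / 2) * G (x / s) / s)))).
  rewrite /f1 /rest /s; apply: is_derive_eq; rewrite /GRing.scale/= hE FU; ring.
have D2 : is_derive x (1 : R) f2 (sg * (d_x w x t - c0 * (G alpha / s) + c2 * (G alpha / s) * amp x t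
     + c2 * Q alpha * ((P x - gamma / x) * amp x t)) -
   (eps * (sqrt_gauss' (x / s) / s) + K * (scale_pow (1 / 4) t * (- (x / s / 2) * G (x / s) / s)) - eps * (G alpha / s))).
  rewrite /f2 /rest /s; apply: is_derive_eq; rewrite /GRing.scale/= hE subrr; ring.
apply: (no_max_convex_kink D1 D2) => /=.
- rewrite -subr_gt0 c2Q.
  rewrite [ltRHS](_ : _ = (sg * (- (c0 * G alpha) + (c2 * G alpha + F' alpha) * amp x t) + eps * G alpha) / s); last first.
    by rewrite /s; field; rewrite !gt_eqF.
  apply: divr_gt0 => //; rewrite c0G Gc2 sgN.
  have ab : 0 < alpha * beta / 2 by rewrite divr_gt0// mulr_gt0.
  have H : alpha * beta / 2 * amp x t <= alpha * beta / 2 * expR (eb * ln (a / alpha)) by rewrite ler_pM2l.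
  by have H2 := c2'; move: H H2; rewrite mulrBr mulr1; lra.
- by rewrite f1E// xE.
- by rewrite f2E// xE// ltW.
- by apply: filterS (lt_nbhsr x0) => y y0 yx; rewrite f1E// -/s -xE.
- have xas : x < a * s by rewrite xE.
  by apply: filterS (lt_nbhsl xas) => y ya xy; rewrite f2E ?(ltW ya)// -xE.
Qed.

(** Up to the factor 1 / sqrt t the slope jumps by [eps * G a] plus the nonnegative surplus
    [(a - alpha) * (A * G a - 2 * B)], less the slope of the amplitude, which is cut off here and is
    at most [U * eb / alpha]. *)
Let kink_a x t : X < x -> T0 < t -> alpha < a -> x = a * Num.sqrt t ->
  ~ (\forall y \near x, gap y t <= gap x t).
Proof.
move=> Xx Tt aa xE; have x0 : 0 < x by exact: lt_trans Xx.
have t0 : 0 < t by exact: lt_trans Tt.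
have s0 : 0 < Num.sqrt t by rewrite sqrtr_gt0.
have sgN : sg = -1 by case: sgE => -[//]; move=> _ aE; move: aa; rewrite aE ltxx.
have [dw dr dQ da dF1] := slice_derivatives x0 t0.
have hE : x / Num.sqrt t = a by rewrite xE mulfK ?gt_eqF.
have amp1 : amp x t = 1 by rewrite /amplitude xE subrr expR0.
have as_ : alpha * Num.sqrt t < a * Num.sqrt t by rewrite ltr_pM2r.
pose s := Num.sqrt t.
pose rest y := eps * sqrt_gauss (y / s) + K * (scale_pow (1 / 4) t * G (y / s)).
pose f1 y := sg * (w y t + c0 * Q (y / s) - c2 * Q (y / s) * amp y t) -
  (rest y + (eps * (Q (y / s) + Q a) + (A * (a - alpha) * Q a + B * ((a - alpha) ^+ 2 - (y / s - alpha) ^+ 2)))).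
pose f2 y := sg * (w y t + c0 * Q (y / s) - c2 * Q (y / s)) -
  (rest y + (eps * (Q (y / s) + Q (y / s)) + A * (a - alpha) * Q (y / s))).
have f1E y : alpha * s <= y -> y <= a * s -> gap y t = f1 y.
  by move=> ys ya; rewrite gap_layer// /f1 /rest /wfun psi_out//; rewrite /s; ring.
have f2E y : a * s <= y -> gap y t = f2 y.
  move=> ya; rewrite gap_outer// /f2 /rest /wfun psi_out//; first by rewrite /s; ring.
  exact: le_trans (ltW as_) ya.
have h' := is_derive_div_sqrt_x x t.
have D1 : is_derive x (1 : R) f1 (sg * (d_x w x t - c0 * (G a / s) + c2 * (G a / s)
     + c2 * Q a * (P x - gamma / x)) -
   (eps * (sqrt_gauss' (x / s) / s) + K * (scale_pow (1 / 4) t * (- (x / s / 2) * G (x / s) / s))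
    - eps * (G a / s) - 2 * B * (a - alpha) / s)).
  rewrite /f1 /rest /s; apply: is_derive_eq; rewrite /GRing.scale/= hE amp1; ring.
have D2 : is_derive x (1 : R) f2 (sg * (d_x w x t - c0 * (G a / s) + c2 * (G a / s)) -
   (eps * (sqrt_gauss' (x / s) / s) + K * (scale_pow (1 / 4) t * (- (x / s / 2) * G (x / s) / s))
    - 2 * eps * (G a / s) - A * (a - alpha) * (G a / s))).
  rewrite /f2 /rest /s; apply: is_derive_eq; rewrite /GRing.scale/= hE; ring.
apply: (no_max_convex_kink D1 D2) => /=.
- rewrite -subr_gt0.
  rewrite [ltRHS](_ : _ = (eps * G a + (a - alpha) * (A * G a - 2 * B) - sg * (c2 * Q a * ((P x - gamma / x) * x / a))) / s); last first.
    by rewrite xE /s; field; rewrite !gt_eqF.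
  apply: divr_gt0 => //.
  have H1 : 0 <= (a - alpha) * (A * G a - 2 * B) by rewrite mulr_ge0// subr_ge0 ?(ltW aa)//; case: c4.
  have H2 : sg * (c2 * Q a * ((P x - gamma / x) * x / a)) <= U * eb / alpha.
    rewrite (le_trans (ler_norm _))// normrM (_ : `|sg| = 1) ?mul1r; last by rewrite sgN normrN1.
    have cQ0 : 0 <= c2 * Q a by apply: mulr_ge0; exact: ltW.
    rewrite normrM (ger0_norm cQ0) -(mulrA U eb); apply: ler_pM => //.
      by rewrite -[leRHS]c2Q ler_pM2l// le_tail4// ltW.
    rewrite normrM normfV (ger0_norm (ltW a_gt0)); apply: ler_pM; rewrite ?invr_ge0 ?(ltW a_gt0)//.
      by rewrite mulrC rate// ltW.
    by rewrite lef_pV2 ?posrE// ltW.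
  by have H3 := c3; move: H1 H2 H3; lra.
- by rewrite f1E// xE// ltW.
- by rewrite f2E// xE.
- have xas : alpha * s < x by rewrite xE.
  apply: filterS (lt_nbhsr xas) => y ya yx; by rewrite f1E// ?(ltW ya)// -xE.
- by apply: filterE => y xy; rewrite f2E// -xE.
Qed.

(** The transmission condition cancels the source exactly, since the amplitude is 1; the two tail
    terms give [2 * eps * G alpha] against the slope of the amplitude. *)
Let kink_joint x t : X < x -> T0 < t -> a = alpha -> x = alpha * Num.sqrt t ->
  ~ (\forall y \near x, gap y t <= gap x t).
Proof.
move=> Xx Tt aa xE; have x0 : 0 < x by exact: lt_trans Xx.
have t0 : 0 < t by exact: lt_trans Tt.
have s0 : 0 < Num.sqrt t by rewrite sqrtr_gt0.
have sgP : sg = 1 by case: sgE => -[//]; move=> _; rewrite aa ltxx.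
have [dw dr dQ da dF1] := slice_derivatives x0 t0.
have hE : x / Num.sqrt t = alpha by rewrite xE mulfK ?gt_eqF.
have amp1 : amp x t = 1 by rewrite /amplitude xE aa subrr expR0.
pose s := Num.sqrt t.
pose rest y := eps * sqrt_gauss (y / s) + K * (scale_pow (1 / 4) t * G (y / s)).
pose f1 y := sg * (w y t + Psi alpha beta alpha - F (y / s) * amp y t) -
  (rest y + (eps * (Q alpha + Q a) + (A * (a - alpha) * Q a + B * (a - alpha) ^+ 2))).
pose f2 y := sg * (w y t + c0 * Q (y / s) - c2 * Q (y / s)) -
  (rest y + (eps * (Q (y / s) + Q (y / s)) + A * (a - alpha) * Q (y / s))).
have f1E y : 0 < y -> y <= alpha * s -> gap y t = f1 y.
  by move=> y0 ys; rewrite gap_inner// /f1 /rest /wfun psi_in ?gtr0_norm//; rewrite /s; ring.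
have f2E y : alpha * s <= y -> gap y t = f2 y.
  by move=> ya; rewrite gap_outer ?aa// /f2 /rest /wfun psi_out// aa; rewrite /s; ring.
have h' := is_derive_div_sqrt_x x t.
have D1 : is_derive x (1 : R) f1 (sg * (d_x w x t - (F' alpha / s - U * (P x - gamma / x))) -
   (eps * (sqrt_gauss' (x / s) / s) + K * (scale_pow (1 / 4) t * (- (x / s / 2) * G (x / s) / s)))).
  rewrite /f1 /rest /s; apply: is_derive_eq; rewrite /GRing.scale/= hE FU amp1; ring.
have D2 : is_derive x (1 : R) f2 (sg * (d_x w x t - c0 * (G alpha / s) + c2 * (G alpha / s)) -
   (eps * (sqrt_gauss' (x / s) / s) + K * (scale_pow (1 / 4) t * (- (x / s / 2) * G (x / s) / s))
    - 2 * eps * (G alpha / s))).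
  rewrite /f2 /rest /s; apply: is_derive_eq; rewrite /GRing.scale/= hE aa subrr; ring.
apply: (no_max_convex_kink D1 D2) => /=.
- rewrite -subr_gt0.
  rewrite [ltRHS](_ : _ = (sg * (- (c0 * G alpha) + (c2 * G alpha + F' alpha)) + 2 * eps * G alpha
     - sg * (U * ((P x - gamma / x) * x / alpha))) / s); last first.
    by rewrite xE /s; field; rewrite !gt_eqF.
  apply: divr_gt0 => //; rewrite c0G Gc2 sgP !mul1r.
  have H2 : U * ((P x - gamma / x) * x / alpha) <= U * eb / alpha.
    rewrite -(mulrA U eb) ler_pM2l// ler_pM2r ?invr_gt0// mulrC (le_trans (ler_norm _))//.
    by rewrite rate// ltW.
  have g0 : 0 < eps * G alpha by rewrite mulr_gt0// gauss4_gt0.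
  by have H3 := c3; move: H2 H3 g0; rewrite aa; lra.
- by rewrite f1E// xE.
- by rewrite f2E// xE.
- by apply: filterS (lt_nbhsr x0) => y y0 yx; rewrite f1E// -/s -xE.
- by apply: filterE => y xy; rewrite f2E// -xE.
Qed.

Lemma no_touch x t : X < x -> T0 < t -> 0 < gap x t ->
  ~ (\forall z \near ((x, t) : R * R), z.2 <= t -> gap z.1 z.2 <= gap x t).
Proof.
move=> Xx Tt g0 mx; have t0 : 0 < t by exact: lt_trans Tt.
have sl : \forall y \near x, gap y t <= gap x t.
  by apply: filterS (near_slicel mx) => y /=; apply; rewrite lexx.
have [xa|ax|xa] := ltgtP x (a * Num.sqrt t).
- have [xt|tx|xt] := ltgtP x (alpha * Num.sqrt t).
  + exact: (no_touch_inner Xx Tt xt g0 mx).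
  + exact: (no_touch_layer Xx Tt tx xa g0 mx).
  + apply: (kink_alpha Xx Tt _ xt sl).
    by move: xa; rewrite xt ltr_pM2r// sqrtr_gt0.
- exact: (no_touch_outer Xx Tt ax mx).
- case: sgE => -[_ aE]; last exact: (kink_a Xx Tt aE xa sl).
  by apply: (kink_joint Xx Tt aE _ sl); rewrite -aE.
Qed.

(** Compactness in x comes from the Gaussian tails of psi and of the barrier: at x = M the gap is
    below half of the positive value to be refuted. That half is subtracted, and the maximum over a
    rectangle is then excluded by [no_touch]. *)
Lemma comparison : (forall x, X <= x -> gap x T0 <= 0) -> (forall t, T0 <= t -> gap X t <= 0) ->
  forall x t, X <= x -> T0 <= t -> gap x t <= 0.
Proof.
move=> bottom left x t Xx Tt; rewrite leNgt; apply/negP => g0.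
have t0 : 0 < t by exact: lt_le_trans Tt.
have s0 : 0 < Num.sqrt t by rewrite sqrtr_gt0.
pose k := c0 + c2; have k0 : 0 < k by rewrite addr_gt0// !mulr_gt0// expR_gt0.
have [M [Ma Mx MQ]] : exists M, [/\ a * Num.sqrt t <= M, x <= M & k * Q (M / Num.sqrt t) < gap x t / 2].
  have e0 : 0 < gap x t / 2 / k by rewrite !divr_gt0.
  have [m [_ Hm]] := cvgr_lt _ (@cvg_tail4 R) _ e0.
  pose h := Num.max (m + 1) (Num.max a (x / Num.sqrt t)).
  exists (h * Num.sqrt t); rewrite mulfK ?gt_eqF//; split.
  - by rewrite ler_pM2r// /h !le_max lexx orbT.
  - by rewrite -ler_pdivrMr// /h !le_max lexx !orbT.
  - by rewrite mulrC -ltr_pdivlMr// Hm// /h lt_max ltrDl ltr01.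
suff : gap x t - gap x t / 2 <= 0 by move: g0; lra.
apply: (@compact_no_backward_max _ (rect X M T0 t) (fun z => gap z.1 z.2 - gap x t / 2) (@compact_rect _ _ _ _ _) _ _ (x, t)).
- apply: (@within_rect _ X M T0 t (fun y s => gap y s - gap x t / 2)) => z /rectP[/andP[z1 _] /andP[z2 _]].
  apply: (@cont2B _ gap (fun _ _ => gap x t / 2)); last exact: cont2_cst.
  by case: z z1 z2 => y s /= y1 s1; apply: cont2_gap; [exact: lt_le_trans y1|exact: lt_le_trans s1].
- move=> [y s] /rectP[/= /andP[y1 y2] /andP[s1 s2]]; rewrite subr_gt0 => gy.
  have gy0 : 0 < gap y s by apply: lt_trans gy; rewrite divr_gt0.
  have Xy : X < y.
    by rewrite lt_neqAle y1 andbT; apply/eqP => yE; move: (left s s1); rewrite yE leNgt gy0.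
  have Ts : T0 < s.
    by rewrite lt_neqAle s1 andbT; apply/eqP => sE; move: (bottom y y1); rewrite sE leNgt gy0.
  have sp : 0 < s by exact: lt_trans Ts.
  have rp : 0 < Num.sqrt s by rewrite sqrtr_gt0.
  have yM : y < M.
    rewrite lt_neqAle y2 andbT; apply/eqP => yE; move: gy; apply/negP; rewrite -leNgt.
    have yas : a * Num.sqrt s <= y by rewrite yE (le_trans _ Ma)// ler_pM2l// ler_wsqrtr.
    have xas : alpha * Num.sqrt s <= y by rewrite (le_trans _ yas)// ler_pM2r.
    have uk : u y s <= c0 * Q (y / Num.sqrt s).
      by rewrite -(psi_out beta alpha_gt0 sp xas) (u_le_psi alpha_gt0 beta_gt0 W).
    have u0 := u_ge0 alpha_gt0 beta_gt0 W y sp.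
    have Q0 := tQ (y / Num.sqrt s).
    apply: le_trans (gap_le y s) _.
    have gE : guess y s = c2 * Q (y / Num.sqrt s).
      rewrite /guess /= min_r ?etaP' // ?max_l ?etaP'// min_r// subrr expR0 mulr1 FU (mulrBr c2) c2Q.
      by rewrite addrCA subrr addr0.
    apply: le_trans (ltW MQ); rewrite gE; apply: (@le_trans _ _ (k * Q (y / Num.sqrt s))).
      have q1 : 0 <= c2 * Q (y / Num.sqrt s) by apply: mulr_ge0; exact: ltW.
      have q2 : 0 <= c0 * Q (y / Num.sqrt s) by exact: le_trans uk.
      rewrite /k mulrDl; apply: sign_sub_le => //; rewrite ?u0 ?q1 /=; first by rewrite ler_wpDr.
      by rewrite ler_wpDl.
    apply: ler_wpM2l; first exact: ltW.
    apply: le_tail4; rewrite yE ler_pM2l; last by rewrite (lt_le_trans _ Ma)// mulr_gt0.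
    by rewrite lef_pV2 ?posrE// ler_wsqrtr.
  split.
    apply: filterS2 (near_XT Xy Ts) (near_fst s (lt_nbhsl yM)) => z [z1 z2] zM zs.
    apply/rectP; split; first by rewrite (ltW z1) (ltW zM).
    by rewrite (ltW z2) (le_trans zs).
  move=> mx; apply: (no_touch Xy Ts gy0); apply: filterS mx => z mz /mz /=.
  by rewrite lerD2r.
- by apply/rectP; rewrite /= Xx Mx Tt lexx.
Qed.

End comparison.

(** * Choice of the constants and convergence to the profile *)

Section small_powers.
Variable R : realType.

Lemma scale_pow_le_near (c e : R) : 0 < c -> 0 < e -> exists2 T, 0 < T & forall t, T <= t -> scale_pow c t <= e.
Proof.
move=> c0 e0; exists (expR (- ln e / c)) => [|t Tt]; first exact: expR_gt0.
apply: le_trans (le_scale_pow (ltW c0) (expR_gt0 _) Tt) _.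
by rewrite /scale_pow expRK mulNr mulrC divfK ?gt_eqF// opprK lnK// posrE.
Qed.

Lemma div_sqrt_le_near (X e : R) : 0 < X -> 0 < e -> exists2 T, 0 < T & forall t, T <= t -> X / Num.sqrt t <= e.
Proof.
move=> X0 e0; exists ((X / e) ^+ 2) => [|t Tt]; first by rewrite exprn_gt0// divr_gt0.
have xe : 0 < X / e by rewrite divr_gt0.
have s : X / e <= Num.sqrt t by rewrite -[leLHS]ger0_norm ?(ltW xe)// -sqrtr_sqr ler_wsqrtr.
by rewrite ler_pdivrMr ?(lt_le_trans xe)// -ler_pdivrMl// mulrC.
Qed.

Lemma norm_expR_sub1 (z : R) : `|expR z - 1| <= `|z| * expR `|z|.
Proof.
have [z0|z0] := leP 0 z.
  have e1 : 1 <= expR z by rewrite -[leLHS]expR0 ler_expR.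
  rewrite (ger0_norm z0) ger0_norm ?subr_ge0//.
  have H := expR_ge1Dx (- z).
  have e0 := expR_gt0 z.
  have : (1 - z) * expR z <= expR (- z) * expR z by rewrite ler_pM2r.
  by rewrite -expRD addNr expR0 mulrBl mul1r; lra.
have e1 : expR z <= 1 by rewrite -[leRHS]expR0 ler_expR ltW.
rewrite (ltr0_norm z0) ler0_norm ?subr_le0//.
have H := expR_ge1Dx z.
have : - z * 1 <= - z * expR (- z).
  by apply: ler_wpM2l; rewrite ?oppr_ge0 ?(ltW z0)// -[leLHS]expR0 ler_expR oppr_ge0 ltW.
by move: H; lra.
Qed.

(** With y = ln(a / h) one has h = a e^(-y) and |e^z - 1| <= eb y e^(y / 2); finally y e^(- y / 2)
    <= 2, uniformly in h. *)
Lemma log_weight (a h eb z : R) : 0 < h <= a -> 0 <= eb -> eb <= 1 / 2 -> `|z| <= eb * ln (a / h) ->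
  h * `|expR z - 1| <= 2 * a * eb.
Proof.
move=> /andP[h0 ha] eb0 eb1 zI; have a0 : 0 < a by exact: lt_le_trans ha.
pose y := ln (a / h); have q0 : 0 < a / h by rewrite divr_gt0.
have y0 : 0 <= y by rewrite ln_ge0// ler_pdivlMr// mul1r.
have hE : h = a * expR (- y) by rewrite expRN /y lnK ?posrE// invfM invrK mulrA divff ?mul1r// gt_eqF.
have ey : 0 <= eb * y by exact: le_trans zI.
have zy : `|z| <= y / 2 by apply: le_trans zI _; rewrite -/y mulrC ler_wpM2l//; lra.
have H1 : `|expR z - 1| <= eb * y * expR (y / 2).
  apply: le_trans (norm_expR_sub1 z) _; apply: ler_pM; [exact: normr_ge0|exact: expR_ge0|exact: zI|].
  by rewrite ler_expR.
have y2 : y / 2 <= expR (y / 2) by apply: le_trans (expR_ge1Dx _); rewrite lerDr.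
apply: le_trans (ler_wpM2l (ltW h0) H1) _.
rewrite hE [leLHS](_ : _ = 2 * a * eb * (y / 2 * expR (- (y / 2)))).
  rewrite -[leRHS]mulr1; apply: ler_wpM2l; first by rewrite mulr_ge0// mulr_ge0// ltW.
  by rewrite expRN ler_pdivrMr ?expR_gt0// mul1r.
have -> : expR (- y) = expR (- (y / 2)) * expR (- (y / 2)) by rewrite -expRD; congr expR; field.
have : expR (- (y / 2)) * expR (y / 2) = 1 by rewrite -expRD addNr expR0.
move: (expR (- _)) (expR (y / 2)) => k1 k2 k12.
rewrite [LHS](_ : _ = a * k1 * eb * y * (k1 * k2)); last by ring.
by rewrite k12; field.
Qed.

End small_powers.

Section convergence.
Variable R : realType.
Notation leb := (@lebesgue_measure R).
Variables (alpha beta ustar gamma : R) (u p : R -> R -> R).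
Hypotheses (alpha_gt0 : 0 < alpha) (beta_gt0 : 0 < beta) (gamma_ge0 : 0 <= gamma).
Hypothesis W : weak_solution alpha beta ustar u p.
Implicit Types x t h : R.
Local Notation c0 := (alpha * beta / 2 * expR (alpha ^+ 2 / 4)).
Variables (F F' F'' : R -> R) (C U : R).
Hypotheses (dF : forall h : R, 0 < h -> [/\ is_derive h (1 : R) F (F' h), is_derive h (1 : R) F' (F'' h),
    {for h, continuous F''} & F'' h + h / 2 * F' h = gamma / h ^+ 2 * F h])
  (Fbound : forall h, 0 < h <= alpha -> 0 <= F h <= C * h /\ `|F' h| <= C)
  (FU : F alpha = U) (U_gt0 : 0 < U)
  (transmission : U * gauss4 alpha / tail4 alpha + F' alpha = alpha * beta / 2).
Variables (N : set R) (P pi E : R -> R).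
Hypotheses (N0 : leb.-negligible N) (mpi : measurable_fun setT pi) (pi01 : forall x : R, 0 <= pi x <= 1)
  (Ppi : is_primitive P pi) (dE : forall x : R, 0 < x -> is_derive x (1 : R) E (P x - gamma / x))
  (ppi : forall x t, 0 < x -> ~ N x -> x ^+ 2 / alpha ^+ 2 < t -> p x t = pi x)
  (Plim : x * P x @[x --> +oo] --> gamma)
  (crude : forall X : R, exists C T1, [/\ 0 < C, 0 < T1 &
     forall x t, `|x| <= X -> T1 <= t -> u x t <= C * scale_pow (3 / 8) t])
  (dry : forall d : R, 0 < d -> exists T, forall x t, T <= t -> (alpha + d) * Num.sqrt t < x -> p x t = 0).
Local Notation Q := (@tail4 R).
Local Notation G := (@gauss4 R).
Local Notation c2 := (U / tail4 alpha).
Local Notation C' := (C + U / alpha + c2).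

Definition profile h := F (Num.min h alpha) + c2 * (Q (Num.max h alpha) - Q alpha).

Let tQ h : 0 < Q h. Proof. exact: tail4_gt0. Qed.
Let c2_gt0 : 0 < c2. Proof. by rewrite divr_gt0. Qed.
Let c2Q : c2 * Q alpha = U. Proof. by rewrite divfK ?gt_eqF. Qed.
Let C_ge0 : 0 <= C.
Proof. by have [|_] := Fbound (h := alpha); [rewrite alpha_gt0 lexx|exact: le_trans]. Qed.
Let C'0 : 0 < C'. Proof. by rewrite ltr_wpDl// addr_ge0// divr_ge0// ltW. Qed.
Let c0_gt0 : 0 < c0. Proof. by rewrite !mulr_gt0// expR_gt0. Qed.

Lemma profile_inner h : h <= alpha -> profile h = F h.
Proof. by move=> ha; rewrite /profile (min_l ha) (max_r ha) subrr mulr0 addr0. Qed.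

Lemma profile_outer h : alpha <= h -> profile h = c2 * Q h.
Proof. by move=> ha; rewrite /profile (min_r ha) (max_l ha) FU (mulrBr c2) c2Q addrCA subrr addr0. Qed.

Lemma profile_bounds h : 0 < h -> 0 <= profile h <= C' * h.
Proof.
move=> h0; have [ha|ah] := leP h alpha.
  rewrite profile_inner//; have [|/andP[-> fC] _] := Fbound (h := h); first by rewrite h0.
  by rewrite (le_trans fC)// ler_pM2r// -addrA lerDl addr_ge0// ltW// divr_gt0.
rewrite profile_outer ?(ltW ah)//; have cQ0 : 0 < c2 * Q h by rewrite mulr_gt0.
rewrite (ltW cQ0) (@le_trans _ _ U)//; first by rewrite -[leRHS]c2Q ler_pM2l// le_tail4// ltW.
rewrite (@le_trans _ _ (U / alpha * h))//.
  by rewrite -mulrA ler_pMr// mulrC ler_pdivlMr// mul1r ltW.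
by rewrite ler_pM2r// addrAC lerDr addr_ge0// ltW.
Qed.

Section guess_estimates.
Variables (a eb X : R).
Hypotheses (alpha_le_a : alpha <= a) (eb_ge0 : 0 <= eb) (eb_le : eb <= 1 / 4) (X_gt0 : 0 < X)
  (Peb : forall x, X <= x -> `|x * P x - gamma| <= eb).
Let a_gt0 : 0 < a. Proof. exact: lt_le_trans alpha_le_a. Qed.
Local Notation S := (guess alpha F U E a).

Let guessE x t : S x t = profile (x / Num.sqrt t) * expR (E (a * Num.sqrt t) - E (Num.min x (a * Num.sqrt t))).
Proof. by []. Qed.

Let guess_outer x t : 0 < t -> a * Num.sqrt t <= x -> S x t = profile (x / Num.sqrt t).
Proof. by move=> t0 ax; rewrite guessE min_r// subrr expR0 mulr1. Qed.

Let guess_exponent x t : 0 < t -> X <= x -> x <= a * Num.sqrt t ->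
  exists2 z, S x t = profile (x / Num.sqrt t) * expR z & `|z| <= eb * ln (a / (x / Num.sqrt t)).
Proof.
move=> t0 Xx xa; exists (E (a * Num.sqrt t) - E x); first by rewrite guessE min_l.
have x0 : 0 < x by exact: lt_le_trans Xx.
have s0 : 0 < Num.sqrt t by rewrite sqrtr_gt0.
rewrite (_ : a / (x / Num.sqrt t) = a * Num.sqrt t / x); last by field; rewrite !gt_eqF.
exact: (le_E_ln X_gt0 dE Peb).
Qed.

Lemma guess_ge0 x t : 0 < x -> 0 < t -> 0 <= S x t.
Proof.
move=> x0 t0; rewrite guessE; apply: mulr_ge0; last exact: expR_ge0.
have s0 : 0 < Num.sqrt t by rewrite sqrtr_gt0.
by case/andP: (profile_bounds (divr_gt0 x0 s0)).
Qed.

(** The linear vanishing of the profile at 0 outweighs the possible blow-up of the amplitude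
    there. *)
Lemma guess_sub_profile x t : X <= x -> 0 < t -> `|S x t - profile (x / Num.sqrt t)| <= C' * (2 * a * eb).
Proof.
move=> Xx t0; have x0 : 0 < x by exact: lt_le_trans Xx.
have s0 : 0 < Num.sqrt t by rewrite sqrtr_gt0.
have h0 : 0 < x / Num.sqrt t by rewrite divr_gt0.
have [ax|xa] := leP (a * Num.sqrt t) x.
  rewrite guess_outer// subrr normr0; apply: mulr_ge0; first exact: ltW.
  by apply: mulr_ge0 => //; rewrite mulr_ge0// ltW.
have [z -> zI] := guess_exponent t0 Xx (ltW xa).
have /andP[p0 pC] := profile_bounds h0.
rewrite -[X in _ - X]mulr1 -mulrBr normrM (ger0_norm p0).
apply: le_trans (ler_wpM2r (normr_ge0 _) pC) _.
rewrite -(mulrA C'); apply: ler_wpM2l; first exact: ltW.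
apply: (log_weight _ eb_ge0 _ zI); first by rewrite h0 ler_pdivrMr// ltW.
by apply: le_trans eb_le _; lra.
Qed.

Lemma guess_le_gauss x t : X <= x -> 0 < t -> S x t <= (C' * a / G a + c2 * (2 / alpha)) * G (x / Num.sqrt t).
Proof.
move=> Xx t0; have x0 : 0 < x by exact: lt_le_trans Xx.
have s0 : 0 < Num.sqrt t by rewrite sqrtr_gt0.
have h0 : 0 < x / Num.sqrt t by rewrite divr_gt0.
have g0 := gauss4_gt0 (x / Num.sqrt t); have ga := gauss4_gt0 a.
have k1 : 0 <= c2 * (2 / alpha) * G (x / Num.sqrt t).
  by apply: mulr_ge0; [apply: mulr_ge0; [exact: ltW|rewrite divr_ge0// ltW]|exact: ltW].
have k2 : 0 <= C' * a / G a * G (x / Num.sqrt t).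
  by apply: mulr_ge0; [apply: divr_ge0; [apply: mulr_ge0|]; exact: ltW|exact: ltW].
rewrite mulrDl; have [ax|xa] := leP (a * Num.sqrt t) x.
  have hx : alpha <= x / Num.sqrt t by rewrite ler_pdivlMr// (le_trans _ ax)// ler_pM2r.
  rewrite guess_outer// profile_outer//; apply: ler_wpDl => //.
  by rewrite -(mulrA c2) ler_pM2l// tail4_le_gauss4.
apply: ler_wpDr => //.
have [z -> zI] := guess_exponent t0 Xx (ltW xa).
have /andP[p0 pC] := profile_bounds h0.
have ha : x / Num.sqrt t <= a by rewrite ler_pdivrMr// ltW.
have q1 : 1 <= a / (x / Num.sqrt t) by rewrite ler_pdivlMr// mul1r.
have l0 : 0 <= ln (a / (x / Num.sqrt t)) by rewrite ln_ge0.
apply: (@le_trans _ _ (C' * a)); last first.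
  rewrite -(mulrA (C' * a)) ler_peMr//; first by apply: mulr_ge0; exact: ltW.
  rewrite mulrC ler_pdivlMr// mul1r ler_expR lerN2 ler_pM2r// ler_pXn2r// nnegrE; exact: ltW.
apply: (@le_trans _ _ (C' * (x / Num.sqrt t) * (a / (x / Num.sqrt t)))); last first.
  by rewrite -(mulrA C') (mulrC (x / _)) divfK// gt_eqF.
apply: ler_pM => //.
rewrite -[leRHS](lnK (_ : _ \is Num.pos)) ?posrE ?(lt_le_trans ltr01 q1)// ler_expR.
apply: le_trans (ler_norm _) _; apply: le_trans zI _; rewrite -[leRHS]mul1r; apply: ler_wpM2r => //.
by apply: le_trans eb_le _; lra.
Qed.

(** With h = X / sqrt t the bound is a constant times h (a / h)^(1/4), that is h^(1/2) h^(1/4):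
    smaller than the allowance [eps * sqrt h] by a factor tending to 0. *)
Lemma guess_left t : 0 < t -> X <= a * Num.sqrt t -> S X t <= 
  C' * expR (ln a / 4) * (Num.sqrt (X / Num.sqrt t) * expR (ln (X / Num.sqrt t) / 4)).
Proof.
move=> t0 Xa; have s0 : 0 < Num.sqrt t by rewrite sqrtr_gt0.
have h0 : 0 < X / Num.sqrt t by rewrite divr_gt0.
have [z -> zI] := guess_exponent t0 (lexx X) Xa.
have /andP[p0 pC] := profile_bounds h0.
have ha : X / Num.sqrt t <= a by rewrite ler_pdivrMr.
move: (X / _) h0 zI p0 pC ha => h h0 zI p0 pC ha.
have C'p := ltW C'0.
have zI' : z <= (ln a - ln h) / 4.
  apply: le_trans (ler_norm _) _; apply: le_trans zI _; rewrite ln_div ?posrE//.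
  have H : 0 <= ln a - ln h by rewrite subr_ge0 ler_ln ?posrE.
  by rewrite [leRHS]mulrC; apply: ler_wpM2r => //; have := eb_le; lra.
apply: (@le_trans _ _ (C' * h * expR ((ln a - ln h) / 4))).
  by apply: ler_pM => //; rewrite ler_expR.
have hE : h = expR (ln h) by rewrite lnK ?posrE.
rewrite -(mulrA C') -(mulrA C'); apply: ler_wpM2l => //.
rewrite [X in X * expR ((_ - _) / 4)]hE -sqrt_expR// -!expRD ler_expR le_eqVlt; apply/orP; left; apply/eqP.
by move: (ln a) (ln h) => k1 k2; field.
Qed.

End guess_estimates.

Lemma sqrt_gauss_le h : 0 <= h -> sqrt_gauss h <= expR 1 :> R.
Proof.
move=> h0; have h1 : Num.sqrt h <= expR h.
  apply: (@le_trans _ _ (1 + h)); last exact: expR_ge1Dx.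
  have s0 := sqrtr_ge0 h; rewrite -[X in 1 + X]sqr_sqrtr//.
  have := sqr_ge0 (Num.sqrt h - 1); rewrite sqrrB1 => H.
  by have q := sqr_ge0 (Num.sqrt h); move: H q s0; rewrite -mulr_natl; lra.
rewrite /sqrt_gauss (@le_trans _ _ (expR h * expR (1 - h)))//.
  by apply: ler_pM; [exact: sqrtr_ge0|exact/ltW/gauss4_gt0|exact: h1|exact: gauss4_le].
by rewrite -expRD addrC subrK.
Qed.

Let u_le_gauss x t : 0 < x -> 0 < t -> u x t <= (c0 * (2 / alpha) + Psi alpha beta alpha / G alpha) * G (x / Num.sqrt t).
Proof.
move=> x0 t0; have s0 : 0 < Num.sqrt t by rewrite sqrtr_gt0.
apply: le_trans (u_le_psi alpha_gt0 beta_gt0 W x t0) _; rewrite mulrDl.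
have g0 := gauss4_gt0 (x / Num.sqrt t); have ga := gauss4_gt0 alpha.
have k1 : 0 <= c0 * (2 / alpha) * G (x / Num.sqrt t).
  by apply: mulr_ge0; [apply: mulr_ge0; [exact: ltW|rewrite divr_ge0// ltW]|exact: ltW].
have Pa := Psi_ge0 alpha_gt0 beta_gt0 alpha.
have k2 : 0 <= Psi alpha beta alpha / G alpha * G (x / Num.sqrt t).
  by apply: mulr_ge0; [apply: divr_ge0 => //; exact: ltW|exact: ltW].
have [ax|xa] := leP (alpha * Num.sqrt t) x.
  rewrite psi_out//; apply: ler_wpDr => //; rewrite -(mulrA c0) ler_pM2l//.
  by apply: tail4_le_gauss4 => //; rewrite ler_pdivlMr.
apply: ler_wpDl => //; apply: le_trans (psi_le _ _ _ _) _ => //.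
rewrite -mulrA; apply: ler_peMr => //; rewrite mulrC ler_pdivlMr// mul1r ler_expR lerN2 ler_pM2r// ler_pXn2r ?nnegrE ?(ltW alpha_gt0)//.
  by rewrite ler_pdivrMr// ltW.
by rewrite divr_ge0// ltW.
Qed.

Let small_near (f : R -> R) c : {for 0, continuous f} -> f 0 < c -> \forall e \near (0 : R)^'+, f e < c.
Proof. by move=> cf fc; apply: (cvgr_lt _ (cvg_at_right_filter cf)). Qed.

Let max5 (x1 x2 x3 x4 x5 : R) : exists2 y, 0 < y & [/\ x1 <= y, x2 <= y, x3 <= y, x4 <= y & x5 <= y].
Proof.
exists (Num.max 1 (Num.max x1 (Num.max x2 (Num.max x3 (Num.max x4 x5))))).
  by rewrite lt_max ltr01.
by split; rewrite !le_max lexx ?orbT.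
Qed.

(** The constants depend on each other in this order: B, A and eps, then a, then eb, then X, then
    T0, and last K. Although K grows with T0, its term decays in t, so a later time makes it
    small. *)
Lemma one_sided_limit (sg th : R) : sg = 1 \/ sg = -1 -> 0 < th -> exists2 T, 0 < T &
  forall t h, T <= t -> 0 <= h -> sg * (u (h * Num.sqrt t) t - (if h == 0 then 0 else profile h)) <= th.
Proof.
move=> sg1 th0; have th8 : 0 < th / 8 by rewrite divr_gt0.
have a10 : 0 < alpha + 1 by rewrite addr_gt0.
(* Using alpha + 1 in place of [a] makes B and A independent of the choice of [a <= alpha + 1]. *)
pose B := gamma / alpha ^+ 2 * U * (Num.sqrt (alpha + 1) / Num.sqrt alpha) / 2.
have B0 : 0 <= B.
  apply: divr_ge0 => //; apply: mulr_ge0; last by rewrite divr_ge0// sqrtr_ge0.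
  by apply: mulr_ge0; [rewrite divr_ge0// sqr_ge0|exact: ltW].
pose A := 2 * B / G (alpha + 1).
have A0 : 0 <= A by apply: divr_ge0; [exact: mulr_ge0|exact/ltW/gauss4_gt0].
pose Z := expR 1 + Q alpha + Q alpha.
have Z0 : 0 < Z by rewrite !addr_gt0// expR_gt0.
pose eps := th / 8 / Z; have eps0 : 0 < eps by rewrite divr_gt0.
have [a [sgE /andP[aa a1] corr]] : exists a, [/\ (sg = 1 /\ a = alpha) \/ (sg = -1 /\ alpha < a),
    alpha <= a <= alpha + 1 & A * (a - alpha) * Q alpha + B * (a - alpha) ^+ 2 <= th / 8].
  case: sg1 => [sE|sE].
    exists alpha; split; [by left|by rewrite lexx lerDl ler01|].
    by rewrite subrr mulr0 mul0r add0r expr0n/= mulr0 ltW.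
  pose k := A * Q alpha + B + 1.
  have k0 : 0 < k by rewrite ltr_wpDl// addr_ge0// mulr_ge0// ltW.
  pose d := Num.min 1 (th / 8 / k).
  have d0 : 0 < d by rewrite lt_min ltr01 divr_gt0.
  have d1 : d <= 1 by rewrite ge_min lexx.
  have dk : d * k <= th / 8 by rewrite -ler_pdivlMr// ge_min lexx orbT.
  exists (alpha + d); split; [by right; rewrite ltrDl|by rewrite lerDl (ltW d0) lerD2l|].
  rewrite (_ : alpha + d - alpha = d); last by ring.
  have dB : B * d ^+ 2 <= B * d by rewrite ler_wpM2l// expr2 ler_piMr// ltW.
  have := dk; rewrite /k !mulrDr; move: dB d0; lra.
have a0 : 0 < a by exact: lt_le_trans aa.
have [eb [eb0 eb4 [c1 c2' c3 c5]]] : exists eb : R, [/\ 0 < eb, eb <= 1 / 4 &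
   [/\ eb * (C' * Num.sqrt a * (a ^+ 2 / 2 + 3)) <= eps * G a / 8,
     alpha * beta / 2 * (expR (eb * ln (a / alpha)) - 1) < eps * G alpha,
     U * eb / alpha < eps * G a & C' * (2 * a * eb) <= th / 8]].
  have ga := gauss4_gt0 a; have gal := gauss4_gt0 alpha.
  have cid : {for (0 : R), continuous (fun e : R => e)} by exact: cvg_id.
  have cM k : {for (0 : R), continuous (fun e : R => k * e)} by apply: cvgM; [exact: cvg_cst|exact: cid].
  have n1 := @small_near (fun e => e) (1 / 4) cid (_ : _ < _).
  have n2 := @small_near (fun e => (C' * Num.sqrt a * (a ^+ 2 / 2 + 3)) * e) (eps * G a / 8) (cM _) (_ : _ < _).
  have n3 := @small_near (fun e => alpha * beta / 2 * (expR (ln (a / alpha) * e) - 1)) (eps * G alpha) _ (_ : _ < _).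
  have n4 := @small_near (fun e => (U / alpha) * e) (eps * G a) (cM _) (_ : _ < _).
  have n5 := @small_near (fun e => (C' * (2 * a)) * e) (th / 8) (cM _) (_ : _ < _).
  have : \forall e \near (0 : R)^'+, exists eb : R, [/\ 0 < eb, eb <= 1 / 4 &
   [/\ eb * (C' * Num.sqrt a * (a ^+ 2 / 2 + 3)) <= eps * G a / 8,
     alpha * beta / 2 * (expR (eb * ln (a / alpha)) - 1) < eps * G alpha,
     U * eb / alpha < eps * G a & C' * (2 * a * eb) <= th / 8]].
    near=> e; exists e; split.
    - by near: e; exact: nbhs_right_gt.
    - by apply: ltW; near: e; apply: n1; rewrite divr_gt0.
    split.
    - by rewrite mulrC; apply: ltW; near: e; apply: n2; rewrite mulr0 divr_gt0// mulr_gt0.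
    - rewrite (mulrC e); near: e; apply: n3; last by rewrite mulr0 expR0 subrr mulr0 mulr_gt0.
      apply: cvgM; first exact: cvg_cst.
      apply: cvgB; last exact: cvg_cst.
      by apply: (@continuous_comp _ _ _ (fun e => ln (a / alpha) * e) expR); [exact: cM|exact: continuous_expR].
    - by rewrite mulrAC; near: e; apply: n4; rewrite mulr0 mulr_gt0.
    - by rewrite mulrA; apply: ltW; near: e; apply: n5; rewrite mulr0.
  by move=> /filter_ex[].
have [X X0 Peb] : exists2 X, 0 < X & forall x, X <= x -> `|x * P x - gamma| <= eb.
  have /cvgrPdist_le /(_ _ eb0) [X [_ HX]] := Plim.
  exists (Num.max 1 (X + 1)) => [|x]; first by rewrite lt_max ltr01.
  by rewrite ge_max => /andP[_ Xx]; rewrite distrC; apply: HX; apply: lt_le_trans Xx; rewrite ltrDl.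
have [Cu [T1 [Cu0 T10 Hu]]] := crude X.
have ga := gauss4_gt0 alpha.
have [T2 T20 HT2] := div_sqrt_le_near X0 (divr_gt0 alpha_gt0 (ltr0n R 2)).
have [Td Hd] : exists Td, alpha < a -> forall x t, Td <= t -> a * Num.sqrt t < x -> p x t = 0.
  have [aE|al] := leP a alpha; first by exists 0.
  have ad : 0 < a - alpha by rewrite subr_gt0.
  have [T HT] := dry ad; exists T => _ x t Tt ax; apply: (HT x t Tt).
  by rewrite addrC subrK.
(* At x = X the allowance is of order t^(-1/4); the decay t^(-3/8) of [u] leaves a spare factor
   t^(-1/8). *)
have [T3 T30 HT3] : exists2 T, 0 < T & forall t, T <= t -> Cu * scale_pow (1 / 8) t <= eps * G alpha * Num.sqrt X.
  have e0 : 0 < eps * G alpha * Num.sqrt X / Cu by apply: divr_gt0 => //; apply: mulr_gt0; [apply: mulr_gt0|rewrite sqrtr_gt0].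
  have [T T0 HT] := scale_pow_le_near (divr_gt0 ltr01 (ltr0n R 8)) e0.
  by exists T => // t /HT; rewrite ler_pdivlMr// mulrC.
have C'p := C'0.
have [T4 T40 HT4] : exists2 T, 0 < T & forall t, T <= t ->
    C' * expR (ln a / 4) * expR (ln (X / Num.sqrt t) / 4) <= eps * G alpha.
  have k0 : 0 < C' * expR (ln a / 4) by rewrite mulr_gt0// expR_gt0.
  have e0 : 0 < eps * G alpha / (C' * expR (ln a / 4)) by rewrite divr_gt0// mulr_gt0.
  have [T T0 HT] := div_sqrt_le_near X0 (expR_gt0 (4 * ln (eps * G alpha / (C' * expR (ln a / 4))))).
  exists T => // t Tt; rewrite mulrC -ler_pdivlMr// -[leRHS](lnK (_ : _ \is Num.pos)) ?posrE// ler_expR.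
  have t0 : 0 < t by exact: lt_le_trans Tt.
  have q0 : 0 < X / Num.sqrt t by rewrite divr_gt0// sqrtr_gt0.
  by have := HT t Tt; rewrite -ler_ln ?posrE ?expR_gt0// expRK; lra.
have [T0 T00 [T01 T02 T03 T04 T0d]] := max5 T1 T2 T3 T4 Td.
have s0 : 0 < Num.sqrt T0 by rewrite sqrtr_gt0.
have XT t : T0 <= t -> X < alpha * Num.sqrt t.
  move=> Tt; rewrite -ltr_pdivrMr ?sqrtr_gt0 ?(lt_le_trans T00)//.
  by apply: le_lt_trans (HT2 t (le_trans T02 Tt)) _; rewrite ltr_pdivrMr// ltr_pMr// ltr1n.
pose K0 := (c0 * (2 / alpha) + Psi alpha beta alpha / G alpha) + (C' * a / G a + c2 * (2 / alpha)).
(* The factor T0^(1/4) cancels the decay at the initial time, where [K0] times the Gaussian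
   dominates both [u] and the barrier. *)
pose K := K0 * scale_pow (- (1 / 4)) T0.
have K00 : 0 <= K0.
  have Pa := Psi_ge0 alpha_gt0 beta_gt0 alpha; have gaa := gauss4_gt0 a.
  apply: addr_ge0; apply: addr_ge0.
  - by apply: mulr_ge0; [exact: ltW|rewrite divr_ge0// ltW].
  - by apply: divr_ge0 => //; exact: ltW.
  - by apply: divr_ge0; [apply: mulr_ge0; exact: ltW|exact: ltW].
  - by apply: mulr_ge0; [exact: ltW|rewrite divr_ge0// ltW].
have K_0 : 0 <= K by rewrite mulr_ge0// ltW// scale_pow_gt0.
have c4 : gamma / alpha ^+ 2 * U * (Num.sqrt a / Num.sqrt alpha) <= 2 * B /\ 2 * B <= A * G a.
  split.
    rewrite /B [leRHS]mulrC divfK//; apply: ler_wpM2l; first by apply: mulr_ge0; [rewrite divr_ge0// sqr_ge0|exact: ltW].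
    by rewrite ler_pM2r ?invr_gt0 ?sqrtr_gt0// ler_wsqrtr.
  have g1 := gauss4_gt0 (alpha + 1).
  rewrite /A mulrAC ler_pdivlMr//; apply: ler_wpM2l; first exact: mulr_ge0.
  by rewrite ler_expR lerN2 ler_pM2r// ler_pXn2r// nnegrE ltW.
have gapE x t : X <= x -> 0 < t -> gap alpha u F U E sg a eps K A B x t <=
   sg * (u x t - guess alpha F U E a x t) -
     (eps * sqrt_gauss (x / Num.sqrt t) + K * (scale_pow (1 / 4) t * G (x / Num.sqrt t))).
  move=> Xx t0; rewrite lerD2l lerN2 /error; apply: lerD => //; rewrite -[leLHS]addr0; apply: lerD.
    by apply: ler_wpM2l; [exact: ltW|rewrite -addrA lerDl addr_ge0// ltW].
  exact: (correction_ge0 sgE A0 B0).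
have bottom x : X <= x -> gap alpha u F U E sg a eps K A B x T0 <= 0.
  move=> Xx; have x0 : 0 < x by exact: lt_le_trans Xx.
  apply: le_trans (gapE x T0 Xx T00) _; rewrite subr_le0.
  have u0 := u_ge0 alpha_gt0 beta_gt0 W x T00; have uG := u_le_gauss x0 T00.
  have g0 := guess_ge0 a x0 T00.
  have gG := guess_le_gauss aa eb4 X0 Peb Xx T00.
  have kE : K * (scale_pow (1 / 4) T0 * G (x / Num.sqrt T0)) = K0 * G (x / Num.sqrt T0).
    transitivity (K0 * G (x / Num.sqrt T0) * (scale_pow (- (1 / 4)) T0 * scale_pow (1 / 4) T0)).
      by rewrite /K; move: (G _) (scale_pow _ _) (scale_pow _ _) => k1 k2 k3; ring.
    by rewrite scale_powN mulr1.
  have sq : 0 <= eps * sqrt_gauss (x / Num.sqrt T0).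
    by apply: mulr_ge0; [exact: ltW|apply: mulr_ge0; [exact: sqrtr_ge0|exact/ltW/gauss4_gt0]].
  have k1 := le_trans u0 uG; have k2 := le_trans g0 gG.
  apply: ler_wpDl => //; rewrite kE /K0 mulrDl.
  apply: sign_sub_le => //; rewrite ?u0 ?g0 /=; first by rewrite ler_wpDr.
  by rewrite ler_wpDl.
have left_ t : T0 <= t -> gap alpha u F U E sg a eps K A B X t <= 0.
  move=> Tt; have t0 : 0 < t by exact: lt_le_trans Tt.
  have r0 : 0 < Num.sqrt t by rewrite sqrtr_gt0.
  apply: le_trans (gapE X t (lexx X) t0) _; rewrite subr_le0; apply: ler_wpDr.
    by apply: mulr_ge0 => //; apply: mulr_ge0; apply: ltW; [exact: scale_pow_gt0|exact: gauss4_gt0].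
  have u0 := u_ge0 alpha_gt0 beta_gt0 W X t0; have g0 := guess_ge0 a X0 t0.
  have Gh : eps * Num.sqrt (X / Num.sqrt t) * G alpha <= eps * sqrt_gauss (X / Num.sqrt t).
    rewrite /sqrt_gauss -mulrA; apply: ler_wpM2l; first exact: ltW.
    apply: ler_wpM2l; first exact: sqrtr_ge0.
    rewrite ler_expR lerN2 ler_pM2r// ler_pXn2r ?nnegrE ?(ltW alpha_gt0)//.
      by rewrite ler_pdivrMr// ltW// XT.
    by rewrite divr_ge0// ltW.
  apply: le_trans Gh; case: sg1 => ->; rewrite ?mul1r ?mulN1r.
    rewrite (@le_trans _ _ (u X t)) ?gerBl//.
    have H := Hu X t _ (le_trans T01 Tt); apply: le_trans (H _) _; first by rewrite ger0_norm// ltW.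
    have -> : Num.sqrt (X / Num.sqrt t) = Num.sqrt X * scale_pow (1 / 4) t.
      rewrite sqrtrM ?ltW// sqrtrV ?sqrtr_ge0//; congr (_ * _).
      by rewrite -sqrt_expR// -sqrt_expR ?expR_gt0// expRK -expRN /scale_pow; congr expR; field.
    have -> : Cu * scale_pow (3 / 8) t = Cu * scale_pow (1 / 8) t * scale_pow (1 / 4) t.
      by rewrite -mulrA /scale_pow -expRD; congr (_ * expR _); field.
    have -> : eps * (Num.sqrt X * scale_pow (1 / 4) t) * G alpha = eps * G alpha * Num.sqrt X * scale_pow (1 / 4) t.
      by ring.
    by apply: ler_wpM2r; [exact/ltW/scale_pow_gt0|exact: HT3 (le_trans T03 Tt)].
  have Xa : X <= a * Num.sqrt t by rewrite (le_trans (ltW (XT t Tt)))// ler_pM2r.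
  rewrite opprB (@le_trans _ _ (guess alpha F U E a X t)) ?gerBl//.
  apply: le_trans (guess_left aa eb4 X0 Peb t0 Xa) _.
  have -> : eps * Num.sqrt (X / Num.sqrt t) * G alpha = eps * G alpha * Num.sqrt (X / Num.sqrt t) by ring.
  rewrite [leLHS](_ : _ = C' * expR (ln a / 4) * expR (ln (X / Num.sqrt t) / 4) * Num.sqrt (X / Num.sqrt t)); last first.
    by move: (Num.sqrt _) (expR (ln a / 4)) (expR _) => k1 k2 k3; ring.
  by apply: ler_wpM2r; [exact: sqrtr_ge0|exact: HT4 (le_trans T04 Tt)].
have dry0 : alpha < a -> forall x t, T0 <= t -> a * Num.sqrt t < x -> p x t = 0.
  by move=> al x t Tt; apply: (Hd al); exact: le_trans Tt.
have main := comparison alpha_gt0 beta_gt0 gamma_ge0 W dF Fbound FU U_gt0 transmission N0 mpi pi01 Ppi dE ppi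
  sgE eps0 K_0 A0 B0 X0 T00 eb4 Peb c1 c2' c3 c4 dry0 bottom left_.
have [T5 T50 HT5] := scale_pow_le_near (divr_gt0 ltr01 (ltr0n R 4)) (divr_gt0 th8 (ltr_wpDl K_0 ltr01)).
have [T6 T60 HT6] := scale_pow_le_near (divr_gt0 (ltr0n R 3) (ltr0n R 8)) (divr_gt0 th0 Cu0).
have [T7 T70 HT7] := div_sqrt_le_near X0 (divr_gt0 th0 C'p).
have [T T00' [TT0 TT5 TT6 TT7 _]] := max5 T0 T5 T6 T7 0.
exists T => // t h Tt h0; have t0 : 0 < t by exact: lt_le_trans Tt.
have r0 : 0 < Num.sqrt t by rewrite sqrtr_gt0.
have T0t := le_trans TT0 Tt.
(* For x < X the comparison says nothing; there [u] is small by its decay and the profile because h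
   is small. *)
have [Xx|xX] := leP X (h * Num.sqrt t).
  have x0 : 0 < h * Num.sqrt t by exact: lt_le_trans Xx.
  have hp : 0 < h by move: x0; rewrite pmulr_lgt0.
  rewrite gt_eqF//.
  have hE : h * Num.sqrt t / Num.sqrt t = h by rewrite mulfK ?gt_eqF.
  have G1 : G h <= 1 by rewrite /gauss4 -[leRHS]expR0 ler_expR oppr_le0 divr_ge0// sqr_ge0.
  have := main (h * Num.sqrt t) t Xx T0t; rewrite /gap subr_le0 /error hE => M1.
  have := guess_sub_profile aa (ltW eb0) eb4 X0 Peb Xx t0; rewrite hE => M2.
  have M3 : sg * (guess alpha F U E a (h * Num.sqrt t) t - profile h) <= th / 8.
    apply: le_trans (ler_norm _) _; rewrite normrM; apply: le_trans c5; apply: le_trans M2.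
    by case: sg1 => ->; rewrite ?normrN1 ?normr1 mul1r.
  have M4 : eps * (sqrt_gauss h + Q (Num.max h alpha) + Q (Num.max h a)) <= th / 8.
    rewrite -[leRHS](divfK (lt0r_neq0 Z0)); apply: ler_wpM2l; first exact: ltW.
    apply: lerD; first apply: lerD; first exact: sqrt_gauss_le.
      by apply: le_tail4; rewrite le_max lexx orbT.
    by apply: le_tail4; rewrite le_max aa orbT.
  have M5 : correction alpha a A B h <= th / 8.
    apply: le_trans corr; rewrite /correction; apply: lerD.
      apply: ler_wpM2l; first by rewrite mulr_ge0// subr_ge0.
      by apply: le_tail4; rewrite le_max aa orbT.
    by apply: ler_wpM2l => //; rewrite gerBl sqr_ge0.
  have M6 : K * (scale_pow (1 / 4) t * G h) <= th / 8.
    have K1 : 0 < K + 1 by rewrite ltr_wpDl.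
    have := HT5 t (le_trans TT5 Tt); rewrite ler_pdivlMr// mulrC => H.
    apply: le_trans H; apply: ler_pM => //; last by rewrite ler_piMr// ltW// scale_pow_gt0.
      by apply: mulr_ge0; apply: ltW; [exact: scale_pow_gt0|exact: gauss4_gt0].
    by rewrite lerDl.
  rewrite -(subrKA (guess alpha F U E a (h * Num.sqrt t) t)) mulrDr.
  apply: le_trans (lerD (le_trans M1 (lerD (lerD M4 M5) M6)) M3) _.
  rewrite (_ : _ + _ + _ + _ = th / 2); last by field.
  by rewrite ler_pdivrMr// ler_peMr ?ler1n// ltW.
have u0 := u_ge0 alpha_gt0 beta_gt0 W (h * Num.sqrt t) t0.
have ut : u (h * Num.sqrt t) t <= th.
  have x0 : 0 <= h * Num.sqrt t by rewrite mulr_ge0// ltW.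
  apply: le_trans (Hu _ t _ (le_trans T01 T0t)) _; first by rewrite ger0_norm// ltW.
  by have := HT6 t (le_trans TT6 Tt); rewrite ler_pdivlMr// mulrC.
have [p0 pt] : 0 <= (if h == 0 then 0 else profile h) /\ (if h == 0 then 0 else profile h) <= th.
  have [_|hn] := eqVneq h 0; first by split; rewrite ?lexx ?ltW.
  have hp : 0 < h by rewrite lt_neqAle eq_sym hn.
  have /andP[-> pC] := profile_bounds hp; split => //; apply: le_trans pC _.
  have := HT7 t (le_trans TT7 Tt); rewrite ler_pdivlMr// mulrC; apply: le_trans.
  by apply: ler_wpM2l; [exact: ltW|rewrite ler_pdivlMr// ltW].
by apply: sign_sub_le; rewrite // ?u0 ?p0.
Unshelve. all: by end_near. Qed.

End convergence.

(** * Convergence *)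

Section good_points.
Variable R : realType.
Notation leb := (@lebesgue_measure R).
Variables (alpha beta ustar gamma : R) (u p : R -> R -> R).
Hypotheses (alpha_gt0 : 0 < alpha) (beta_gt0 : 0 < beta) (ustar_gt0 : 0 < ustar).
Hypothesis W : weak_solution alpha beta ustar u p.
Implicit Types x y t s : R.
Variables (N : set R) (P pi : R -> R).
Hypotheses (N0 : leb.-negligible N) (mpi : measurable_fun setT pi) (pi01 : forall x : R, 0 <= pi x <= 1)
  (Ppi : is_primitive P pi)
  (ppi : forall x t, 0 < x -> ~ N x -> x ^+ 2 / alpha ^+ 2 < t -> p x t = pi x)
  (Plim : x * P x @[x --> +oo] --> gamma).

Let endpoints_negligible (l h : R) : leb.-negligible (N `|` ([set l] `|` [set h])).
Proof.
have n1 (z : R) : leb.-negligible [set z].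
  by apply/negligibleP; [exact: measurable_set1|exact: lebesgue_measure_set1].
by apply: negligibleU => //; exact: negligibleU.
Qed.

Let integrable1 (l h : R) : leb.-integrable `[l, h] (EFin \o (fun _ : R => 1 : R)).
Proof. exact: integrable_segment (@within_cst _ l h 1). Qed.

Let outside_endpoints (l h y : R) : l <= y <= h -> ~ (N `|` ([set l] `|` [set h])) y -> ~ N y /\ l < y < h.
Proof.
move=> /andP[ly yh] Ny; split; first by move=> ?; apply: Ny; left.
rewrite !lt_neqAle ly yh !andbT; apply/andP; split; apply/eqP => E; apply: Ny; right.
  by left; rewrite /= E.
by right.
Qed.

(** Otherwise [pi] would be 1 almost everywhere on the interval and its integral would be the full
    length. *)
Lemma exists_pi_lt1 l h : l < h -> P l - P h < h - l -> exists y, [/\ l < y, y < h, ~ N y & pi y < 1].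
Proof.
move=> lh; apply: contraPP => H; apply/negP; rewrite -leNgt (Ppi (ltW lh)).
have <- : \int[leb]_(r in `[l, h]) (1 : R) = h - l by rewrite Rintegral_segment_cst ?mul1r.
apply: (le_Rintegral_negligible _ (endpoints_negligible l h) (integrable1 l h)) => // y.
- by rewrite normr1.
- by move=> _ _; have /andP[p0 p1] := pi01 y; rewrite ger0_norm.
rewrite /= in_itv/= => yI Ny; have [Ny' /andP[ly yh]] := outside_endpoints yI Ny.
by rewrite leNgt; apply/negP => p1; apply: H; exists y.
Qed.

Lemma exists_pi_gt0 l h : l < h -> 0 < P l - P h -> exists y, [/\ l < y, y < h, ~ N y & 0 < pi y].
Proof.
move=> lh; apply: contraPP => H; apply/negP; rewrite -leNgt (Ppi (ltW lh)).
have <- : \int[leb]_(r in `[l, h]) (0 : R) = 0 by rewrite Rintegral_segment_cst ?mul0r.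
apply: (le_Rintegral_negligible _ (endpoints_negligible l h) (integrable1 l h)) => // y.
- by move=> _ _; have /andP[p0 p1] := pi01 y; rewrite ger0_norm.
- by rewrite normr0.
rewrite /= in_itv/= => yI Ny; have [Ny' /andP[ly yh]] := outside_endpoints yI Ny.
by rewrite leNgt; apply/negP => p1; apply: H; exists y.
Qed.

(** Once [u] exceeds u* at [y], the running supremum keeps p = 1 there, against the final value
    [pi y]. *)
Lemma u_le_ustar y s : 0 < y -> ~ N y -> pi y < 1 -> 0 < s -> u y s <= ustar.
Proof.
move=> y0 Ny py s0; rewrite leNgt; apply/negP => us.
pose t := Num.max s (y ^+ 2 / alpha ^+ 2 + 1).
have st : s <= t by rewrite /t le_max lexx.
have t0 : 0 <= t by rewrite (le_trans (ltW s0)).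
have [_ _ H] := weak_precipitation W y t0.
have ut : (ustar%:E < running_sup u y t)%E.
  apply: (@lt_le_trans _ _ (u y s)%:E); first by rewrite lte_fin.
  by apply: running_sup_ge; rewrite (ltW s0).
move: (H ut); rewrite ppi//; first by move=> pE; move: py; rewrite pE ltxx.
by rewrite /t lt_max ltrDl ltr01 orbT.
Qed.

(** P(x) = O(1 / x), so the integral of [pi] over a window of length d sqrt t is O(t^(-1/2)), far
    less than the length. *)
Let small_oscillation d : 0 < d -> exists2 T, 0 < T & forall t, T <= t ->
  P (alpha * Num.sqrt t) - P ((alpha + d) * Num.sqrt t) < d * Num.sqrt t.
Proof.
move=> d0; have /cvgrPdist_le /(_ _ ltr01) [M [_ HM]] := Plim.
pose k := `|gamma| + 1; have k0 : 0 < k by rewrite ltr_wpDl.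
pose M' := Num.max M 0 + 1; have M'0 : 0 < M' by rewrite ltr_wpDl// le_max lexx orbT.
have HP x : M' <= x -> `|P x| <= k / x.
  move=> Mx; have x0 : 0 < x by exact: lt_le_trans Mx.
  have MM : M < x by apply: lt_le_trans Mx; rewrite /M' ltr_pwDr// le_max lexx.
  have := HM x MM; rewrite /= distrC => H.
  rewrite ler_pdivlMr// mulrC -{1}(ger0_norm (ltW x0)) -normrM.
  by have := ler_normB gamma (gamma - x * P x); rewrite opprB addrC subrK (distrC gamma); rewrite /k; lra.
have [T1 T10 HT1] := div_sqrt_le_near M'0 alpha_gt0.
have kd : 0 < 4 * k / (alpha * d) by rewrite divr_gt0 ?mulr_gt0.
exists (Num.max T1 (4 * k / (alpha * d))); first by rewrite lt_max T10.
move=> t; rewrite ge_max => /andP[T1t kt]; have t0 : 0 < t by exact: lt_le_trans T1t.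
have s0 : 0 < Num.sqrt t by rewrite sqrtr_gt0.
have Mx : M' <= alpha * Num.sqrt t by rewrite -ler_pdivrMr// HT1.
have as0 : 0 < alpha * Num.sqrt t by rewrite mulr_gt0.
have ad : alpha * Num.sqrt t <= (alpha + d) * Num.sqrt t by rewrite ler_pM2r// lerDl ltW.
have H1 := HP _ Mx; have H2 := HP _ (le_trans Mx ad).
have H3 : k / ((alpha + d) * Num.sqrt t) <= k / (alpha * Num.sqrt t).
  by rewrite ler_pM2l// lef_pV2 ?posrE// (lt_le_trans as0).
have H4 : 4 * (k / (alpha * Num.sqrt t)) <= d * Num.sqrt t.
  rewrite mulrA ler_pdivrMr//; move: kt; rewrite ler_pdivrMr ?mulr_gt0// => kt.
  apply: le_trans kt _; rewrite -{1}(sqr_sqrtr (ltW t0)).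
  by rewrite le_eqVlt; apply/orP; left; apply/eqP; ring.
have H5 : 0 < k / (alpha * Num.sqrt t) by rewrite divr_gt0.
have H6 := ler_norm (P (alpha * Num.sqrt t)).
have H7 := ler_norm (- P ((alpha + d) * Num.sqrt t)); rewrite normrN in H7.
by move: H1 H2 H3 H4 H5 H6 H7; lra.
Qed.

Lemma exists_subcritical d : 0 < d -> exists2 T, 0 < T & forall t, T <= t ->
  exists y, [/\ alpha * Num.sqrt t < y, y < (alpha + d) * Num.sqrt t & forall s, 0 < s -> u y s <= ustar].
Proof.
move=> d0; have [T T0 HT] := small_oscillation d0; exists T => // t Tt.
have t0 : 0 < t by exact: lt_le_trans Tt.
have s0 : 0 < Num.sqrt t by rewrite sqrtr_gt0.
have lh : alpha * Num.sqrt t < (alpha + d) * Num.sqrt t by rewrite ltr_pM2r// ltrDl.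
have [|y [ly yh Ny py]] := exists_pi_lt1 lh.
  rewrite (_ : (alpha + d) * Num.sqrt t - alpha * Num.sqrt t = d * Num.sqrt t); [exact: HT|ring].
exists y; split => // s; apply: u_le_ustar => //.
by apply: lt_trans ly; rewrite mulr_gt0.
Qed.

Lemma dry d : 0 < d -> exists T, forall x t, T <= t -> (alpha + d) * Num.sqrt t < x -> p x t = 0.
Proof.
move=> d0; have [T T0 HT] := exists_subcritical d0; exists T => x t Tt tx.
have t0 : 0 < t by exact: lt_le_trans Tt.
have [y [ly yh uy]] := HT t Tt.
apply: (no_precipitation alpha_gt0 beta_gt0 ustar_gt0 W _ uy t0 ly (lt_trans yh tx)).
by apply: lt_trans ly; rewrite mulr_gt0// sqrtr_gt0.
Qed.

(** If [pi] vanished almost everywhere beyond some point, P would be constant there and x P(x) would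
    be 0 or unbounded; neither has the limit gamma > 0. Where [pi y > 0], the running supremum
    cannot stay below u*. *)
Lemma exists_critical M : 0 < gamma -> exists y, [/\ M < y, 0 < y &
  forall t, y ^+ 2 / alpha ^+ 2 < t -> (ustar%:E <= running_sup u y t)%E].
Proof.
move=> g0; pose l := Num.max M 0 + 1.
have l0 : 0 < l by rewrite ltr_wpDl// le_max lexx orbT.
have [h lh Ph] : exists2 h, l < h & P h < P l.
  apply: contrapT => H.
  have Pc h : l <= h -> P h = P l.
    rewrite le_eqVlt => /orP[/eqP ->//|lh]; apply/eqP; rewrite eq_le.
    have /andP[PP _] := primitive_lip mpi pi01 Ppi (ltW lh); rewrite subr_ge0 in PP.
    by rewrite PP leNgt; apply/negP => Ph; apply: H; exists h.
  have /cvgrPdist_le /(_ _ ltr01) [M1 [_ HM1]] := Plim.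
  have [P0|P0] := eqVneq (P l) 0.
    have /cvgrPdist_le /(_ _ (divr_gt0 g0 (ltr0n R 2))) [M2 [_ HM2]] := Plim.
    have := HM2 (Num.max (M2 + 1) l); rewrite /= Pc ?le_max ?lexx ?orbT// P0 mulr0 subr0 (gtr0_norm g0).
    by rewrite lt_max ltrDl ltr01 => /(_ isT); move: g0; lra.
  have nP : 0 < `|P l| by rewrite normr_gt0.
  have g2 : 0 < gamma + 2 by rewrite addr_gt0.
  pose x := Num.max (Num.max (M1 + 1) l) ((gamma + 2) / `|P l|).
  have lx : l <= x by rewrite /x !le_max lexx orbT.
  have := HM1 x; rewrite /= Pc// /x !lt_max ltrDl ltr01 => /(_ isT); rewrite -/x.
  have x0 : 0 < x by exact: lt_le_trans lx.
  have xP : gamma + 2 <= `|x * P l|.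
    by rewrite normrM (gtr0_norm x0) -ler_pdivrMr// /x le_max lexx orbT.
  have := ler_normB gamma (gamma - x * P l); rewrite opprB addrC subrK (gtr0_norm g0).
  by move: xP; lra.
have [|y [ly yh Ny py]] := exists_pi_gt0 lh; first by rewrite subr_gt0.
have y0 : 0 < y by exact: lt_trans ly.
exists y; split => // [|t yt].
  by apply: le_lt_trans ly; rewrite /l ler_wpDr// le_max lexx.
have t0 : 0 <= t by rewrite (le_trans _ (ltW yt))// divr_ge0// sqr_ge0.
have [H _ _] := weak_precipitation W y t0.
by rewrite leNgt; apply/negP => /H; rewrite ppi// => pE; move: py; rewrite pE ltxx.
Qed.

End good_points.

Theorem theorem16 (R : realType) (alpha beta ustar : R)
    (alpha_gt0 : 0 < alpha) (beta_gt0 : 0 < beta) (ustar_gt0 : 0 < ustar)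
    (u p : R -> R -> R) (up_weak : weak_solution alpha beta ustar u p)
    (ustar_lt : ustar < Psi alpha beta alpha)
    (pstar : R -> R) (p_P : condition_P alpha p pstar)
    (gamma : R) (gamma_ge0 : 0 <= gamma)
    (pstar_lim :
      (x%:E * \int[@lebesgue_measure R]_(xi in `[x, +oo[) (pstar xi)%:E)%E
        @[x --> +oo] --> gamma%:E) :
  [/\ ereal_sup [set `|u (eta * Num.sqrt t) t - Phi alpha beta gamma eta|%:E
                   | eta in `[0, +oo[]
        @[t --> +oo] --> 0%E,
      0 < gamma -> Phi alpha beta gamma alpha = ustar
    & gamma = 0 -> 0 < Phi alpha beta 0 alpha <= ustar].
Proof.
pose W := up_weak.
have [N [pi [P [N0 mpi pi01 Ppi [_ ppi Plim]]]]] := precipitation_profile W p_P pstar_lim.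
have cP := continuous_primitive mpi pi01 Ppi.
pose E x := \int[@lebesgue_measure R]_(r in `[0, x]) P r - gamma * ln x.
have dE (x : R) : 0 < x -> is_derive x (1 : R) E (P x - gamma / x).
  move=> x0; have d1 := is_derive_Rintegral0 cP x0; have d2 := is_derive1_ln x0.
  by rewrite /E; apply: is_derive_eq; rewrite /GRing.scale/=; ring.
have [F [F' [F'' [C [dF Fbound FU transmission PhiE]]]]] := profile_exists alpha_gt0 beta_gt0 gamma_ge0.
have U0 := ustar_gamma_gt0 alpha_gt0 beta_gt0 gamma_ge0.
set U := ustar_gamma alpha beta gamma in FU U0 transmission PhiE.
have [x0 [t0 [x00 x01 t00 core]]] := precipitation_core alpha_gt0 beta_gt0 W ustar_lt.
have crude (X : R) : exists C T1 : R, [/\ 0 < C, 0 < T1 & forall x t, `|x| <= X -> T1 <= t -> u x t <= C * scale_pow (3 / 8) t].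
  exact: (crude_bound alpha_gt0 beta_gt0 W x00 x01 core X).
have dry := dry alpha_gt0 beta_gt0 ustar_gt0 W N0 pi01 Ppi ppi Plim.
have PhiE' h : 0 <= h -> Phi alpha beta gamma h = if h == 0 then 0 else profile alpha F U h.
  move=> h0; rewrite PhiE//; case: ifP => // _; case: ifPn => [ha|].
    by rewrite (profile_inner _ _ (ltW ha)).
  by rewrite -leNgt => ha; rewrite (profile_outer FU ha).
have Phia : Phi alpha beta gamma alpha = U.
  by rewrite PhiE ?(ltW alpha_gt0)// (gt_eqF alpha_gt0) ltxx divfK// gt_eqF// tail4_gt0.
have conv th : 0 < th -> exists2 T, 0 < T & forall t h, T <= t -> 0 <= h ->
    `|u (h * Num.sqrt t) t - Phi alpha beta gamma h| <= th.
  move=> th0.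
  have one sg : sg = 1 \/ sg = -1 -> exists2 T, 0 < T & forall t h, T <= t -> 0 <= h ->
      sg * (u (h * Num.sqrt t) t - Phi alpha beta gamma h) <= th.
    move=> sg1; have [T T0 HT] := one_sided_limit alpha_gt0 beta_gt0 gamma_ge0 W dF Fbound FU U0 transmission
      N0 mpi pi01 Ppi dE ppi Plim crude dry sg1 th0.
    by exists T => // t h Tt h0; rewrite PhiE'//; exact: HT.
  have [T1 T10 H1] := one 1 (or_introl erefl); have [T2 T20 H2] := one (-1) (or_intror erefl).
  exists (Num.max T1 T2) => [|t h]; first by rewrite lt_max T10.
  rewrite ge_max => /andP[/H1 {}H1 /H2 {}H2] h0; move: (H1 h h0) (H2 h h0); rewrite mul1r mulN1r => k1 k2.
  by rewrite ler_norml k1 andbT lerNl.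
(* At a point [y] where [u] never exceeds u*, the time (y / alpha)^2 samples the solution at eta =
   alpha. *)
have Ule : U <= ustar.
  apply/ler_addgt0Pr => th th0; have [T T0 HT] := conv th th0.
  have [T1 T10 HT1] := exists_subcritical alpha_gt0 W N0 pi01 Ppi ppi Plim ltr01.
  have T1m : T1 <= Num.max T T1 by rewrite le_max lexx orbT.
  have [y [ly yh uy]] := HT1 (Num.max T T1) T1m.
  have m0 : 0 < Num.max T T1 by rewrite lt_max T0.
  have s0 : 0 < Num.sqrt (Num.max T T1) by rewrite sqrtr_gt0.
  have y0 : 0 < y by apply: lt_trans ly; rewrite mulr_gt0.
  have ya : 0 < y / alpha by rewrite divr_gt0.
  have Ty : T <= (y / alpha) ^+ 2.
    rewrite (@le_trans _ _ (Num.max T T1)) ?le_max ?lexx// -[leLHS]sqr_sqrtr ?(ltW m0)//.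
    by rewrite ler_pXn2r ?nnegrE ?(ltW s0) ?(ltW ya)// ler_pdivlMr// mulrC ltW.
  have := HT _ alpha Ty (ltW alpha_gt0); rewrite sqrtr_sqr (gtr0_norm ya) mulrC divfK ?gt_eqF// Phia.
  have := uy ((y / alpha) ^+ 2) (exprn_gt0 _ ya).
  by rewrite ler_norml => k1 /andP[k2 _]; move: k1 k2; lra.
split.
- pose S (t : R) := ereal_sup [set `|u (eta * Num.sqrt t) t - Phi alpha beta gamma eta|%:E | eta in `[0, +oo[].
  have sup (th : R) : 0 < th -> exists T : R, forall t, T < t -> (0 <= S t <= th%:E)%E.
    move=> th0; have [T T0 HT] := conv th th0; exists T => t Tt; apply/andP; split.
      apply: (@le_trans _ _ `|u (0 * Num.sqrt t) t - Phi alpha beta gamma 0|%:E); first by rewrite lee_fin.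
      by apply: ereal_sup_ubound; exists 0 => //=; rewrite in_itv/= lexx.
    apply: ge_ereal_sup => _ [h /= + <-]; rewrite in_itv/= andbT => h0.
    by rewrite lee_fin HT// ltW.
  have fin (x : \bar R) (e : R) : (0 <= x <= e%:E)%E -> x \is a fin_num.
    by move=> /andP[xp xe]; rewrite ge0_fin_numE// (le_lt_trans xe)// ltry.
  apply/fine_cvgP; split.
    by have [T HT] := sup 1 ltr01; exists T; split; [exact: num_real|move=> t /HT; exact: fin].
  apply/cvgrPdist_le => e e0; have [T HT] := sup e e0.
  exists T; split; [exact: num_real|move=> t /HT H]; have /andP[s0 se] := H.
  by rewrite sub0r normrN ger0_norm ?fine_ge0//= -lee_fin fineK// (fin _ _ H).
- move=> g0; rewrite Phia; apply/eqP; rewrite eq_le Ule /=.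
  apply/ler_addgt0Pr => th th0; have th2 : 0 < th / 2 by rewrite divr_gt0.
  have [T T0 HT] := conv _ th2.
  (* The final value of [p] is available only strictly after y^2 / alpha^2, so the history is
     followed a little past the source, to eta = h1 < alpha; continuity keeps the profile near [U]
     there. *)
  have [h1 /andP[h10 h1a] Fh1] : exists2 h1, 0 < h1 < alpha & forall h, h1 <= h -> h <= alpha -> F h <= U + th / 2.
    have [d _ _ _] := dF alpha alpha_gt0.
    have [e /= e0 He] := (nbhs_ballP alpha _).1 (cvgr_lt _ (is_derive_continuous d) (U + th / 2) ltac:(by rewrite FU ltrDl)).
    exists (Num.max (alpha / 2) (alpha - e / 2)).
      by rewrite lt_max divr_gt0//= gt_max ltr_pdivrMr// ltr_pMr// ltr1n gtrDl oppr_lt0 divr_gt0.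
    move=> h; rewrite ge_max => /andP[_ he] ha; apply/ltW/He.
    by rewrite /ball/= ger0_norm ?subr_ge0//; move: he e0; lra.
  pose c0 := alpha * beta / 2 * expR (alpha ^+ 2 / 4).
  have c00 : 0 < c0 by rewrite !mulr_gt0// expR_gt0.
  have [m [_ Hm]] := cvgr_lt _ (@cvg_tail4 R) _ (divr_gt0 th0 c00).
  have sT : 0 < Num.sqrt T by rewrite sqrtr_gt0.
  have [y [My y0 crit]] := exists_critical W N0 mpi pi01 Ppi ppi Plim (Num.max (m * Num.sqrt T) (alpha * Num.sqrt T)) g0.
  move: My; rewrite gt_max => /andP[my ay].
  pose t := (y / h1) ^+ 2; have tp : 0 < t by rewrite exprn_gt0// divr_gt0.
  have st : Num.sqrt t = y / h1 by rewrite sqrtr_sqr gtr0_norm// divr_gt0.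
  have yt : y ^+ 2 / alpha ^+ 2 < t.
    by rewrite /t exprMn exprVn ltr_pM2l ?exprn_gt0// ltf_pV2 ?posrE ?exprn_gt0// ltr_pXn2r// nnegrE ltW.
  have bound s : 0 <= s <= t -> u y s <= U + th.
    move=> /andP[]; rewrite le_eqVlt => /orP[/eqP <- _|s0 le_st].
      have := w_initial alpha_gt0 beta_gt0 W y; rewrite /wfun /psi eqxx gt_eqF// subr0 => ->.
      by rewrite addr_ge0// ltW.
    have r0 : 0 < Num.sqrt s by rewrite sqrtr_gt0.
    (* Before [T] convergence says nothing, but [y] was chosen so far out that psi is at most [th]
       there. *)
    have [Ts|sT'] := leP T s; last first.
      have sq : Num.sqrt s <= Num.sqrt T by rewrite ler_wsqrtr// ltW.
      have as_ : alpha * Num.sqrt s <= y by rewrite (le_trans _ (ltW ay))// ler_pM2l.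
      apply: le_trans (u_le_psi alpha_gt0 beta_gt0 W y s0) _; rewrite psi_out//.
      apply: (@le_trans _ _ th); last by rewrite lerDr ltW.
      rewrite -/c0 mulrC -ler_pdivlMr//; apply: (@le_trans _ _ (tail4 (y / Num.sqrt T))).
        by apply: le_tail4; rewrite ler_pM2l// lef_pV2 ?posrE.
      by apply/ltW/Hm; rewrite ltr_pdivlMr.
    have h0 : 0 < y / Num.sqrt s by rewrite divr_gt0.
    have := HT s (y / Num.sqrt s) Ts (ltW h0); rewrite divfK ?gt_eqF// => H.
    suff : Phi alpha beta gamma (y / Num.sqrt s) <= U + th / 2.
      by move: H; rewrite ler_norml => /andP[_]; lra.
    rewrite PhiE' ?(ltW h0)// gt_eqF//.
    have [ha|ha] := leP (y / Num.sqrt s) alpha; last first.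
      rewrite (profile_outer FU (ltW ha)) (@le_trans _ _ U)// ?lerDl ?(ltW th2)//.
      rewrite -[leRHS](divfK (lt0r_neq0 (tail4_gt0 alpha))) ler_pM2l ?divr_gt0 ?tail4_gt0//.
      by rewrite le_tail4// ltW.
    rewrite (profile_inner _ _ ha).
    have h1s : h1 <= y / Num.sqrt s.
      rewrite ler_pdivlMr// mulrC -ler_pdivlMr// -st; exact: ler_wsqrtr.
    by apply: Fh1.
  rewrite -lee_fin; apply: le_trans (crit t yt) _.
  by apply: ge_ereal_sup => _ [s /= + <-]; rewrite in_itv/= lee_fin; exact: bound.
- by move=> g0; rewrite -[X in Phi _ _ X _]g0 Phia U0.
Qed.
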